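(* $\vec{\chi}(\mathbb{N}_{10})=\vec{\chi}(\mathbb{S}_5)=4$.
   Context: $\mathbb{S}_k$ denotes the sphere with $k$ handles and $\mathbb{N}_k$ the sphere with $k$ cross-caps. A $k$-dicolouring of a digraph is a partition of its vertex set into $k$ subsets each inducing an acyclic subdigraph (no directed cycle); a digraph is $k$-dicolourable if it has a $k$-dicolouring. An oriented graph is a digraph obtained from a finite simple graph (its underlying graph) by replacing each edge by exactly one of the two possible arcs; it is embeddable on a surface if its underlying graph is. The dichromatic number $\vec{\chi}(\Sigma)$ of a surface $\Sigma$ is the least integer $k$ such that every oriented graph embeddable on $\Sigma$ is $k$-dicolourable. *)

(* Defs.v *)
From HB Require Import structures.
From mathcomp Require Export all_boot all_order all_algebra.
From mathcomp Require Export generic_quotient.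
From mathcomp Require Export all_classical reals topology normedtype.
From mathcomp Require Import lra.

Set Implicit Arguments.
Unset Strict Implicit.
Unset Printing Implicit Defensive.

Import Order.TTheory GRing.Theory Num.Theory.
Import numFieldNormedType.Exports.

Local Open Scope classical_set_scope.
Local Open Scope ring_scope.
Local Open Scope quotient_scope.

Section Digraphs.
Context {V : finType}.
Implicit Types (a e : rel V) (A : {set V}) (k : nat).

Definition simple_graph e : Prop := symmetric e /\ irreflexive e.

Definition oriented_graph a : Prop :=
  irreflexive a /\ forall u v : V, ~~ (a u v && a v u).

Definition underlying a : rel V := fun u v => a u v || a v u.

Lemma underlying_simple a : oriented_graph a -> simple_graph (underlying a).
Proof.
move=> [a_irr _]; split=> [u v|u]; first by rewrite /underlying orbC.
by rewrite /underlying a_irr.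
Qed.

Definition acyclic_on a A : Prop :=
  forall c : seq V, c != [::] -> {subset c <= A} -> ~~ ucycleb a c.

Definition dicolourable a k : Prop :=
  exists f : V -> 'I_k, forall i : 'I_k, acyclic_on a [set u | f u == i]%SET.

End Digraphs.

(* The edge uv is drawn as the arc [gamma u v]; [gamma v u] is the same arc
   run backwards. *)
Definition embeddable (R : realType) (X : topologicalType)
    (V : finType) (e : rel V) : Prop :=
  exists (phi : V -> X) (gamma : V -> V -> R -> X),
    [/\ injective phi,
        forall u v, e u v ->
          [/\ {within `[0, 1], continuous (gamma u v)},
              {in `[0, 1] &, injective (gamma u v)},
              gamma u v 0 = phi u & gamma u v 1 = phi v],
        forall u v (t : R), e u v -> t \in `[0, 1] ->
          gamma v u t = gamma u v (1 - t),
        forall u v w (t : R), e u v -> t \in `]0, 1[ -> gamma u v t <> phi w &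
        forall u v u' v' (s t : R), e u v -> e u' v' ->
          s \in `]0, 1[ -> t \in `]0, 1[ -> gamma u v s = gamma u' v' t ->
          (u' = u /\ v' = v) \/ (u' = v /\ v' = u)].

Section Surfaces.
Context (R : realType).

Definition sphere : topologicalType := one_point_compactification (R * R)%type.

Definition sqdist (c p : R * R) : R := (p.1 - c.1) ^+ 2 + (p.2 - c.2) ^+ 2.

Lemma sqdist_antipode (c p : R * R) : sqdist c (2 *: c - p) = sqdist c p.
Proof.
case: c p => [c1 c2] [p1 p2]; rewrite /sqdist /=.
suff h (a b : R) : 2 *: a - b - a = a - b by rewrite !h !(sqrrB c1) !(sqrrB c2); lra.
by rewrite scaler_nat; lra.
Qed.

Definition open_disc (c : R * R) : set sphere :=
  [set Some p | p in [set p : R * R | sqdist c p < 1]].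

Definition holed_sphere (I : Type) (c : I -> R * R) : set sphere :=
  ~` \bigcup_i open_disc (c i).

(* The k handles: the boundary circles of the unit discs centred at (4i, 2) and
   (4i, -2) are identified by the reflection (x, y) |-> (x, -y), which runs them
   in opposite directions, as needed for an orientable surface. *)
Section Handles.
Context (k : nat).

Definition handle_centre (ib : 'I_k * bool) : R * R :=
  (4 * (val ib.1)%:R, if ib.2 then 2 else - 2).

Definition handle_rel (x y : set_type (holed_sphere handle_centre)) : bool :=
  `[< x = y \/ exists ib p, [/\ sqdist (handle_centre ib) p = 1,
        val x = Some p & val y = Some (p.1, - p.2)] >].

Lemma handle_rel_refl : reflexive handle_rel.
Proof. by move=> x; apply/asboolP; left. Qed.

Lemma handle_rel_imp x y : handle_rel x y -> handle_rel y x.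
Proof.
move=> /asboolP[->|[[i b] [p [pc xp yp]]]]; first exact: handle_rel_refl.
apply/asboolP; right; exists (i, ~~ b), (p.1, - p.2); split => //=.
  by rewrite -pc /sqdist /=; case: b {pc} => /=; lra.
by rewrite opprK xp; case: (p).
Qed.

Lemma handle_rel_sym : symmetric handle_rel.
Proof. by move=> x y; apply/idP/idP; exact: handle_rel_imp. Qed.

Lemma handle_rel_trans : transitive handle_rel.
Proof.
move=> y x z /asboolP[->//|[ib [p [pc xp yp]]]] /asboolP[<-|].
  by apply/asboolP; right; exists ib, p.
move=> [jb [q [_]]]; rewrite yp => -[<-] zq; apply/asboolP; left.
by apply: val_inj; rewrite xp zq /= opprK; case: (p).
Qed.

Canonical handle_equiv :=
  EquivRel handle_rel handle_rel_refl handle_rel_sym handle_rel_trans.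

Definition orientable_surface : topologicalType :=
  quotient_topology {eq_quot handle_equiv}.

End Handles.

(* The k cross-caps: antipodal points of the boundary circle of the unit disc
   centred at (4i, 0) are identified. *)
Section CrossCaps.
Context (k : nat).

Definition crosscap_centre (i : 'I_k) : R * R := (4 * (val i)%:R, 0).

Definition crosscap_rel (x y : set_type (holed_sphere crosscap_centre)) : bool :=
  `[< x = y \/ exists i p, [/\ sqdist (crosscap_centre i) p = 1,
        val x = Some p & val y = Some (2 *: crosscap_centre i - p)] >].

Lemma crosscap_rel_refl : reflexive crosscap_rel.
Proof. by move=> x; apply/asboolP; left. Qed.

Lemma crosscap_rel_imp x y : crosscap_rel x y -> crosscap_rel y x.
Proof.
move=> /asboolP[->|[i [p [pc xp yp]]]]; first exact: crosscap_rel_refl.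
apply/asboolP; right; exists i, (2 *: crosscap_centre i - p); split => //=.
  by rewrite sqdist_antipode.
by rewrite subKr.
Qed.

Lemma crosscap_rel_sym : symmetric crosscap_rel.
Proof. by move=> x y; apply/idP/idP; exact: crosscap_rel_imp. Qed.

Lemma crosscap_circle_inj (i j : 'I_k) (p : R * R) :
  sqdist (crosscap_centre i) p = 1 -> sqdist (crosscap_centre j) p = 1 -> i = j.
Proof.
wlog ij : i j / (i <= j)%N => [ih pi pj|].
  by have [ij|/ltnW ji] := leqP i j; [exact: ih|exact/esym/ih].
rewrite leq_eqVlt in ij; case/orP: ij => [/eqP/val_inj//|ij].
have {ij} : (i%:R + 1 <= j%:R :> R) by rewrite natr1 ler_nat.
rewrite /sqdist /=; move: (i%:R) (j%:R) p.1 p.2 => a b x y ab pi pj; exfalso.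
have y2 := sqr_ge0 (y - 0).
have : x - 4 * a <= 1.
  by rewrite leNgt; apply/negP => h; nra.
have : - 1 <= x - 4 * b.
  by rewrite leNgt; apply/negP => h; nra.
lra.
Qed.

Lemma crosscap_rel_trans : transitive crosscap_rel.
Proof.
move=> y x z /asboolP[->//|[i [p [pc xp yp]]]] /asboolP[<-|].
  by apply/asboolP; right; exists i, p.
move=> [j [q [qc]]]; rewrite yp => -[qE] zq; apply/asboolP; left.
have ij : i = j.
  apply: crosscap_circle_inj qc; rewrite -qE.
  by rewrite sqdist_antipode.
by apply: val_inj; rewrite xp zq -qE -ij subKr.
Qed.

Canonical crosscap_equiv :=
  EquivRel crosscap_rel crosscap_rel_refl crosscap_rel_sym crosscap_rel_trans.

Definition nonorientable_surface : topologicalType :=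
  quotient_topology {eq_quot crosscap_equiv}.

End CrossCaps.

Definition all_dicolourable (X : topologicalType) (k : nat) : Prop :=
  forall (V : finType) (a : rel V), oriented_graph a ->
    embeddable R X (underlying a) -> dicolourable a k.

Definition is_dichromatic_number (X : topologicalType) (k : nat) : Prop :=
  all_dicolourable X k /\ forall j, all_dicolourable X j -> (k <= j)%N.

End Surfaces.

(* Main.v *)
From Stdlib Require Import BinInt.
Require Import Defs.
From mathcomp Require Import realfun.
From mathcomp Require Import ssrZ zify ring lra.

Set Implicit Arguments.
Unset Strict Implicit.
Unset Printing Implicit Defensive.

Import Order.TTheory GRing.Theory Num.Theory.
Import numFieldNormedType.Exports.

Local Open Scope classical_set_scope.
Local Open Scope ring_scope.

(** Upper bound. By Euler's formula a graph with n vertices drawn on a surface whose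
    first Betti number modulo 2 is ten, as it is for both surfaces here, has at most
    3 n + 24 edges ([euler_inequality], [grid_euler], [drawing_arcs]). The colouring
    argument ([sparse_dicolourable]) uses nothing else: in a smallest subdigraph
    that is not 4-dicolourable all in- and out-degrees are at least four, so the
    inequality leaves at most 24 vertices and little excess over degree four. Up to
    seventeen vertices a large acyclic set is removed, and what remains, ten or
    eleven vertices, is 3-dicolourable. From eighteen vertices on, the few vertices
    of larger out-degree are covered by two maximal acyclic sets, and what remains
    has out-degrees at most two; the directed analogue of Brooks' theorem for this
    degree ([not_regular]) colours it with two colours.

    Euler's formula is obtained without triangulating anything. After a deformation
    of the plane that makes the round holes square, the surface is covered by the
    stars of the vertices of a fine square grid with its holes glued. Distinct
    points have disjoint star neighbourhoods at every fine enough scale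
    ([star_separated]), so by compactness a drawing of a graph becomes, at a fine
    scale, a family of disjoint connected vertex sets of the grid, joined as the
    graph prescribes ([BranchSets]). For the grid itself the homological input is
    explicit: a cochain orthogonal to the faces is a coboundary when ten further
    functionals vanish on it, one for each cross-cap or two for each handle.
    Contraction and deletion of edges preserve this property, and the inequality
    follows by comparing dimensions over the field with two elements, as in Mac
    Lane's planarity criterion.

    Lower bound. The Paley tournament on eleven vertices has no partition into three
    acyclic sets, already because of its directed triangles ([paley_stuck]), and the
    complete graph on eleven vertices is drawn on both surfaces with explicit
    polygonal arcs through the cross-caps and handles. That the arcs are disjoint is
    decided by integer arithmetic ([drawing_ok], [drawing_embeddable]). *)

(** * Euler's inequality from a cellular structure modulo 2 *)

Section ModTwo.

Lemma F2P (x : 'F_2) : x = 0 \/ x = 1.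
Proof. by case: x => [[|[|n]] h] //; [left | right]; apply/val_inj. Qed.

Lemma F2_neq0 (x : 'F_2) : x != 0 -> x = 1.
Proof. by case: (F2P x) => -> //; rewrite eqxx. Qed.

Lemma addrr_F2 (x : 'F_2) : x + x = 0.
Proof. by case: (F2P x) => ->; apply/val_inj. Qed.

Lemma oppr_F2 (x : 'F_2) : - x = x.
Proof. by apply/esym/eqP; rewrite -addr_eq0 addrr_F2. Qed.

Lemma add_eq0_F2 (x y : 'F_2) : x + y = 0 -> x = y.
Proof. by move/eqP; rewrite addr_eq0 oppr_F2 => /eqP. Qed.

Definition dot (Y : finType) (F h : {ffun Y -> 'F_2}) : 'F_2 :=
  \sum_y F y * h y.

Lemma dotDl (Y : finType) (F G h : {ffun Y -> 'F_2}) :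
  dot (F + G) h = dot F h + dot G h.
Proof. by rewrite -big_split; apply: eq_bigr => y _; rewrite ffunE mulrDl. Qed.

Lemma dotBr (Y : finType) (F g h : {ffun Y -> 'F_2}) :
  dot F (g - h) = dot F g - dot F h.
Proof.
by rewrite -sumrB; apply: eq_bigr => y _; rewrite !ffunE mulrBr.
Qed.

Lemma dot0l (Y : finType) (h : {ffun Y -> 'F_2}) : dot 0 h = 0.
Proof. by rewrite /dot big1 // => y _; rewrite ffunE mul0r. Qed.

Definition incidence_le2 (Y : finType) (fs : seq {ffun Y -> 'F_2}) :=
  forall y, (count (fun F : {ffun Y -> 'F_2} => F y != 0%R) fs <= 2)%N.

(** The chains that avoid the coordinate y are spanned by those members of the
    list that avoid y, together with the sum of the two members that meet y:
    this is how deleting an edge of a map merges the two faces beside it.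
    Dually, a cochain orthogonal to the merged list can be corrected at y so
    as to become orthogonal to the original one. *)
Lemma merge_step (Y : finType) (y : Y) (fs : seq {ffun Y -> 'F_2}) :
  incidence_le2 fs ->
  exists fs' : seq {ffun Y -> 'F_2},
  [/\ incidence_le2 fs',
      forall F, F \in fs' -> F y = 0,
      forall z, (forall F, F \in fs -> F z = 0) -> forall F, F \in fs' -> F z = 0,
      forall h, (forall F, F \in fs -> dot F h = 0) ->
        forall F, F \in fs' -> dot F h = 0 &
      forall h, (forall F, F \in fs' -> dot F h = 0) ->
        exists h' : {ffun Y -> 'F_2}, (forall z, z != y -> h' z = h z) /\
          (forall F, F \in fs -> dot F h' = 0)].
Proof.
move=> inc2; pose a := fun F : {ffun Y -> 'F_2} => F y != 0.
pose rest := [seq F <- fs | predC a F].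
have pe : perm_eq fs ([seq F <- fs | a F] ++ rest).
  by rewrite perm_sym; apply/permPl; exact: perm_filterC.
have restP F : F \in rest -> F y = 0.
  by rewrite mem_filter /= negbK => /andP[/eqP].
have aP F : F \in [seq F <- fs | a F] -> F y = 1.
  by rewrite mem_filter => /andP[/F2_neq0].
have sz : (size [seq F <- fs | a F] <= 2)%N.
  by rewrite size_filter; exact: inc2.
have memfs F : (F \in fs) = (F \in [seq F <- fs | a F]) || (F \in rest).
  by rewrite (perm_mem pe) mem_cat.
have cnt z : count (fun F : {ffun Y -> 'F_2} => F z != 0) fs =
  (count (fun F : {ffun Y -> 'F_2} => F z != 0%R) [seq F <- fs | a F] +
   count (fun F : {ffun Y -> 'F_2} => F z != 0%R) rest)%N.
  by rewrite -count_cat; apply/permP.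
pose fix_ (F h : {ffun Y -> 'F_2}) : {ffun Y -> 'F_2} :=
  [ffun z => if z == y then \sum_(x | x != y) F x * h x else h z].
have dot_split (F h : {ffun Y -> 'F_2}) : dot F h = F y * h y + \sum_(x | x != y) F x * h x.
  by rewrite /dot (bigD1 y).
have off (F G h : {ffun Y -> 'F_2}) : \sum_(x | x != y) F x * fix_ G h x = \sum_(x | x != y) F x * h x.
  by apply: eq_bigr => x /negbTE xy; rewrite ffunE xy.
have fixy F h : fix_ F h y = \sum_(x | x != y) F x * h x by rewrite ffunE eqxx.
have fix_dot (F h : {ffun Y -> 'F_2}) : F y = 1 -> dot F (fix_ F h) = 0.
  by move=> Fy; rewrite dot_split off fixy Fy mul1r addrr_F2.
have fix_dot0 (F G h : {ffun Y -> 'F_2}) : F y = 0 -> dot F (fix_ G h) = dot F h.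
  by move=> Fy; rewrite !dot_split off Fy !mul0r.
case E : [seq F <- fs | a F] sz => [|F [|G [|//]]] _.
- exists fs; split => //.
    by move=> F; rewrite memfs E /=; exact: restP.
  by move=> h hh; exists h.
- exists rest; split => //.
  + by move=> z; apply: leq_trans (inc2 z); rewrite cnt leq_addl.
  + by move=> z hz G GR; apply: hz; rewrite memfs GR orbT.
  + by move=> h hh G GR; apply: hh; rewrite memfs GR orbT.
  + move=> h hh; exists (fix_ F h); split.
      by move=> z /negbTE zy; rewrite ffunE zy.
    have Fy : F y = 1 by apply: aP; rewrite E mem_head.
    move=> G; rewrite memfs E inE => /orP[/eqP->|GR]; first exact: fix_dot.
    by rewrite fix_dot0 ?restP// hh.
- have Fy : F y = 1 by apply: aP; rewrite E mem_head.
  have Gy : G y = 1 by apply: aP; rewrite E !inE eqxx orbT.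
  have FI : F \in fs by rewrite memfs E !inE eqxx.
  have GI : G \in fs by rewrite memfs E !inE eqxx orbT.
  have RI K : K \in rest -> K \in fs by move=> KR; rewrite memfs KR orbT.
  exists (F + G :: rest); split => //.
  + move=> z; apply: leq_trans (inc2 z); rewrite cnt E /= addn0.
    rewrite leq_add2r ffunE.
    by case: (F2P (F z)) => ->; case: (F2P (G z)) => ->.
  + move=> K; rewrite inE => /orP[/eqP->|/restP//].
    by rewrite ffunE Fy Gy addrr_F2.
  + move=> z hz K; rewrite inE => /orP[/eqP->|/RI]; last exact: hz.
    by rewrite ffunE !hz// addr0.
  + move=> h hh K; rewrite inE => /orP[/eqP->|/RI]; last exact: hh.
    by rewrite dotDl !hh// addr0.
  + move=> h hh; exists (fix_ F h); split.
      by move=> z /negbTE zy; rewrite ffunE zy.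
    have dF := fix_dot F h Fy.
    have dR K : K \in rest -> dot K (fix_ F h) = 0.
      by move=> KR; rewrite fix_dot0 ?restP// hh// inE KR orbT.
    move=> K; rewrite memfs E !inE => /orP[/orP[/eqP->//|/eqP->]|/dR//].
    have := fix_dot0 (F + G) F h; rewrite ffunE Fy Gy addrr_F2 => /(_ erefl).
    by rewrite dotDl dF add0r => ->; rewrite hh// mem_head.
Qed.

Lemma merge_faces (Y : finType) (D : seq Y) (fs : seq {ffun Y -> 'F_2}) :
  incidence_le2 fs ->
  exists fs' : seq {ffun Y -> 'F_2},
  [/\ incidence_le2 fs',
      forall F y, F \in fs' -> y \in D -> F y = 0,
      forall z, (forall F, F \in fs -> F z = 0) -> forall F, F \in fs' -> F z = 0,
      forall h, (forall F, F \in fs -> dot F h = 0) ->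
        forall F, F \in fs' -> dot F h = 0 &
      forall h, (forall F, F \in fs' -> dot F h = 0) ->
        exists h' : {ffun Y -> 'F_2}, (forall z, z \notin D -> h' z = h z) /\
          (forall F, F \in fs -> dot F h' = 0)].
Proof.
elim: D fs => [|y D ih] fs inc2.
  by exists fs; split => // h hh; exists h.
have [fs1 [i1 y1 s1 c1 d1]] := merge_step y inc2.
have [fs2 [i2 y2 s2 c2 d2]] := ih _ i1.
exists fs2; split => //.
- by move=> F z FI; rewrite inE => /orP[/eqP->|/y2->//]; exact: s2 FI.
- by move=> z /s1/s2.
- by move=> h /c1/c2.
move=> h /d2[h1 [e1 /d1[h2 [e2 o2]]]]; exists h2; split => // z.
by rewrite inE negb_or => /andP[/e2-> /e1].
Qed.

Lemma card_halve (T : finType) (A B : {set {ffun T -> 'F_2}}) :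
  (forall x y, x \in A -> y \in A -> x \notin B -> y \notin B -> x - y \in B) ->
  (#|A| <= 2 * #|B|)%N.
Proof.
move=> AB; have [D0|[x0]] := set_0Vmem (A :\: B).
  have/subset_leq_card : A \subset B by rewrite -finset.setD_eq0 D0.
  by move/leq_trans; apply; rewrite mul2n -addnn leq_addr.
rewrite inE => /andP[x0B x0A].
rewrite -(cardsID B A) mul2n -addnn; apply: leq_add.
  by apply/subset_leq_card; rewrite subsetIr.
rewrite -(card_imset (A :\: B) (addIr (- x0))); apply: subset_leq_card.
apply/fintype.subsetP => z /imsetP[y]; rewrite inE => /andP[yB yA] ->.
exact: AB.
Qed.

Lemma card_orthogonal (T : finType) (gs : seq {ffun T -> 'F_2}) :
  (2 ^ #|T| <=
    2 ^ size gs * #|[set g : {ffun T -> 'F_2} | all (fun G => dot G g == 0%R) gs]%SET|)%N.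
Proof.
elim: gs => [|G gs ih] /=.
  rewrite expn0 mul1n.
  rewrite -[X in (X ^ _ <= _)%N](card_Fp (isT : prime 2)) -card_ffun.
  apply: subset_leq_card; by apply/fintype.subsetP => g _; rewrite inE.
apply: leq_trans ih _; rewrite expnSr -mulnA leq_mul2l; apply/orP; right.
apply: card_halve => x y; rewrite !inE => xg yg; rewrite xg yg !andbT => /F2_neq0 Gx /F2_neq0 Gy.
rewrite dotBr Gx Gy subrr eqxx; apply/allP => F FI.
by rewrite dotBr (eqP (allP xg _ FI)) (eqP (allP yg _ FI)) subrr.
Qed.

Lemma card_coboundary (V E : finType) (src tgt : E -> V) : (0 < #|V|)%N ->
  (2 * #|[set [ffun e => (q (src e) + q (tgt e))%R] | q : {ffun V -> 'F_2}]%SET|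
    <= 2 ^ #|V|)%N.
Proof.
move=> /card_gt0P[v0 _].
pose d (q : {ffun V -> 'F_2}) : {ffun E -> 'F_2} := [ffun e => q (src e) + q (tgt e)].
pose one : {ffun V -> 'F_2} := [ffun=> 1].
pose A := [set q : {ffun V -> 'F_2} | q v0 == 0]%SET.
have sub : d @: [set: {ffun V -> 'F_2}]%SET \subset d @: A.
  apply/fintype.subsetP => _ /imsetP[q _ ->]; have [q0|/F2_neq0 q1] := eqVneq (q v0) 0.
    by apply/imsetP; exists q; rewrite // inE q0.
  apply/imsetP; exists (q + one); first by rewrite inE !ffunE q1 addrr_F2.
  by apply/ffunP => e; rewrite !ffunE addrACA addrr_F2 addr0.
have -> : [set [ffun e => q (src e) + q (tgt e)] | q : {ffun V -> 'F_2}]%SET =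
  d @: [set: {ffun V -> 'F_2}]%SET.
  by apply/setP => g; apply/imsetP/imsetP => -[q _ ->]; exists q; rewrite ?inE.
apply: (@leq_trans (2 * #|A|)).
  by rewrite leq_mul2l/= (leq_trans (subset_leq_card sub))// leq_imset_card.
rewrite mul2n -addnn -{2}(card_imset A (addIr one)).
rewrite -[X in (_ <= X ^ _)%N](card_Fp (isT : prime 2)) -card_ffun -cardsT.
rewrite -cardsUI (_ : _ :&: _ = finset.set0)%SET ?cards0 ?addn0 ?subset_leq_card//.
apply/setP => q; rewrite !inE; apply/negP => /andP[/eqP q0 /imsetP[r]].
by rewrite inE => /eqP r0 qE; move: q0; rewrite qE !ffunE r0.
Qed.

(** A nonzero cycle modulo 2 of a simple graph has length at least three: both
    ends of an edge of the cycle lie on a further edge of it, and these two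
    further edges differ since the graph has no parallel edges. *)
Lemma cycle_support (V E : finType) (src tgt : E -> V) (c : {ffun E -> 'F_2}) :
  (forall e, src e != tgt e) ->
  (forall e e', [set src e; tgt e]%SET = [set src e'; tgt e']%SET -> e = e') ->
  c != 0 -> (forall q : V -> 'F_2, \sum_e c e * (q (src e) + q (tgt e)) = 0) ->
  (3 <= #|[set e | c e != 0%R]%SET|)%N.
Proof.
move=> ne simp c0 cyc.
have [e ce] : exists e, c e != 0.
  apply/existsP; apply: contraR c0 => /existsPn h.
  by apply/eqP/ffunP => e; rewrite ffunE; apply/eqP; rewrite -[_ == _]negbK.
have other v (f : E) : (src f == v) || (tgt f == v) -> c f != 0 ->
    exists2 g, g != f & (c g != 0) && ((src g == v) || (tgt g == v)).
  move=> fv cf; have := cyc (fun w => (w == v)%:R).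
  rewrite (bigD1 f)//= (F2_neq0 cf) mul1r.
  have -> : (src f == v)%:R + (tgt f == v)%:R = 1 :> 'F_2.
    case/orP: fv => /eqP fE; rewrite fE eqxx.
      by rewrite -fE eq_sym (negbTE (ne f)) addr0.
    by rewrite -fE (negbTE (ne f)) add0r.
  move=> s0; have : \sum_(i | i != f) c i * ((src i == v)%:R + (tgt i == v)%:R) != 0.
    by apply/eqP => s1; move: s0; rewrite s1 addr0.
  case: (boolP [exists g, [&& g != f, c g != 0 & (src g == v) || (tgt g == v)]]).
    by case/existsP => g /and3P[gf cg gv] _; exists g; rewrite // cg.
  move/existsPn => h; rewrite big1 ?eqxx// => g gf.
  move: (h g); rewrite gf /=; have [->|] := eqVneq (c g) 0; first by rewrite mul0r.
  by rewrite negb_or => _ /andP[/negbTE-> /negbTE->]; rewrite addr0 mulr0.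
have [f fe /andP[cf fv]] := other (src e) e (introT orP (or_introl (eqxx _))) ce.
have [g ge /andP[cg gv]] := other (tgt e) e (introT orP (or_intror (eqxx _))) ce.
have fg : f != g.
  apply: contra_neq fe => fg; rewrite -{}fg in gv; apply: simp.
  case/orP: fv => /eqP fv; case/orP: gv => /eqP gv; rewrite ?fv ?gv// 1?finset.setUC//.
  - by move: (ne e); rewrite -fv -gv eqxx.
  - by move: (ne e); rewrite -fv -gv eqxx.
have /subset_leq_card : (e |: (f |: [set g]))%SET \subset [set e | c e != 0]%SET.
  by apply/fintype.subsetP => x; rewrite !inE => /orP[|/orP[]] /eqP->.
move=> le3; apply: leq_trans le3; rewrite !cardsU1 !inE cards1 (negbTE fg).
by rewrite eq_sym (negbTE fe) eq_sym (negbTE ge).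
Qed.

Lemma face_count (T : finType) (gs : seq {ffun T -> 'F_2}) :
  incidence_le2 gs ->
  (forall G, G \in gs -> (3 <= #|[set e | G e != 0%R]%SET|)%N) ->
  (3 * size gs <= 2 * #|T|)%N.
Proof.
move=> inc g3.
have : (\sum_(G <- gs) #|[set e | G e != 0%R]%SET| <= 2 * #|T|)%N.
  under eq_bigr do rewrite -sum1_card.
  have -> : (\sum_(G <- gs) \sum_(e in [set e | G e != 0%R]%SET) 1 =
      \sum_e count (fun G : {ffun T -> 'F_2} => G e != 0%R) gs)%N.
    rewrite (eq_bigr (fun G : {ffun T -> 'F_2} => \sum_e (G e != 0%R : nat))%N).
      by rewrite exchange_big/=; apply: eq_bigr => e _; rewrite -sum1_count [RHS]big_mkcond;
      apply: eq_bigr => G _; case: (G e != 0).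
    by move=> G _; rewrite big_mkcond; apply: eq_bigr => e _; rewrite inE.
  rewrite -sum1_card big_distrr/=; apply: leq_sum => e _; exact: inc.
move=> le; apply: leq_trans le; rewrite mulnC -sum1_size big_distrl/= !big_seq.
by apply: leq_sum => G /g3.
Qed.

Lemma sum_incidence (T : finType) (gs : seq {ffun T -> 'F_2}) e :
  (\sum_(G <- gs) G) e = (count (fun G : {ffun T -> 'F_2} => G e != 0) gs)%:R.
Proof.
elim: gs => [|G gs ih]; first by rewrite big_nil ffunE.
rewrite big_cons ffunE ih /= natrD; congr (_ + _).
by have [->//|/F2_neq0->] := eqVneq (G e) 0.
Qed.

Lemma dot_suml (T : finType) (gs : seq {ffun T -> 'F_2}) g :
  dot (\sum_(G <- gs) G) g = \sum_(G <- gs) dot G g.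
Proof.
by elim: gs => [|G gs ih]; rewrite ?big_nil ?dot0l// !big_cons dotDl ih.
Qed.

(** Mac Lane's form of Euler's formula. The edges Y of a map on a surface carry
    face boundaries covering no edge more than twice, and a cochain orthogonal
    to the faces is a coboundary as soon as t further linear functionals vanish
    on it, t being the first Betti number modulo 2. Contracting the edges in I
    and deleting those that are neither in I nor of the form [rep e] gives the
    graph on V with edges E. Both operations keep this structure, so that the
    graph has a family of f cycles that covers no edge twice and whose span has
    rank at least (m - n + 1) - t; adding the sum of the cycles shows that this
    rank is at most f - 1, and 3 f <= 2 m because the graph is simple. *)
Theorem euler_inequality (V E Y : finType) (src tgt : E -> V) (rep : E -> Y)
    (I : {set Y}) (fs : seq {ffun Y -> 'F_2}) (t : nat)
    (theta : 'I_t -> {ffun Y -> 'F_2} -> 'F_2) :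
  (0 < #|V|)%N -> (1 < t)%N ->
  (forall e, src e != tgt e) ->
  (forall e e', [set src e; tgt e]%SET = [set src e'; tgt e']%SET -> e = e') ->
  injective rep -> (forall e, rep e \notin I) ->
  incidence_le2 fs ->
  (forall i g h, theta i (g - h) = theta i g - theta i h) ->
  (forall q : V -> 'F_2, exists h : {ffun Y -> 'F_2},
    [/\ forall F, F \in fs -> dot F h = 0, forall y, y \in I -> h y = 0 &
        forall e, h (rep e) = q (src e) + q (tgt e)]) ->
  (forall h : {ffun Y -> 'F_2}, (forall F, F \in fs -> dot F h = 0) ->
    (forall y, y \in I -> h y = 0) -> (forall i, theta i h = 0) ->
    exists q : V -> 'F_2, forall e, h (rep e) = q (src e) + q (tgt e)) ->
  (#|E| + 6 <= 3 * #|V| + 3 * t)%N.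
Proof.
move=> V0 t2 ne simp repI repNI inc thetaB H1 H2.
pose D := [seq y <- enum Y | (y \notin I) && (y \notin codom rep)].
have [fs' [inc' D0 _ fs_fs' ext]] := merge_faces D inc.
pose rho (F : {ffun Y -> 'F_2}) : {ffun E -> 'F_2} := [ffun e => F (rep e)].
have dot_rho (F h : {ffun Y -> 'F_2}) : F \in fs' -> (forall y, y \in I -> h y = 0) ->
    dot F h = \sum_e F (rep e) * h (rep e).
  move=> FI hI; rewrite /dot (bigID (fun y => y \in codom rep))/=.
  rewrite [X in _ + X]big1 ?addr0; last first.
    move=> y yr; have [/hI->|yI] := boolP (y \in I); first by rewrite mulr0.
    by rewrite (D0 F y)// ?mul0r// mem_filter yI yr mem_enum.
  rewrite -big_filter -[RHS]big_enum -(big_map rep predT (fun y => F y * h y)).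
  apply: perm_big; apply: uniq_perm; first by rewrite filter_uniq// index_enum_uniq.
    by rewrite map_inj_uniq// enum_uniq.
  by move=> y; rewrite mem_filter mem_index_enum andbT.
pose gs := [seq G <- map rho fs' | G != 0].
have gs_cyc G : G \in gs -> forall q : V -> 'F_2,
    \sum_e G e * (q (src e) + q (tgt e)) = 0.
  rewrite mem_filter => /andP[_ /mapP[F FI ->]] q.
  have [h [hf hI he]] := H1 q.
  rewrite -[RHS](fs_fs' _ hf _ FI) (dot_rho _ _ FI hI).
  by apply: eq_bigr => e _; rewrite ffunE he.
have gs_inc : incidence_le2 gs.
  move=> e; apply: leq_trans (inc' (rep e)); rewrite count_filter count_map.
  by apply: sub_count => F /= /andP[]; rewrite ffunE.
have gs3 G : G \in gs -> (3 <= #|[set e | G e != 0%R]%SET|)%N.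
  move=> GI; apply: cycle_support ne simp _ (gs_cyc _ GI).
  by move: GI; rewrite mem_filter => /andP[].
pose Q (j : nat) := [set g : {ffun E -> 'F_2} | `[< exists h : {ffun Y -> 'F_2},
  [/\ forall F, F \in fs -> dot F h = 0, forall y, y \in I -> h y = 0,
      forall i : 'I_t, (i < j)%N -> theta i h = 0 & forall e, h (rep e) = g e] >]]%SET.
have QP j (g : {ffun E -> 'F_2}) : reflect (exists h : {ffun Y -> 'F_2},
    [/\ forall F, F \in fs -> dot F h = 0, forall y, y \in I -> h y = 0,
      forall i : 'I_t, (i < j)%N -> theta i h = 0 & forall e, h (rep e) = g e])
    (g \in Q j).
  by rewrite inE; exact: asboolP.
have Qhalve j : (j <= t)%N -> (#|Q 0%N| <= 2 ^ j * #|Q j|)%N.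
  elim: j => [|j ih] jt; first by rewrite mul1n.
  apply: leq_trans (ih (ltnW jt)) _; rewrite expnSr -mulnA leq_mul2l card_halve ?orbT//.
  move=> x y /QP[h [hF hI ht hx]] /QP[k [kF kI kt ky]].
  move=> /negP xQ /negP yQ; apply/QP; exists (h - k); split.
  - by move=> F FI; rewrite dotBr hF// kF// subrr.
  - by move=> z zI; rewrite !ffunE hI// kI// subrr.
  - move=> i; rewrite ltnS leq_eqVlt => /orP[/eqP ij|ij]; last first.
      by rewrite thetaB ht// kt// subrr.
    rewrite thetaB; have [h0|/F2_neq0->] := eqVneq (theta i h) 0.
      case: xQ; apply/QP; exists h; split => // i'; rewrite ltnS leq_eqVlt => /orP[/eqP i'j|/ht//].
      by rewrite (_ : i' = i)//; apply/val_inj; rewrite /= i'j.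
    have [k0|/F2_neq0->] := eqVneq (theta i k) 0; last by rewrite subrr.
    case: yQ; apply/QP; exists k; split => // i'; rewrite ltnS leq_eqVlt => /orP[/eqP i'j|/kt//].
    by rewrite (_ : i' = i)//; apply/val_inj; rewrite /= i'j.
  - by move=> e; rewrite !ffunE hx ky.
have Qt : (2 * #|Q t| <= 2 ^ #|V|)%N.
  apply: leq_trans (card_coboundary src tgt V0); rewrite leq_mul2l/=.
  apply/subset_leq_card/fintype.subsetP => g /QP[h [hF hI ht hg]].
  have [q qe] := H2 h hF hI (fun i => ht i (ltn_ord i)).
  apply/imsetP; exists [ffun v => q v]; rewrite //; apply/ffunP => e.
  by rewrite !ffunE -hg qe.
have ZQ : [set g : {ffun E -> 'F_2} | all (fun G => dot G g == 0) gs]%SET \subset Q 0%N.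
  apply/fintype.subsetP => g; rewrite inE => /allP gZ; apply/QP.
  pose h0 : {ffun Y -> 'F_2} := [ffun y => \sum_(e | rep e == y) g e].
  have h0rep e : h0 (rep e) = g e.
    rewrite ffunE (eq_bigl (pred1 e)) ?big_pred1_eq//.
    by move=> f; rewrite /= (inj_eq repI).
  have h0I y : y \in I -> h0 y = 0.
    move=> yI; rewrite ffunE big1// => e /eqP ey.
    by move: (repNI e); rewrite ey yI.
  have h0F F : F \in fs' -> dot F h0 = 0.
    move=> FI; rewrite dot_rho//.
    have [r0|r0] := eqVneq (rho F) 0.
      by apply: big1 => e _; move/ffunP: r0 => /(_ e); rewrite !ffunE => ->; rewrite mul0r.
    rewrite -[RHS](eqP (gZ (rho F) _)); last by rewrite mem_filter r0 map_f.
    by apply: eq_bigr => e _; rewrite h0rep ffunE.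
  have [h [hD hF]] := ext h0 h0F.
  exists h; split => // [y yI|e].
    by rewrite hD ?h0I// mem_filter yI.
  by rewrite hD ?h0rep// mem_filter codom_f !andbF.
have key (r : seq {ffun E -> 'F_2}) :
    [set g : {ffun E -> 'F_2} | all (fun G => dot G g == 0) r]%SET \subset Q 0%N ->
    (#|E| + 1 <= size r + t + #|V|)%N.
  move=> rQ; rewrite -(leq_exp2l (m := 2))//.
  rewrite addn1 expnS !expnD.
  apply: (@leq_trans (2 * (2 ^ size r * #|Q 0%N|))).
    by rewrite leq_mul2l/= (leq_trans (card_orthogonal r))// leq_mul2l subset_leq_card ?orbT.
  rewrite mulnCA -mulnA leq_mul2l; apply/orP; right.
  apply: (@leq_trans (2 * (2 ^ t * #|Q t|))); first by rewrite leq_mul2l Qhalve.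
  by rewrite mulnCA leq_mul2l Qt orbT.
pose S := \sum_(G <- gs) G.
have [S0|S0] := eqVneq S 0; last first.
  have : (3 * size (S :: gs) <= 2 * #|E|)%N.
    apply: face_count => [e|G].
      rewrite /= sum_incidence; move: (gs_inc e).
      by case: (count _ _) => [|[|[|]]].
    rewrite inE => /orP[/eqP->|]; last exact: gs3.
    apply: cycle_support ne simp S0 _ => q.
    rewrite -[LHS](_ : dot S [ffun e => q (src e) + q (tgt e)] = _); last first.
      by apply: eq_bigr => e _; congr (_ * _); rewrite ffunE.
    rewrite dot_suml big_seq big1// => K KI.
    by rewrite -[RHS](gs_cyc _ KI q); apply: eq_bigr => e _; rewrite ffunE.
  by move=> /=; have := key _ ZQ; move: (size gs) (#|E|) (#|V|) => a b c; move=> A B; lia.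
case E0 : gs => [|G r].
  have := key _ ZQ; rewrite E0 /=.
  by move: (#|E|) (#|V|) V0 => b c ? A; lia.
have rQ : [set g : {ffun E -> 'F_2} | all (fun G => dot G g == 0) r]%SET \subset Q 0%N.
  apply: (fintype.subset_trans _ ZQ); apply/fintype.subsetP => g; rewrite !inE E0 /= => rg; rewrite rg andbT.
  have : dot S g = 0 by rewrite S0 dot0l.
  rewrite dot_suml E0 big_cons [X in _ + X]big_seq big1 ?addr0 => [->//|F FI].
  exact/eqP/(allP rg).
have := face_count gs_inc gs3; rewrite E0 /=.
by have := key _ rQ; move: (size r) (#|E|) (#|V|) => a b c A B; lia.
Qed.

End ModTwo.
(** * A square grid with glued square holes *)

Section Grid.
Variables (I : finType) (N k : nat) (x0 y0 : I -> nat) (xf : bool).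
Local Notation m := (k + k)%N.

Hypothesis k_gt0 : (0 < k)%N.
Hypothesis inside : forall i,
  [&& 0 < x0 i, x0 i + m < N, 0 < y0 i & y0 i + m < N]%N.
Hypothesis apart : forall i j, i != j ->
  [|| x0 i + m < x0 j, x0 j + m < x0 i, y0 i + m < y0 j | y0 j + m < y0 i]%N.
Variable partner : I -> I.
Hypothesis partner_x : forall i, x0 (partner i) = x0 i.
Hypothesis partner_y : forall i, (y0 (partner i) + m + y0 i = N)%N.

(** The horizontal part of the gluing, b |-> N - b being the vertical part: together
    they are a half-turn if xf holds and a reflection otherwise. *)
Definition glue_x i a := if xf then (x0 i + x0 i + m - a)%N else a.
Definition in_square i a b :=
  [&& x0 i <= a, a < x0 i + m, y0 i <= b & b < y0 i + m]%N.
Definition on_rim i a b :=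
  [&& x0 i <= a, a <= x0 i + m, y0 i <= b, b <= y0 i + m &
      [|| a == x0 i, a == x0 i + m, b == y0 i | b == y0 i + m]]%N.
Definition hor_inner i a b := [&& x0 i <= a, a < x0 i + m, y0 i < b & b < y0 i + m]%N.
Definition ver_inner i a b := [&& x0 i < a, a < x0 i + m, y0 i <= b & b < y0 i + m]%N.
Definition hor_rim i a b :=
  [&& x0 i <= a, a < x0 i + m & (b == y0 i) || (b == y0 i + m)]%N.
Definition ver_rim i a b :=
  [&& y0 i <= b, b < y0 i + m & (a == x0 i) || (a == x0 i + m)]%N.
Definition hor_valid a b := [forall i, ~~ hor_inner i a b].
Definition ver_valid a b := [forall i, ~~ ver_inner i a b].
Definition outer a b := [|| a == 0, a == N, b == 0 | b == N]%N.
Definition hor_glue i a b := (if xf then x0 i + x0 i + m - a.+1 else a, N - b)%N.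
Definition ver_glue i a b := (glue_x i a, N - b.+1)%N.

Lemma same_hole i j a b :
  (x0 i <= a <= x0 i + m)%N -> (y0 i <= b <= y0 i + m)%N ->
  (x0 j <= a <= x0 j + m)%N -> (y0 j <= b <= y0 j + m)%N -> i = j.
Proof.
move=> h1 h2 h3 h4; apply/eqP; apply: contraT => /apart h.
by exfalso; lia.
Qed.

Lemma hor_rim_valid i a b : hor_rim i a b -> hor_valid a b.
Proof.
move=> r; apply/forallP => j; apply/negP => h.
have ij : i = j by move: r h; rewrite /hor_rim /hor_inner => r h; apply: (@same_hole i j a b); lia.
by subst j; move: r h; rewrite /hor_rim /hor_inner; lia.
Qed.

Lemma ver_rim_valid i a b : ver_rim i a b -> ver_valid a b.
Proof.
move=> r; apply/forallP => j; apply/negP => h.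
have ij : i = j by move: r h; rewrite /ver_rim /ver_inner => r h; apply: (@same_hole i j a b); lia.
by subst j; move: r h; rewrite /ver_rim /ver_inner; lia.
Qed.

Lemma hor_glue_rim i a b : hor_rim i a b ->
  hor_rim (partner i) (hor_glue i a b).1 (hor_glue i a b).2.
Proof.
rewrite /hor_rim /hor_glue /= partner_x; have := partner_y i; have := inside i.
by case: xf; lia.
Qed.

Lemma ver_glue_rim i a b : ver_rim i a b ->
  ver_rim (partner i) (ver_glue i a b).1 (ver_glue i a b).2.
Proof.
rewrite /ver_rim /ver_glue /glue_x /= partner_x; have := partner_y i; have := inside i.
by case: xf; lia.
Qed.

Implicit Types H V p : nat -> nat -> 'F_2.

Definition curl H V a b := H a b + V a.+1 b + H a b.+1 + V a b.

Definition hole_curl H V i :=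
  \sum_(u < m) \sum_(v < m) curl H V (x0 i + u)%N (y0 i + v)%N.

(** A cochain on the edges of a square is corrected on interior edges only: the
    curl of each row is pushed to its last cell, then up the last column, and
    what arrives in the top corner is the total curl. *)
Lemma fill_square i H V : hole_curl H V i = 0 -> exists H' V',
  [/\ forall a b, ~~ hor_inner i a b -> H' a b = H a b,
      forall a b, ~~ ver_inner i a b -> V' a b = V a b &
      forall a b, in_square i a b -> curl H' V' a b = 0].
Proof.
move=> tot.
pose S n b := \sum_(u < n) curl H V (x0 i + u)%N b.
pose T n := \sum_(v < n) S m (y0 i + v)%N.
have Tm : T m = 0 by rewrite -tot /hole_curl exchange_big.
have S0 b : S 0%N b = 0 by rewrite /S big_ord0.
have T0 : T 0%N = 0 by rewrite /T big_ord0.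
pose V' a b := V a b + if ver_inner i a b then S (a - x0 i)%N b else 0.
pose H' a b := H a b +
  if hor_inner i a b && (a.+1 == x0 i + m)%N then T (b - y0 i)%N else 0.
exists H', V'; split.
- by move=> a b /negbTE h; rewrite /H' h addr0.
- by move=> a b /negbTE h; rewrite /V' h addr0.
move=> a b; rewrite /in_square => /and4P[a1 a2 b1 b2].
have Va : V' a b = V a b + S (a - x0 i)%N b.
  rewrite /V' /ver_inner; case: ifPn => // h; rewrite (_ : a - x0 i = 0)%N ?S0//.
  by lia.
have SS : S (a.+1 - x0 i)%N b = S (a - x0 i)%N b + curl H V a b.
  by rewrite subSn// /S big_ord_recr/= subnKC.
have [al|al] := eqVneq a.+1 (x0 i + m)%N; last first.
  have -> : curl H' V' a b = curl H V a b + S (a.+1 - x0 i)%N b + S (a - x0 i)%N b.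
    rewrite {1}/curl Va /H' /V' (negbTE al) !andbF !addr0.
    have -> : ver_inner i a.+1 b by rewrite /ver_inner; lia.
    by rewrite /curl; ring.
  rewrite SS; set c := curl H V a b; set t := S _ _.
  rewrite (_ : c + (t + c) + t = (c + c) + (t + t)); last by ring.
  by rewrite !addrr_F2.
have Hb : H' a b = H a b + T (b - y0 i)%N.
  rewrite /H' /hor_inner al eqxx andbT; case: ifPn => // h.
  by rewrite (_ : b - y0 i = 0)%N ?T0//; lia.
have Hb1 : H' a b.+1 = H a b.+1 + T (b.+1 - y0 i)%N.
  rewrite /H' /hor_inner al eqxx andbT; case: ifPn => // h.
  by rewrite (_ : b.+1 - y0 i = m)%N ?Tm//; lia.
have Va1 : V' a.+1 b = V a.+1 b.
  by rewrite /V' (_ : ver_inner i a.+1 b = false) ?addr0// /ver_inner; lia.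
have TT : T (b.+1 - y0 i)%N = T (b - y0 i)%N + S (a - x0 i)%N b + curl H V a b.
  rewrite subSn// {1}/T big_ord_recr/= subnKC// -/(T _) -addrA -SS.
  by rewrite al addKn.
have -> : curl H' V' a b = curl H V a b + T (b.+1 - y0 i)%N + T (b - y0 i)%N + S (a - x0 i)%N b.
  by rewrite {1}/curl Va Va1 Hb Hb1 /curl; ring.
rewrite TT; set c := curl H V a b; set t := T _; set s := S _ _.
rewrite (_ : c + (t + s + c) + t + s = (c + c) + (t + t) + (s + s)); last by ring.
by rewrite !addrr_F2.
Qed.

Lemma fill_squares (s : seq I) H V : uniq s ->
  (forall i, i \in s -> hole_curl H V i = 0) -> exists H' V',
  [/\ forall a b, (forall i, i \in s -> ~~ hor_inner i a b) -> H' a b = H a b,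
      forall a b, (forall i, i \in s -> ~~ ver_inner i a b) -> V' a b = V a b &
      forall i a b, i \in s -> in_square i a b -> curl H' V' a b = 0].
Proof.
elim: s H V => [|i s ih] H V /=; first by exists H, V; split.
move=> /andP[iNs us] hs.
have [H1 [V1 [eH eV c0]]] := fill_square (hs i (mem_head _ _)).
have eqc H2 V2 H3 V3 j l a b : j != l -> in_square l a b ->
  (forall a b, ~~ hor_inner j a b -> H2 a b = H3 a b) ->
  (forall a b, ~~ ver_inner j a b -> V2 a b = V3 a b) ->
  curl H2 V2 a b = curl H3 V3 a b.
  move=> /apart ap sq e1 e2; rewrite /curl !e1 ?e2//;
    by move: ap sq; rewrite /in_square /hor_inner /ver_inner; lia.
have ineq j : j \in s -> i != j by apply: contraTneq => <-.
have hs1 j : j \in s -> hole_curl H1 V1 j = 0.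
  move=> js; rewrite -(hs j); last by rewrite inE js orbT.
  apply: eq_bigr => u _; apply: eq_bigr => v _; apply: (eqc _ _ _ _ i j) => //.
    exact: ineq.
  by rewrite /in_square !leq_addr !ltn_add2l !ltn_ord.
have [H2 [V2 [eH2 eV2 c2]]] := ih H1 V1 us hs1.
exists H2, V2; split.
- move=> a b h; rewrite eH2; first by apply: eH; apply: h; rewrite mem_head.
  by move=> j js; apply: h; rewrite inE js orbT.
- move=> a b h; rewrite eV2; first by apply: eV; apply: h; rewrite mem_head.
  by move=> j js; apply: h; rewrite inE js orbT.
move=> j a b; rewrite inE => /orP[/eqP->|js]; last exact: c2 js.
move=> sq; rewrite -[RHS](c0 a b sq) /curl !eH2 ?eV2// => j' /ineq/apart.
all: by move: sq; rewrite /in_square /hor_inner /ver_inner; lia.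
Qed.

(** The value at a vertex is the sum along the bottom row and then up a column. *)
Lemma plane_potential H V :
  (forall a b, (a < N)%N -> (b < N)%N -> curl H V a b = 0) ->
  exists p, (forall a b, (a < N)%N -> (b <= N)%N -> H a b = p a b + p a.+1 b) /\
            (forall a b, (a <= N)%N -> (b < N)%N -> V a b = p a b + p a b.+1).
Proof.
move=> c0.
exists (fun a b => \sum_(u < a) H u 0%N + \sum_(v < b) V a v); split; last first.
  move=> a b _ _; rewrite [X in _ = _ + (_ + X)]big_ord_recr/=.
  set A := \sum_(u < a) _; set B := \sum_(v < b) _.
  rewrite (_ : A + B + (A + (B + V a b)) = (A + A) + (B + B) + V a b); last by ring.
  by rewrite !addrr_F2 !add0r.
move=> a b aN; elim: b => [|b ih] bN.
  rewrite !big_ord0 !addr0 big_ord_recr/= addrA addrr_F2 add0r//.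
have := ih (ltnW bN); have := c0 a b aN bN; rewrite /curl !big_ord_recr/=.
set A := \sum_(u < a) _; set B := \sum_(v < b) V a v; set C := \sum_(v < b) V a.+1 v.
move: (H a b) (H a b.+1) (V a b) (V a.+1 b) (H a 0%N) A B C => h h1 v v1 z A B C.
move=> e ih'; have -> : h1 = h + v1 + v.
  by apply: add_eq0_F2; rewrite -[RHS]e; ring.
by rewrite ih'; ring.
Qed.

(** The gluing commutes with the edges of the rim, so the difference of a
    potential across the gluing is constant along the rim. *)
Lemma rim_constant i p :
  (forall a b, hor_rim i a b ->
     p a b + p a.+1 b = p (glue_x i a) (N - b)%N + p (glue_x i a.+1) (N - b)%N) ->
  (forall a b, ver_rim i a b ->
     p a b + p a b.+1 = p (glue_x i a) (N - b)%N + p (glue_x i a) (N - b.+1)%N) ->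
  forall a b a' b', on_rim i a b -> on_rim i a' b' ->
    p a b = p (glue_x i a) (N - b)%N -> p a' b' = p (glue_x i a') (N - b')%N.
Proof.
move=> hH hV.
pose g a b := p a b + p (glue_x i a) (N - b)%N.
have gH a b : hor_rim i a b -> g a.+1 b = g a b.
  move=> /hH e; apply: add_eq0_F2; rewrite /g.
  rewrite (_ : _ + _ = (p a b + p a.+1 b) +
    (p (glue_x i a) (N - b)%N + p (glue_x i a.+1) (N - b)%N)); last by ring.
  by rewrite e addrr_F2.
have gV a b : ver_rim i a b -> g a b.+1 = g a b.
  move=> /hV e; apply: add_eq0_F2; rewrite /g.
  rewrite (_ : _ + _ = (p a b + p a b.+1) +
    (p (glue_x i a) (N - b)%N + p (glue_x i a) (N - b.+1)%N)); last by ring.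
  by rewrite e addrr_F2.
have rowc b : (b == y0 i) || (b == y0 i + m)%N ->
    forall u, (u <= m)%N -> g (x0 i + u)%N b = g (x0 i) b.
  move=> bb; elim=> [|u ih] um; first by rewrite addn0.
  by rewrite addnS gH ?ih//; [lia|rewrite /hor_rim bb; lia].
have colc a : (a == x0 i) || (a == x0 i + m)%N ->
    forall v, (v <= m)%N -> g a (y0 i + v)%N = g a (y0 i).
  move=> aa; elim=> [|v ih] vm; first by rewrite addn0.
  by rewrite addnS gV ?ih//; [lia|rewrite /ver_rim aa; lia].
have all0 a b : on_rim i a b -> g a b = g (x0 i) (y0 i).
  rewrite /on_rim => /and5P[a1 a2 b1 b2 /or4P[/eqP ae|/eqP ae|/eqP be|/eqP be]].
  - rewrite -(subnKC b1) ae colc ?eqxx//; lia.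
  - rewrite -(subnKC b1) ae colc ?eqxx ?orbT//; last by lia.
    by rewrite rowc ?eqxx//.
  - rewrite -(subnKC a1) be rowc ?eqxx//; lia.
  - rewrite -(subnKC a1) be rowc ?eqxx ?orbT//; last by lia.
    by rewrite colc ?eqxx//.
move=> a b a' b' r r' e; apply: add_eq0_F2; rewrite -[LHS]/(g a' b') all0// -(all0 a b)//.
by rewrite /g e addrr_F2.
Qed.

Definition glued H V :=
  (forall i a b, hor_rim i a b -> H a b = H (hor_glue i a b).1 (hor_glue i a b).2) /\
  (forall i a b, ver_rim i a b -> V a b = V (ver_glue i a b).1 (ver_glue i a b).2).

(** Edges inside a hole belong to no face, so the values there are replaced by zero
    before curls are taken. *)
Definition clear_hor H a b := if hor_valid a b then H a b else 0.
Definition clear_ver V a b := if ver_valid a b then V a b else 0.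

Lemma clear_hor_in i H a b : (x0 i <= a < x0 i + m)%N -> (y0 i <= b <= y0 i + m)%N ->
  clear_hor H a b = if (b == y0 i) || (b == y0 i + m)%N then H a b else 0.
Proof.
move=> ha hb; rewrite /clear_hor; case: ifPn => [v|v]; case: ifPn => // r.
  by move/forallP: v => /(_ i); rewrite /hor_inner; lia.
by case/negP: v; apply: (@hor_rim_valid i); rewrite /hor_rim r; lia.
Qed.

Lemma clear_ver_in i V a b : (x0 i <= a <= x0 i + m)%N -> (y0 i <= b < y0 i + m)%N ->
  clear_ver V a b = if (a == x0 i) || (a == x0 i + m)%N then V a b else 0.
Proof.
move=> ha hb; rewrite /clear_ver; case: ifPn => [v|v]; case: ifPn => // r.
  by move/forallP: v => /(_ i); rewrite /ver_inner; lia.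
by case/negP: v; apply: (@ver_rim_valid i); rewrite /ver_rim r; lia.
Qed.

Lemma curl_clear i H V a b : in_square i a b ->
  curl (clear_hor H) (clear_ver V) a b =
    (if (b == y0 i) || (b == y0 i + m)%N then H a b else 0) +
    (if (a.+1 == x0 i) || (a.+1 == x0 i + m)%N then V a.+1 b else 0) +
    (if (b.+1 == y0 i) || (b.+1 == y0 i + m)%N then H a b.+1 else 0) +
    (if (a == x0 i) || (a == x0 i + m)%N then V a b else 0).
Proof.
by rewrite /in_square => sq; rewrite /curl !(@clear_hor_in i) ?(@clear_ver_in i)//; lia.
Qed.

Lemma curl_glue i H V a b : glued H V -> in_square i a b ->
  curl (clear_hor H) (clear_ver V) a b =
  curl (clear_hor H) (clear_ver V)
    (if xf then x0 i + x0 i + m - a.+1 else a)%N (N - b.+1)%N.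
Proof.
move=> [gH gV] sq0; have := partner_y i; have := inside i => ins py.
have sq : in_square (partner i) (if xf then x0 i + x0 i + m - a.+1 else a)%N (N - b.+1)%N.
  by move: sq0; rewrite /in_square partner_x; case: xf; lia.
rewrite (curl_clear _ _ sq0) (curl_clear _ _ sq) partner_x.
move: sq0 => /and4P[a1 a2 b1 b2] {sq}.
have e1 : (if (b == y0 i) || (b == y0 i + m)%N then H a b else 0) =
  (if ((N - b.+1).+1 == y0 (partner i)) || ((N - b.+1).+1 == y0 (partner i) + m)%N
   then H (if xf then x0 i + x0 i + m - a.+1 else a)%N (N - b.+1).+1 else 0).
  have -> : ((N - b.+1).+1 = N - b)%N by lia.
  case: ifPn => r; last by case: ifPn => //; lia.
  rewrite (gH i); last by rewrite /hor_rim r; lia.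
  by case: ifPn => //; lia.
have e2 : (if (b.+1 == y0 i) || (b.+1 == y0 i + m)%N then H a b.+1 else 0) =
  (if ((N - b.+1)%N == y0 (partner i)) || ((N - b.+1)%N == y0 (partner i) + m)%N
   then H (if xf then x0 i + x0 i + m - a.+1 else a)%N (N - b.+1)%N else 0).
  case: ifPn => r; last by case: ifPn => //; lia.
  rewrite (gH i); last by rewrite /hor_rim r; lia.
  by case: ifPn => //; lia.
have glV a' : (x0 i <= a' <= x0 i + m)%N ->
  (if (a' == x0 i) || (a' == x0 i + m)%N then V a' b else 0) =
  (if (glue_x i a' == x0 i) || (glue_x i a' == x0 i + m)%N
   then V (glue_x i a') (N - b.+1)%N else 0).
  move=> ha'; case: ifPn => r.
    rewrite (gV i); last by rewrite /ver_rim r; lia.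
    by rewrite /ver_glue /=; case: ifPn => //; rewrite /glue_x; case: xf; lia.
  by case: ifPn => //; rewrite /glue_x; case: xf; lia.
rewrite e1 e2 !glV ?a1 ?leqW ?(ltnW a2)//; rewrite /glue_x; case: {+}xf.
  have -> : ((x0 i + x0 i + m - a.+1).+1 = x0 i + x0 i + m - a)%N by lia.
  by ring.
by ring.
Qed.

(** The reflection of one hole onto the other preserves the curls of the cells. *)
Lemma hole_curl_partner i H V : ~~ xf -> glued H V ->
  hole_curl (clear_hor H) (clear_ver V) (partner i) =
  hole_curl (clear_hor H) (clear_ver V) i.
Proof.
move=> xfN g; rewrite /hole_curl partner_x; apply: eq_bigr => u _.
rewrite [RHS](reindex_inj rev_ord_inj)/=; apply: eq_bigr => v _.
rewrite [RHS](@curl_glue i)// ?(negbTE xfN)//.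
  by congr (curl _ _ _ _); have := partner_y i; have := inside i; have := ltn_ord v; lia.
by rewrite /in_square; have := ltn_ord u; have := ltn_ord v; lia.
Qed.

(** The point reflection of the hole fixes no cell and preserves the curls, so the sum
    vanishes modulo 2. *)
Lemma hole_curl_crosscap i H V : xf -> glued H V -> partner i = i ->
  hole_curl (clear_hor H) (clear_ver V) i = 0.
Proof.
move=> xft g pi; rewrite /hole_curl.
set c := fun u v => curl (clear_hor H) (clear_ver V) (x0 i + u)%N (y0 i + v)%N.
have cE (u v : 'I_m) : c u v = c (rev_ord u) (rev_ord v).
  rewrite /c (@curl_glue i)// ?xft; last first.
    by rewrite /in_square; have := ltn_ord u; have := ltn_ord v; lia.
  congr (curl _ _ _ _); rewrite /=; first by move: (ltn_ord u); clear; lia.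
  by move: (partner_y i) (ltn_ord v); rewrite pi; clear; lia.
rewrite -[LHS]/(\sum_(u < m) \sum_(v < m) c u v).
pose r (u : 'I_m) := \sum_(v < m) c u v.
have rE u : r u = r (rev_ord u).
  by rewrite /r [RHS](reindex_inj rev_ord_inj)/=; apply: eq_bigr => v _; rewrite cE.
rewrite -[LHS]/(\sum_(u < m) r u) big_split_ord/=.
rewrite [X in _ + X](reindex_inj rev_ord_inj)/=.
rewrite [X in _ + X](eq_bigr (fun u => r (lshift k u))) ?addrr_F2// => u _.
rewrite rE; congr r; apply/val_inj; rewrite /=; have := ltn_ord u; lia.
Qed.

Lemma outer_constant p :
  (forall a b a' b', outer a b -> outer a' b' ->
    (a' = a.+1 /\ b' = b \/ a' = a /\ b' = b.+1) ->
    (a' <= N)%N -> (b' <= N)%N -> p a b = p a' b') ->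
  forall a b, outer a b -> (a <= N)%N -> (b <= N)%N -> p a b = p 0%N 0%N.
Proof.
move=> st.
have rowc b : (b == 0)%N || (b == N) -> (b <= N)%N ->
    forall a, (a <= N)%N -> p a b = p 0%N b.
  move=> bb bN; elim=> [//|a ih] aN; rewrite -ih ?(ltnW aN)//.
  by apply/esym/st; rewrite ?/outer ?bb ?orbT//; (try lia); left.
have colc a : (a == 0)%N || (a == N) -> (a <= N)%N ->
    forall b, (b <= N)%N -> p a b = p a 0%N.
  move=> aa aN; elim=> [//|b ih] bN; rewrite -ih ?(ltnW bN)//.
  by apply/esym/st; rewrite ?/outer ?aa ?orbT//; (try lia); right.
move=> a b /or4P[/eqP->|/eqP->|/eqP->|/eqP->] aN bN.
- by rewrite colc.
- by rewrite colc ?eqxx ?orbT// rowc.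
- by rewrite rowc.
- by rewrite rowc ?eqxx ?orbT// colc.
Qed.

Let Y : finType := (bool * ('I_N.+1 * 'I_N.+1))%type.
Definition hedge a b : bool * ('I_N.+1 * 'I_N.+1) := (true, (inord a, inord b)).
Definition vedge a b : bool * ('I_N.+1 * 'I_N.+1) := (false, (inord a, inord b)).
Definition hpart (h : {ffun Y -> 'F_2}) a b := h (hedge a b).
Definition vpart (h : {ffun Y -> 'F_2}) a b := h (vedge a b).
Definition unit_chain (y : Y) : {ffun Y -> 'F_2} := [ffun z => (z == y)%:R].

Definition cell (s : 'I_N * 'I_N) : {ffun Y -> 'F_2} :=
  unit_chain (hedge s.1 s.2) + unit_chain (vedge s.1.+1 s.2) +
  unit_chain (hedge s.1 s.2.+1) + unit_chain (vedge s.1 s.2).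
Definition hbigon (t : I * ('I_N.+1 * 'I_N.+1)) : {ffun Y -> 'F_2} :=
  unit_chain (hedge t.2.1 t.2.2) +
  unit_chain (hedge (hor_glue t.1 t.2.1 t.2.2).1 (hor_glue t.1 t.2.1 t.2.2).2).
Definition vbigon (t : I * ('I_N.+1 * 'I_N.+1)) : {ffun Y -> 'F_2} :=
  unit_chain (vedge t.2.1 t.2.2) +
  unit_chain (vedge (ver_glue t.1 t.2.1 t.2.2).1 (ver_glue t.1 t.2.1 t.2.2).2).
Definition cells : {set {ffun Y -> 'F_2}} :=
  cell @: [set s | ~~ [exists i, in_square i (val s.1) (val s.2)]].
Definition hbigons : {set {ffun Y -> 'F_2}} :=
  hbigon @: [set t | hor_rim t.1 (val t.2.1) (val t.2.2)].
Definition vbigons : {set {ffun Y -> 'F_2}} :=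
  vbigon @: [set t | ver_rim t.1 (val t.2.1) (val t.2.2)].

(** Besides the cells outside the holes, the faces are the pairs formed by a rim
    edge and the edge glued to it: the identification of two parallel edges is
    expressed by a face of length two. *)
Definition faces := enum cells ++ enum hbigons ++ enum vbigons.

Lemma dot_unit y h : dot (unit_chain y) h = h y.
Proof.
rewrite /dot (bigD1 y)//= big1 ?addr0 => [|z /negbTE zy]; rewrite ffunE ?eqxx ?mul1r//.
by rewrite zy mul0r.
Qed.

Lemma count_enum (A : {set {ffun Y -> 'F_2}}) y :
  count (fun F : {ffun Y -> 'F_2} => F y != 0) (enum A) =
  #|[set F in A | F y != 0]%SET|.
Proof.
rewrite -sum1_count big_enum_cond -sum1_card/=.
by apply: eq_bigl => F; rewrite inE.
Qed.

Lemma card_set_le1 (T : finType) (A : {set T}) :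
  (forall x y, x \in A -> y \in A -> x = y) -> (#|A| <= 1)%N.
Proof. by move=> h; apply/fintype.card_le1_eqP => x y xA yA; apply: h. Qed.

Lemma unit_neq0 (y z : Y) : unit_chain y z != 0 -> z = y.
Proof.
by move=> h; apply/eqP; apply: contraNT h => /negbTE zy; rewrite ffunE zy.
Qed.

Lemma add_neq0 (x y : 'F_2) : x + y != 0 -> x != 0 \/ y != 0.
Proof. by have [->|] := eqVneq x 0; [rewrite add0r; right|left]. Qed.

Lemma add_ffunE (f g : {ffun Y -> 'F_2}) y : (f + g) y = f y + g y.
Proof. by rewrite ffunE. Qed.

Lemma hedge_inj a b a' b' : (a <= N)%N -> (b <= N)%N -> (a' <= N)%N -> (b' <= N)%N ->
  hedge a b = hedge a' b' -> a = a' /\ b = b'.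
Proof.
by move=> ? ? ? ? [/(congr1 val) /= e /(congr1 val) /= e']; move: e e'; rewrite !inordK.
Qed.

Lemma vedge_inj a b a' b' : (a <= N)%N -> (b <= N)%N -> (a' <= N)%N -> (b' <= N)%N ->
  vedge a b = vedge a' b' -> a = a' /\ b = b'.
Proof.
by move=> ? ? ? ? [/(congr1 val) /= e /(congr1 val) /= e']; move: e e'; rewrite !inordK.
Qed.

Lemma cell_hedge (s : 'I_N * 'I_N) a b : (a <= N)%N -> (b <= N)%N ->
  cell s (hedge a b) != 0 -> val s.1 = a /\ (val s.2 = b \/ (val s.2).+1 = b).
Proof.
move=> aN bN; have := ltn_ord s.1; have := ltn_ord s.2 => s2 s1.
rewrite /cell !add_ffunE => /add_neq0[/add_neq0[/add_neq0[]|]|] /unit_neq0.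
- move=> /hedge_inj[]; rewrite ?(ltnW s1) ?(ltnW s2)// => -> ->; auto.
- by [].
- move=> /hedge_inj[]; rewrite ?(ltnW s1) ?(ltnW s2)// => -> ->; auto.
- by [].
Qed.

Lemma cell_vedge (s : 'I_N * 'I_N) a b : (a <= N)%N -> (b <= N)%N ->
  cell s (vedge a b) != 0 -> val s.2 = b /\ (val s.1 = a \/ (val s.1).+1 = a).
Proof.
move=> aN bN; have := ltn_ord s.1; have := ltn_ord s.2 => s2 s1.
rewrite /cell !add_ffunE => /add_neq0[/add_neq0[/add_neq0[]|]|] /unit_neq0.
- by [].
- move=> /vedge_inj[]; rewrite ?(ltnW s1) ?(ltnW s2)// => -> ->; auto.
- by [].
- move=> /vedge_inj[]; rewrite ?(ltnW s1) ?(ltnW s2)// => -> ->; auto.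
Qed.

Lemma hor_glueK i a b : hor_rim i a b ->
  hor_glue (partner i) (hor_glue i a b).1 (hor_glue i a b).2 = (a, b).
Proof.
rewrite /hor_glue /hor_rim /= partner_x => r; have := partner_y i; have := inside i => h1 h2.
by congr pair; [case: xf r|]; lia.
Qed.

Lemma ver_glueK i a b : ver_rim i a b ->
  ver_glue (partner i) (ver_glue i a b).1 (ver_glue i a b).2 = (a, b).
Proof.
rewrite /ver_glue /glue_x /ver_rim /= partner_x => r; have := partner_y i; have := inside i => h1 h2.
by congr pair; [case: xf r|]; lia.
Qed.

Lemma hor_rim_in i a b : hor_rim i a b ->
  [/\ (a < N)%N, (b <= N)%N, (x0 i <= a <= x0 i + m)%N & (y0 i <= b <= y0 i + m)%N].
Proof. by rewrite /hor_rim; have := inside i => h r; split; lia. Qed.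

Lemma ver_rim_in i a b : ver_rim i a b ->
  [/\ (a <= N)%N, (b < N)%N, (x0 i <= a <= x0 i + m)%N & (y0 i <= b <= y0 i + m)%N].
Proof. by rewrite /ver_rim; have := inside i => h r; split; lia. Qed.

Lemma hbigon_at t a b : (a <= N)%N -> (b <= N)%N ->
  hor_rim t.1 (val t.2.1) (val t.2.2) -> hbigon t (hedge a b) != 0 ->
  exists2 j, hor_rim j a b & hbigon t = unit_chain (hedge a b) +
    unit_chain (hedge (hor_glue j a b).1 (hor_glue j a b).2).
Proof.
case: t => [i [c d]] /= aN bN r; have [cN dN _ _] := hor_rim_in r.
have r' := hor_glue_rim r; have [cN' dN' _ _] := hor_rim_in r'.
rewrite /hbigon /= ffunE => /add_neq0[] /unit_neq0 /hedge_inj[]//; rewrite ?(ltnW cN) ?(ltnW cN')//.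
  by move=> -> ->; exists i.
move=> -> ->; exists (partner i); [exact: r'|].
by have := hor_glueK r; rewrite /hor_glue /= => -[-> ->]; exact: addrC.
Qed.

Lemma vbigon_at t a b : (a <= N)%N -> (b <= N)%N ->
  ver_rim t.1 (val t.2.1) (val t.2.2) -> vbigon t (vedge a b) != 0 ->
  exists2 j, ver_rim j a b & vbigon t = unit_chain (vedge a b) +
    unit_chain (vedge (ver_glue j a b).1 (ver_glue j a b).2).
Proof.
case: t => [i [c d]] /= aN bN r; have [cN dN _ _] := ver_rim_in r.
have r' := ver_glue_rim r; have [cN' dN' _ _] := ver_rim_in r'.
rewrite /vbigon /= ffunE => /add_neq0[] /unit_neq0 /vedge_inj[]//; rewrite ?(ltnW dN) ?(ltnW dN')//.
  by move=> -> ->; exists i.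
move=> -> ->; exists (partner i); [exact: r'|].
by have := ver_glueK r; rewrite /ver_glue /= => -[-> ->]; exact: addrC.
Qed.

Lemma ord_pair_eq (s t : 'I_N * 'I_N) : val s.1 = val t.1 -> val s.2 = val t.2 -> s = t.
Proof. by case: s t => [a b] [c d] /= /val_inj-> /val_inj->. Qed.

Lemma faces_incidence : incidence_le2 faces.
Proof.
have cells_le (P Q : pred ('I_N * 'I_N)) y :
    (forall s, cell s y != 0 -> P s || Q s) ->
    (#|[set F in cells | F y != 0%R]%SET| <=
     #|[set s | ~~ [exists i, in_square i (val s.1) (val s.2)] && P s]%SET| +
     #|[set s | ~~ [exists i, in_square i (val s.1) (val s.2)] && Q s]%SET|)%N.
  move=> PQ; apply: leq_trans (leq_card_setU _ _).
  apply: leq_trans (leq_imset_card cell _); apply/subset_leq_card/fintype.subsetP => F.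
  rewrite inE => /andP[/imsetP[s]]; rewrite inE => sg -> /PQ PQs.
  by apply/imsetP; exists s; rewrite // !inE sg.
case=> -[] [a b]; rewrite /faces !count_cat !count_enum.
  have -> : #|[set F in vbigons | F (true, (a, b)) != 0]%SET| = 0%N.
    apply/eqP; rewrite cards_eq0; apply/eqP/setP => F; rewrite !inE.
    apply/negP => /andP[/imsetP[t _ ->]]; rewrite /vbigon ffunE.
    by move=> /add_neq0[] /unit_neq0.
  have yE : (true, (a, b)) = hedge a b by rewrite /hedge !inord_val.
  have aN : (a <= N)%N by rewrite -ltnS.
  have bN : (b <= N)%N by rewrite -ltnS.
  have := @cells_le (fun s => (val s.1 == a) && (val s.2 == b))
    (fun s => (val s.1 == a) && ((val s.2).+1 == b)) (true, (a, b)).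
  rewrite yE.
  pose good (s : 'I_N * 'I_N) := ~~ [exists i, in_square i (val s.1) (val s.2)].
  set U := [set s | good s && ((val s.1 == a) && (val s.2 == b))]%SET.
  set W := [set s | good s && ((val s.1 == a) && ((val s.2).+1 == b))]%SET.
  have U1 : (#|U| <= 1)%N.
    apply: card_set_le1 => s t; rewrite !inE /= => /and3P[_ /eqP a1 /eqP b1] /and3P[_ /eqP a2 /eqP b2].
    by apply: ord_pair_eq; rewrite /= ?a1 ?a2 ?b1 ?b2.
  have W1 : (#|W| <= 1)%N.
    apply: card_set_le1 => s t; rewrite !inE /= => /and3P[_ /eqP a1 /eqP b1] /and3P[_ /eqP a2 /eqP b2].
    by apply: ord_pair_eq; rewrite /= ?a1 ?a2//; apply: succn_inj; rewrite b1 b2.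
  move=> le; have {le} : (#|[set F in cells | F (hedge a b) != 0%R]%SET| <= #|U| + #|W|)%N.
    apply: le => s /cell_hedge[]// -> [->|e]; first by rewrite !eqxx.
    by rewrite -e !eqxx orbT.
  have [/existsP[j rj]|/existsPn nr] := boolP [exists j, hor_rim j a b].
    have B1 : (#|[set F in hbigons | F (hedge a b) != 0%R]%SET| <= 1)%N.
      apply: card_set_le1 => F G; rewrite !inE => /andP[/imsetP[s]]; rewrite inE => sr -> sn.
      move=> /andP[/imsetP[t]]; rewrite inE => tr -> tn.
      have [i1 r1 ->] := hbigon_at aN bN sr sn.
      have [i2 r2 ->] := hbigon_at aN bN tr tn.
      have [_ _ p1 p2] := hor_rim_in r1; have [_ _ q1 q2] := hor_rim_in r2.
      by rewrite (same_hole p1 p2 q1 q2).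
    have UW : (#|U| == 0)%N || (#|W| == 0)%N.
      rewrite !cards_eq0; move: rj; rewrite /hor_rim => /and3P[a1 a2 /orP[]] /eqP bb.
        apply/orP; left; apply/eqP/setP => s; rewrite !inE /=; apply/negP.
        move=> /and3P[/existsPn/(_ j)]; rewrite /in_square => ns /eqP e1 /eqP e2.
        move: ns e1 e2 a1 a2 bb; rewrite /=.
        by move: (nat_of_ord s.1) (nat_of_ord s.2) (nat_of_ord a) (nat_of_ord b) => c d a' b'; lia.
      apply/orP; right; apply/eqP/setP => s; rewrite !inE /=; apply/negP.
      move=> /and3P[/existsPn/(_ j)]; rewrite /in_square => ns /eqP e1 /eqP e2.
      move: ns e1 e2 a1 a2 bb; rewrite /=.
      by move: (nat_of_ord s.1) (nat_of_ord s.2) (nat_of_ord a) (nat_of_ord b) => c d a' b'; lia.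
    move: U1 W1 UW B1; move: (#|U|) (#|W|) (#|[set _ in hbigons | _]%SET|) (#|[set _ in cells | _]%SET|).
    by lia.
  have -> : #|[set F in hbigons | F (hedge a b) != 0]%SET| = 0%N.
    apply/eqP; rewrite cards_eq0; apply/eqP/setP => F; rewrite !inE.
    apply/negP => /andP[/imsetP[t]]; rewrite inE => tr -> tn.
    by have [i /(negP (nr i))] := hbigon_at aN bN tr tn.
  move: U1 W1; move: (#|U|) (#|W|) (#|[set _ in cells | _]%SET|).
  by lia.
have -> : #|[set F in hbigons | F (false, (a, b)) != 0]%SET| = 0%N.
  apply/eqP; rewrite cards_eq0; apply/eqP/setP => F; rewrite !inE.
  apply/negP => /andP[/imsetP[t _ ->]]; rewrite /hbigon ffunE.
  by move=> /add_neq0[] /unit_neq0.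
have yE : (false, (a, b)) = vedge a b by rewrite /vedge !inord_val.
have aN : (a <= N)%N by rewrite -ltnS.
have bN : (b <= N)%N by rewrite -ltnS.
have := @cells_le (fun s => (val s.2 == b) && (val s.1 == a))
  (fun s => (val s.2 == b) && ((val s.1).+1 == a)) (false, (a, b)).
rewrite yE.
pose good (s : 'I_N * 'I_N) := ~~ [exists i, in_square i (val s.1) (val s.2)].
set U := [set s | good s && ((val s.2 == b) && (val s.1 == a))]%SET.
set W := [set s | good s && ((val s.2 == b) && ((val s.1).+1 == a))]%SET.
have U1 : (#|U| <= 1)%N.
  apply: card_set_le1 => s t; rewrite !inE /= => /and3P[_ /eqP a1 /eqP b1] /and3P[_ /eqP a2 /eqP b2].
  by apply: ord_pair_eq; rewrite /= ?a1 ?a2 ?b1 ?b2.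
have W1 : (#|W| <= 1)%N.
  apply: card_set_le1 => s t; rewrite !inE /= => /and3P[_ /eqP a1 /eqP b1] /and3P[_ /eqP a2 /eqP b2].
  by apply: ord_pair_eq; rewrite /= ?a1 ?a2//; apply: succn_inj; rewrite b1 b2.
move=> le; have {le} : (#|[set F in cells | F (vedge a b) != 0%R]%SET| <= #|U| + #|W|)%N.
  apply: le => s /cell_vedge[]// -> [->|e]; first by rewrite !eqxx.
  by rewrite -e !eqxx orbT.
have [/existsP[j rj]|/existsPn nr] := boolP [exists j, ver_rim j a b].
  have B1 : (#|[set F in vbigons | F (vedge a b) != 0%R]%SET| <= 1)%N.
    apply: card_set_le1 => F G; rewrite !inE => /andP[/imsetP[s]]; rewrite inE => sr -> sn.
    move=> /andP[/imsetP[t]]; rewrite inE => tr -> tn.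
    have [i1 r1 ->] := vbigon_at aN bN sr sn.
    have [i2 r2 ->] := vbigon_at aN bN tr tn.
    have [_ _ p1 p2] := ver_rim_in r1; have [_ _ q1 q2] := ver_rim_in r2.
    by rewrite (same_hole p1 p2 q1 q2).
  have UW : (#|U| == 0)%N || (#|W| == 0)%N.
    rewrite !cards_eq0; move: rj; rewrite /ver_rim => /and3P[a1 a2 /orP[]] /eqP bb.
      apply/orP; left; apply/eqP/setP => s; rewrite !inE /=; apply/negP.
      move=> /and3P[/existsPn/(_ j)]; rewrite /in_square => ns /eqP e1 /eqP e2.
      move: ns e1 e2 a1 a2 bb; rewrite /=.
      by move: (nat_of_ord s.1) (nat_of_ord s.2) (nat_of_ord a) (nat_of_ord b) => c d a' b'; lia.
    apply/orP; right; apply/eqP/setP => s; rewrite !inE /=; apply/negP.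
    move=> /and3P[/existsPn/(_ j)]; rewrite /in_square => ns /eqP e1 /eqP e2.
    move: ns e1 e2 a1 a2 bb; rewrite /=.
    by move: (nat_of_ord s.1) (nat_of_ord s.2) (nat_of_ord a) (nat_of_ord b) => c d a' b'; lia.
  move: U1 W1 UW B1; move: (#|U|) (#|W|) (#|[set _ in vbigons | _]%SET|) (#|[set _ in cells | _]%SET|).
  by lia.
have -> : #|[set F in vbigons | F (vedge a b) != 0]%SET| = 0%N.
  apply/eqP; rewrite cards_eq0; apply/eqP/setP => F; rewrite !inE.
  apply/negP => /andP[/imsetP[t]]; rewrite inE => tr -> tn.
  by have [i /(negP (nr i))] := vbigon_at aN bN tr tn.
move: U1 W1; move: (#|U|) (#|W|) (#|[set _ in cells | _]%SET|).
by lia.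
Qed.

Lemma faces_orthogonal h : (forall F, F \in faces -> dot F h = 0) <->
  [/\ forall a b, (a < N)%N -> (b < N)%N -> (forall i, ~~ in_square i a b) ->
        curl (hpart h) (vpart h) a b = 0 & glued (hpart h) (vpart h)].
Proof.
split=> [o|[oc [oh ov]] F].
  split.
    move=> a b aN bN ns; have := o (cell (Ordinal aN, Ordinal bN)).
    rewrite /cell !dotDl !dot_unit; apply.
    rewrite mem_cat mem_enum; apply/orP; left; apply/imsetP.
    by exists (Ordinal aN, Ordinal bN); rewrite // inE; apply/existsPn.
  split=> i a b r; apply: add_eq0_F2.
    have [aN bN _ _] := hor_rim_in r.
    have := o (hbigon (i, (inord a, inord b))).
    rewrite /hbigon /= !dotDl !dot_unit !inordK// ?ltnS ?(ltnW aN)//; apply.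
    rewrite !mem_cat !mem_enum; apply/orP; right; apply/orP; left; apply/imsetP.
    exists (i, (inord a, inord b)); first by rewrite inE /= !inordK// ltnS ltnW.
    by rewrite /hbigon /= !inordK// ltnS ltnW.
  have [aN bN _ _] := ver_rim_in r.
  have := o (vbigon (i, (inord a, inord b))).
  rewrite /vbigon /= !dotDl !dot_unit !inordK// ?ltnS ?(ltnW bN)//; apply.
  rewrite !mem_cat !mem_enum; apply/orP; right; apply/orP; right; apply/imsetP.
  exists (i, (inord a, inord b)); first by rewrite inE /= !inordK// ltnS ltnW.
  by rewrite /vbigon /= !inordK// ltnS ltnW.
rewrite !mem_cat !mem_enum => /or3P[] /imsetP[t]; rewrite inE => tP ->.
- by rewrite /cell !dotDl !dot_unit; apply: oc => // i; move/existsPn: tP; apply.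
- by rewrite /hbigon !dotDl !dot_unit; have := oh _ _ _ tP; rewrite /hpart => ->; rewrite addrr_F2.
- by rewrite /vbigon !dotDl !dot_unit; have := ov _ _ _ tP; rewrite /vpart => ->; rewrite addrr_F2.
Qed.

Lemma glue_xK i a : (x0 i <= a <= x0 i + m)%N ->
  glue_x (partner i) (glue_x i a) = a.
Proof. by rewrite /glue_x partner_x; case: xf; lia. Qed.

Lemma on_rim_glue i a b : on_rim i a b ->
  on_rim (partner i) (glue_x i a) (N - b)%N.
Proof.
rewrite /on_rim /glue_x partner_x; have := partner_y i; have := inside i.
by case: xf; lia.
Qed.

Definition valid (d : bool) a b := if d then hor_valid a b else ver_valid a b.
Definition head (d : bool) a b := if d then (a.+1, b) else (a, b.+1).

(** Euler's inequality for a graph that is a minor of the glued grid: the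
    functionals theta account for the handles or cross-caps. Connectedness of a
    branch set is used, and stated, in the form that every potential that does
    not change along its edges is constant on it. *)
Theorem grid_euler (V E : finType) (src tgt : E -> V) (B : V -> nat -> nat -> bool)
    (t : nat) (theta : 'I_t -> (nat -> nat -> 'F_2) -> (nat -> nat -> 'F_2) -> 'F_2) :
  (0 < #|V|)%N -> (1 < t)%N ->
  (forall e, src e != tgt e) ->
  (forall e e', [set src e; tgt e]%SET = [set src e'; tgt e']%SET -> e = e') ->
  (forall j H V H' V', theta j (fun a b => H a b - H' a b) (fun a b => V a b - V' a b) =
     theta j H V - theta j H' V') ->
  (forall H V, glued H V -> (forall j, theta j H V = 0) ->
     forall i, hole_curl (clear_hor H) (clear_ver V) i = 0) ->
  (forall H V p, (forall j, theta j H V = 0) -> 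
     (forall a b, (a < N)%N -> (b <= N)%N -> hor_valid a b -> H a b = p a b + p a.+1 b) ->
     (forall a b, (a <= N)%N -> (b < N)%N -> ver_valid a b -> V a b = p a b + p a b.+1) ->
     forall i, exists a b, on_rim i a b /\ p a b = p (glue_x i a) (N - b)%N) ->
  (forall u a b, B u a b -> (a <= N)%N /\ (b <= N)%N) ->
  (forall u w a b, B u a b -> B w a b -> u = w) ->
  (forall u i a b, B u a b -> on_rim i a b -> B u (glue_x i a) (N - b)%N) ->
  (forall u a b a' b', B u a b -> outer a b -> outer a' b' ->
     (a' <= N)%N -> (b' <= N)%N -> B u a' b') ->
  (forall u, exists a b, B u a b) ->
  (forall u p,
     (forall d a b, valid d a b -> B u a b -> B u (head d a b).1 (head d a b).2 ->
        p a b = p (head d a b).1 (head d a b).2) ->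
     (forall i a b, B u a b -> on_rim i a b -> p a b = p (glue_x i a) (N - b)%N) ->
     (forall a b a' b', B u a b -> B u a' b' -> outer a b -> outer a' b' ->
        p a b = p a' b') ->
     forall a b a' b', B u a b -> B u a' b' -> p a b = p a' b') ->
  (forall e, exists d a b, valid d a b /\
     (B (src e) a b /\ B (tgt e) (head d a b).1 (head d a b).2 \/
      B (tgt e) a b /\ B (src e) (head d a b).1 (head d a b).2)) ->
  (#|E| + 6 <= 3 * #|V| + 3 * t)%N.
Proof.
move=> V0 t2 ne simp thB thC thP Bbox Bdisj Bglue Bout Bne Bconn /choice[d /choice[ra /choice[rb rP]]].
pose rep e : Y := (d e, (inord (ra e), inord (rb e))).
have rbox e : (ra e <= N)%N /\ (rb e <= N)%N.
  by have [_ [[/Bbox]|[/Bbox]]] := rP e.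
have hbox e : ((head (d e) (ra e) (rb e)).1 <= N)%N /\ ((head (d e) (ra e) (rb e)).2 <= N)%N.
  by have [_ [[_ /Bbox]|[_ /Bbox]]] := rP e.
pose hd (y : Y) := head y.1 (val y.2.1) (val y.2.2).
have hdrep e : hd (rep e) = head (d e) (ra e) (rb e).
  by have [h1 h2] := rbox e; rewrite /hd /= !inordK.
have ends e :
   B (src e) (val (rep e).2.1) (val (rep e).2.2) /\ B (tgt e) (hd (rep e)).1 (hd (rep e)).2 \/
   B (tgt e) (val (rep e).2.1) (val (rep e).2.2) /\ B (src e) (hd (rep e)).1 (hd (rep e)).2.
  by have [h1 h2] := rbox e; have [_] := rP e; rewrite hdrep /= !inordK.
pose inner (y : Y) := [exists u, B u (val y.2.1) (val y.2.2) && B u (hd y).1 (hd y).2] ||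
  [&& outer (val y.2.1) (val y.2.2), outer (hd y).1 (hd y).2,
      ((hd y).1 <= N)%N & ((hd y).2 <= N)%N].
apply: (@euler_inequality V E Y src tgt rep [set y | inner y]%SET faces t
  (fun j h => theta j (hpart h) (vpart h))) => //.
- move=> e e' ee; apply: simp; apply/setP => z; rewrite !inE.
  have := ends e; have := ends e'; rewrite ee /=.
  by case=> -[a1 a2] [] [b1 b2]; rewrite (Bdisj _ _ _ _ a1 b1) (Bdisj _ _ _ _ a2 b2)// orbC.
- move=> e; rewrite inE /inner negb_or; apply/andP; split.
    apply/existsPn => u; apply/negP => /andP[u1 u2]; have /negP := ne e; apply; apply/eqP.
    by have := ends e; case=> -[b1 b2]; rewrite -(Bdisj _ _ _ _ u1 b1) -(Bdisj _ _ _ _ u2 b2).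
  apply/negP => /and4P[o1 o2 n1 n2]; have /negP := ne e; apply; apply/eqP.
  by have := ends e; case=> -[b1 b2]; have b3 := Bout _ _ _ _ _ b1 o1 o2 n1 n2;
    rewrite (Bdisj _ _ _ _ b2 b3).
- exact: faces_incidence.
- move=> j g h; rewrite -thB; congr theta; apply/funext => a; apply/funext => b;
  by rewrite /hpart /vpart !ffunE.
- move=> q; pose p a b := if [pick u | B u a b] is Some u then q u else 0.
  have pE u a b : B u a b -> p a b = q u.
    by move=> Bu; rewrite /p; case: pickP => [w Bw|/(_ u)]; [rewrite (Bdisj _ _ _ _ Bw Bu)|rewrite Bu].
  have pglue i a b : on_rim i a b -> p (glue_x i a) (N - b)%N = p a b.
    move=> r; rewrite {2}/p; case: pickP => [u Bu|nB].
      by rewrite (pE u)//; exact: Bglue.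
    rewrite /p; case: pickP => // w Bw; have := Bglue _ _ _ _ Bw (on_rim_glue r).
    rewrite glue_xK ?subKn ?nB//; first by move: r; rewrite /on_rim; have := inside i; lia.
    by move: r; rewrite /on_rim; lia.
  exists [ffun y : Y => p (val y.2.1) (val y.2.2) + p (hd y).1 (hd y).2]; split.
  + apply/faces_orthogonal; rewrite /hpart /vpart; split.
      move=> a b aN bN _; rewrite /curl !ffunE /hd /head /=.
      rewrite !inordK//; try by lia.
      move: (p a b) (p a.+1 b) (p a b.+1) (p a.+1 b.+1) => x y z w.
      by case: (F2P x) => ->; case: (F2P y) => ->; case: (F2P z) => ->; case: (F2P w) => ->; apply/val_inj.
    split=> i a b r; rewrite !ffunE /hd /head /=.
      have [aN bN a1 b1] := hor_rim_in r; have [aN' bN' a2 b2] := hor_rim_in (hor_glue_rim r).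
      rewrite !inordK ?ltnS ?(ltnW aN) ?(ltnW aN')//.
      rewrite -(pglue i a b) -1?(pglue i a.+1 b); try by move: r; rewrite /hor_rim /on_rim; lia.
      rewrite /hor_glue /glue_x /=; case: {+}xf => //.
      by rewrite addrC; congr (p _ _ + p _ _); move: r; rewrite /hor_rim; lia.
    have [aN bN a1 b1] := ver_rim_in r; have [aN' bN' a2 b2] := ver_rim_in (ver_glue_rim r).
    rewrite !inordK ?ltnS ?(ltnW bN) ?(ltnW bN')//.
    rewrite -(pglue i a b) -1?(pglue i a b.+1); try by move: r; rewrite /ver_rim /on_rim; lia.
    rewrite /ver_glue /= addrC; congr (p _ _ + p _ _).
    by lia.
  + move=> y; rewrite inE ffunE => /orP[/existsP[u /andP[u1 u2]]|/and4P[o1 o2 n1 n2]].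
      by rewrite (pE _ _ _ u1) (pE _ _ _ u2) addrr_F2.
    suff -> : p (val y.2.1) (val y.2.2) = p (hd y).1 (hd y).2 by rewrite addrr_F2.
    rewrite {1}/p; case: pickP => [u Bu|nB].
      by rewrite (pE u)//; exact: (Bout _ _ _ _ _ Bu).
    rewrite /p; case: pickP => // w Bw.
    by have := nB w; rewrite (Bout _ _ _ _ _ Bw) ?leq_ord// -ltnS.
  + by move=> e; rewrite ffunE; case: (ends e) => -[b1 b2]; rewrite (pE _ _ _ b1) (pE _ _ _ b2)// addrC.
move=> h /faces_orthogonal[hc hg] hI ht.
have hole0 := thC _ _ hg ht.
have [H' [V' [eH eV c0]]] := fill_squares (enum_uniq I) (fun i _ => hole0 i).
have H'E a b : hor_valid a b -> H' a b = hpart h a b.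
  by move=> v; rewrite eH ?/clear_hor ?v// => i _; move/forallP: v; apply.
have V'E a b : ver_valid a b -> V' a b = vpart h a b.
  by move=> v; rewrite eV ?/clear_ver ?v// => i _; move/forallP: v; apply.
have [p [pH pV]] : exists p, (forall a b, (a < N)%N -> (b <= N)%N -> H' a b = p a b + p a.+1 b) /\
    (forall a b, (a <= N)%N -> (b < N)%N -> V' a b = p a b + p a b.+1).
  apply: plane_potential => a b aN bN.
  have [/existsP[i sq]|/existsPn nsq] := boolP [exists i, in_square i a b].
    by apply: (c0 i) => //; rewrite mem_enum.
  rewrite -(hc a b aN bN nsq) /curl !H'E ?V'E//;
    by apply/forallP => i; have := nsq i; rewrite /in_square /hor_inner /ver_inner; lia.
have pH' a b : (a < N)%N -> (b <= N)%N -> hor_valid a b -> hpart h a b = p a b + p a.+1 b.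
  by move=> aN bN v; rewrite -pH// H'E.
have pV' a b : (a <= N)%N -> (b < N)%N -> ver_valid a b -> vpart h a b = p a b + p a b.+1.
  by move=> aN bN v; rewrite -pV// V'E.
have prim i a b : on_rim i a b -> p a b = p (glue_x i a) (N - b)%N.
  move=> r; have [a0 [b0 [r0 e0]]] := thP _ _ p ht pH' pV' i.
  apply: (rim_constant _ _ r0 r e0) => a1 b1 r1.
    have [aN bN _ _] := hor_rim_in r1; have [aN' bN' _ _] := hor_rim_in (hor_glue_rim r1).
    rewrite -pH' ?(hor_rim_valid r1)// (hg.1 i _ _ r1) pH' ?(hor_rim_valid (hor_glue_rim r1))//.
    rewrite /hor_glue /glue_x /=; case: {+}xf => //.
    by rewrite addrC; congr (p _ _ + p _ _); move: r1; rewrite /hor_rim; lia.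
  have [aN bN _ _] := ver_rim_in r1; have [aN' bN' _ _] := ver_rim_in (ver_glue_rim r1).
  rewrite -pV' ?(ver_rim_valid r1)// (hg.2 i _ _ r1) pV' ?(ver_rim_valid (ver_glue_rim r1))//.
  by rewrite /ver_glue /= addrC; congr (p _ _ + p _ _); lia.
have he dd a b : (a <= N)%N -> (b <= N)%N ->
    ((head dd a b).1 <= N)%N -> ((head dd a b).2 <= N)%N -> valid dd a b ->
    h (dd, (inord a, inord b)) = p a b + p (head dd a b).1 (head dd a b).2.
  by case: dd => /= aN bN aN' bN' v; [exact: pH'|exact: pV'].
have hinner dd a b : (a <= N)%N -> (b <= N)%N ->
    ((head dd a b).1 <= N)%N -> ((head dd a b).2 <= N)%N ->
    (exists2 u, B u a b & B u (head dd a b).1 (head dd a b).2) \/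
    (outer a b /\ outer (head dd a b).1 (head dd a b).2) ->
    h (dd, (inord a, inord b)) = 0.
  move=> aN bN aN' bN' c; apply: hI; rewrite inE /inner /hd /= !inordK// aN' bN' !andbT.
  case: c => [[u b1 b2]|[-> ->]]; last by rewrite orbT.
  by apply/orP; left; apply/existsP; exists u; rewrite b1.
have pouts dd a b : (a <= N)%N -> (b <= N)%N ->
    ((head dd a b).1 <= N)%N -> ((head dd a b).2 <= N)%N ->
    outer a b -> outer (head dd a b).1 (head dd a b).2 ->
    p a b = p (head dd a b).1 (head dd a b).2.
  move=> aN bN aN' bN' o o'; apply: add_eq0_F2; rewrite -he//; first by apply: hinner => //; right.
  by case: dd o o' aN' bN' => o o' aN' bN'; apply/forallP => i; have := inside i;
    move: o o'; rewrite /outer /hor_inner /ver_inner /=; lia.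
have pout a b a' b' : (a <= N)%N -> (b <= N)%N -> (a' <= N)%N -> (b' <= N)%N ->
    outer a b -> outer a' b' -> p a b = p a' b'.
  have st c e c' e' : outer c e -> outer c' e' ->
      (c' = c.+1 /\ e' = e \/ c' = c /\ e' = e.+1) ->
      (c' <= N)%N -> (e' <= N)%N -> p c e = p c' e'.
    move=> oc oc' [[? ?]|[? ?]] cN eN; subst c' e'.
      by apply: (pouts true) => //; exact: ltnW.
    by apply: (pouts false) => //; exact: ltnW.
  by move=> aN bN aN' bN' o o'; rewrite (outer_constant st o)// (outer_constant st o').
have pconst u a b a' b' : B u a b -> B u a' b' -> p a b = p a' b'.
  apply: Bconn => [dd c e v b1 b2|i c e _|c e c' e' b1 b2].
  - have [cN eN] := Bbox _ _ _ b1; have [cN' eN'] := Bbox _ _ _ b2.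
    by apply: add_eq0_F2; rewrite -he//; apply: hinner => //; left; exists u.
  - exact: prim.
  - by have [? ?] := Bbox _ _ _ b1; have [? ?] := Bbox _ _ _ b2; exact: pout.
have /choice[wa /choice[wb wP]] := Bne.
exists (fun u => p (wa u) (wb u)) => e.
have [vl BB] := rP e; have [? ?] := rbox e; have [? ?] := hbox e.
have -> : h (rep e) = p (ra e) (rb e) + p (head (d e) (ra e) (rb e)).1 (head (d e) (ra e) (rb e)).2.
  by apply: he.
by case: BB => -[b1 b2]; rewrite (pconst _ _ _ _ _ b1 (wP _)) (pconst _ _ _ _ _ b2 (wP _))// addrC.
Qed.

End Grid.

(** * Branch sets from stars and middles *)

Section BranchSets.
Variables (T : Type) (hard soft : T -> T -> Prop).
Hypothesis soft_sym : forall q q', soft q q' -> soft q' q.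
Implicit Types (Q : T -> Prop) (p : T -> 'F_2).

Definition compatible Q p : Prop :=
  forall q q', Q q -> Q q' -> hard q q' \/ soft q q' -> p q = p q'.

(** Connectedness of a set of vertices, stated through functions that are locally
    constant on it. *)
Definition tied Q : Prop :=
  forall p, compatible Q p -> forall q q', Q q -> Q q' -> p q = p q'.

Definition soft_closed Q : Prop := forall q q', soft q q' -> Q q -> Q q'.

Variables (V E : finType) (src tgt : E -> V) (S : V -> T -> Prop) (M : E -> T -> Prop).
Hypothesis S_tied : forall u, tied (S u).
Hypothesis S_closed : forall u, soft_closed (S u).
Hypothesis M_tied : forall e, tied (M e).
Hypothesis M_closed : forall e, soft_closed (M e).
Hypothesis S_ne : forall u, exists q, S u q.
Hypothesis S_disj : forall u w q, S u q -> S w q -> u = w.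
Hypothesis M_disj : forall e f q, M e q -> M f q -> e = f.
Hypothesis MS : forall e u q, M e q -> S u q -> u = src e \/ u = tgt e.
Hypothesis M_src : forall e, exists q, M e q /\ S (src e) q.
Hypothesis M_tgt : forall e, exists q, M e q /\ S (tgt e) q.
Hypothesis loopless : forall e, src e != tgt e.

(** The part of the middle of e that the star of its source reaches without
    entering the star of its target: no function that is locally constant off the
    star of the target separates it from the star of the source. *)
Definition tail e q : Prop := [/\ M e q, ~ S (tgt e) q &
  forall p, compatible (fun r => S (src e) r \/ (M e r /\ ~ S (tgt e) r)) p ->
    (forall r, S (src e) r -> p r = 0) -> p q = 0].

Definition branch u q : Prop := S u q \/ exists e, src e = u /\ tail e q.

Lemma tail_step e q q' : S (src e) q \/ tail e q -> M e q' -> ~ S (tgt e) q' ->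
  [\/ hard q q', hard q' q | soft q q'] -> tail e q'.
Proof.
move=> hq mq' nq' st; split => // p cp p0.
have hq' : S (src e) q \/ M e q /\ ~ S (tgt e) q by case: hq => [|[]]; [left|right].
have pq : p q = 0 by case: hq => [/p0//|[_ _]]; apply.
have step r r' : hard r r' \/ soft r r' ->
    (r = q /\ r' = q') \/ (r = q' /\ r' = q) -> p r = p r'.
  move=> h [[e1 e2]|[e1 e2]]; apply: cp => //; rewrite ?e1 ?e2//.
  - by right.
  - by right.
case: st => h.
- by rewrite -(step q q')//; [left|left].
- by rewrite (step q' q)//; [left|right].
- by rewrite -(step q q')//; [right|left].
Qed.

Lemma tail_closed e : soft_closed (tail e).
Proof.
move=> q q' s tq; have [mq nq _] := tq.
apply: (@tail_step e q) => //; first by right.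
- exact: M_closed s mq.
- by move=> sq'; apply: nq; exact: S_closed (soft_sym s) sq'.
- by constructor 3.
Qed.

Lemma tail_tied e p : compatible (fun q => S (src e) q \/ tail e q) p ->
  (forall q, S (src e) q -> p q = 0) -> forall q, tail e q -> p q = 0.
Proof.
move=> cp p0 q tq; have [mq nq sep] := tq.
pose p' r := if `[< S (src e) r \/ tail e r >] then p r else 0.
have p'E r : S (src e) r \/ tail e r -> p' r = p r by move=> h; rewrite /p' asboolT.
have p'N r : ~ (S (src e) r \/ tail e r) -> p' r = 0 by move=> h; rewrite /p' asboolF.
rewrite -(p'E q); last by right.
apply: sep; last by move=> r sr; rewrite p'E ?p0//; left.
move=> r r' hr hr' st.
have [br|nbr] := pselect (S (src e) r \/ tail e r);
  have [br'|nbr'] := pselect (S (src e) r' \/ tail e r').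
- by rewrite !p'E//; exact: cp.
- case: hr' => [sr'|[mr' nr']]; first by case: nbr'; left.
  case: nbr'; right; apply: (tail_step br) => //.
  by case: st => h; [constructor 1|constructor 3].
- case: hr => [sr|[mr nr]]; first by case: nbr; left.
  case: nbr; right; apply: (tail_step br') => //.
  by case: st => h; [constructor 2|constructor 3; exact: soft_sym].
- by rewrite !p'N.
Qed.

Lemma branch_tied u : tied (branch u).
Proof.
move=> p cp; have [q0 sq0] := S_ne u.
suff h q : branch u q -> p q = p q0 by move=> q q' /h -> /h ->.
have cS : compatible (S u) p by move=> r r' h h'; apply: cp; left.
case=> [sq|[e [eu tq]]]; first exact: (S_tied cS).
apply/eqP; rewrite -subr_eq0; apply/eqP.
apply: (@tail_tied e (fun r => p r - p q0)) tq => [r r' hr hr' st|r].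
  by congr (_ - _); apply: cp => //; rewrite -eu;
    [case: hr|case: hr'] => h; by [left|right; exists e].
by rewrite eu => sr; rewrite (S_tied cS sr sq0) subrr.
Qed.

Lemma branch_closed u : soft_closed (branch u).
Proof.
move=> q q' s [/(S_closed s)|[e [eu /(tail_closed s) t]]]; first by left.
by right; exists e.
Qed.

Lemma branch_disjoint u w q : branch u q -> branch w q -> u = w.
Proof.
case=> [su|[e [<- te]]]; case=> [sw|[f [<- tf]]].
- exact: S_disj su sw.
- by have [mf nf _] := tf; have [//|ut] := MS mf su; rewrite -ut in nf.
- by have [me ne _] := te; have [//|wt] := MS me sw; rewrite -wt in ne.
- by have [me _ _] := te; have [mf _ _] := tf; rewrite (M_disj me mf).
Qed.

Lemma branch_edge e : exists q q', (hard q q' \/ hard q' q) /\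
  branch (src e) q /\ branch (tgt e) q'.
Proof.
apply: contrapT => none.
have none' q q' : S (src e) q \/ tail e q -> S (tgt e) q' -> hard q q' \/ hard q' q -> False.
  move=> hq hq' st; apply: none; exists q, q'; split => //; split; last by left.
  by case: hq; [left|right; exists e].
pose p q : 'F_2 := if `[< S (src e) q \/ tail e q >] then 0 else 1.
have pT r : S (src e) r \/ tail e r -> p r = 0 by move=> h; rewrite /p asboolT.
have pF r : ~ (S (src e) r \/ tail e r) -> p r = 1 by move=> h; rewrite /p asboolF.
have disj r : S (tgt e) r -> ~ (S (src e) r \/ tail e r).
  move=> sr [sr'|[]//]; have := loopless e.
  by rewrite (S_disj sr' sr) eqxx.
have [r [mr sr]] := M_src e; have [r' [mr' sr']] := M_tgt e.
have : p r = p r'; last first.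
  by rewrite pT ?pF//; [exact: disj|left].
apply: (@M_tied e p) => // q q' mq mq' st.
have out x x' : M e x' -> [\/ hard x x', hard x' x | soft x x'] ->
    S (src e) x \/ tail e x -> S (src e) x' \/ tail e x'.
  move=> mx' hx bx; apply: contrapT => nb.
  have [sx'|nx'] := pselect (S (tgt e) x'); last first.
    by apply: nb; right; apply: tail_step hx.
  case: hx => h; first by apply: (none' x x') => //; left.
    by apply: (none' x x') => //; right.
  by apply: (disj x) bx; exact: S_closed (soft_sym h) sx'.
have [bq|nbq] := pselect (S (src e) q \/ tail e q);
  have [bq'|nbq'] := pselect (S (src e) q' \/ tail e q').
- by rewrite !pT.
- case: nbq'; apply: (out q) => //.
  by case: st => h; [constructor 1|constructor 3].
- case: nbq; apply: (out q') => //.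
  by case: st => h; [constructor 2|constructor 3; exact: soft_sym].
- by rewrite !pF.
Qed.

End BranchSets.

Lemma compact_eventually (X : topologicalType) (A B : set X) (P : nat -> X -> X -> Prop) :
  compact A -> compact B ->
  (forall x y, A x -> B y -> exists (K : nat) (U W : set X),
     [/\ nbhs x U, nbhs y W & forall k u w, (K <= k)%N -> U u -> W w -> P k u w]) ->
  exists K : nat, forall k, (K <= k)%N -> forall u w, A u -> B w -> P k u w.
Proof.
move=> /compact_near_coveringP cA /compact_near_coveringP cB h.
have hB x : A x -> \forall x' \near x & k \near \oo, B `<=` P k x'.
  move=> Ax; have c := cB (X * nat)%type (filter_prod (nbhs x) \oo) (fun i => P i.2 i.1) _.
  apply: c => y By.
  have [K [U [W [nU nW Pk]]]] := h x y Ax By.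
  exists (W, (U `*` [set k | (K <= k)%N])); last by move=> [w [u k]] [/= Ww [Uu Kk]]; exact: Pk.
  split => //=; exists (U, [set k | (K <= k)%N]) => //=.
  by split => //=; exists K.
have [K _ hK] := cA _ \oo (fun k x => B `<=` P k x) _ hB.
by exists K => k Kk u w Au Bw; exact: hK Au _ Bw.
Qed.

Lemma uniformly (T : finType) (P : T -> nat -> Prop) :
  (forall x, exists K, forall k, (K <= k)%N -> P x k) ->
  exists K, forall k, (K <= k)%N -> forall x, P x k.
Proof.
move=> /choice[f hf]; exists (\max_x f x)%N => k hk x.
by apply: hf; apply: leq_trans hk; exact: leq_bigmax.
Qed.
(** * Colouring sparse oriented graphs *)

Section Colouring.
Variables (V : finType) (a : rel V).
Hypothesis a_oriented : oriented_graph a.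
Implicit Types (A B S T H : {set V}) (u v w x y : V) (k : nat).

Lemma arc_irr v : a v v = false.
Proof. exact: (proj1 a_oriented). Qed.

Lemma arc_asym u v : a u v -> a v u = false.
Proof. by move=> uv; have := proj2 a_oriented u v; rewrite uv => /negbTE. Qed.

(** Acyclicity in the form in which it is used: every nonempty subset has a source. *)
Definition acyc A := [forall B : {set V}, (B \subset A) && (B != finset.set0) ==>
  [exists v in B, [forall u in B, ~~ a u v]]].

Lemma acycP A : reflect (forall B, B \subset A -> B != finset.set0 ->
  exists2 v, v \in B & forall u, u \in B -> ~~ a u v) (acyc A).
Proof.
apply: (iffP forallP) => [h B BA B0|h B].
  have := h B; rewrite BA B0 => /existsP[v /andP[vB /forallP hv]].
  by exists v => // u uB; have := hv u; rewrite uB.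
apply/implyP => /andP[BA B0]; have [v vB hv] := h B BA B0.
by apply/existsP; exists v; rewrite vB; apply/forallP => u; apply/implyP; exact: hv.
Qed.

Lemma acyc_acyclic_on A : acyc A -> acyclic_on a A.
Proof.
move=> /acycP h c c0 cA; apply/negP => /andP[cc uc].
have [||v] := h [set x in c]%SET.
- by apply/fintype.subsetP => x; rewrite inE; exact: cA.
- by case: c c0 {cA cc uc} => // x c _; apply/set0Pn; exists x; rewrite inE mem_head.
rewrite inE => vc /(_ (prev c v)); rewrite inE mem_prev => /(_ vc).
by rewrite (prev_cycle cc vc).
Qed.

Lemma acycS A B : B \subset A -> acyc A -> acyc B.
Proof.
move=> BA /acycP h; apply/acycP => C CB; apply: h; exact: (fintype.subset_trans CB BA).
Qed.

Lemma acyc0 : acyc finset.set0.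
Proof.
by apply/acycP => B; rewrite finset.subset0 => /eqP->; rewrite eqxx.
Qed.

Lemma acycU_in A v : acyc A -> (forall u, u \in A -> ~~ a u v) -> acyc (v |: A).
Proof.
move=> /acycP hA hv; apply/acycP => B BA B0.
have [vB|vB] := boolP (v \in B).
  exists v => // u /(fintype.subsetP BA); rewrite in_setU1 => /orP[/eqP->|/hv//].
  by rewrite arc_irr.
apply: hA => //; apply/fintype.subsetP => x xB.
have := fintype.subsetP BA x xB; rewrite in_setU1 => /orP[/eqP xv|//].
by rewrite -xv xB in vB.
Qed.

Lemma acycU_out A v : acyc A -> (forall u, u \in A -> ~~ a v u) -> acyc (v |: A).
Proof.
move=> /acycP hA hv; apply/acycP => B BA B0.
have BvA : B :\ v \subset A.
  by apply/fintype.subsetP => x; rewrite in_setD1 => /andP[/negbTE xv /(fintype.subsetP BA)]; rewrite in_setU1 xv.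
have [Bv0|Bv0] := eqVneq (B :\ v) finset.set0.
  have vB x : x \in B -> x = v.
    move=> xB; apply/eqP; apply: contraT => xv.
    have : x \in B :\ v by rewrite in_setD1 xv.
    by rewrite Bv0 inE.
  have [x xB] := set0Pn _ B0; exists x => // u uB.
  by rewrite (vB x xB) (vB u uB) arc_irr.
have [x xB hx] := hA _ BvA Bv0.
exists x => [|u uB]; first by move: xB; rewrite in_setD1 => /andP[].
have [->|uv] := eqVneq u v; first by apply: hv; exact: (fintype.subsetP BvA).
by apply: hx; rewrite in_setD1 uv.
Qed.

Definition colk S k := exists f : V -> 'I_k, forall i, acyc [set u in S | f u == i]%SET.

Lemma colkS S A k : acyc A -> colk (S :\: A) k -> colk S k.+1.
Proof.
move=> aA [f hf].
exists (fun u => if u \in A then ord0 else lift ord0 (f u)) => i.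
case: (unliftP ord0 i) => [j ->|->]; last first.
  apply: acycS aA; apply/fintype.subsetP => j jS.
  by move: jS; rewrite inE => /andP[_]; case: ifP.
apply: acycS (hf j); apply/fintype.subsetP => x; rewrite !inE.
case: ifP => xA /andP[xS]; first by rewrite (negbTE (neq_lift _ _)).
by rewrite (inj_eq lift_inj) xS.
Qed.

Lemma colk0S S k : colk S k -> colk S k.+1.
Proof. by move=> c; apply: (@colkS S finset.set0); rewrite ?acyc0 ?finset.setD0. Qed.

Definition indeg S v := #|[set u in S | a u v]%SET|.
Definition outdeg S v := #|[set u in S | a v u]%SET|.

Lemma free_colour k (N : {set V}) (f : V -> 'I_k) : (#|N| < k)%N ->
  exists i, forall u, u \in N -> f u != i.
Proof.
move=> Nk; have /existsP[i iP] : [exists i, i \notin f @: N].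
  apply: contraLR Nk => /existsPn h; rewrite -leqNgt.
  apply: leq_trans (leq_imset_card f N); rewrite -[X in (X <= _)%N]card_ord.
  by apply/subset_leq_card/fintype.subsetP => i _; rewrite -[_ \in _]negbK h.
by exists i => u uN; apply: contraNneq iP => <-; apply/imsetP; exists u.
Qed.

(** A vertex coloured unlike all its in-neighbours is a source of its class, so it
    closes no directed cycle. *)
Lemma colk_in S v k : colk (S :\ v) k -> (indeg S v < k)%N -> colk S k.
Proof.
move=> [f hf] /(free_colour f)[i hi].
exists (fun u => if u == v then i else f u) => j.
have [->|ji] := eqVneq j i.
  apply: (@acycS (v |: [set u in S :\ v | f u == i]%SET)).
    by apply/fintype.subsetP => x; rewrite !inE; case: (eqVneq x v) => //= xv.
  apply: acycU_in (hf i) _ => u; rewrite !inE => /andP[/andP[_ uS] /eqP fu].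
  by apply/negP => uv; have := hi u; rewrite inE uS uv fu eqxx => /(_ isT).
apply: acycS (hf j); apply/fintype.subsetP => x; rewrite !inE.
by case: (eqVneq x v) => [_|xv] /andP[-> //]; rewrite eq_sym (negbTE ji).
Qed.

Lemma colk_out S v k : colk (S :\ v) k -> (outdeg S v < k)%N -> colk S k.
Proof.
move=> [f hf] /(free_colour f)[i hi].
exists (fun u => if u == v then i else f u) => j.
have [->|ji] := eqVneq j i.
  apply: (@acycS (v |: [set u in S :\ v | f u == i]%SET)).
    by apply/fintype.subsetP => x; rewrite !inE; case: (eqVneq x v) => //= xv.
  apply: acycU_out (hf i) _ => u; rewrite !inE => /andP[/andP[_ uS] /eqP fu].
  by apply/negP => uv; have := hi u; rewrite inE uS uv fu eqxx => /(_ isT).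
apply: acycS (hf j); apply/fintype.subsetP => x; rewrite !inE.
by case: (eqVneq x v) => [_|xv] /andP[-> //]; rewrite eq_sym (negbTE ji).
Qed.

(** ** Small oriented graphs *)

Lemma acyc_extend_in S v n : v \in S ->
  (exists A, [/\ A \subset [set u in S :\ v | ~~ a u v]%SET, acyc A & #|A| = n]) ->
  exists A, [/\ A \subset S, acyc A & #|A| = n.+1].
Proof.
move=> vS [A [AS aA An]]; exists (v |: A); split.
- by apply/fintype.subsetP => x; rewrite in_setU1 => /orP[/eqP->//|/(fintype.subsetP AS)]; rewrite !inE => /andP[/andP[]].
- by apply: acycU_in => // u /(fintype.subsetP AS); rewrite !inE => /andP[].
- rewrite cardsU1 An; case: (boolP (v \in A)) => // /(fintype.subsetP AS).
  by rewrite !inE eqxx.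
Qed.

Lemma acyc_extend_out S v n : v \in S ->
  (exists A, [/\ A \subset [set u in S :\ v | ~~ a v u]%SET, acyc A & #|A| = n]) ->
  exists A, [/\ A \subset S, acyc A & #|A| = n.+1].
Proof.
move=> vS [A [AS aA An]]; exists (v |: A); split.
- by apply/fintype.subsetP => x; rewrite in_setU1 => /orP[/eqP->//|/(fintype.subsetP AS)]; rewrite !inE => /andP[/andP[]].
- by apply: acycU_out => // u /(fintype.subsetP AS); rewrite !inE => /andP[].
- rewrite cardsU1 An; case: (boolP (v \in A)) => // /(fintype.subsetP AS).
  by rewrite !inE eqxx.
Qed.

Lemma card_split S (P : pred V) : #|S| =
  (#|[set u in S | P u]%SET| + #|[set u in S | ~~ P u]%SET|)%N.
Proof.
rewrite -(cardsID [set u | P u]%SET S); congr (_ + _)%N; apply: eq_card => x; rewrite !inE//.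
by rewrite andbC.
Qed.

Lemma card_nonin S v : v \in S ->
  (#|[set u in S :\ v | ~~ a u v]%SET| + indeg S v).+1 = #|S|.
Proof.
move=> vS; rewrite (cardsD1 v S) vS (card_split (S :\ v) (a^~ v)) addnC add1n.
congr (_ + _).+1; apply: eq_card => x; rewrite !inE.
by case: eqP => // ->; rewrite arc_irr andbF.
Qed.

Lemma card_nonout S v : v \in S ->
  (#|[set u in S :\ v | ~~ a v u]%SET| + outdeg S v).+1 = #|S|.
Proof.
move=> vS; rewrite (cardsD1 v S) vS (card_split (S :\ v) (a v)) addnC add1n.
congr (_ + _).+1; apply: eq_card => x; rewrite !inE.
by case: eqP => // ->; rewrite arc_irr andbF.
Qed.

Lemma indeg_outdeg S v : v \in S -> (indeg S v + outdeg S v < #|S|)%N.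
Proof.
move=> vS; rewrite -(card_nonin vS) ltnS addnC leq_add2r.
apply/subset_leq_card/fintype.subsetP => x; rewrite !inE => /andP[-> vx].
by rewrite (arc_asym vx) andbT andbT; apply: contraTneq vx => ->; rewrite arc_irr.
Qed.

(** A vertex is extended by an acyclic set found among its non-in-neighbours or
    among its non-out-neighbours, one of which makes up at least half of the rest. *)
Lemma large_acyc n S : (2 ^ n <= #|S|)%N ->
  exists A, [/\ A \subset S, acyc A & #|A| = n.+1].
Proof.
elim: n S => [|n ih] S nS.
  have /card_gt0P[v vS] : (0 < #|S|)%N by [].
  exists [set v]%SET; rewrite finset.sub1set cards1; split => //.
  rewrite -(finset.setU0 [set v]%SET); apply: acycU_in acyc0 _ => u.
  by rewrite inE.
have /card_gt0P[v vS] : (0 < #|S|)%N by apply: leq_trans nS; rewrite expn_gt0.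
have := card_nonin vS; have := card_nonout vS; have := indeg_outdeg vS => h1 h2 h3.
have [le|lt] := leqP (2 ^ n) #|[set u in S :\ v | ~~ a u v]%SET|.
  by apply: (acyc_extend_in vS); exact: ih.
apply: (acyc_extend_out vS); apply: ih.
by move: nS h1 h2 h3 lt; rewrite expnS; lia.
Qed.

Lemma acyc_le2 A : (#|A| <= 2)%N -> acyc A.
Proof.
move=> A2; have [/eqP A0|A0] := posnP #|A|.
  by rewrite cards_eq0 in A0; rewrite (eqP A0) acyc0.
have [A1 | A1] := leqP 2 #|A|.
  have [B [BA aB B2]] := @large_acyc 1 A A1.
  suff <- : B = A by [].
  by apply/eqP; rewrite eqEcard BA B2.
have [B [BA aB B2]] := @large_acyc 0 A A0.
suff <- : B = A by [].
by apply/eqP; rewrite eqEcard BA B2.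
Qed.

Lemma acyc_pair x y : acyc [set x; y]%SET.
Proof. by apply: acyc_le2; rewrite cards2; case: (_ != _). Qed.

(** Only a directed triangle is not acyclic on three vertices. *)
Lemma acyc_triple x y z : a x y -> ~~ acyc [set x; y; z]%SET -> a y z /\ a z x.
Proof.
move=> xy; have yx := arc_asym xy.
have e1 : [set x; y; z]%SET = y |: [set x; z]%SET by apply/setP => w; rewrite !inE; case: (w == x); case: (w == y).
have e2 : [set x; y; z]%SET = x |: [set y; z]%SET by apply/setP => w; rewrite !inE orbA.
move=> na; split; apply: contraNT na => h.
  rewrite e1; apply: acycU_out; first exact: acyc_pair.
  by move=> u; rewrite !inE => /orP[] /eqP->; rewrite ?yx.
rewrite e2; apply: acycU_in; first exact: acyc_pair.
by move=> u; rewrite !inE => /orP[] /eqP->; rewrite ?yx.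
Qed.

Lemma acyc_triple0 x y z : ~~ a x y -> ~~ a y x -> acyc [set x; y; z]%SET.
Proof.
move=> xy yx.
have -> : [set x; y; z]%SET = x |: [set y; z]%SET by apply/setP => w; rewrite !inE orbA.
have [zx|zx] := boolP (a z x).
  apply: acycU_out; first exact: acyc_pair.
  by move=> u; rewrite !inE => /orP[] /eqP->//; rewrite (arc_asym zx).
by apply: acycU_in; [exact: acyc_pair|move=> u; rewrite !inE => /orP[] /eqP->].
Qed.

Lemma colk1 S : acyc S -> colk S 1.
Proof.
by move=> aS; exists (fun=> ord0) => i; apply: acycS aS; apply/fintype.subsetP => x; rewrite inE => /andP[].
Qed.

Lemma colk2_parts S A : acyc A -> acyc (S :\: A) -> colk S 2.
Proof. by move=> aA /colk1; exact: colkS. Qed.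

Lemma card_setD_sub S A : A \subset S -> #|S :\: A| = (#|S| - #|A|)%N.
Proof. by move=> AS; rewrite cardsD (finset.setIidPr AS). Qed.

Lemma colk2_le5 S : (#|S| <= 5)%N -> colk S 2.
Proof.
move=> S5; have [S2|S2] := leqP #|S| 2; first by apply/colk0S/colk1/acyc_le2.
have [S3|S3] := leqP #|S| 3.
  have [A [AS aA A2]] := @large_acyc 1 S (ltnW S2).
  by apply: (colk2_parts aA); apply: acyc_le2; rewrite card_setD_sub// A2; lia.
have [A [AS aA A3]] := @large_acyc 2 S S3.
by apply: (colk2_parts aA); apply: acyc_le2; rewrite card_setD_sub// A3; lia.
Qed.

Lemma sum_outdeg S : (\sum_(v in S) outdeg S v = \sum_(v in S) indeg S v)%N.
Proof.
have e1 v : outdeg S v = (\sum_(u in S) (a v u : nat))%N.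
  rewrite /outdeg -sum1_card (eq_bigl (fun u => (u \in S) && a v u)).
    by rewrite big_mkcondr; apply: eq_bigr => u _; case: (a v u).
  by move=> u; rewrite inE.
have e2 v : indeg S v = (\sum_(u in S) (a u v : nat))%N.
  rewrite /indeg -sum1_card (eq_bigl (fun u => (u \in S) && a u v)).
    by rewrite big_mkcondr; apply: eq_bigr => u _; case: (a u v).
  by move=> u; rewrite inE.
rewrite (eq_bigr _ (fun v _ => e1 v)) [RHS](eq_bigr _ (fun v _ => e2 v)).
exact: exchange_big.
Qed.

Lemma low_degree S (d : V -> nat) k : (\sum_(v in S) d v < k.+1 * #|S|)%N ->
  exists2 v, v \in S & (d v <= k)%N.
Proof.
move=> h; have /existsP[v /andP[vS dv]] : [exists v, (v \in S) && (d v <= k)%N].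
  apply: contraLR h => /existsPn h; rewrite -leqNgt mulnC -sum_nat_const.
  by apply: leq_sum => v vS; have := h v; rewrite vS /= -ltnNge.
by exists v.
Qed.

(** In an oriented graph on six vertices take a vertex v of out-degree two, with
    out-neighbours x -> y, and suppose that no partition into two acyclic
    triples works. Then every triple formed by x, y and a further vertex w is a
    directed triangle, so that y is the only out-neighbour of x. *)
Lemma colk2_le6 S : (#|S| <= 6)%N -> colk S 2.
Proof.
move=> S6; have [S5|S5] := leqP #|S| 5; first exact: colk2_le5.
have {S5}S6 : #|S| = 6 by lia.
have rem v : v \in S -> colk (S :\ v) 2.
  by move=> vS; apply: colk2_le5; have := cardsD1 v S; rewrite vS S6; lia.
have [/existsP[v /andP[vS dv]]|/existsPn hout] :=
  boolP [exists v, (v \in S) && (outdeg S v < 2)%N].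
  exact: colk_out (rem v vS) dv.
have [v vS dv] : exists2 v, v \in S & (outdeg S v <= 2)%N.
  apply: low_degree; have : (\sum_(v in S) indeg S v + \sum_(v in S) outdeg S v <= 5 * #|S|)%N.
    rewrite mulnC -sum_nat_const -big_split; apply: leq_sum => v /indeg_outdeg.
    by rewrite S6.
  by rewrite -sum_outdeg S6; lia.
have {}dv : outdeg S v = 2 by have := hout v; rewrite vS /= -leqNgt; lia.
pose W := [set u in S :\ v | ~~ a v u]%SET.
have W3 : #|W| = 3 by have := card_nonout vS; rewrite dv S6 -/W; lia.
have WS : W \subset S.
  by apply/fintype.subsetP => x; rewrite !inE => /andP[/andP[]].
have vW (U : {set V}) : U \subset W -> acyc U -> acyc (v |: U).
  move=> UW aU; apply: acycU_out => // u /(fintype.subsetP UW).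
  by rewrite !inE => /andP[].
have [x [y [xy [vx vy] N2]]] : exists x y, [/\ x != y, a v x /\ a v y &
    [set u in S | a v u]%SET = [set x; y]%SET].
  have /cards2P[x [y [xy E]]] : #|[set u in S | a v u]%SET| == 2 by rewrite -dv.
  exists x, y; split => //; split.
    have : x \in [set x; y]%SET by rewrite !inE eqxx.
    by rewrite -E inE => /andP[].
  have : y \in [set x; y]%SET by rewrite !inE eqxx orbT.
  by rewrite -E inE => /andP[].
have memS u : u \in S -> [|| u == v, u \in W, u == x | u == y].
  move=> uS; have : u \in [set u in S | a v u]%SET = ((u == x) || (u == y)) by rewrite N2 !inE.
  by rewrite /W !inE uS andbT => <-; case: eqP => //= _; case: (a v u).
have [aW|naW] := boolP (acyc W).
  apply: (colk2_parts (vW W (fintype.subxx W) aW)); apply: acyc_le2.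
  rewrite card_setD_sub; first by rewrite cardsU1 W3 /W !inE eqxx S6.
  by rewrite finset.subUset finset.sub1set vS.
have part w : w \in W -> acyc [set x; y; w]%SET -> colk S 2.
  move=> wW aw; apply: (colk2_parts aw).
  apply: (@acycS (v |: (W :\ w))); last first.
    apply: vW; first exact: finset.subD1set.
    by apply: acyc_le2; have := cardsD1 w W; rewrite wW W3; lia.
  apply/fintype.subsetP => u; rewrite finset.in_setD in_setU1 in_setD1 => /andP[].
  rewrite !inE !negb_or => /andP[/andP[/negbTE ux /negbTE uy] uw] /memS.
  by rewrite ux uy !orbF uw inE => /orP[->|] //; rewrite !inE => ->; rewrite orbT.
have [/existsP[w /andP[wW aw]]|/existsPn h] := boolP [exists w, (w \in W) && acyc [set x; y; w]%SET].
  exact: part wW aw.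
have [w0 w0W] : exists w, w \in W by apply/set0Pn; rewrite -card_gt0 W3.
have key x' y' : x' \in S -> a x' y' -> (forall u, u \in S -> [|| u == v, u \in W, u == x' | u == y']) ->
    a v x' -> (forall w, w \in W -> ~~ acyc [set x'; y'; w]%SET) -> colk S 2.
  move=> x'S xy' mem vx' nW; apply: (@colk_out S x'); first exact: rem.
  apply: (@leq_ltn_trans #|[set y']%SET|); last by rewrite cards1.
  apply/subset_leq_card/fintype.subsetP => u; rewrite inE => /andP[/mem uS xu].
  rewrite inE; case/or4P: uS => [/eqP uv|/nW/(acyc_triple xy')[_ ux]|/eqP ux|//].
  - by move: xu; rewrite uv (arc_asym vx').
  - by move: xu; rewrite (arc_asym ux).
  - by move: xu; rewrite ux arc_irr.
have xyS u : (u == x) || (u == y) -> u \in S.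
  have -> : (u == x) || (u == y) = (u \in [set u in S | a v u]%SET) by rewrite N2 !inE.
  by rewrite inE => /andP[].
have nW w : w \in W -> ~~ acyc [set x; y; w]%SET by move=> wW; have := h w; rewrite wW.
have [axy|naxy] := boolP (a x y); first by apply: (key x y) => //; apply: xyS; rewrite eqxx.
have [ayx|nayx] := boolP (a y x); last by case/negP: (nW _ w0W); exact: acyc_triple0.
apply: (key y x) => //; first by apply: xyS; rewrite eqxx orbT.
  by move=> u /memS; rewrite [(u == y) || _]orbC.
by move=> w /nW; rewrite (finset.setUC [set y]%SET).
Qed.

Lemma colkW S k l : (k <= l)%N -> colk S k -> colk S l.
Proof.
move=> /subnKC <-; elim: (l - k)%N => [|n ih] c; first by rewrite addn0.
by rewrite addnS; apply: colk0S; exact: ih.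
Qed.

Lemma colk3_le10 S : (#|S| <= 10)%N -> colk S 3.
Proof.
move=> S10; have [S6|S6] := leqP #|S| 6; first by apply: (@colkW S 2) => //; exact: colk2_le6.
have [n [n0 nS le]] : exists n, [/\ (n <= 3)%N, (2 ^ n <= #|S|)%N & (#|S| <= 7 + n)%N].
  have [S8|S8] := leqP 8 #|S|; first by exists 3.
  by exists 2; split => //; lia.
have [A [AS aA An]] := large_acyc nS.
by apply: (colkS aA); apply: colk2_le6; rewrite card_setD_sub// An; lia.
Qed.

(** A set of seven vertices without an acyclic quadruple spans a regular
    tournament: the non-out-neighbours of a vertex number at most three, and
    likewise its non-in-neighbours. *)
Lemma regular7 S : #|S| = 7 ->
  (forall A, A \subset S -> acyc A -> #|A| != 4) ->
  forall v, v \in S -> outdeg S v = 3 /\ (forall u, u \in S -> u != v -> a u v || a v u).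
Proof.
move=> S7 no4 v vS.
have h1 : (#|[set u in S :\ v | ~~ a u v]%SET| <= 3)%N.
  rewrite leqNgt; apply/negP => /(@large_acyc 2) e.
  by have [A [AS aA /eqP A4]] := acyc_extend_in vS e; have := no4 A AS aA; rewrite A4.
have h2 : (#|[set u in S :\ v | ~~ a v u]%SET| <= 3)%N.
  rewrite leqNgt; apply/negP => /(@large_acyc 2) e.
  by have [A [AS aA /eqP A4]] := acyc_extend_out vS e; have := no4 A AS aA; rewrite A4.
have e1 := card_nonin vS; have e2 := card_nonout vS; have e3 := indeg_outdeg vS.
rewrite S7 in e1 e2 e3; split; first by lia.
move=> u uS uv; apply: contraT; rewrite negb_or => /andP[n1 n2].
have h3 : [set x in S | a x v]%SET \proper [set x in S :\ v | ~~ a v x]%SET.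
  apply/properP; split.
    apply/fintype.subsetP => x; rewrite !inE => /andP[-> xv]; rewrite (arc_asym xv) !andbT.
    by apply: contraTneq xv => ->; rewrite arc_irr.
  by exists u; rewrite !inE ?uv ?uS ?n1 ?n2.
by have := proper_card h3; rewrite -/(indeg S v); lia.
Qed.

(** On eleven vertices with all out-degrees at least three, let T be the set of
    vertices of out-degree exactly three. If no 3-colouring exists then for v in
    T the seven vertices outside the closed out-neighbourhood of v contain no
    acyclic quadruple, hence span a regular tournament. An arc u -> v inside T
    would give u a fourth out-neighbour, and three vertices of T would give two
    non-adjacent vertices in a tournament, so T has at most two elements. *)
Lemma colk3_eleven S : #|S| = 11 -> (\sum_(v in S) outdeg S v <= 41)%N -> colk S 3.
Proof.
move=> S11 deg.
have rem v : v \in S -> colk (S :\ v) 3.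
  by move=> vS; apply: colk3_le10; have := cardsD1 v S; rewrite vS S11; lia.
have [/existsP[v /andP[vS dv]]|/existsPn hout] :=
  boolP [exists v, (v \in S) && (outdeg S v < 3)%N].
  exact: colk_out (rem v vS) dv.
pose T := [set v in S | outdeg S v == 3]%SET.
have TS : T \subset S by apply/fintype.subsetP => x; rewrite inE => /andP[].
have T3 : (2 < #|T|)%N.
  have : (\sum_(v in S) (3 + (outdeg S v != 3)) <= 41)%N.
    apply: leq_trans deg; apply: leq_sum => v vS; have := hout v; rewrite vS /= -leqNgt.
    by case: eqP => /=; lia.
  rewrite big_split /= sum_nat_const S11.
  have -> : (\sum_(v in S) (outdeg S v != 3) = #|S :\: T|)%N.
    rewrite -sum1_card [LHS]big_mkcond [RHS]big_mkcond; apply: eq_bigr => v _.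
    by rewrite !inE; case: (v \in S) => //=; case: eqP.
  by rewrite card_setD_sub// S11; lia.
have [//|nc] := pselect (colk S 3).
pose R v := [set u in S :\ v | ~~ a v u]%SET.
have RS v : R v \subset S by apply/fintype.subsetP => x; rewrite !inE => /andP[/andP[]].
have Rreg v : v \in T -> forall u, u \in R v ->
    outdeg (R v) u = 3 /\ (forall w, w \in R v -> w != u -> a w u || a u w).
  rewrite inE => /andP[vS /eqP dv].
  have R7 : #|R v| = 7 by have := card_nonout vS; rewrite dv S11 -/(R v); lia.
  apply: regular7 => // A AR aA; apply/eqP => A4; apply: nc.
  have aB : acyc (v |: A).
    apply: acycU_out => // u /(fintype.subsetP AR).
    by rewrite !inE => /andP[].
  have vA : v \notin A by apply/negP => /(fintype.subsetP AR); rewrite !inE eqxx.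
  apply: (colkS aB); apply: colk2_le6; rewrite card_setD_sub.
    by rewrite cardsU1 vA A4 S11.
  by rewrite finset.subUset finset.sub1set vS (fintype.subset_trans AR).
have indep u v : u \in T -> v \in T -> ~~ a u v.
  move=> uT vT; apply/negP => uv.
  have uR : u \in R v.
    rewrite !inE (arc_asym uv) (fintype.subsetP TS _ uT) !andbT.
    by apply: contraTneq uv => ->; rewrite arc_irr.
  have [d3 _] := Rreg v vT u uR.
  have h : [set x in R v | a u x]%SET \proper [set x in S | a u x]%SET.
    apply/properP; split.
      by apply/fintype.subsetP => x; rewrite inE => /andP[/(fintype.subsetP (RS v)) xS ux]; rewrite inE xS.
    by exists v; rewrite inE ?uv ?(fintype.subsetP TS _ vT)// !inE eqxx.
  have := proper_card h; rewrite -/(outdeg (R v) u) d3.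
  by move: uT; rewrite inE => /andP[_ /eqP e]; rewrite -/(outdeg S u) e.
have /card_gt2P[x [y [z [[xT yT zT] [xy yz zx]]]]] := T3.
have inR w : w \in T -> w != x -> w \in R x.
  by move=> wT wx; rewrite !inE wx (fintype.subsetP TS _ wT) indep.
have [_ /(_ z)] := Rreg x xT y (inR y yT (negbT (etrans (eq_sym _ _) (negbTE xy)))).
rewrite (inR z zT zx) eq_sym yz => /(_ isT isT).
by rewrite (negbTE (indep _ _ zT yT)) (negbTE (indep _ _ yT zT)).
Qed.

(** ** The regular case *)

Section Regular.
Variable H : {set V}.
Hypothesis H_out : forall v, v \in H -> indeg H v = 2.
Hypothesis H_not : ~ colk H 2.
Implicit Types f : V -> bool.

Definition class f v c := [set x in H | (x != v) && (f x == c)]%SET.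
(** A partial 2-colouring that leaves out the single vertex v. Since no full
    colouring exists, v has exactly one in-neighbour of each colour, and the
    uncoloured vertex can be moved to either of them. *)
Definition state f v := v \in H /\ forall c, acyc (class f v c).
Definition recolour f v c : V -> bool := fun x => if x == v then c else f x.

Lemma state_colour f v c : state f v -> exists u, [/\ u \in H, a u v & f u = c].
Proof.
move=> [vH st]; have [/existsP[u /and3P[uH uv /eqP fu]]|/existsPn h] :=
  boolP [exists u, [&& u \in H, a u v & f u == c]]; first by exists u.
case: H_not; exists (fun x => if recolour f v c x then ord0 else ord_max) => i.
pose d := i == ord0.
apply: (@acycS (if d == c then v |: class f v d else class f v d)).
  apply/fintype.subsetP => x; rewrite inE /recolour => /andP[xH].
  have [->|xv] := eqVneq x v.
    by rewrite /d; case: c {h} => /eqP <-; rewrite ?eqxx ?in_setU1 ?eqxx.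
  move=> fx; have {fx}fd : f x == d.
    by rewrite /d; move: fx; case: (f x) => /eqP <-.
  by case: ifP => _; rewrite ?in_setU1 !inE xH xv fd ?orbT.
case: eqP => [dc|_]; last exact: st.
apply: acycU_in (st d) _ => u; rewrite inE => /and3P[uH _ fu].
by have := h u; rewrite uH -dc fu andbT.
Qed.

Lemma state_unique f v u w : state f v -> u \in H -> w \in H -> a u v -> a w v ->
  u != w -> f u != f w.
Proof.
move=> st uH wH uv wv uw; apply/negP => /eqP fuw.
have [x [xH xv fx]] := state_colour (~~ f u) st.
have := H_out st.1; rewrite /indeg => d2.
have : (#|x |: (u |: [set w])| <= #|[set u in H | a u v]%SET|)%N.
  apply/subset_leq_card/fintype.subsetP => z; rewrite !inE => /or3P[]/eqP->; by rewrite ?xH ?uH ?wH.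
rewrite d2 !cardsU1 !inE cards1 uw.
have -> : (x == u) = false by apply/eqP => xu; move: fx; rewrite xu; case: (f u).
by have -> : (x == w) = false by apply/eqP => xw; move: fx; rewrite xw -fuw; case: (f u).
Qed.

Lemma state_move f v u : state f v -> u \in H -> a u v -> state (recolour f v (f u)) u.
Proof.
move=> st uH uv; split => // c.
have uv' : u != v by apply: contraTneq uv => ->; rewrite arc_irr.
apply: (@acycS (if c == f u then v |: (class f v c :\ u) else class f v c)).
  apply/fintype.subsetP => x; rewrite inE /recolour => /and3P[xH xu].
  have [->|xv] := eqVneq x v; first by move=> /eqP->; rewrite eqxx in_setU1 eqxx.
  by move=> fx; case: ifP => _; rewrite ?in_setU1 ?in_setD1 !inE xH xv fx ?xu ?orbT.
case: eqP => [cu|_]; last exact: st.2.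
apply: acycU_in; first exact: acycS (finset.subD1set _ _) (st.2 c).
move=> w; rewrite !inE => /and4P[wu wH _ /eqP fw]; apply/negP => wv.
by have := state_unique st wH uH wv uv wu; rewrite fw cu eqxx.
Qed.

(* paths run against the arcs *)
Local Notation back := (fun x y => a y x).

(** Moving the uncoloured vertex backwards along a path shifts the colours of the
    path by one place. *)
Lemma state_walk f v p : state f v -> path back v p -> uniq (v :: p) -> {subset p <= H} ->
  exists f', [/\ state f' (last v p), (forall x, x \notin v :: p -> f' x = f x) &
    forall u q, p = u :: q -> f' v = f u].
Proof.
elim: p f v => [|u p ih] f v st /=; first by exists f; split.
move=> /andP[uv pp] /andP[vup up] sub.
have uH : u \in H by apply: sub; rewrite mem_head.
have [f' [st' off _]] := ih _ _ (state_move st uH uv) pp up (fun x xp => sub x (mem_behead (s := u :: p) xp)).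
exists f'; split => //.
  move=> x; rewrite inE negb_or => /andP[xv xup]; rewrite off//.
  by rewrite /recolour (negbTE xv).
by move=> _ _ [<- _]; rewrite off// /recolour eqxx.
Qed.

(** Shift the colours along a directed cycle through the uncoloured vertex v: the
    two in-neighbours of v must still have different colours afterwards. *)
Lemma rotation f v u1 u2 p w : state f v -> path back v [:: u1, u2 & p] ->
  uniq [:: v, u1, u2 & p] -> {subset [:: u1, u2 & p] <= H} -> a v (last u2 p) ->
  w \in H -> a w v -> w \notin [:: v, u1, u2 & p] -> f u1 = f u2.
Proof.
move=> st pp up sub cl wH wv wN.
have u1H : u1 \in H by apply: sub; rewrite mem_head.
have u1v : a u1 v by move: pp => /= /andP[].
have wu1 : w != u1 by apply: contraNneq wN => ->; rewrite !inE eqxx orbT.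
have st1 := state_move st u1H u1v.
have pp' : path back u1 (u2 :: p) by case/andP: pp.
have up' : uniq [:: u1, u2 & p] by case/andP: up.
have [f' [st' off hd]] := state_walk st1 pp' up' (fun x xp => sub x (mem_behead (s := [:: u1, u2 & p]) xp)).
have vN : v \notin [:: u1, u2 & p] by case/andP: up.
have lN : last u2 p != v.
  by apply: contraNneq vN => <-; rewrite inE mem_last orbT.
have lN1 : last u2 p != u1.
  by move: up => /= /and3P[_ u1N _]; apply: contraNneq u1N => <-; rewrite mem_last.
have st2 := state_move st' st.1 cl.
have := state_unique st2 wH u1H wv u1v wu1.
have wl : w != last u2 p.
  by apply: contraNneq wN => ->; rewrite inE [X in _ || X]inE mem_last !orbT.
rewrite /recolour (negbTE wl) [u1 == _]eq_sym (negbTE lN1).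
rewrite (hd u2 p erefl) off; last by apply: contra wN => h; rewrite inE h orbT.
have wv' : w != v by apply: contraNneq wN => ->; rewrite mem_head.
rewrite /recolour (negbTE wv').
have u2v : u2 != v by apply: contraNneq vN => <-; rewrite !inE eqxx orbT.
rewrite (negbTE u2v).
have := state_unique st wH u1H wv u1v wu1.
by case: (f w); case: (f u1); case: (f u2).
Qed.

Definition altpath f v p := [&& path back v p, uniq (v :: p), all (mem H) p &
  sorted (fun x y => f x != f y) p].

Lemma no_alternating_cycle f v p : state f v -> altpath f v p -> p != [::] ->
  a v (last v p) -> False.
Proof.
move=> st /and4P[]; case: p => [//|u1 [|u2 p]] pp up /allP pH ap _ cl.
  by move: pp cl => /= /andP[/arc_asym->].
have {}pH : {subset [:: u1, u2 & p] <= H} by move=> x /pH.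
have u1H : u1 \in H by apply: pH; rewrite mem_head.
have u1v : a u1 v by case/andP: pp.
have [w [wH wv fw]] := state_colour (~~ f u1) st.
have f12 : f u1 != f u2 by case/andP: ap.
have wu1 : w != u1 by apply: contra_eq_neq fw => ->; case: (f u1).
have [wp|wN] := boolP (w \in [:: v, u1, u2 & p]); last first.
  by move: f12; rewrite (rotation st pp up pH cl wH wv wN) eqxx.
have wvN : w != v by apply: contraTneq wv => ->; rewrite arc_irr.
have {wp} : w \in u2 :: p by move: wp; rewrite inE (negbTE wvN) inE (negbTE wu1).
move=> /path.splitPr E; move: pp up pH ap cl; case: E => r1 r2.
rewrite -cat_cons => pp up pH ap cl.
case: r2 => [|w2 r2] in pp up pH ap cl *.
  by move: cl; rewrite /= last_cat /= (arc_asym wv).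
have pp' : path back v [:: w, w2 & r2].
  by move: pp; rewrite /= cat_path /= => /and4P[_ _ _ ->]; rewrite wv.
have up' : uniq [:: v, w, w2 & r2].
  move: up; rewrite cons_uniq => /andP[vN]; rewrite cat_uniq => /and3P[_ _ u3].
  by rewrite cons_uniq u3 andbT; apply: contra vN => h; rewrite mem_cat h orbT.
have pH' : {subset [:: w, w2 & r2] <= H}.
  by move=> x xp; apply: pH; rewrite mem_cat xp orbT.
have cl' : a v (last w2 r2) by move: cl; rewrite /= last_cat.
have u1N : u1 \notin [:: v, w, w2 & r2].
  have u1vN : u1 != v by apply: contraTneq u1v => ->; rewrite arc_irr.
  move: up; rewrite /= => /and3P[_ u1N _]; rewrite inE negb_or u1vN /=.
  by apply: contra u1N => h; rewrite mem_cat h orbT.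
have := rotation st pp' up' pH' cl' u1H u1v u1N.
move: ap; rewrite /= cat_path /= => /and4P[_ _ /negP fN _] /eqP; exact: fN.
Qed.

(** A longest path that runs backwards from an uncoloured vertex and alternates
    in colour closes up to a directed cycle alternating in colour. By the
    rotation lemma the second in-neighbour of its uncoloured vertex lies on the
    cycle; it cuts off a shorter cycle, to which the lemma applies as well, and
    which still contains two consecutive vertices of different colours. *)
Lemma not_regular v0 f0 : ~ state f0 v0.
Proof.
move=> st0.
pose P n := `[< exists f v p, [/\ state f v, altpath f v p & size p = n] >].
have exP : exists n, P n by exists 0%N; apply/asboolP; exists f0, v0, [::].
have ubP n : P n -> (n <= #|V|)%N.
  move=> /asboolP[f [v [p [_ /and4P[_ up _ _] <-]]]].
  by apply: leq_trans (max_card (mem (v :: p))); rewrite (card_uniqP up).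
case: (ex_maxnP exP ubP) => n /asboolP[f [v [p [st alt pn]]]] nmax.
have /and4P[pp up pH ap] := alt.
have pH' : {subset p <= H} by move=> x /(allP pH).
have [f' [st' off _]] := state_walk st pp up pH'.
have [u [uH uz fu]] := state_colour (~~ f (last v p)) st'.
have uzN : u != last v p by apply: contraTneq uz => ->; rewrite arc_irr.
have upath : u \in v :: p.
  apply: contraT => uN.
  have : P n.+1.
    apply/asboolP; exists f, v, (rcons p u); split => //; last by rewrite size_rcons pn.
    rewrite /altpath rcons_path pp uz -rcons_cons rcons_uniq uN up all_rcons /= uH pH /=.
    have fu' : f u = ~~ f (last v p) by rewrite -(off u uN).
    case: (p) ap fu' => [//|x q] /= ap fu'; rewrite rcons_path ap fu' /=.
    by case: (f (last x q)).
  by move/nmax; rewrite ltnn.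
move: upath; rewrite inE => /orP[/eqP uv|].
  apply: (no_alternating_cycle st alt); last by move: uz; rewrite uv.
  by apply: contraNneq uzN => p0; rewrite uv p0.
move=> /path.splitPr E; move: pp up pH' ap uz uzN {pH pn alt off st' fu}.
case: E => p1 p2 pp up pH ap uz uzN.
move: pp up ap; rewrite -cat_rcons => pp up ap.
have [pp1 pp2] := andP (etrans (esym (cat_path _ _ _ _)) pp).
rewrite last_rcons in pp2.
have [up1 up2] : uniq (v :: rcons p1 u) /\ uniq (u :: p2).
  move: up; rewrite -cat_cons cat_uniq => /and3P[h1 h2 h3]; split => //.
  by rewrite cons_uniq h3 andbT; apply: contra h2 => h; apply/hasP; exists u => //; rewrite inE mem_rcons mem_head orbT.
have sub1 : {subset rcons p1 u <= H}.
  by move=> x xp; apply: pH; rewrite -cat_rcons mem_cat xp.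
have [f1 [st1 off1 _]] := state_walk st pp1 up1 sub1.
rewrite last_rcons in st1.
have e12 x : x \in p2 -> f1 x = f x.
  move=> xp; apply: off1; move: up; rewrite -cat_cons cat_uniq => /and3P[_ h2 _].
  by apply: contra h2 => h; apply/hasP; exists x.
apply: (@no_alternating_cycle f1 u p2 st1).
- apply/and4P; split => //.
    by apply/allP => x xp; apply: pH; rewrite mem_cat inE xp !orbT.
  have : sorted (fun x y => f x != f y) p2.
    move: ap; case: p2 {pp up pH uz uzN pp2 up2 e12} => [//|y q].
    by case: (p1) => [|x r] /=; rewrite ?cat_path /=; [case/andP|case/and3P].
  case: p2 e12 {pp up pH uz uzN pp2 up2 ap} => [//|y q] e12 /=.
  rewrite (@eq_in_path _ (mem (y :: q)) (fun x z => f1 x != f1 z) (fun x z => f x != f z))//.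
    by move=> x z xq zq; rewrite !e12.
  by apply/allP.
- apply: contraNneq uzN => p20; by rewrite p20 last_cat.
- by move: uz; rewrite last_cat.
Qed.

End Regular.

Lemma minimal_noncolourable S k : ~ colk S k ->
  exists T, [/\ T \subset S, ~ colk T k & forall v, v \in T -> colk (T :\ v) k].
Proof.
have [n] := ubnP #|S|; elim: n S => // n ih S Sn nS.
have [/existsP[v /andP[vS /asboolP nv]]|/existsPn h] :=
  boolP [exists v, (v \in S) && `[< ~ colk (S :\ v) k >]].
  have [|//|T [TS nT mT]] := ih (S :\ v).
    by move: Sn; rewrite (cardsD1 v S) vS.
  by exists T; split => //; apply: (fintype.subset_trans TS); exact: finset.subD1set.
exists S; split => // v vS; apply: contrapT => nv.
by have := h v; rewrite vS /= => /asboolP.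
Qed.

(** A smallest counterexample would have all in-degrees equal to two. *)
Lemma colk2_outdeg2 S : (forall v, v \in S -> (outdeg S v <= 2)%N) -> colk S 2.
Proof.
move=> d2; apply: contrapT => /minimal_noncolourable[T [TS nT mT]].
have dout v : v \in T -> outdeg T v = 2.
  move=> vT; apply/eqP; rewrite eqn_leq; apply/andP; split.
    apply: leq_trans (d2 v (fintype.subsetP TS _ vT)); apply/subset_leq_card/fintype.subsetP => x.
    by rewrite !inE => /andP[/(fintype.subsetP TS)-> ->].
  by rewrite leqNgt; apply/negP => /(colk_out (mT v vT)).
have din2 v : v \in T -> (2 <= indeg T v)%N.
  by move=> vT; rewrite leqNgt; apply/negP => /(colk_in (mT v vT)).
have din v : v \in T -> indeg T v = 2.
  move=> vT; apply/eqP; rewrite eqn_leq din2// andbT.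
  have : (\sum_(i in T | i != v) 2 <= \sum_(i in T | i != v) indeg T i)%N.
    by apply: leq_sum => u /andP[uT _]; exact: din2.
  have : (\sum_(u in T) outdeg T u = \sum_(u in T) 2)%N by exact: eq_bigr.
  rewrite sum_outdeg (bigD1 v vT)/= [RHS](bigD1 v vT)/=.
  by move: (indeg T v) (\sum_(i in T | _) 2)%N (\sum_(i in T | _) indeg T i)%N => x y z; lia.
have [T0|[v vT]] := set_0Vmem T.
  by apply: nT; apply: colk2_le5; rewrite T0 cards0.
have [f hf] := mT v vT.
apply: (@not_regular T din nT v (fun x => f x == ord0)); split => // c.
apply: acycS (hf (if c then ord0 else ord_max)).
apply/fintype.subsetP => x; rewrite !inE => /and3P[-> -> /eqP <-] /=.
by case: (f x) => [[|[|m]] hm].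
Qed.

Definition arcs A B := (\sum_(x in A) \sum_(y in B) (a x y : nat))%N.

Lemma outdegE S v : outdeg S v = (\sum_(u in S) (a v u : nat))%N.
Proof.
rewrite /outdeg -sum1_card (eq_bigl (fun u => (u \in S) && a v u)).
  by rewrite big_mkcondr; apply: eq_bigr => u _; case: (a v u).
by move=> u; rewrite inE.
Qed.

Lemma indegE S v : indeg S v = (\sum_(u in S) (a u v : nat))%N.
Proof.
rewrite /indeg -sum1_card (eq_bigl (fun u => (u \in S) && a u v)).
  by rewrite big_mkcondr; apply: eq_bigr => u _; case: (a u v).
by move=> u; rewrite inE.
Qed.

Lemma arcs_out A B : arcs A B = (\sum_(x in A) outdeg B x)%N.
Proof. by apply: eq_bigr => x _; rewrite outdegE. Qed.

Lemma arcs_in A B : arcs A B = (\sum_(y in B) indeg A y)%N.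
Proof. by rewrite /arcs exchange_big; apply: eq_bigr => y _; rewrite indegE. Qed.

Lemma sum_setU (T : {set V}) A B (F : V -> nat) : (A :&: B == finset.set0) -> T = A :|: B ->
  (\sum_(x in T) F x = \sum_(x in A) F x + \sum_(x in B) F x)%N.
Proof.
move=> /eqP AB0 ->; rewrite (big_setID A)/= finset.setUK finset.setDUl finset.setDv.
rewrite finset.set0U; congr (_ + _)%N; apply: eq_bigl => x; rewrite finset.in_setD.
have : x \notin A :&: B by rewrite AB0 inE.
by rewrite inE; case: (x \in A); case: (x \in B).
Qed.

Lemma arcs_Ul (T : {set V}) A B C : (A :&: B == finset.set0) -> T = A :|: B ->
  arcs T C = (arcs A C + arcs B C)%N.
Proof. by move=> dAB TE; rewrite /arcs (sum_setU _ dAB TE). Qed.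

Lemma arcs_Ur (T : {set V}) A B C : (A :&: B == finset.set0) -> T = A :|: B ->
  arcs C T = (arcs C A + arcs C B)%N.
Proof.
by move=> dAB TE; rewrite /arcs -big_split; apply: eq_bigr => x _; rewrite (sum_setU _ dAB TE).
Qed.

Lemma arcs_inside A : (2 * arcs A A <= #|A| * #|A|.-1)%N.
Proof.
have -> : (2 * arcs A A = \sum_(x in A) (outdeg A x + indeg A x))%N.
  by rewrite big_split /= -arcs_out -arcs_in mul2n addnn.
rewrite -sum_nat_const; apply: leq_sum => x xA.
by have := indeg_outdeg xA; have := cardsD1 x A; rewrite xA; lia.
Qed.

Section Minimal.
Variable S : {set V}.
Hypothesis S_not : ~ colk S 4.
Hypothesis S_min : forall v, v \in S -> colk (S :\ v) 4.
Local Notation n := (#|S|).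
Hypothesis S_sparse : (arcs S S <= 3 * n + 24)%N.

Lemma min_outdeg v : v \in S -> (4 <= outdeg S v)%N.
Proof. by move=> vS; rewrite leqNgt; apply/negP => /(colk_out (S_min vS)). Qed.

Lemma min_indeg v : v \in S -> (4 <= indeg S v)%N.
Proof. by move=> vS; rewrite leqNgt; apply/negP => /(colk_in (S_min vS)). Qed.

Lemma acyc_rest A : A \subset S -> acyc A -> ~ colk (S :\: A) 3.
Proof. by move=> AS aA /(colkS aA). Qed.

Lemma acyc_small A : A \subset S -> acyc A -> (#|A| + 10 < n)%N.
Proof.
move=> AS aA; rewrite ltnNge; apply/negP => le; apply: (acyc_rest AS aA).
by apply: colk3_le10; rewrite card_setD_sub//; lia.
Qed.

(** A is as large as acyclic sets can be, so every other vertex has an out-neighbour in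
    it, and out-degrees within the eleven remaining vertices are smaller by one. *)
Lemma not_eleven A : A \subset S -> acyc A -> (#|A| + 11 = n)%N -> (n < 16)%N.
Proof.
move=> AS aA An; rewrite ltnNge; apply/negP => n16.
have R11 : #|S :\: A| = 11 by rewrite card_setD_sub//; lia.
apply: (acyc_rest AS aA); apply: colk3_eleven => //.
have out v : v \in S :\: A -> (outdeg (S :\: A) v + 1 <= outdeg S v)%N.
  rewrite finset.in_setD => /andP[vA vS].
  have [/existsP[u /andP[uA vu]]|/existsPn h] := boolP [exists u, (u \in A) && a v u].
    rewrite addn1; apply: proper_card; apply/properP; split.
      by apply/fintype.subsetP => x; rewrite !inE => /andP[/andP[_ ->] ->].
    by exists u; rewrite !inE ?vu ?uA ?(fintype.subsetP AS _ uA).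
  have /acyc_small : v |: A \subset S by rewrite finset.subUset finset.sub1set vS.
  have aU : acyc (v |: A) by apply: acycU_out => // u uA; have := h u; rewrite uA.
  by move=> /(_ aU); rewrite cardsU1 vA; lia.
have : (\sum_(v in S :\: A) (outdeg (S :\: A) v + 1) <= \sum_(v in S :\: A) outdeg S v)%N.
  exact: leq_sum.
have : (4 * #|A| <= \sum_(v in A) outdeg S v)%N.
  rewrite mulnC -sum_nat_const; apply: leq_sum => v vA.
  exact/min_outdeg/(fintype.subsetP AS).
have e : S = A :|: S :\: A by rewrite -{1}(finset.setID S A) (finset.setIidPr AS).
have d : (A :&: (S :\: A) == finset.set0) by rewrite finset.setI_eq0 finset.disjoints_subset; apply/fintype.subsetP => x xA; rewrite !inE xA.
have := sum_setU (outdeg S) d e; rewrite -arcs_out big_split /= sum_nat_const R11.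
move: S_sparse n16 An; move: (arcs S S) (\sum_(v in A) _)%N (\sum_(v in S :\: A) outdeg S v)%N
  (\sum_(v in S :\: A) outdeg (S :\: A) v)%N (#|A|) (#|S|) => e1 e2 e3 e4 cA cS.
by lia.
Qed.

Lemma seventeen : n = 17 -> exists A, [/\ A \subset S, acyc A & #|A| = 6].
Proof.
move=> n17.
have [v vS dv] : exists2 v, v \in S & (indeg S v <= 4)%N.
  by apply: low_degree; rewrite -arcs_in n17; move: S_sparse; rewrite n17; lia.
have {}dv : indeg S v = 4 by have := min_indeg vS; lia.
pose P := [set u in S | a u v]%SET; pose T := [set u in S :\ v | ~~ a u v]%SET.
have T12 : #|T| = 12 by have := card_nonin vS; rewrite dv n17 -/T; lia.
have dPT : (P :&: T == finset.set0).
  by rewrite finset.setI_eq0 finset.disjoints_subset; apply/fintype.subsetP => x; rewrite !inE => /andP[_ ->]; rewrite andbF.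
have dv1 : ([set v]%SET :&: (P :|: T) == finset.set0).
  by rewrite finset.setI_eq0 disjoints1 !inE arc_irr eqxx andbF.
have SE : S = [set v]%SET :|: (P :|: T).
  apply/setP => x; rewrite !inE; case: (eqVneq x v) => [->|xv] //=.
  by case: (x \in S) => //; case: (a x v).
have P4 : #|P| = 4%N by exact: dv.
have PS : P \subset S by apply/fintype.subsetP => x; rewrite inE => /andP[].
have TS : T \subset S by apply/fintype.subsetP => x; rewrite !inE => /andP[/andP[]].
have PP := arcs_inside P; rewrite P4 in PP.
have e1 := arcs_Ur S dv1 SE; have e2 := arcs_Ur S dPT (erefl (P :|: T)).
have e3 := arcs_Ul T dv1 SE; have e4 := arcs_Ul T dPT (erefl (P :|: T)).
have e5 := arcs_Ur P dv1 SE; have e6 := arcs_Ur P dPT (erefl (P :|: T)).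
have e7 := arcs_Ur [set v]%SET dv1 SE; have e8 := arcs_Ur [set v]%SET dPT (erefl (P :|: T)).
have f1 : arcs S [set v]%SET = 4 by rewrite arcs_in big_set1.
have f2 : arcs [set v]%SET [set v]%SET = 0%N by rewrite arcs_in big_set1 indegE big_set1 arc_irr.
have f3 : arcs [set v]%SET P = 0%N.
  by rewrite arcs_out big_set1 outdegE big1// => u; rewrite inE => /andP[_ /arc_asym->].
have f4 : arcs P [set v]%SET = 4.
  rewrite arcs_in big_set1 indegE (eq_bigr (fun=> 1%N)) ?sum1_card// => u.
  by rewrite inE => /andP[_ ->].
have f5 : (4 <= arcs [set v]%SET S)%N by rewrite arcs_out big_set1 min_outdeg.
have f6 : (4 * 4 <= arcs S P)%N.
  rewrite arcs_in -{1}P4 -sum_nat_const; apply: leq_sum => u uP.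
  exact/min_indeg/(fintype.subsetP PS).
have f7 : (4 * 4 <= arcs P S)%N.
  rewrite arcs_out -{1}P4 -sum_nat_const; apply: leq_sum => u uP.
  exact/min_outdeg/(fintype.subsetP PS).
have TT : (arcs T T <= 45)%N by move: S_sparse; rewrite n17; lia.
have [w wT dw] : exists2 w, w \in T & (indeg T w <= 3)%N.
  by apply: low_degree; rewrite -arcs_in T12; lia.
apply: (acyc_extend_in vS); apply: (acyc_extend_in wT); apply: (@large_acyc 3).
by have := card_nonin wT; rewrite T12; lia.
Qed.

(** A maximal acyclic set of B has an out-neighbour of every other vertex of B, which
    would otherwise be added to it as a sink. *)
Lemma maximal_acyc A B : acyc A -> A \subset B -> exists C : {set V},
  [/\ A \subset C, C \subset B, acyc C &
      forall v, v \in B -> v \notin C -> exists2 u, u \in C & a v u].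
Proof.
move=> aA AB; pose P C := acyc C && (C \subset B).
have [|C /maxsetP[/andP[aC CB] Cmax] AC] := @maxset_exists _ P A; first by rewrite /P aA.
exists C; split => // v vB vC.
have [/existsP[u /andP[uC vu]]|/existsPn h] := boolP [exists u, (u \in C) && a v u].
  by exists u.
have : v |: C = C.
  apply: Cmax; last exact: finset.subsetUr.
  rewrite /P finset.subUset finset.sub1set vB CB !andbT.
  by apply: acycU_out => // u uC; have := h u; rewrite uC.
by move=> vCE; move: vC; rewrite -vCE !inE eqxx.
Qed.

(** From eighteen vertices on, the excess 24 - n of the out-degrees over four leaves at
    most six vertices of out-degree at least five. Two disjoint acyclic sets, both
    maximal, can be chosen to cover them; every other vertex has an out-neighbour in
    each, so that out-degrees drop to two. *)
Lemma large_case : (n < 18)%N.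
Proof.
rewrite ltnNge; apply/negP => n18.
pose P := [set v in S | (4 < outdeg S v)%N]%SET.
have PS : P \subset S by apply/fintype.subsetP => x; rewrite inE => /andP[].
have P6 : (#|P| <= 6)%N.
  have : (\sum_(v in S) (4 + (v \in P)) <= \sum_(v in S) outdeg S v)%N.
    apply: leq_sum => v vS; have := min_outdeg vS; rewrite inE vS /=.
    by case: (ltnP 4 (outdeg S v)) => /=; lia.
  rewrite -arcs_out big_split /= sum_nat_const.
  have -> : (\sum_(i in S) (i \in P) = #|P|)%N.
    rewrite -sum1_card [LHS]big_mkcond [RHS]big_mkcond; apply: eq_bigr => v _.
    by rewrite inE; case: (v \in S) => //=; case: (_ < _)%N.
  by move: S_sparse n18; lia.
have [f hf] := colk2_le6 P6.
pose B1 := [set u in P | f u == ord0]%SET; pose B2 := [set u in P | f u == ord_max]%SET.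
have B1S : B1 \subset S :\: B2.
  by apply/fintype.subsetP => x; rewrite !inE => /andP[/andP[-> ->] /eqP->].
have [A1 [BA1 AS1 aA1 m1]] := maximal_acyc (hf ord0) B1S.
have A1S : A1 \subset S by apply: (fintype.subset_trans AS1); exact: finset.subsetDl.
have B2S : B2 \subset S :\: A1.
  apply/fintype.subsetP => x xB2; rewrite finset.in_setD; apply/andP; split.
    apply/negP => /(fintype.subsetP AS1); rewrite finset.in_setD => /andP[/negP]; exact.
  by move: xB2; rewrite inE => /andP[/(fintype.subsetP PS)].
have [A2 [BA2 AS2 aA2 m2]] := maximal_acyc (hf ord_max) B2S.
apply: S_not; apply: (colkS aA1); apply: (colkS aA2); apply: colk2_outdeg2 => v.
rewrite !finset.in_setD => /and3P[vA2 vA1 vS].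
have [u1 u1A vu1] : exists2 u, u \in A1 & a v u.
  apply: m1 => //; rewrite finset.in_setD vS andbT.
  by apply: contra vA2; exact: (fintype.subsetP BA2).
have [u2 u2A vu2] : exists2 u, u \in A2 & a v u.
  by apply: m2 => //; rewrite finset.in_setD vS vA1.
have u2N : u2 \in S :\: A1 by exact: (fintype.subsetP AS2).
have vP : v \notin P.
  apply/negP => vP; case: (unliftP ord0 (f v)) => [j|] fv.
    case/negP: vA2; apply: (fintype.subsetP BA2); rewrite inE vP fv /=.
    by apply/eqP/val_inj; case: j {fv} => [[]].
  by case/negP: vA1; apply: (fintype.subsetP BA1); rewrite inE vP fv /=.
have d4 : (outdeg S v <= 4)%N by move: vP; rewrite inE vS /= -leqNgt.
have := d4; rewrite /outdeg (cardsD1 u1) (cardsD1 u2).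
have -> : u1 \in [set u in S | a v u]%SET by rewrite inE vu1 (fintype.subsetP A1S).
have -> : u2 \in [set u in S | a v u]%SET :\ u1.
  rewrite in_setD1 inE vu2 andbT; move: u2N; rewrite finset.in_setD => /andP[u2N ->].
  by rewrite andbT; apply: contraNneq u2N => ->.
rewrite !add1n !ltnS; apply: leq_trans; apply/subset_leq_card/fintype.subsetP => x.
rewrite !inE => /andP[/and3P[xA2 xA1 ->] ->]; rewrite !andbT; apply/andP; split.
  by apply: contraNneq xA2 => ->.
by apply: contraNneq xA1 => ->.
Qed.

Lemma no_minimal : False.
Proof.
have n18 := large_case.
have [n14|n14] := leqP n 14.
  have := acyc_small (finset.sub0set S) acyc0; rewrite cards0 add0n => n10.
  have [|A [AS aA A4]] := @large_acyc 3 S; first by lia.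
  by have := acyc_small AS aA; rewrite A4; lia.
have [n15|n15] := leqP n 15.
  have [v vS dv] : exists2 v, v \in S & (indeg S v <= 6)%N.
    by apply: low_degree; rewrite -arcs_in; move: S_sparse; lia.
  have [|A [AS aA A5]] := acyc_extend_in (n := 4) vS.
    by apply: (@large_acyc 3); have := card_nonin vS; lia.
  by have := acyc_small AS aA; rewrite A5; lia.
have [n16|n16] := leqP n 16.
  have [v vS dv] : exists2 v, v \in S & (indeg S v <= 4)%N.
    by apply: low_degree; rewrite -arcs_in; move: S_sparse; lia.
  have [|A [AS aA A5]] := acyc_extend_in (n := 4) vS.
    by apply: (@large_acyc 3); have := card_nonin vS; lia.
  by have := not_eleven AS aA; rewrite A5; lia.
have [|A [AS aA A6]] := seventeen; first by lia.
by have := not_eleven AS aA; rewrite A6; lia.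
Qed.

End Minimal.

(** A minimal subdigraph that is not 4-dicolourable has all in- and out-degrees
    at least four. Being sparse, it has at most 24 vertices and out-degree sum at
    most (24 - n) above the minimum. Up to seventeen vertices, a large acyclic
    set is found greedily and leaves ten or eleven vertices. *)
Theorem sparse_dicolourable :
  (forall S, S != finset.set0 -> (forall v, v \in S -> exists2 u, u \in S & a v u) ->
     (arcs S S <= 3 * #|S| + 24)%N) ->
  dicolourable a 4.
Proof.
move=> sparse.
have [f hf] : colk [set: V]%SET 4.
  apply: contrapT => /minimal_noncolourable[T [_ nT mT]].
  apply: (no_minimal nT mT); apply: sparse.
    apply/negP => /eqP T0; apply: nT; rewrite T0.
    by apply: (@colkW _ 1) => //; exact: colk1 acyc0.
  move=> v vT; have := min_outdeg nT mT vT.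
  rewrite -[(4 <= _)%N]/(3 < _)%N => /(leq_ltn_trans (leq0n 3)).
  by move=> /card_gt0P[u]; rewrite inE => /andP[uT vu]; exists u.
exists f => i; apply: acyc_acyclic_on; apply: acycS (hf i).
by apply/fintype.subsetP => x; rewrite !inE.
Qed.

End Colouring.
(** * Turning round holes into square holes *)

Section Squaring.
Variable R : realType.
Implicit Types (p q v : R * R) (s : R).

Definition supn v : R := Num.max `|v.1| `|v.2|.
Definition eucl v : R := Num.sqrt (v.1 ^+ 2 + v.2 ^+ 2).

(** Near a unit circle the plane is stretched along the rays from the centre,
    with the sup-norm m of a vector of Euclidean norm r becoming
    2 - (2 - m) r / (2 r - m) as long as m <= 2: this is 1 when r = 1, it is 2
    when m = 2, and it is affine along each ray. *)
Definition stretch v : R :=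
  Num.max 0 (2 - supn v) * (eucl v - supn v) / (supn v * (2 * eucl v - supn v)).

Lemma supn_ge0 v : 0 <= supn v.
Proof. by rewrite le_max normr_ge0. Qed.

Lemma eucl_ge0 v : 0 <= eucl v.
Proof. exact: sqrtr_ge0. Qed.

Lemma eucl_sqr v : eucl v ^+ 2 = v.1 ^+ 2 + v.2 ^+ 2.
Proof. by rewrite sqr_sqrtr// addr_ge0// sqr_ge0. Qed.

Lemma supn_le_eucl v : supn v <= eucl v.
Proof.
rewrite ge_max; apply/andP; split; rewrite -sqrtr_sqr; apply: ler_wsqrtr.
  by rewrite lerDl sqr_ge0.
by rewrite lerDr sqr_ge0.
Qed.

Lemma supn_ltP v s : (supn v < s) = [&& - s < v.1, v.1 < s, - s < v.2 & v.2 < s].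
Proof. by rewrite gt_max !ltr_norml -andbA. Qed.

Lemma supn_leP v s : (supn v <= s) = [&& - s <= v.1, v.1 <= s, - s <= v.2 & v.2 <= s].
Proof. by rewrite ge_max !ler_norml -andbA. Qed.

Lemma supn_scale s v : 0 <= s -> supn (s *: v) = s * supn v.
Proof.
move=> s0; rewrite /supn /= !normrZ (ger0_norm s0).
by rewrite maxr_pMr.
Qed.

Lemma eucl_scale s v : 0 <= s -> eucl (s *: v) = s * eucl v.
Proof.
move=> s0; rewrite /eucl /= /GRing.scale/= !exprMn -mulrDr sqrtrM ?sqr_ge0//.
by rewrite sqrtr_sqr ger0_norm.
Qed.

Lemma supn_eq0 v : supn v = 0 -> v = 0.
Proof.
move=> v0; have : supn v <= 0 by rewrite v0.
rewrite supn_leP oppr0 => /and4P[a b c d].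
by case: v a b c d {v0} => x y /= a b c d; congr pair; lra.
Qed.

Lemma eucl1_le2 v : 1 <= eucl v -> 0 < supn v.
Proof.
move=> e1; rewrite lt_neqAle supn_ge0 andbT eq_sym; apply/eqP => /supn_eq0 v0.
by move: e1; rewrite v0 /eucl /= expr0n /= addr0 sqrtr0 ler10.
Qed.

Lemma stretch_ge0 v : 0 <= stretch v.
Proof.
rewrite /stretch; have h1 := supn_le_eucl v; have h2 := supn_ge0 v.
apply: divr_ge0; apply: mulr_ge0.
- by rewrite le_max lexx.
- by rewrite subr_ge0.
- exact: h2.
- by rewrite subr_ge0; lra.
Qed.

Lemma stretch_far v : 2 <= supn v -> stretch v = 0.
Proof.
by move=> h; rewrite /stretch (max_idPl _) ?mul0r//; lra.
Qed.

Lemma stretch_supn v : 0 < supn v -> supn v <= 2 ->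
  (1 + stretch v) * supn v = 1 + supn v * (eucl v - 1) / (2 * eucl v - supn v).
Proof.
move=> m0 m2; have h := supn_le_eucl v; rewrite /stretch (max_idPr _); last by lra.
have r0 : 2 * eucl v - supn v != 0 by apply/eqP; lra.
have m0' : supn v != 0 by apply/eqP; lra.
by field; rewrite r0 m0'.
Qed.

Lemma stretch_supn' v : 0 < supn v -> supn v <= 2 ->
  (1 + stretch v) * supn v = 2 - (2 - supn v) * eucl v / (2 * eucl v - supn v).
Proof.
move=> m0 m2; have h := supn_le_eucl v; rewrite stretch_supn//.
have r0 : 2 * eucl v - supn v != 0 by apply/eqP; lra.
by field; rewrite r0.
Qed.

Lemma stretch_inj p q : 0 < supn p < 2 -> 0 < supn q < 2 ->
  (1 + stretch p) *: p = (1 + stretch q) *: q -> p = q.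
Proof.
move=> /andP[p0 p2] /andP[q0 q2] pq.
have sp := stretch_ge0 p; have sq := stretch_ge0 q.
pose s := (1 + stretch p) / (1 + stretch q).
have s0 : 0 < s by rewrite divr_gt0//; lra.
have qE : q = s *: p.
  rewrite /s [_ / _]mulrC -scalerA pq scalerA mulVf ?scale1r//.
  by apply/eqP; lra.
have := congr1 supn pq; rewrite !supn_scale; [|lra|lra].
rewrite stretch_supn//; last exact: ltW.
rewrite stretch_supn//; last exact: ltW.
rewrite qE supn_scale ?eucl_scale; try exact: ltW.
have h := supn_le_eucl p; set m := supn p in p0 h *; set r := eucl p in h *.
have d0 : 2 * r - m != 0 by apply/eqP; lra.
rewrite (_ : s * m * (s * r - 1) / (2 * (s * r) - s * m) = m * (s * r - 1) / (2 * r - m)); last first.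
  have d1 : 2 * (s * r) - s * m != 0.
    have -> : 2 * (s * r) - s * m = s * (2 * r - m) by ring.
    by rewrite mulf_neq0//; apply/eqP; lra.
  by field; rewrite d0 d1.
move=> /(congr1 (fun x => (x - 1) * (2 * r - m))).
rewrite ![1 + _]addrC !addrK !mulfVK// => e.
have {e}e : r = s * r.
  have m0 : m != 0 by apply/eqP; lra.
  by have := mulfI m0 e => e'; lra.
have -> : s = 1.
  have r0 : r != 0 by apply/eqP; lra.
  by apply: (mulIf r0); rewrite mul1r -e.
by rewrite scale1r.
Qed.

Lemma supn_continuous : continuous supn.
Proof.
move=> v; apply: (@continuous_max _ _ (fun v => `|v.1|) (fun v => `|v.2|)).
  by apply: continuous_comp; [exact: cvg_fst|exact: norm_continuous].
by apply: continuous_comp; [exact: cvg_snd|exact: norm_continuous].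
Qed.

Lemma eucl_continuous : continuous eucl.
Proof.
move=> v; apply: continuous_comp; last exact: sqrt_continuous.
apply: cvgD.
  exact: (cvgM cvg_fst cvg_fst).
exact: (cvgM cvg_snd cvg_snd).
Qed.

Lemma stretch_continuous v : 0 < supn v -> {for v, continuous stretch}.
Proof.
move=> m0; have h := supn_le_eucl v.
apply: cvgM; first apply: cvgM.
- apply: (@continuous_max _ _ (fun=> 0) (fun v => 2 - supn v)); first exact: cvg_cst.
  by apply: cvgB; [exact: cvg_cst|exact: supn_continuous].
- by apply: cvgB; [exact: eucl_continuous|exact: supn_continuous].
- apply: cvgV; first by rewrite mulf_eq0 negb_or; apply/andP; split; apply/eqP; lra.
  apply: cvgM; first exact: supn_continuous.
  apply: cvgB; last exact: supn_continuous.
  by apply: cvgM; [exact: cvg_cst|exact: eucl_continuous].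
Qed.

End Squaring.
Section Model.
Variables (R : realType) (I : finType) (cx cy : I -> nat) (ctr : I -> R * R).
Variables (xf : bool) (partner : I -> I).
Hypothesis ctrE : forall i, ctr i = ((cx i)%:R, (cy i)%:R - 3).
Hypothesis cx_le : forall i, (cx i <= 36)%N.
Hypothesis cy_bd : forall i, (1 <= cy i <= 5)%N.
Hypothesis ctr_apart : forall i j, i != j ->
  [|| cx i + 4 <= cx j, cx j + 4 <= cx i, cy i + 4 <= cy j | cy j + 4 <= cy i]%N.
Hypothesis cx_partner : forall i, cx (partner i) = cx i.
Hypothesis cy_partner : forall i, (cy (partner i) + cy i = 6)%N.
Implicit Types (i j : I) (p q z : R * R) (k : nat).

(** The rims are glued by half-turns around (cx i, 0) if xf holds, as for cross-caps,
    and by the reflection in the horizontal axis otherwise, as for handles. *)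
Definition flip i p : R * R := (if xf then 2 * (cx i)%:R - p.1 else p.1, - p.2).
Definition rnd p := forall i, 1 <= eucl (p - ctr i).
(** The boxes of half-width two around the holes are disjoint, so at most one term is
    nonzero at each point, and outside the boxes the map is the identity. *)
Definition squaring p : R * R :=
  p + \sum_i stretch (p - ctr i) *: (p - ctr i).
Local Notation Phi := squaring.

Lemma box_unique i j p : supn (p - ctr i) < 2 -> supn (p - ctr j) < 2 -> i = j.
Proof.
rewrite !supn_ltP !ctrE /= => /and4P[a1 a2 a3 a4] /and4P[b1 b2 b3 b4].
apply/eqP; apply: contraT => /ctr_apart.
rewrite -!(ler_nat R) !natrD => /or4P[] h; exfalso; lra.
Qed.

Lemma squaring_in i p : supn (p - ctr i) < 2 ->
  Phi p = ctr i + (1 + stretch (p - ctr i)) *: (p - ctr i).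
Proof.
move=> h; rewrite /squaring (bigD1 i)//= big1 ?addr0 => [|j ji].
  by rewrite scalerDl scale1r addrA subrKC.
rewrite stretch_far ?scale0r// leNgt; apply: contra ji => hj.
by rewrite (box_unique h hj).
Qed.

Lemma squaring_out p : (forall i, 2 <= supn (p - ctr i)) -> Phi p = p.
Proof.
by move=> h; rewrite /squaring big1 ?addr0// => i _; rewrite stretch_far ?scale0r.
Qed.

Lemma in_or_out p : (exists i, supn (p - ctr i) < 2) \/ forall i, 2 <= supn (p - ctr i).
Proof.
have [/existsP[i h]|/existsPn h] := boolP [exists i, supn (p - ctr i) < 2].
  by left; exists i.
by right => i; rewrite leNgt.
Qed.

Lemma squaring_supn i p : supn (p - ctr i) < 2 ->
  supn (Phi p - ctr i) = (1 + stretch (p - ctr i)) * supn (p - ctr i).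
Proof.
move=> h; rewrite (squaring_in h) addrC addKr supn_scale//.
by have := stretch_ge0 (p - ctr i); lra.
Qed.

Lemma rnd_supn i p : rnd p -> 0 < supn (p - ctr i).
Proof. by move=> /(_ i)/eucl1_le2. Qed.

Lemma squaring_box i p : rnd p -> supn (p - ctr i) < 2 -> supn (Phi p - ctr i) < 2.
Proof.
move=> rp h; have m0 := rnd_supn i rp; rewrite squaring_supn// stretch_supn'//; last exact: ltW.
have l := supn_le_eucl (p - ctr i).
rewrite ltrBlDr ltrDl divr_gt0//; first by rewrite mulr_gt0//; lra.
by lra.
Qed.

Lemma squaring_boxE i p : rnd p -> (supn (Phi p - ctr i) < 2) = (supn (p - ctr i) < 2).
Proof.
move=> rp; apply/idP/idP => [h|]; last exact: squaring_box.
have [[j hj]|ho] := in_or_out p; last by rewrite squaring_out// in h.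
by rewrite (box_unique h (squaring_box rp hj)).
Qed.

Lemma squaring_ge1 i p : rnd p -> 1 <= supn (Phi p - ctr i).
Proof.
move=> rp; have [h|h] := ltP (supn (p - ctr i)) 2; last first.
  have : 2 <= supn (Phi p - ctr i) by rewrite leNgt squaring_boxE// -leNgt.
  by lra.
have m0 := rnd_supn i rp; rewrite squaring_supn// stretch_supn//; last exact: ltW.
have l := supn_le_eucl (p - ctr i); have := rp i => e1.
by rewrite lerDl divr_ge0// ?mulr_ge0//; lra.
Qed.

Lemma squaring_rim i p : rnd p -> supn (Phi p - ctr i) = 1 -> eucl (p - ctr i) = 1.
Proof.
move=> rp e; have h : supn (p - ctr i) < 2 by rewrite -squaring_boxE// e; lra.
have m0 := rnd_supn i rp; move: e.
rewrite squaring_supn// stretch_supn//; last exact: ltW.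
have l := supn_le_eucl (p - ctr i).
move=> /(congr1 (fun x => x - 1)); rewrite addrC addKr subrr => /eqP.
rewrite !mulf_eq0 invr_eq0 => /orP[/orP[]|] /eqP e; try by exfalso; lra.
by lra.
Qed.

Lemma rim_supn i p : eucl (p - ctr i) = 1 -> 0 < supn (p - ctr i) <= 1.
Proof.
move=> e; rewrite eucl1_le2 ?e//=.
by rewrite -e supn_le_eucl.
Qed.

Lemma rim_squaring i p : eucl (p - ctr i) = 1 -> supn (Phi p - ctr i) = 1.
Proof.
move=> e; have /andP[m0 m1] := rim_supn e.
have h : supn (p - ctr i) < 2 by lra.
rewrite squaring_supn// stretch_supn//; last exact: ltW.
by rewrite e subrr mulr0 mul0r addr0.
Qed.

Lemma squaring_inj p q : rnd p -> rnd q -> Phi p = Phi q -> p = q.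
Proof.
move=> rp rq pq; have [[i h]|h] := in_or_out p.
  have h' : supn (q - ctr i) < 2 by rewrite -squaring_boxE// -pq squaring_boxE.
  move: pq; rewrite (squaring_in h) (squaring_in h') => /addrI /stretch_inj e.
  have := e; rewrite !rnd_supn ?h ?h'// => /(_ isT isT).
  by move/addIr.
have h' i : 2 <= supn (q - ctr i).
  by rewrite leNgt -squaring_boxE// -pq squaring_boxE// -leNgt.
by move: pq; rewrite !squaring_out.
Qed.

Lemma flip_sub i p : flip i p - ctr (partner i) =
  (if xf then - (p - ctr i).1 else (p - ctr i).1, - (p - ctr i).2).
Proof.
have : (cy (partner i))%:R + (cy i)%:R = 6 :> R by rewrite -natrD cy_partner.
move=> e; rewrite !ctrE cx_partner /flip /=; congr pair; last by rewrite /=; lra.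
by rewrite /=; case: xf; lra.
Qed.

Lemma supn_flip i p : supn (flip i p - ctr (partner i)) = supn (p - ctr i).
Proof. by rewrite flip_sub /supn /=; case: xf; rewrite !normrN. Qed.

Lemma eucl_flip i p : eucl (flip i p - ctr (partner i)) = eucl (p - ctr i).
Proof. by rewrite flip_sub /eucl /=; case: xf; rewrite !sqrrN. Qed.

Lemma flipK i p : flip (partner i) (flip i p) = p.
Proof. by rewrite /flip cx_partner; case: p => a b; congr pair; rewrite /=; [case: xf; lra|lra]. Qed.

(** The stretching is radial and the gluing is an isometry of the boxes, so the
    squared rims are glued by the same formula. *)
Lemma squaring_flip i p : eucl (p - ctr i) = 1 -> Phi (flip i p) = flip i (Phi p).
Proof.
move=> e; have /andP[m0 m1] := rim_supn e.
have h : supn (p - ctr i) < 2 by lra.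
have h' : supn (flip i p - ctr (partner i)) < 2 by rewrite supn_flip.
rewrite (squaring_in h) (squaring_in h').
have -> : stretch (flip i p - ctr (partner i)) = stretch (p - ctr i).
  by rewrite /stretch supn_flip eucl_flip.
set s := 1 + stretch _; have : (cy (partner i))%:R + (cy i)%:R = 6 :> R by rewrite -natrD cy_partner.
rewrite flip_sub !ctrE cx_partner /flip /GRing.scale /= => e6; congr pair; last by rewrite /=; lra.
by rewrite /=; case: xf; lra.
Qed.

Lemma squaring_continuous p : rnd p -> {for p, continuous Phi}.
Proof.
move=> rp; rewrite /prop_for /continuous_at /squaring.
have -> : (fun q => q + \sum_i stretch (q - ctr i) *: (q - ctr i)) =
  (fun q : R * R => q) \+ (fun q => \sum_i stretch (q - ctr i) *: (q - ctr i)) by [].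
apply: cvgD; first exact: cvg_id.
apply: cvg_big => [x|i _]; first exact: add_continuous.
have c1 : (fun q => q - ctr i) x @[x --> p] --> p - ctr i.
  by apply: cvgB; [exact: cvg_id|exact: cvg_cst].
apply: cvgZ => //.
apply: (@continuous_comp _ _ _ (fun q : R * R => q - ctr i) (@stretch R)) => //.
exact/stretch_continuous/rnd_supn.
Qed.

Lemma squaring_far p : 60 <= supn p -> Phi p = p.
Proof.
move=> p60; apply: squaring_out => i; rewrite leNgt; apply/negP.
have := cx_le i; have := cy_bd i; rewrite -!(ler_nat R) => /andP[y1 y2] x1.
have := ler0n R (cx i); move: p60; rewrite leNgt => /negP h1 x0.
rewrite supn_ltP ctrE /= => /and4P[a b c d]; apply: h1.
by rewrite supn_ltP; apply/and4P; split; lra.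
Qed.

(** ** Stars of grid vertices *)

Lemma supn_tri (u v w : R * R) (e f : R) : supn (u - w) < e -> supn (w - v) < f ->
  supn (u - v) < e + f.
Proof.
rewrite !supn_ltP /= => /and4P[? ? ? ?] /and4P[? ? ? ?].
by apply/and4P; split; lra.
Qed.

Lemma supn_sym (u v : R * R) : supn (u - v) = supn (v - u).
Proof. by rewrite /supn /= distrC [`|u.2 - _|]distrC. Qed.

(** At level k the grid has mesh 1/k and covers the square of half-width k; these are
    the coordinates of the lower left corners of its square holes, whose sides
    consist of 2k edges. From level 50 on all holes lie well inside the grid. *)
Definition gx0 k i := (k * (cx i + k - 1))%N.
Definition gy0 k i := (k * (cy i + k - 4))%N.
Definition gN k := (k * k + k * k)%N.
Local Notation gouter k := (outer (gN k)).
Local Notation grim k := (on_rim k (gx0 k) (gy0 k)).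
Local Notation gglue k := (glue_x k (gx0 k) xf).

Lemma gx0E k i : (1 <= k)%N -> (gx0 k i)%:R = k%:R * ((cx i)%:R + k%:R - 1) :> R.
Proof. by move=> k1; rewrite natrM natrB ?natrD//; lia. Qed.

Lemma gy0E k i : (4 <= k)%N -> (gy0 k i)%:R = k%:R * ((cy i)%:R + k%:R - 4) :> R.
Proof. by move=> k1; rewrite natrM natrB ?natrD//; lia. Qed.

Lemma grid_inside k i : (50 <= k)%N ->
  [&& 0 < gx0 k i, gx0 k i + (k + k) < gN k, 0 < gy0 k i & gy0 k i + (k + k) < gN k]%N.
Proof.
move=> k50; have := cx_le i; have := cy_bd i; rewrite /gx0 /gy0 /gN => /andP[c1 c5] x36.
have hx : (k * (cx i + k - 1) <= k * (k + 35))%N by rewrite leq_mul2l; lia.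
have hy : (k * (cy i + k - 4) <= k * (k + 1))%N by rewrite leq_mul2l; lia.
have hk : (k * 50 <= k * k)%N by rewrite leq_mul2l k50 orbT.
rewrite !muln_gt0; move: hx hy; rewrite !mulnDr => hx hy.
by apply/and4P; split; lia.
Qed.

Lemma grid_apart k i j : (50 <= k)%N -> i != j ->
  [|| gx0 k i + (k + k) < gx0 k j, gx0 k j + (k + k) < gx0 k i,
      gy0 k i + (k + k) < gy0 k j | gy0 k j + (k + k) < gy0 k i]%N.
Proof.
move=> k50 /ctr_apart; rewrite /gx0 /gy0.
have st a b c : (a + 4 <= b)%N -> (c <= 4)%N -> (k * (a + k - c) + (k + k) < k * (b + k - c))%N.
  move=> ab c4; have : (k * (a + k - c + 4) <= k * (b + k - c))%N by rewrite leq_mul2l; lia.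
  by rewrite mulnDr; lia.
by case/or4P => h; apply/or4P; [apply: Or41|apply: Or42|apply: Or43|apply: Or44]; apply: st.
Qed.

Lemma grid_partner_x k i : gx0 k (partner i) = gx0 k i.
Proof. by rewrite /gx0 cx_partner. Qed.

Lemma grid_partner_y k i : (50 <= k)%N -> (gy0 k (partner i) + (k + k) + gy0 k i = gN k)%N.
Proof.
move=> k50; rewrite /gy0 /gN; have := cy_partner i => e.
rewrite -(addnA _ (k + k)%N) (addnC (k + k)%N) addnA -mulnDr.
have -> : (cy (partner i) + k - 4 + (cy i + k - 4) = k + (k - 2))%N by lia.
rewrite mulnDr mulnBr; have : (k * 2 <= k * k)%N by rewrite leq_mul2l; lia.
by lia.
Qed.

Definition vpos k a : R := a%:R / k%:R - k%:R.
Definition vpt k a b : R * R := (vpos k a, vpos k b).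
Definition farp k z := [|| z.1 < vpos k 1, vpos k (gN k).-1 < z.1,
  z.2 < vpos k 1 | vpos k (gN k).-1 < z.2].
Definition nearp k z a b := supn (z - vpt k a b) < k%:R^-1.

(** The star of a grid vertex is the open square of half-width 1/k around it,
    except that the outermost vertices, which count as a single one, share as
    star the whole outside of the grid, with the point at infinity. *)
Definition touch k (s : option (R * R)) a b : Prop :=
  [/\ (a <= gN k)%N, (b <= gN k)%N &
    match s with
    | None => gouter k a b
    | Some p => if gouter k a b then farp k (Phi p) else nearp k (Phi p) a b
    end].

Lemma vpos_lt k (x : R) a : (0 < k)%N -> (x < vpos k a) = (k%:R * (x + k%:R) < a%:R).
Proof.
move=> k0; have k0' : 0 < k%:R :> R by rewrite ltr0n.
by rewrite /vpos ltrBrDr ltr_pdivlMr// mulrC.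
Qed.

Lemma vpos_gt k (x : R) a : (0 < k)%N -> (vpos k a < x) = (a%:R < k%:R * (x + k%:R)).
Proof.
move=> k0; have k0' : 0 < k%:R :> R by rewrite ltr0n.
by rewrite /vpos ltrBlDr ltr_pdivrMr// mulrC.
Qed.

Definition gpos k (x : R) : R := k%:R * (x + k%:R).

Lemma nearpE k z a b : (0 < k)%N -> nearp k z a b =
  [&& a%:R - 1 < gpos k z.1, gpos k z.1 < a%:R + 1,
      b%:R - 1 < gpos k z.2 & gpos k z.2 < b%:R + 1].
Proof.
move=> k0; have k0' : 0 < k%:R :> R by rewrite ltr0n.
have e (x : R) c : (- k%:R^-1 < x - vpos k c) = (c%:R - 1 < gpos k x).
  rewrite /vpos /gpos -(ltr_pM2l k0') mulrN mulfV ?gt_eqF// !mulrBr mulrCA mulfV ?gt_eqF// mulr1 mulrDr.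
  by apply/idP/idP => h; lra.
have e' (x : R) c : (x - vpos k c < k%:R^-1) = (gpos k x < c%:R + 1).
  rewrite /vpos /gpos -(ltr_pM2l k0') mulfV ?gt_eqF// !mulrBr mulrCA mulfV ?gt_eqF// mulr1 mulrDr.
  by apply/idP/idP => h; lra.
by rewrite /nearp supn_ltP /= !e !e'.
Qed.

Lemma farpE k z : (0 < k)%N -> farp k z =
  [|| gpos k z.1 < 1, (gN k)%:R - 1 < gpos k z.1, gpos k z.2 < 1 | (gN k)%:R - 1 < gpos k z.2].
Proof.
move=> k0; rewrite /farp !vpos_lt ?vpos_gt//.
by rewrite -subn1 natrB ?addn_gt0 ?muln_gt0 ?k0.
Qed.

Lemma natr_lt1 a b : (a%:R < b%:R + 1 :> R) = (a <= b)%N.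
Proof. by rewrite natr1 ltr_nat ltnS. Qed.

Lemma squaring_out_hole k i p : (50 <= k)%N -> rnd p ->
  (gx0 k i)%:R < gpos k (Phi p).1 < (gx0 k i)%:R + k%:R + k%:R ->
  (gy0 k i)%:R < gpos k (Phi p).2 < (gy0 k i)%:R + k%:R + k%:R -> False.
Proof.
move=> k50 rp /andP[h1 h2] /andP[h3 h4]; have k0 : 0 < k%:R :> R by rewrite ltr0n; lia.
have := squaring_ge1 i rp; rewrite leNgt => /negP; apply.
move: h1 h2 h3 h4; rewrite gx0E ?gy0E; [|lia|lia].
have e (x : R) : k%:R * x + k%:R + k%:R = k%:R * (x + 2) by ring.
rewrite /gpos supn_ltP ctrE /= !e !ltr_pM2l// => h1 h2 h3 h4.
by apply/and4P; split; lra.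
Qed.

Lemma natr_le a b : (a <= b)%N -> a%:R <= b%:R :> R.
Proof. by rewrite ler_nat. Qed.

Lemma natr_lt a b : (a < b)%N -> a%:R + 1 <= b%:R :> R.
Proof. by rewrite natr1 ler_nat. Qed.

Lemma touch_hor_valid k p a b : (50 <= k)%N -> rnd p ->
  nearp k (Phi p) a b -> nearp k (Phi p) a.+1 b ->
  hor_valid k (gx0 k) (gy0 k) a b.
Proof.
move=> k50 rp; rewrite !nearpE; [|lia|lia].
move=> /and4P[h1 h2 h3 h4] /and4P[h5 h6 _ _].
apply/forallP => i; apply/negP; rewrite /hor_inner => /and4P[i1 i2 i3 i4].
apply: (@squaring_out_hole k i p) => //.
  by have := natr_le i1; have := natr_lt i2; move: h5; rewrite -natr1 !natrD; lra.
by have := natr_lt i3; have := natr_lt i4; rewrite !natrD; lra.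
Qed.

Lemma touch_ver_valid k p a b : (50 <= k)%N -> rnd p ->
  nearp k (Phi p) a b -> nearp k (Phi p) a b.+1 ->
  ver_valid k (gx0 k) (gy0 k) a b.
Proof.
move=> k50 rp; rewrite !nearpE; [|lia|lia].
move=> /and4P[h1 h2 h3 h4] /and4P[_ _ h7 h8].
apply/forallP => i; apply/negP; rewrite /ver_inner => /and4P[i1 i2 i3 i4].
apply: (@squaring_out_hole k i p) => //.
  by have := natr_lt i1; have := natr_lt i2; rewrite !natrD; lra.
by have := natr_le i3; have := natr_lt i4; move: h7; rewrite -natr1 !natrD; lra.
Qed.

Lemma outer_hor_valid k a b : (50 <= k)%N -> gouter k a b \/ gouter k a.+1 b ->
  (a < gN k)%N -> hor_valid k (gx0 k) (gy0 k) a b.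
Proof.
move=> k50 o aN; apply/forallP => i; have := grid_inside i k50.
by move: o; rewrite /outer /hor_inner; lia.
Qed.

Lemma outer_ver_valid k a b : (50 <= k)%N -> gouter k a b \/ gouter k a b.+1 ->
  (b < gN k)%N -> ver_valid k (gx0 k) (gy0 k) a b.
Proof.
move=> k50 o bN; apply/forallP => i; have := grid_inside i k50.
by move: o; rewrite /outer /ver_inner; lia.
Qed.

Definition proper_point (s : option (R * R)) := forall p, s = Some p -> rnd p.

(** The vertices whose stars contain a given point are corners of a common cell, or
    belong to the outermost ones. *)
Lemma touch_connected k s (p : nat -> nat -> 'F_2) : (50 <= k)%N -> proper_point s ->
  (forall d a b, valid k (gx0 k) (gy0 k) d a b -> touch k s a b ->
     touch k s (head d a b).1 (head d a b).2 -> p a b = p (head d a b).1 (head d a b).2) ->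
  (forall a b a' b', touch k s a b -> touch k s a' b' -> gouter k a b -> gouter k a' b' ->
     p a b = p a' b') ->
  forall a b a' b', touch k s a b -> touch k s a' b' -> p a b = p a' b'.
Proof.
move=> k50 sp edge out; have k0 : (0 < k)%N by lia.
have N2 : (100 < gN k)%N by have : (50 * 50 <= k * k)%N := leq_mul k50 k50; rewrite /gN; lia.
case: s sp edge out => [z|] sp edge out; last first.
  by move=> a b a' b' t t'; apply: out => //; [case: t|case: t'].
have rz := sp z erefl.
have inner_touch a b : (a <= gN k)%N -> (b <= gN k)%N -> ~~ gouter k a b ->
    nearp k (Phi z) a b -> touch k (Some z) a b.
  by move=> aN bN /negbTE o h; split; rewrite ?o.
have outer_touch a b : (a <= gN k)%N -> (b <= gN k)%N -> gouter k a b -> farp k (Phi z) ->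
    touch k (Some z) a b.
  by move=> aN bN o h; split; rewrite ?o.
have [fz|nfz] := boolP (farp k (Phi z)).
  suff base a b : touch k (Some z) a b -> p a b = p 0%N 0%N.
    by move=> a b a' b' /base -> /base ->.
  have t00 : touch k (Some z) 0 0 by apply: outer_touch.
  move=> t; have [aN bN] := t; case: ifPn => [o _|o nz].
    by apply: out.
  have b_in : (0 < a < gN k)%N && (0 < b < gN k)%N by move: o aN bN; rewrite /outer; lia.
  have [d [a1 [b1 [o1 h1]]]] : exists d a1 b1, gouter k a1 b1 /\ 
      (head d a1 b1 = (a, b) \/ head d a b = (a1, b1)).
    move: (fz) nz; rewrite farpE// nearpE// => fz' /and4P[h1 h2 h3 h4].
    case/or4P: fz' => f.
    - have a1 : (a <= 1)%N by rewrite -natr_lt1; lra.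
      exists true, 0%N, b; rewrite /outer eqxx; split => //; left; congr pair; lia.
    - have a1 : (gN k <= a.+1)%N by rewrite -natr_lt1 -natr1; lra.
      exists true, (gN k), b; rewrite /outer eqxx orbT; split => //; right; congr pair; lia.
    - have a1 : (b <= 1)%N by rewrite -natr_lt1; lra.
      exists false, a, 0%N; rewrite /outer eqxx !orbT; split => //; left; congr pair; lia.
    - have a1 : (gN k <= b.+1)%N by rewrite -natr_lt1 -natr1; lra.
      exists false, a, (gN k); rewrite /outer eqxx !orbT; split => //; right; congr pair; lia.
  case: h1 => h1.
    have [e1 e2] : (head d a1 b1).1 = a /\ (head d a1 b1).2 = b by rewrite h1.
    have bd : (a1 <= a)%N && (b1 <= b)%N by move: h1; case: d {e1 e2} => -[]; lia.
    have t1 : touch k (Some z) a1 b1 by apply: outer_touch => //; lia.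
    rewrite -{1}e1 -{1}e2 -(edge d)//; first exact: out.
      case: d {e1 e2} h1 => -[h1 h2].
        by apply: outer_hor_valid => //; [left|lia].
      by apply: outer_ver_valid => //; [left|lia].
    by rewrite e1 e2.
  have [e1 e2] : (head d a b).1 = a1 /\ (head d a b).2 = b1 by rewrite h1.
  have bd : (a1 <= gN k)%N && (b1 <= gN k)%N by move: h1; case: d {e1 e2} => -[]; lia.
  have t1 : touch k (Some z) a1 b1 by apply: outer_touch => //; lia.
  rewrite (edge d a b)//; last by rewrite e1 e2.
    by rewrite e1 e2; exact: out.
  case: d {e1 e2} h1 => -[h1 h2].
    by apply: outer_hor_valid => //; [right; rewrite h1 h2|lia].
  by apply: outer_ver_valid => //; [right; rewrite h1 h2|lia].
have tE a b : touch k (Some z) a b ->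
    [/\ (0 < a < gN k)%N, (0 < b < gN k)%N & nearp k (Phi z) a b].
  move=> [aN bN]; case: ifPn => [_ h|o h]; first by rewrite h in nfz.
  by split => //; move: o aN bN; rewrite /outer; lia.
have mk a b : (0 < a < gN k)%N -> (0 < b < gN k)%N -> nearp k (Phi z) a b -> touch k (Some z) a b.
  by move=> aN bN; apply: inner_touch; rewrite ?/outer; lia.
have stepx a b : touch k (Some z) a b -> touch k (Some z) a.+1 b -> p a b = p a.+1 b.
  move=> t t'; apply: (edge true) => //=.
  by have [_ _ n1] := tE _ _ t; have [_ _ n2] := tE _ _ t'; exact: (touch_hor_valid k50 rz).
have stepy a b : touch k (Some z) a b -> touch k (Some z) a b.+1 -> p a b = p a b.+1.
  move=> t t'; apply: (edge false) => //=.
  by have [_ _ n1] := tE _ _ t; have [_ _ n2] := tE _ _ t'; exact: (touch_ver_valid k50 rz).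
move=> a b a' b' t t'; have [a1 b1 n1] := tE _ _ t; have [a2 b2 n2] := tE _ _ t'.
have t3 : touch k (Some z) a' b.
  apply: mk => //; move: n1 n2; rewrite !nearpE//.
  by move=> /and4P[_ _ -> ->] /and4P[-> -> _ _].
move: n1 n2; rewrite !nearpE// => /and4P[h1 h2 h3 h4] /and4P[h5 h6 h7 h8].
transitivity (p a' b).
  have c1 : (a <= a'.+1)%N by rewrite -natr_lt1 -natr1; lra.
  have c2 : (a' <= a.+1)%N by rewrite -natr_lt1 -natr1; lra.
  have [e|[e|e]] : a = a' \/ a = a'.+1 \/ a' = a.+1 by lia.
  - by rewrite e.
  - by rewrite e; apply/esym/stepx => //; rewrite -e.
  - by rewrite e; apply: stepx => //; rewrite -e.
have c1 : (b <= b'.+1)%N by rewrite -natr_lt1 -natr1; lra.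
have c2 : (b' <= b.+1)%N by rewrite -natr_lt1 -natr1; lra.
have [e|[e|e]] : b = b' \/ b = b'.+1 \/ b' = b.+1 by lia.
- by rewrite e.
- by rewrite e; apply/esym/stepy => //; rewrite -e.
- by rewrite e; apply: stepy => //; rewrite -e.
Qed.

Lemma touch_exists k s : (50 <= k)%N -> exists a b, touch k s a b.
Proof.
move=> k50; have k0 : (0 < k)%N by lia.
have N2 : (100 < gN k)%N by have : (50 * 50 <= k * k)%N := leq_mul k50 k50; rewrite /gN; lia.
case: s => [z|]; last by exists 0%N, 0%N.
have [fz|nfz] := boolP (farp k (Phi z)); first by exists 0%N, 0%N; split.
move: (nfz); rewrite farpE// !negb_or -!leNgt => /and4P[h1 h2 h3 h4].
have x0 : 0 <= gpos k (Phi z).1 by lra.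
have y0 : 0 <= gpos k (Phi z).2 by lra.
have /andP[a1 a2] := truncn_itv x0; have /andP[b1 b2] := truncn_itv y0.
move: a1 a2 b1 b2; set a := Num.truncn _; set b := Num.truncn _ => a1 a2 b1 b2.
have aP : (0 < a)%N by rewrite -ltnS -(ltr_nat R); lra.
have bP : (0 < b)%N by rewrite -ltnS -(ltr_nat R); lra.
have aN : (a < gN k)%N by rewrite -(ltr_nat R); lra.
have bN : (b < gN k)%N by rewrite -(ltr_nat R); lra.
exists a, b; split; try exact: ltnW.
have -> : gouter k a b = false.
  by rewrite /outer (gtn_eqF aP) (ltn_eqF aN) (gtn_eqF bP) (ltn_eqF bN).
by rewrite nearpE//; apply/and4P; move: a2 b2; rewrite -!natr1; split; lra.
Qed.

(** A point of a rim lies only in stars of rim vertices, and the gluing carries the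
    one to the others. *)
Lemma rim_glue k i p a b : (50 <= k)%N -> eucl (p - ctr i) = 1 ->
  touch k (Some p) a b ->
  grim k i a b /\ touch k (Some (flip i p)) (gglue k i a) (gN k - b).
Proof.
move=> k50 e1; have k0 : (0 < k)%N by lia.
have kR : 0 < k%:R :> R by rewrite ltr0n.
have /and4P[i1 i2 i3 i4] := grid_inside i k50.
have [z zE] : exists z, z = Phi p by exists (Phi p).
have e : supn (z - ctr i) = 1 by rewrite zE rim_squaring.
have : supn (z - ctr i) <= 1 by rewrite e.
rewrite supn_leP ctrE /= => /and4P[z1 z2 z3 z4].
have X0 := gx0E i (leq_trans (isT : (1 <= 50)%N) k50).
have Y0 := gy0E i (leq_trans (isT : (4 <= 50)%N) k50).
have g1 : (gx0 k i)%:R <= gpos k z.1 by rewrite X0 /gpos ler_pM2l//; lra.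
have g2 : gpos k z.1 <= (gx0 k i)%:R + (k%:R + k%:R).
  by rewrite X0 (_ : _ + _ = k%:R * ((cx i)%:R + k%:R + 1)) /gpos ?ler_pM2l//; [lra|ring].
have g3 : (gy0 k i)%:R <= gpos k z.2 by rewrite Y0 /gpos ler_pM2l//; lra.
have g4 : gpos k z.2 <= (gy0 k i)%:R + (k%:R + k%:R).
  by rewrite Y0 (_ : _ + _ = k%:R * ((cy i)%:R + k%:R - 2)) /gpos ?ler_pM2l//; [lra|ring].
have nf : ~~ farp k z.
  have := natr_lt i1; have := natr_lt i2; have := natr_lt i3; have := natr_lt i4.
  by rewrite farpE// !natrD !negb_or -!leNgt => ? ? ? ?; apply/and4P; split; lra.
move=> [aN bN]; rewrite -zE; case: ifPn => [_ h|o nz]; first by rewrite h in nf.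
move: (nz); rewrite nearpE// => /and4P[h1 h2 h3 h4].
have a1 : (gx0 k i <= a)%N by rewrite -natr_lt1; lra.
have a2 : (a <= gx0 k i + (k + k))%N by rewrite -natr_lt1 !natrD; lra.
have b1 : (gy0 k i <= b)%N by rewrite -natr_lt1; lra.
have b2 : (b <= gy0 k i + (k + k))%N by rewrite -natr_lt1 !natrD; lra.
have bd : [|| a == gx0 k i, a == gx0 k i + (k + k), b == gy0 k i | b == gy0 k i + (k + k)]%N.
  have : ~~ (supn (z - ctr i) < 1) by rewrite e ltxx.
  rewrite supn_ltP ctrE /= !negb_and -!leNgt => /or4P[] h.
  - have : gpos k z.1 <= (gx0 k i)%:R by rewrite X0 /gpos ler_pM2l//; lra.
    by move=> g; apply/or4P/Or41; rewrite eqn_leq a1 andbT -natr_lt1; lra.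
  - have : (gx0 k i)%:R + (k%:R + k%:R) <= gpos k z.1.
      by rewrite X0 (_ : _ + _ = k%:R * ((cx i)%:R + k%:R + 1)) /gpos ?ler_pM2l//; [lra|ring].
    by move=> g; apply/or4P/Or42; rewrite eqn_leq a2 -natr_lt1 !natrD; lra.
  - have : gpos k z.2 <= (gy0 k i)%:R by rewrite Y0 /gpos ler_pM2l//; lra.
    by move=> g; apply/or4P/Or43; rewrite eqn_leq b1 andbT -natr_lt1; lra.
  - have : (gy0 k i)%:R + (k%:R + k%:R) <= gpos k z.2.
      by rewrite Y0 (_ : _ + _ = k%:R * ((cy i)%:R + k%:R - 2)) /gpos ?ler_pM2l//; [lra|ring].
    by move=> g; apply/or4P/Or44; rewrite eqn_leq b2 -natr_lt1 !natrD; lra.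
split; first by rewrite /on_rim a1 a2 b1 b2 bd.
have gl : (gglue k i a <= gN k)%N.
  by move: a1 a2 i2 aN; clear; rewrite /glue_x; case: xf; lia.
split; [exact: gl|exact: leq_subr|].
have -> : gouter k (gglue k i a) (gN k - b)%N = false.
  by move: i1 i2 i3 i4 a1 a2 b1 b2; clear; rewrite /outer /glue_x; case: xf; lia.
rewrite squaring_flip// -zE nearpE// natrB//.
have gy : gpos k (flip i z).2 = (gN k)%:R - gpos k z.2.
  by rewrite /gpos /flip /gN /= natrD natrM; ring.
have le2 : (a <= gx0 k i + gx0 k i + (k + k))%N by move: a2; clear; lia.
rewrite gy; case E: xf.
  have gx : gpos k (flip i z).1 = (gx0 k i + gx0 k i + (k + k))%:R - gpos k z.1.
    by rewrite /gpos /flip E /= !natrD X0; ring.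
  by rewrite gx /glue_x natrB//; apply/and4P; split; lra.
have gx : gpos k (flip i z).1 = gpos k z.1 by rewrite /gpos /flip E.
by rewrite gx /glue_x; apply/and4P; split; lra.
Qed.

Lemma vpt_rim k i a b : (50 <= k)%N -> grim k i a b ->
  supn (vpt k a b - ctr i) = 1 /\ vpt k (gglue k i a) (gN k - b) = flip i (vpt k a b).
Proof.
move=> k50 /and5P[a1 a2 b1 b2 bd]; have k0 : (0 < k)%N by lia.
have kR : k%:R != 0 :> R by rewrite pnatr_eq0; lia.
have kR0 : 0 < k%:R :> R by rewrite ltr0n.
have /and4P[i1 i2 i3 i4] := grid_inside i k50.
have X0 := gx0E i (leq_trans (isT : (1 <= 50)%N) k50).
have Y0 := gy0E i (leq_trans (isT : (4 <= 50)%N) k50).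
have vE c : k%:R * (vpos k c + k%:R) = c%:R by rewrite /vpos subrK mulrCA mulfV// mulr1.
have A1 := natr_le a1; have A2 := natr_le a2; have B1 := natr_le b1; have B2 := natr_le b2.
rewrite !natrD in A2 B2.
have x1 : (cx i)%:R - 1 <= vpos k a by rewrite -(lerD2r k%:R) -(ler_pM2l kR0) vE; move: A1; rewrite X0; lra.
have x2 : vpos k a <= (cx i)%:R + 1 by rewrite -(lerD2r k%:R) -(ler_pM2l kR0) vE; move: A2; rewrite X0; lra.
have y1 : (cy i)%:R - 4 <= vpos k b by rewrite -(lerD2r k%:R) -(ler_pM2l kR0) vE; move: B1; rewrite Y0; lra.
have y2 : vpos k b <= (cy i)%:R - 2 by rewrite -(lerD2r k%:R) -(ler_pM2l kR0) vE; move: B2; rewrite Y0; lra.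
split.
  apply/eqP; rewrite eq_le; apply/andP; split.
    by rewrite supn_leP ctrE /=; apply/and4P; split; lra.
  rewrite leNgt supn_ltP ctrE /=; apply/negP => /and4P[c1 c2 c3 c4].
  have veq c (t : R) : c%:R = k%:R * (t + k%:R) -> vpos k c = t.
    by move=> h; apply: (addIr k%:R); apply: (mulfI kR); rewrite vE.
  case/or4P: bd => /eqP h.
  - have E : vpos k a = (cx i)%:R - 1 by apply: veq; rewrite h X0; ring.
    by lra.
  - have E : vpos k a = (cx i)%:R + 1 by apply: veq; rewrite h !natrD X0; ring.
    by lra.
  - have E : vpos k b = (cy i)%:R - 4 by apply: veq; rewrite h Y0; ring.
    by lra.
  - have E : vpos k b = (cy i)%:R - 2 by apply: veq; rewrite h !natrD Y0; ring.
    by lra.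
have inj c (t : R) : k%:R * (t + k%:R) = c%:R -> vpos k c = t.
  by move=> h; apply: (addIr k%:R); apply: (mulfI kR); rewrite vE h.
have le1 : (a <= gx0 k i + gx0 k i + (k + k))%N by move: a2; clear; lia.
have le2 : (b <= gN k)%N by apply: leq_trans b2 (ltnW i4).
rewrite /vpt /flip /=; congr pair; apply: inj.
  rewrite /glue_x; case: xf; rewrite ?vE// natrB//.
  rewrite -[a%:R](vE a) !natrD X0; ring.
rewrite natrB//.
by rewrite -[b%:R](vE b) /gN natrD natrM; ring.
Qed.

(** ** Stars on the surface *)

Variables (X : topologicalType) (proj : set_type (holed_sphere ctr) -> X).
Hypothesis proj_surj : forall xi, exists x, proj x = xi.
Hypothesis proj_open : forall U : set X, open (proj @^-1` U) -> open U.
Hypothesis proj_fib : forall x y, proj x = proj y -> x = y \/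
  exists i p, [/\ sqdist (ctr i) p = 1, val x = Some p & val y = Some (flip i p)].
Hypothesis proj_glue : forall x y i p, sqdist (ctr i) p = 1 ->
  val x = Some p -> val y = Some (flip i p) -> proj x = proj y.
Implicit Types (x y : set_type (holed_sphere ctr)) (xi eta : X).

Lemma sqdistE i p : sqdist (ctr i) p = eucl (p - ctr i) ^+ 2.
Proof. by rewrite eucl_sqr. Qed.

Lemma sqdist1 i p : sqdist (ctr i) p = 1 <-> eucl (p - ctr i) = 1.
Proof.
rewrite sqdistE; split => [/eqP|->]; last by rewrite expr1n.
by rewrite sqrf_eq1 => /orP[/eqP//|/eqP e]; have := eucl_ge0 (p - ctr i); rewrite e; lra.
Qed.

Lemma holed_sphereP p : holed_sphere ctr (Some p) <-> rnd p.
Proof.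
split=> [h i|h [i _ [q] /=]].
  rewrite leNgt; apply/negP => lt1; apply: h; exists i => //; exists p => //=.
  by rewrite sqdistE expr_lt1// eucl_ge0.
move=> lt1 [qp]; move: lt1; rewrite qp sqdistE expr_lt1 ?eucl_ge0//.
by have := h i; rewrite leNgt => /negP.
Qed.

Lemma proper x : proper_point (val x).
Proof. by move=> p xp; apply/holed_sphereP; rewrite -xp; exact: set_valP. Qed.

Lemma rnd_flip i p : eucl (p - ctr i) = 1 -> rnd (flip i p).
Proof.
move=> e j; have e' : eucl (flip i p - ctr (partner i)) = 1 by rewrite eucl_flip.
have [->|ji] := eqVneq j (partner i); first by rewrite e'.
apply: le_trans (supn_le_eucl _); have [h|h] := leP 1 (supn (flip i p - ctr j)) => //.
have h1 : supn (flip i p - ctr j) < 2 by lra.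
have h2 : supn (flip i p - ctr (partner i)) < 2.
  by have := supn_le_eucl (flip i p - ctr (partner i)); rewrite e'; lra.
by rewrite (box_unique h1 h2) eqxx in ji.
Qed.

Lemma flip_point i p : eucl (p - ctr i) = 1 -> exists y, val y = Some (flip i p).
Proof.
move=> /rnd_flip/holed_sphereP h.
by exists (SigSub (mem_set h)).
Qed.

(** A vertex on a rim and its glued copy are one vertex of the surface, so their stars
    are united. *)
Definition star k xi a b : Prop := exists x, proj x = xi /\
  (touch k (val x) a b \/
   exists i, grim k i a b /\ touch k (val x) (gglue k i a) (gN k - b)).

Lemma grim_le k i a b : (50 <= k)%N -> grim k i a b -> (a <= gN k)%N /\ (b <= gN k)%N.
Proof. by move=> /(grid_inside i) h; rewrite /on_rim; lia. Qed.

Lemma grim_outer k i a b : (50 <= k)%N -> grim k i a b -> gouter k a b = false.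
Proof. by move=> /(grid_inside i) h; rewrite /on_rim /outer; lia. Qed.

Lemma grim_glue k i a b : (50 <= k)%N -> grim k i a b ->
  grim k (partner i) (gglue k i a) (gN k - b)%N.
Proof.
move=> k50; apply: on_rim_glue; first lia.
- by move=> j; exact: grid_inside.
- exact: grid_partner_x.
- by move=> j; apply: grid_partner_y; lia.
Qed.

Lemma grim_unique k i j a b : (50 <= k)%N -> grim k i a b -> grim k j a b -> i = j.
Proof.
move=> k50 /and5P[a1 a2 b1 b2 _] /and5P[c1 c2 d1 d2 _].
apply: (@same_hole I k (gx0 k) (gy0 k) _ _ i j a b); rewrite ?a1 ?b1 ?c1 ?d1//; first lia.
by move=> i' j'; exact: grid_apart.
Qed.

Lemma gglueK k i a b : (50 <= k)%N -> grim k i a b ->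
  gglue k (partner i) (gglue k i a) = a /\ (gN k - (gN k - b))%N = b.
Proof.
move=> k50 r; have [aN bN] := grim_le k50 r; split; last by rewrite subKn.
apply: glue_xK; [lia|exact: grid_partner_x|].
by move: r => /and5P[-> -> _ _ _].
Qed.

Lemma star_le k xi a b : (50 <= k)%N -> star k xi a b -> (a <= gN k)%N /\ (b <= gN k)%N.
Proof. by move=> k50 [x [_ [[aN bN _]|[i [/(grim_le k50)]]]]]. Qed.

Lemma star_glue k xi i a b : (50 <= k)%N -> star k xi a b -> grim k i a b ->
  star k xi (gglue k i a) (gN k - b)%N.
Proof.
move=> k50 [x [px [t|[j [rj t]]]]] r; exists x; split => //.
  right; exists (partner i); split; first exact: grim_glue.
  by have [-> ->] := gglueK k50 r.
by left; rewrite (grim_unique k50 r rj).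
Qed.

Lemma star_outer k xi a b a' b' : (50 <= k)%N -> star k xi a b -> gouter k a b ->
  gouter k a' b' -> (a' <= gN k)%N -> (b' <= gN k)%N -> star k xi a' b'.
Proof.
move=> k50 [x [px [[aN bN t]|[i [/(grim_outer k50)-> //]]]]] o o' aN' bN'.
exists x; split => //; left; split => //.
by move: t; case: (val x) => [p|//]; rewrite o o'.
Qed.

Lemma star_exists k xi : (50 <= k)%N -> exists a b, star k xi a b.
Proof.
move=> k50; have [x px] := proj_surj xi.
by have [a [b t]] := touch_exists (val x) k50; exists a, b, x; split => //; left.
Qed.

Lemma star_connected k xi (p : nat -> nat -> 'F_2) : (50 <= k)%N ->
  (forall d a b, valid k (gx0 k) (gy0 k) d a b -> star k xi a b ->
     star k xi (head d a b).1 (head d a b).2 -> p a b = p (head d a b).1 (head d a b).2) ->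
  (forall i a b, star k xi a b -> grim k i a b -> p a b = p (gglue k i a) (gN k - b)%N) ->
  (forall a b a' b', star k xi a b -> star k xi a' b' -> gouter k a b -> gouter k a' b' ->
     p a b = p a' b') ->
  forall a b a' b', star k xi a b -> star k xi a' b' -> p a b = p a' b'.
Proof.
move=> k50 edge rim out.
have tS x a b : proj x = xi -> touch k (val x) a b -> star k xi a b.
  by move=> px t; exists x; split => //; left.
have base a b : star k xi a b -> exists x a1 b1,
    [/\ proj x = xi, touch k (val x) a1 b1 & p a b = p a1 b1].
  move=> s; have [x [px [t|[i [r t]]]]] := s; first by exists x, a, b.
  by exists x, (gglue k i a), (gN k - b)%N; split => //; exact: rim.
have same x a b a' b' : proj x = xi -> touch k (val x) a b -> touch k (val x) a' b' ->
    p a b = p a' b'.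
  move=> px; apply: (touch_connected k50 (@proper x)) => {a b a' b'}.
    by move=> d a b v t t'; apply: edge => //; exact: tS px _.
  by move=> a b a' b' t t' o o'; apply: out => //; exact: tS px _.
move=> a b a' b' /base[x [a1 [b1 [px t ->]]]] /base[y [a2 [b2 [py t' ->]]]].
have [xy|[i [q [/sqdist1 e xq yq]]]] := proj_fib (etrans px (esym py)).
  by apply: (same x) => //; rewrite xy.
have [r tg] : grim k i a1 b1 /\ touch k (Some (flip i q)) (gglue k i a1) (gN k - b1).
  by apply: rim_glue => //; rewrite -xq.
rewrite (rim i)//; last exact: tS px t.
by apply: (same y) => //; rewrite yq.
Qed.

Lemma supn_compact (B : R) : compact [set q : R * R | supn q <= B].
Proof.
have -> : [set q : R * R | supn q <= B] = `[- B, B] `*` `[- B, B].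
  apply/seteqP; split => q /=; rewrite supn_leP !in_itv /=.
    by move=> /and4P[-> -> -> ->].
  by move=> [/andP[-> ->] /andP[-> ->]].
by apply: compact_setX; exact: segment_compact.
Qed.

Lemma supn_closed (B : R) : closed [set q : R * R | supn q <= B].
Proof.
rewrite (_ : [set q : R * R | supn q <= B] = (@supn R) @^-1` [set r | r <= B])//.
by apply: closed_comp; [move=> q _; exact: supn_continuous|exact: closed_le].
Qed.

Lemma touch_open k a b : (50 <= k)%N -> open [set y : set_type (holed_sphere ctr) | touch k (val y) a b].
Proof.
move=> k50; rewrite openE => y ty.
have k0 : (0 < k)%N by lia.
suff : nbhs (val y) [set s : sphere R | touch k s a b].
  exact: (@initial_continuous _ (sphere R) set_val y).
move: (@proper y) ty; rewrite /mkset; case: (val y) => [q|] sq [aN bN].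
  have rq := sq q erefl; have cPhi := squaring_continuous rq.
  have cF : (fun q => (Phi q).1) x @[x --> q] --> (Phi q).1.
    exact: (cvg_comp _ _ cPhi cvg_fst).
  have cS : (fun q => (Phi q).2) x @[x --> q] --> (Phi q).2.
    exact: (cvg_comp _ _ cPhi cvg_snd).
  rewrite -[nbhs _ _]/(nbhs q (Some @^-1` [set s : sphere R | touch k s a b])).
  case: ifPn => o.
    have -> : Some @^-1` [set s : sphere R | touch k s a b] = [set q | farp k (Phi q)].
      by apply/seteqP; split => r; [move=> [_ _]|move=> h; split => //]; rewrite /= o.
    rewrite /farp => /or4P[] h.
    - by apply: filterS (cvgr_lt _ cF _ h) => r /= ->.
    - by apply: filterS (cvgr_gt _ cF _ h) => r /= ->; rewrite orbT.
    - by apply: filterS (cvgr_lt _ cS _ h) => r /= ->; rewrite !orbT.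
    - by apply: filterS (cvgr_gt _ cS _ h) => r /= ->; rewrite !orbT.
  have -> : Some @^-1` [set s : sphere R | touch k s a b] = [set q | nearp k (Phi q) a b].
    by apply/seteqP; split => r; [move=> [_ _]|move=> h; split => //]; rewrite /= (negbTE o).
  rewrite /nearp => h.
  have c : (fun q => supn (Phi q - vpt k a b)) x @[x --> q] --> supn (Phi q - vpt k a b).
    apply: (@continuous_comp _ _ _ (fun q => Phi q - vpt k a b) (@supn R)).
      by apply: cvgB => //; exact: cvg_cst.
    exact: supn_continuous.
  exact: (cvgr_lt _ c _ h).
move=> o; exists [set q | supn q <= (k + 60)%:R].
  by split; [exact: supn_compact|exact: supn_closed].
move=> s [[q /= /negP qb <-]|->]; last by split.
split => //; rewrite o farpE//.
move: qb; rewrite -ltNge => qb.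
rewrite squaring_far; last by move: qb; rewrite natrD; have := ler0n R k; lra.
have kR : 1 <= k%:R :> R by rewrite ler1n.
have gNE : (gN k)%:R = k%:R * (k%:R + k%:R) :> R by rewrite /gN natrD !natrM; ring.
have : ~~ (supn q <= k%:R) by rewrite -ltNge; move: qb; rewrite natrD; lra.
rewrite supn_leP !negb_and -!ltNge /gpos gNE => /or4P[] h.
- apply/orP; left; have : k%:R * (q.1 + k%:R) <= 0 by rewrite pmulr_rle0//; lra.
  by lra.
- apply/orP; right; apply/orP; left.
  have : k%:R * (k%:R + k%:R) <= k%:R * (q.1 + k%:R) by rewrite ler_pM2l//; lra.
  by lra.
- apply/orP; right; apply/orP; right; apply/orP; left.
  have : k%:R * (q.2 + k%:R) <= 0 by rewrite pmulr_rle0//; lra.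
  by lra.
- do 3 (apply/orP; right).
  have : k%:R * (k%:R + k%:R) <= k%:R * (q.2 + k%:R) by rewrite ler_pM2l//; lra.
  by lra.
Qed.

Lemma star_open k a b : (50 <= k)%N -> open [set xi | star k xi a b].
Proof.
move=> k50; apply: proj_open.
rewrite (_ : _ @^-1` _ = [set y : set_type (holed_sphere ctr) | touch k (val y) a b] `|`
  \bigcup_(i in [set i | grim k i a b]) [set y : set_type (holed_sphere ctr) | touch k (val y) (gglue k i a) (gN k - b)%N]).
  apply: openU; first exact: touch_open.
  by apply: bigcup_open => i _; exact: touch_open.
apply/seteqP; split => y /=; last first.
  by case=> [t|[i ri t]]; exists y; split => //; [left|right; exists i].
move=> [x [/proj_fib[xy|[i [q [/sqdist1 e xq yq]]]]]].
  by rewrite xy; case=> [t|[i [ri t]]]; [left|right; exists i].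
rewrite xq yq; case=> [t|[j [rj t]]].
  by have [r t'] := rim_glue k50 e t; right; exists i; rewrite //= yq.
have [r t'] := rim_glue k50 e t; left.
have ij : i = partner j by apply: (grim_unique k50 r); exact: grim_glue.
by move: t'; rewrite ij; have [-> ->] := gglueK k50 rj.
Qed.

(** ** Distinct points have disjoint neighbourhoods of stars *)

Lemma farp_supn k z : (50 <= k)%N -> farp k z -> k%:R - 1 < supn z.
Proof.
move=> k50; have k0 : (0 < k)%N by lia.
have kR : 50%:R <= k%:R :> R by rewrite ler_nat.
have gNE : (gN k)%:R = k%:R * (k%:R + k%:R) :> R by rewrite /gN natrD !natrM; ring.
rewrite farpE// gNE; apply: contraTT; rewrite -leNgt supn_leP => /and4P[h1 h2 h3 h4].
have lo (x : R) : - (k%:R - 1) <= x -> 1 <= gpos k x.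
  move=> h; have : k%:R * (- (k%:R - 1) + k%:R) <= gpos k x.
    by rewrite /gpos ler_pM2l ?ltr0n//; lra.
  by lra.
have hi (x : R) : x <= k%:R - 1 -> gpos k x <= k%:R * (k%:R + k%:R) - 1.
  move=> h; have : gpos k x <= k%:R * (k%:R - 1 + k%:R).
    by rewrite /gpos ler_pM2l ?ltr0n//; lra.
  by lra.
by rewrite !negb_or -!leNgt !lo ?hi.
Qed.

Lemma ctr_small i : supn (ctr i) <= 40.
Proof.
rewrite supn_leP ctrE /=; have := cx_le i; have /andP[] := cy_bd i.
rewrite -!(ler_nat R) => h1 h2 h3; have := ler0n R (cx i).
by move: h1 h2 h3; move: (cx i)%:R (cy i)%:R => a b *; apply/and4P; split; lra.
Qed.

Lemma rim_small i z : supn (z - ctr i) = 1 -> supn z < 42.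
Proof.
move=> e; rewrite -(subr0 z) (_ : 42 = 1 + 1 / 2 + (40 + 1 / 2)); last by lra.
by apply: (@supn_tri _ _ (ctr i)); [|rewrite subr0; have := ctr_small i]; lra.
Qed.

Lemma flip_isometry i u v : supn (flip i u - flip i v) = supn (u - v).
Proof.
rewrite /supn /flip /=; case: xf.
  by congr Num.max; rewrite -normrN; congr `| _ |; ring.
by congr Num.max; rewrite -normrN; congr `| _ |; ring.
Qed.

Lemma finite_bound (T : finType) (f : T -> R) : exists K0 : nat, forall K t,
  (K0 <= K)%N -> f t < K%:R.
Proof.
exists (Num.bound (\sum_t `|f t|)) => K t hK.
apply: le_lt_trans (ler_norm _) _.
apply: (@le_lt_trans _ _ (\sum_t `|f t|)).
  by rewrite (bigD1 t)//= lerDl sumr_ge0.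
apply: lt_le_trans (_ : (Num.bound (\sum_t `|f t|))%:R <= _); last by rewrite ler_nat.
by apply: archi_boundP; rewrite sumr_ge0.
Qed.

(** Distances are measured after squaring, from the nearest lift of the point. *)
Definition close xi (r : R) z : Prop := exists x p,
  [/\ proj x = xi, val x = Some p & supn (Phi p - z) < r].

(** All lifts of a point are among one of them and its images under the finitely many
    gluings, whence the uniform bounds below. *)
Definition lifts p (o : option I) := if o is Some i then flip i p else p.

Lemma liftsP x p y : val x = Some p -> proj y = proj x ->
  exists o, val y = Some (lifts p o).
Proof.
move=> xp /esym/proj_fib[<-|[i [q [_]]]]; first by exists None.
by rewrite xp => -[<-] yq; exists (Some i).
Qed.

(** At scale 1/K the point behaves as its limit position: it is close to the rim
    of a hole only if it lies on it, and it is far from infinity. *)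
Definition tame xi K : Prop := [/\ (50 <= K)%N,
  forall x p, proj x = xi -> val x = Some p -> supn (Phi p) + 60 < K%:R &
  forall x p i, proj x = xi -> val x = Some p -> 1 < supn (Phi p - ctr i) ->
    1 + 3 / K%:R < supn (Phi p - ctr i)].

Lemma tame_exists x p : val x = Some p ->
  exists K0, forall K, (K0 <= K)%N -> tame (proj x) K.
Proof.
move=> xp.
have [K1 h1] := finite_bound (fun o => supn (Phi (lifts p o)) + 60).
have [K2 h2] := finite_bound (fun oi : option I * I => 3 / (supn (Phi (lifts p oi.1) - ctr oi.2) - 1)).
exists (50 + K1 + K2)%N => K hK; have kR : 0 < K%:R :> R by rewrite ltr0n; lia.
split; first by lia.
  move=> y q /(liftsP xp)[o yo] yq; move: yo; rewrite yq => -[->].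
  by apply: h1; lia.
move=> y q i /(liftsP xp)[o yo] yq; move: yo; rewrite yq => -[->] gt1.
have := h2 K (o, i); rewrite /= ltr_pdivrMr; last by lra.
move=> h; have {h}: 3 < K%:R * (supn (Phi (lifts p o) - ctr i) - 1) by apply: h; lia.
by rewrite mulrC -ltr_pdivrMr//; lra.
Qed.

Lemma close_flip xi K r i w : tame xi K -> r <= 3 / K%:R -> supn (w - ctr i) = 1 ->
  close xi r w -> close xi r (flip i w).
Proof.
move=> [_ _ tm] rK wi [x [p [px xp d]]].
have e1 : supn (Phi p - ctr i) = 1.
  apply/eqP; rewrite eq_le; apply/andP; split; last exact: squaring_ge1 (proper xp).
  rewrite leNgt; apply/negP => gt1.
  have := tm _ _ _ px xp gt1; apply/negP; rewrite -leNgt.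
  have wi' e : 0 < e -> supn (w - ctr i) < 1 + e by rewrite wi; lra.
  apply/ler_addgt0Pl => e e0; apply: ltW.
  rewrite (_ : e + _ = 3 / K%:R + (1 + e)); last by ring.
  by apply: supn_tri (wi' _ e0); exact: lt_le_trans rK.
have ep := squaring_rim (proper xp) e1; have [y yq] := flip_point ep.
exists y, (flip i p); split => //; last by rewrite squaring_flip// flip_isometry.
by rewrite -px; apply/esym/(proj_glue _ xp yq); apply/sqdist1.
Qed.

Lemma close_small xi K r w : tame xi K -> r <= 1 -> close xi r w -> supn w + 50 < K%:R.
Proof.
move=> [_ bd _] r1 [x [p [px xp d]]].
have b := bd _ _ px xp.
have d' : supn (w - Phi p) < 1 by rewrite supn_sym; lra.
have : supn (w - 0) < 1 + (K%:R - 60) by apply: supn_tri d' _; rewrite subr0; lra.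
by rewrite subr0; lra.
Qed.

Lemma close_le xi (r s : R) w : r <= s -> close xi r w -> close xi s w.
Proof. by move=> rs [x [p [px xp d]]]; exists x, p; split => //; exact: lt_le_trans rs. Qed.

Lemma close_tri xi (r s : R) u w : supn (u - w) < s -> close xi r u -> close xi (r + s) w.
Proof. by move=> uw [x [p [px xp d]]]; exists x, p; split => //; exact: supn_tri d uw. Qed.

Lemma inv_le k K : (0 < K)%N -> (K <= k)%N -> k%:R^-1 <= K%:R^-1 :> R.
Proof. by move=> K0 Kk; rewrite lef_pV2 ?posrE ?ltr0n ?ler_nat//; lia. Qed.

Lemma tame_scale xi K : tame xi K -> 0 < K%:R^-1 :> R /\ 3 / K%:R <= 1 :> R.
Proof.
move=> [K50 _ _]; have h : 0 < K%:R :> R by rewrite ltr0n; lia.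
by split; [rewrite invr_gt0|rewrite ler_pdivrMr// mul1r ler_nat; lia].
Qed.

Definition finite xi : Prop := forall x, proj x = xi -> exists p, val x = Some p.

Lemma finiteP x p : val x = Some p -> finite (proj x).
Proof. by move=> xp y /(liftsP xp)[o ->]; exists (lifts p o). Qed.

Lemma touch_close xi K k x a b : finite xi -> tame xi K -> (K <= k)%N -> proj x = xi ->
  touch k (val x) a b -> gouter k a b = false /\ close xi k%:R^-1 (vpt k a b).
Proof.
move=> fin [K50 bd _] Kk px [_ _]; have [p xp] := fin x px; rewrite xp.
have k50 := leq_trans K50 Kk; have b1 := bd _ _ px xp.
have kR : K%:R <= k%:R :> R by rewrite ler_nat.
case: ifP => _; first by move/(farp_supn k50); lra.
by move=> np; split => //; exists x, p.
Qed.

Lemma grim_glueK k i a b : (50 <= k)%N -> grim k i a b ->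
  supn (vpt k (gglue k i a) (gN k - b) - ctr (partner i)) = 1 /\
  flip (partner i) (vpt k (gglue k i a) (gN k - b)) = vpt k a b.
Proof. by move=> k50 /(vpt_rim k50)[e ->]; rewrite supn_flip flipK. Qed.

Lemma close_star xi K k a b : finite xi -> tame xi K -> (K <= k)%N -> star k xi a b ->
  gouter k a b = false /\ close xi k%:R^-1 (vpt k a b).
Proof.
move=> fin tm Kk; have [K50 _ _] := tm; have k50 := leq_trans K50 Kk.
have [K1 K3] := tame_scale tm; have kK := inv_le (leq_trans (isT : (0 < 50)%N) K50) Kk.
move=> [x [px [|[i [r]]]]]; first by move=> t; exact: (touch_close fin tm Kk px t).
move=> /(touch_close fin tm Kk px)[_ c]; split; first exact: grim_outer r.
have [e <-] := grim_glueK k50 r; apply: close_flip tm _ e c.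
by apply: le_trans kK _; rewrite mulrC; lra.
Qed.

Lemma nbr_close xi K eta a b y : finite xi -> tame xi K -> star K xi a b -> star K eta a b ->
  proj y = eta -> exists q, val y = Some q /\ close xi (2 / K%:R) (Phi q).
Proof.
move=> fin tm sx sy py; have [K50 _ _] := tm; have [K1 K3] := tame_scale tm.
have [x [a' [b' [px sx' tx]]]] : exists x a' b', [/\ proj x = eta, star K xi a' b' &
    touch K (val x) a' b'].
  move: sy => [x [px [t|[i [r t]]]]]; first by exists x, a, b.
  by exists x, (gglue K i a), (gN K - b)%N; split => //; exact: star_glue.
have [o c] := close_star fin tm (leqnn K) sx'.
have [q [xq cq]] : exists q, val x = Some q /\ close xi (2 / K%:R) (Phi q).
  move: tx => [_ _]; case: (val x) => [q|]; rewrite o// => np; exists q; split => //.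
  rewrite (_ : 2 / K%:R = K%:R^-1 + K%:R^-1); last by lra.
  by apply: close_tri c; rewrite supn_sym.
have [<-|[i [q' [e]]]] := proj_fib (etrans px (esym py)); first by exists q.
rewrite xq => -[qq yq]; subst q'; exists (flip i q); split => //.
have e1 := (sqdist1 i q).1 e; rewrite squaring_flip//; apply: close_flip tm _ _ cq; first by lra.
exact: rim_squaring.
Qed.

(** The point eta shares a star with xi at the coarse level, so it is close to xi, and
    all vertices whose finer stars contain eta are close to xi as well. *)
Lemma nbr_star xi K k eta a b c d : finite xi -> tame xi K -> (K <= k)%N ->
  star K xi a b -> star K eta a b -> star k eta c d ->
  gouter k c d = false /\ close xi (3 / K%:R) (vpt k c d).
Proof.
move=> fin tm Kk sx sy [y [py ty]]; have [K50 _ _] := tm; have [K1 K3] := tame_scale tm.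
have k50 := leq_trans K50 Kk; have kK := inv_le (leq_trans (isT : (0 < 50)%N) K50) Kk.
have kR : K%:R <= k%:R :> R by rewrite ler_nat.
have [q [yq cq]] := nbr_close fin tm sx sy py.
have near u v : touch k (val y) u v -> gouter k u v = false /\ close xi (3 / K%:R) (vpt k u v).
  rewrite yq => -[_ _]; case: ifP => _.
    move=> /(farp_supn k50); have : supn (Phi q) + 50 < K%:R by apply: close_small tm _ cq; lra.
    by lra.
  move=> np; split => //; apply: (@close_le _ (2 / K%:R + k%:R^-1)); first by lra.
  by apply: close_tri cq.
move: ty => [/near//|[i [r /near[_ cl]]]]; split; first exact: grim_outer r.
by have [e <-] := grim_glueK k50 r; apply: close_flip tm _ e cl.
Qed.

Lemma star_infinity K x a b : (50 <= K)%N -> val x = None -> star K (proj x) a b ->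
  gouter K a b.
Proof.
move=> K50 xN [y [py t]].
have yN : val y = None.
  have [<-//|[i [p []]]] := proj_fib (esym py).
  by rewrite xN.
move: t; rewrite yN => -[[]//|[i [/(grim_glue K50)/(grim_outer K50) o []]]].
by rewrite o.
Qed.

Lemma nbr_infinity K k x eta a b c d : (100 <= K)%N -> (K <= k)%N -> val x = None ->
  star K (proj x) a b -> star K eta a b -> star k eta c d ->
  gouter k c d \/ K%:R - 2 < supn (vpt k c d).
Proof.
move=> K100 Kk xN sx sy [y [py ty]].
have K50 : (50 <= K)%N by lia.
have k50 := leq_trans K50 Kk; have ab := star_infinity K50 xN sx.
have KR : 100%:R <= K%:R :> R by rewrite ler_nat.
have far : forall q, val y = Some q -> K%:R - 1 < supn (Phi q).
  move: sy => [y0 [py0 [[_ _]|[i [/(grim_outer K50)]]]]]; last by rewrite ab.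
  have [<-|[i [q [/sqdist1/rim_squaring/rim_small h -> _]]]] := proj_fib (etrans py0 (esym py)).
    by move=> t q E; move: t; rewrite E ab; exact: farp_supn.
  by rewrite ab => /(farp_supn K50); lra.
have near u v : touch k (val y) u v -> gouter k u v \/ K%:R - 2 < supn (vpt k u v).
  move=> [_ _]; case E: (val y) => [q|]; last by left.
  case: ifP => _; [by left|move=> np; right].
  have h : supn (Phi q - 0) < k%:R^-1 + (supn (vpt k u v) + 1 / 2).
    by apply: supn_tri np _; rewrite subr0; lra.
  have k2 : k%:R^-1 <= 1 / 2 :> R.
    have k2' := inv_le (isT : (0 < 2)%N) (leq_trans (isT : (2 <= 50)%N) k50).
    by move: k2'; lra.
  by have := far q E; move: h; rewrite subr0; lra.
move: ty => [/near//|[i [r /near[]]]].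
  by rewrite (grim_outer k50 (grim_glue k50 r)).
by have [/rim_small e _] := grim_glueK k50 r; lra.
Qed.

Definition separated K xi xi' : Prop := forall k eta eta' a b a' b' c d, (K <= k)%N ->
  star K xi a b -> star K eta a b -> star K xi' a' b' -> star K eta' a' b' ->
  star k eta c d -> star k eta' c d -> False.

Lemma separated_sym K xi xi' : separated K xi xi' -> separated K xi' xi.
Proof. by move=> h k eta eta' a b a' b' c d Kk s1 s2 s3 s4 s5 s6; exact: h s3 s4 s1 s2 s6 s5. Qed.

Lemma separated_finite x p x' p' : val x = Some p -> val x' = Some p' -> proj x != proj x' ->
  exists2 K, (50 <= K)%N & separated K (proj x) (proj x').
Proof.
move=> xp xp' xx'; have fx := finiteP xp; have fx' := finiteP xp'.
have [K1 h1] := tame_exists xp; have [K2 h2] := tame_exists xp'.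
have [K3 h3] := finite_bound (fun o : option I * option I =>
  6 / supn (Phi (lifts p o.1) - Phi (lifts p' o.2))).
exists (50 + K1 + K2 + K3)%N; first by lia.
set K := (_ + _)%N; have t1 : tame (proj x) K by apply: h1; rewrite /K; lia.
have t2 : tame (proj x') K by apply: h2; rewrite /K; lia.
have {}h3 o : 6 / supn (Phi (lifts p o.1) - Phi (lifts p' o.2)) < K%:R by apply: h3; rewrite /K; lia.
have K0 : 0 < K%:R :> R by rewrite ltr0n /K; lia.
move=> k eta eta' a b a' b' c d Kk s1 s2 s3 s4 s5 s6.
have [_ [y [q [py yq c1]]]] := nbr_star fx t1 Kk s1 s2 s5.
have [_ [y' [q' [py' yq' c2]]]] := nbr_star fx' t2 Kk s3 s4 s6.
have lt6 : supn (Phi q - Phi q') < 3 / K%:R + 3 / K%:R.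
  by apply: supn_tri c1 _; rewrite supn_sym.
have [o yo] := liftsP xp py; have [o' yo'] := liftsP xp' py'.
have qo : q = lifts p o by move: yo; rewrite yq => -[].
have qo' : q' = lifts p' o' by move: yo'; rewrite yq' => -[].
have := h3 (o, o'); rewrite /= -qo -qo'.
have [e0|ne0] := eqVneq (supn (Phi q - Phi q')) 0.
  move/eqP: xx' => []; rewrite -py -py'; congr proj; apply: val_inj; rewrite yq yq'.
  congr Some; apply: squaring_inj (proper yq) (proper yq') _.
  by apply/eqP; rewrite -subr_eq0; apply/eqP; exact: supn_eq0.
have gt0 : 0 < supn (Phi q - Phi q') by rewrite lt_neqAle eq_sym ne0 supn_ge0.
rewrite ltr_pdivrMr// => h; have : supn (Phi q - Phi q') < 6 / K%:R by lra.
by rewrite ltr_pdivlMr//; lra.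
Qed.

Lemma separated_infinity x x' p' : val x = None -> val x' = Some p' ->
  exists2 K, (50 <= K)%N & separated K (proj x) (proj x').
Proof.
move=> xN xp'; have fx' := finiteP xp'; have [K1 h1] := tame_exists xp'.
exists (100 + K1)%N; first by lia.
set K := (_ + _)%N; have t1 : tame (proj x') K by apply: h1; rewrite /K; lia.
have [_ K3] := tame_scale t1.
move=> k eta eta' a b a' b' c d Kk s1 s2 s3 s4 s5 s6.
have [o /(close_small t1 K3) sm] := nbr_star fx' t1 Kk s3 s4 s6.
have K100 : (100 <= K)%N by rewrite /K; lia.
have [|] := nbr_infinity K100 Kk xN s1 s2 s5.
  by rewrite o.
by lra.
Qed.

(** Having a common star of level K with a point is a neighbourhood of it; for K large
    the neighbourhoods of two points have no common star at any finer level. *)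
Lemma star_separated xi xi' : xi != xi' -> exists2 K, (50 <= K)%N & separated K xi xi'.
Proof.
have [x <-] := proj_surj xi; have [x' <-] := proj_surj xi'.
case E : (val x) => [p|]; case E' : (val x') => [p'|] ne.
- exact: separated_finite E E' ne.
- by have [K K50 s] := separated_infinity E' E; exists K => //; exact: separated_sym.
- exact: separated_infinity E E'.
- by move/eqP: ne => []; congr proj; apply: val_inj; rewrite E E'.
Qed.

(** ** Clusters of compact and of connected sets *)

Definition cluster_at k (A : set X) (q : nat * nat) : Prop :=
  exists2 xi, A xi & star k xi q.1 q.2.

Definition grid_edge k (q q' : nat * nat) : Prop :=
  exists2 d, valid k (gx0 k) (gy0 k) d q.1 q.2 & q' = head d q.1 q.2.

Definition in_grid k (q : nat * nat) : Prop := (q.1 <= gN k)%N /\ (q.2 <= gN k)%N.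

Definition identified k (q q' : nat * nat) : Prop := in_grid k q /\ in_grid k q' /\
  ((exists2 i, grim k i q.1 q.2 & q' = (gglue k i q.1, gN k - q.2)%N) \/
   (gouter k q.1 q.2 /\ gouter k q'.1 q'.2)).

Lemma identified_sym k (q q' : nat * nat) : (50 <= k)%N -> identified k q q' -> identified k q' q.
Proof.
move=> k50 [g [g' [[i r q'E]|[o o']]]]; split => //; split => //; last by right.
left; exists (partner i); rewrite q'E /=; first exact: grim_glue.
by have [-> ->] := gglueK k50 r; case: (q).
Qed.

Lemma cluster_in_grid k A (q : nat * nat) : (50 <= k)%N -> cluster_at k A q -> in_grid k q.
Proof. by move=> k50 [xi _ /(star_le k50)]. Qed.

Lemma cluster_closed k A : (50 <= k)%N -> soft_closed (identified k) (cluster_at k A).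
Proof.
move=> k50 q q' [_ [[g1 g2] [[i r ->]|[o o']]]] [xi Axi s]; exists xi => //=.
  exact: star_glue.
exact: star_outer s o o' g1 g2.
Qed.

(** A potential on the cluster is constant on the vertices whose stars contain a given
    point, hence it descends to a locally constant function on A. *)
Lemma cluster_tied k A : (50 <= k)%N -> connected A ->
  tied (grid_edge k) (identified k) (cluster_at k A).
Proof.
move=> k50 cA p cp.
have const xi a b a' b' : A xi -> star k xi a b -> star k xi a' b' -> p (a, b) = p (a', b').
  move=> Axi; have cl u v : star k xi u v -> cluster_at k A (u, v) by move=> s; exists xi.
  have box u v : star k xi u v -> in_grid k (u, v) by move=> /cl/(cluster_in_grid k50).
  apply: (star_connected (p := fun a b => p (a, b)) k50) => {a b a' b'}.
  - move=> d a b vd s s'; apply: cp; first exact: cl.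
      by move: s' => /cl; case: (head d a b).
    by left; exists d => //=; case: (head d a b).
  - move=> i a b s r; have s' := star_glue k50 s r.
    apply: cp; [exact: cl|exact: cl|right].
    by split; [exact: box|split; [exact: box|left; exists i]].
  - move=> a b a' b' s s' o o'; apply: cp; [exact: cl|exact: cl|right].
    by split; [exact: box|split; [exact: box|right]].
move=> q q' [xi Axi s] [xi' Axi' s'].
pose C (P : pred 'F_2) := \bigcup_(r in [set r : nat * nat | P (p r)]) [set xi | star k xi r.1 r.2].
have C_open P : open (C P) by apply: bigcup_open => r _; exact: star_open.
have BE : A `&` C (pred1 (p q)) = A `&` ~` C (predC1 (p q)).
  apply/seteqP; split => eta [Aeta h]; split => //=.
    move=> [r' /= ne s2]; case: h => r /= /eqP e s1; move/eqP: ne; apply; rewrite -e.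
    by case: r r' s1 s2 {e} => [a b] [a' b'] s1 s2; exact: const Aeta s2 s1.
  have [a [b sab]] := star_exists eta k50; exists (a, b) => //=.
  by apply: contrapT => ne; apply: h; exists (a, b) => //=; apply/negP.
have : A `&` C (pred1 (p q)) = A.
  apply: cA; first by exists xi; split => //; exists q => /=.
    by exists (C (pred1 (p q))).
  by exists (~` C (predC1 (p q))) => //; exact: open_closedC.
move=> /seteqP[_ /(_ xi' Axi')[_ [r /= /eqP <- sr]]].
by case: r q' s' sr => [a b] [a' b'] /= s1 s2; exact: const Axi' s2 s1.
Qed.

Lemma cluster_disjoint (A B : set X) : compact A -> compact B ->
  (forall xi, A xi -> B xi -> False) ->
  exists K : nat, forall k, (K <= k)%N -> forall q : nat * nat, cluster_at k A q -> cluster_at k B q -> False.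
Proof.
move=> cA cB dAB.
have [|K hK] := @compact_eventually X A B (fun k xi xi' =>
    forall a b, star k xi a b -> star k xi' a b -> False) cA cB.
  move=> xi xi' Axi Bxi'; have ne : xi != xi' by apply/eqP => e; rewrite e in Axi; exact: dAB Axi Bxi'.
  have [K K50 sep] := star_separated ne.
  pose nbr eta := [set zeta | exists a b, star K eta a b /\ star K zeta a b].
  have nb eta : nbhs eta (nbr eta).
    have [a [b s]] := star_exists eta K50.
    apply: filterS (open_nbhs_nbhs (conj (star_open a b K50) s)) => zeta /= s'.
    by exists a, b.
  exists K, (nbr xi), (nbr xi'); split; [exact: nb|exact: nb|].
  by move=> k u w Kk [a1 [b1 [s1 s2]]] [a2 [b2 [s3 s4]]] a b; exact: sep s1 s2 s3 s4.
by exists K => k Kk q [xi Axi s] [xi' Bxi' s']; exact: hK s s'.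
Qed.

(** ** Counting the arcs of an embedded oriented graph *)

Section Count.
Variables (t : nat)
  (theta : nat -> 'I_t -> (nat -> nat -> 'F_2) -> (nat -> nat -> 'F_2) -> 'F_2).
Hypothesis t_gt1 : (1 < t)%N.
Hypothesis theta_sub : forall k (j : 'I_t) H V H' V',
  theta k j (fun a b => H a b - H' a b) (fun a b => V a b - V' a b) =
  theta k j H V - theta k j H' V'.
Hypothesis theta_hole : forall k H V, (50 <= k)%N -> glued (gN k) k (gx0 k) (gy0 k) xf H V ->
  (forall j : 'I_t, theta k j H V = 0) ->
  forall i, hole_curl k (gx0 k) (gy0 k) (clear_hor k (gx0 k) (gy0 k) H)
    (clear_ver k (gx0 k) (gy0 k) V) i = 0.
Hypothesis theta_rim : forall k H V (p : nat -> nat -> 'F_2), (50 <= k)%N ->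
  (forall j : 'I_t, theta k j H V = 0) ->
  (forall a b, (a < gN k)%N -> (b <= gN k)%N -> hor_valid k (gx0 k) (gy0 k) a b ->
     H a b = p a b + p a.+1 b) ->
  (forall a b, (a <= gN k)%N -> (b < gN k)%N -> ver_valid k (gx0 k) (gy0 k) a b ->
     V a b = p a b + p a b.+1) ->
  forall i, exists a b, grim k i a b /\ p a b = p (gglue k i a) (gN k - b)%N.

Section Drawing.
Variables (V : finType) (a : rel V) (phi : V -> X) (gamma : V -> V -> R -> X).
Hypothesis a_oriented : oriented_graph a.
Local Notation e := (underlying a).
Hypothesis phi_inj : injective phi.
Hypothesis gamma_arc : forall u v, e u v ->
  [/\ {within `[0, 1], continuous (gamma u v)}, {in `[0, 1] &, injective (gamma u v)},
      gamma u v 0 = phi u & gamma u v 1 = phi v].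
Hypothesis gamma_rev : forall u v (s : R), e u v -> s \in `[0, 1] ->
  gamma v u s = gamma u v (1 - s).
Hypothesis gamma_off : forall u v w (s : R), e u v -> s \in `]0, 1[ -> gamma u v s <> phi w.
Hypothesis gamma_cross : forall u v u' v' (s s' : R), e u v -> e u' v' ->
  s \in `]0, 1[ -> s' \in `]0, 1[ -> gamma u v s = gamma u' v' s' ->
  (u' = u /\ v' = v) \/ (u' = v /\ v' = u).

Let E : finType := {f : V * V | a f.1 f.2}.
Let src (f : E) := (val f).1.
Let tgt (f : E) := (val f).2.

Lemma e_arc f : e (src f) (tgt f).
Proof. by rewrite /underlying (valP f). Qed.

Lemma e_sym u v : e u v = e v u.
Proof. by rewrite /underlying orbC. Qed.

Lemma arc_loopless f : src f != tgt f.
Proof.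
apply/eqP => st; have := valP f; rewrite -/(src f) -/(tgt f) st.
by case: a_oriented => ->.
Qed.

Lemma arc_pair f g : (src f = src g /\ tgt f = tgt g) \/ (src f = tgt g /\ tgt f = src g) -> f = g.
Proof.
case=> [[s1 t1]|[s1 t1]].
  apply: val_inj; move: s1 t1; rewrite /src /tgt.
  by case: (val f) (val g) => [? ?] [? ?] /= -> ->.
have [_ /(_ (src f) (tgt f))] := a_oriented.
by rewrite (valP f) s1 t1 (valP g).
Qed.

Definition near_part u (o : option V) : set X :=
  if o is Some v then gamma u v @` `[0, 3^-1] else [set phi u].
Definition near_index u : {pred option V} := [pred o | if o is Some v then e u v else true].
(** The first thirds of the arcs at u, with u itself; the last thirds are the first
    thirds of the reversed arcs. *)
Definition star_set u : set X := \bigcup_(o in [set` near_index u]) near_part u o.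
Definition mid_set (f : E) : set X := gamma (src f) (tgt f) @` `[3^-1, 2 / 3].

Lemma third_le1 : 3^-1 <= 1 :> R. Proof. by lra. Qed.

Lemma gamma_part u v (s s' : R) : e u v -> 0 <= s -> s' <= 1 ->
  compact (gamma u v @` `[s, s']) /\ connected (gamma u v @` `[s, s']).
Proof.
move=> /gamma_arc[c _ _ _] s0 s1.
have c' : {within `[s, s'], continuous (gamma u v)}.
  apply: continuous_subspaceW c => x /=; rewrite !in_itv /= => /andP[h1 h2].
  by apply/andP; split; lra.
split; first by apply: continuous_compact => //; exact: segment_compact.
by apply: connected_continuous_connected => //; exact: segment_connected.
Qed.

Lemma star_compact u : compact (star_set u).
Proof.
rewrite /star_set bigcup_pred; apply: bigsetU_compact => -[v|] //= uv; last exact: compact_set1.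
by apply: (gamma_part uv _ third_le1).1.
Qed.

Lemma star_set_connected u : connected (star_set u).
Proof.
apply: bigcup_connected => [|[v|] //= uv]; last exact: connected1.
  exists (phi u) => -[v|] //= uv; exists 0; last by have [] := gamma_arc uv.
  by rewrite /= in_itv /=; apply/andP; split; lra.
by apply: (gamma_part uv _ third_le1).2.
Qed.

Lemma star_setP u xi : star_set u xi -> xi = phi u \/
  exists v s, [/\ e u v, 0 < s <= 3^-1 & xi = gamma u v s].
Proof.
case=> -[v|] /= uv; last by left.
case=> s; rewrite /= in_itv /= => /andP[s0 s1] <-.
have [->|sN] := eqVneq s 0; first by left; have [] := gamma_arc uv.
by right; exists v, s; split => //; rewrite lt_neqAle eq_sym sN s0.
Qed.

Lemma itv01 (s : R) : 0 < s -> s < 1 -> s \in `]0, 1[.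
Proof. by rewrite in_itv /= => -> ->. Qed.

Lemma star_sets_disjoint u w xi : star_set u xi -> star_set w xi -> u = w.
Proof.
move=> /star_setP[->|[v [s [uv /andP[s0 s1] ->]]]] /star_setP[h|[x [s' [wx /andP[s0' s1'] h]]]].
- exact: phi_inj.
- by case: (gamma_off wx _ (esym h)); apply: itv01; lra.
- by case: (gamma_off uv _ h); apply: itv01; lra.
have i1 : s \in `]0, 1[ by apply: itv01; lra.
have i2 : s' \in `]0, 1[ by apply: itv01; lra.
have [[-> //]|[wv xu]] := gamma_cross uv wx i1 i2 h.
move: h; rewrite wv xu (gamma_rev uv); last by rewrite in_itv /=; apply/andP; split; lra.
have [_ inj _ _] := gamma_arc uv.
move=> /inj; rewrite !in_itv /= => h; have : s = 1 - s' by apply: h; apply/andP; split; lra.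
by move=> ?; exfalso; lra.
Qed.

Lemma mid_setP f xi : mid_set f xi -> exists s, [/\ s \in `]0, 1[, 3^-1 <= s <= 2 / 3 &
  xi = gamma (src f) (tgt f) s].
Proof.
case=> s; rewrite /= in_itv /= => h <-; exists s; split => //.
by move/andP: h => [h1 h2]; apply: itv01; lra.
Qed.

Lemma mid_sets_disjoint f g xi : mid_set f xi -> mid_set g xi -> f = g.
Proof.
move=> /mid_setP[s [i1 _ ->]] /mid_setP[s' [i2 _ h]].
apply: arc_pair; have [[-> ->]|[-> ->]] := gamma_cross (e_arc f) (e_arc g) i1 i2 h.
  by left.
by right.
Qed.

Lemma mid_star f u xi : mid_set f xi -> star_set u xi -> u = src f \/ u = tgt f.
Proof.
move=> /mid_setP[s [i1 _ ->]] /star_setP[h|[v [s' [uv /andP[s0 s1] h]]]].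
  by case: (gamma_off (e_arc f) i1 h).
have i2 : s' \in `]0, 1[ by apply: itv01; lra.
by have [[-> _]|[-> _]] := gamma_cross (e_arc f) uv i1 i2 h; [left|right].
Qed.

Lemma mid_src f : exists xi, mid_set f xi /\ star_set (src f) xi.
Proof.
exists (gamma (src f) (tgt f) 3^-1); split.
  by exists 3^-1 => //=; rewrite in_itv /=; apply/andP; split; lra.
exists (Some (tgt f)); first exact: e_arc.
by exists 3^-1 => //=; rewrite in_itv /=; apply/andP; split; lra.
Qed.

Lemma mid_tgt f : exists xi, mid_set f xi /\ star_set (tgt f) xi.
Proof.
exists (gamma (src f) (tgt f) (2 / 3)); split.
  by exists (2 / 3) => //=; rewrite in_itv /=; apply/andP; split; lra.
have tf : e (tgt f) (src f) by rewrite e_sym e_arc.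
exists (Some (src f)); first exact: tf.
exists 3^-1; first by rewrite /= in_itv /=; apply/andP; split; lra.
rewrite gamma_rev ?e_arc//; last by rewrite in_itv /=; apply/andP; split; lra.
by congr (gamma _ _ _); lra.
Qed.

Lemma mid_compact f : compact (mid_set f).
Proof. by apply: (gamma_part (e_arc f) _ _).1; lra. Qed.

Lemma mid_connected f : connected (mid_set f).
Proof. by apply: (gamma_part (e_arc f) _ _).2; lra. Qed.

(** At a fine enough scale the clusters of disjoint stars and middles are disjoint. *)
Lemma scale_exists : exists k, [/\ (50 <= k)%N,
  forall u w (q : nat * nat), cluster_at k (star_set u) q -> cluster_at k (star_set w) q -> u = w,
  forall f g (q : nat * nat), cluster_at k (mid_set f) q -> cluster_at k (mid_set g) q -> f = g &
  forall f u (q : nat * nat), cluster_at k (mid_set f) q -> cluster_at k (star_set u) q ->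
    u = src f \/ u = tgt f].
Proof.
have cl (P : Prop) (A B : set X) : compact A -> compact B ->
    (forall xi, A xi -> B xi -> P) ->
    exists K, forall k, (K <= k)%N -> forall q : nat * nat, cluster_at k A q -> cluster_at k B q -> P.
  move=> cA cB AB; have [p|np] := pselect P; first by exists 0%N.
  have [xi h1 h2|K hK] := cluster_disjoint cA cB; first exact: np (AB xi h1 h2).
  by exists K => k Kk q q1 q2; case: (hK k Kk q q1 q2).
have [K1 h1] : exists K, forall k, (K <= k)%N -> forall uw : V * V, forall q : nat * nat,
    cluster_at k (star_set uw.1) q -> cluster_at k (star_set uw.2) q -> uw.1 = uw.2.
  apply: (@uniformly _ (fun uw k => forall q : nat * nat, cluster_at k (star_set uw.1) q ->
    cluster_at k (star_set uw.2) q -> uw.1 = uw.2)) => uw.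
  by apply: cl; [exact: star_compact|exact: star_compact|exact: star_sets_disjoint].
have [K2 h2] : exists K, forall k, (K <= k)%N -> forall uw : E * E, forall q : nat * nat,
    cluster_at k (mid_set uw.1) q -> cluster_at k (mid_set uw.2) q -> uw.1 = uw.2.
  apply: (@uniformly _ (fun uw k => forall q : nat * nat, cluster_at k (mid_set uw.1) q ->
    cluster_at k (mid_set uw.2) q -> uw.1 = uw.2)) => uw.
  by apply: cl; [exact: mid_compact|exact: mid_compact|exact: mid_sets_disjoint].
have [K3 h3] : exists K, forall k, (K <= k)%N -> forall uw : E * V, forall q : nat * nat,
    cluster_at k (mid_set uw.1) q -> cluster_at k (star_set uw.2) q ->
    uw.2 = src uw.1 \/ uw.2 = tgt uw.1.
  apply: (@uniformly _ (fun uw k => forall q : nat * nat, cluster_at k (mid_set uw.1) q ->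
    cluster_at k (star_set uw.2) q -> uw.2 = src uw.1 \/ uw.2 = tgt uw.1)) => uw.
  by apply: cl; [exact: mid_compact|exact: star_compact|exact: mid_star].
exists (50 + K1 + K2 + K3)%N; split; first by lia.
- by move=> u w q; apply: (h1 _ _ (u, w)); lia.
- by move=> f g q; apply: (h2 _ _ (f, g)); lia.
- by move=> f u q; apply: (h3 _ _ (f, u)); lia.
Qed.

Lemma drawing_arcs (v0 : V) : (#|E| + 6 <= 3 * #|V| + 3 * t)%N.
Proof.
have [k [k50 dSS dMM dMS]] := scale_exists.
have idS (q q' : nat * nat) := @identified_sym k q q' k50.
pose S u := cluster_at k (star_set u); pose M f := cluster_at k (mid_set f).
have ne (A : set X) : (exists xi, A xi) -> exists q : nat * nat, cluster_at k A q.
  by move=> [xi Axi]; have [a' [b' s]] := star_exists xi k50; exists (a', b'), xi.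
have ne2 (A B : set X) : (exists xi, A xi /\ B xi) ->
    exists q : nat * nat, cluster_at k A q /\ cluster_at k B q.
  move=> [xi [Axi Bxi]]; have [a' [b' s]] := star_exists xi k50.
  by exists (a', b'); split; exists xi.
have S_ne u : exists q : nat * nat, S u q by apply: ne; exists (phi u); exists None.
have St u := cluster_tied k50 (@star_set_connected u).
have Sc u := @cluster_closed k (star_set u) k50.
have Mt f := cluster_tied k50 (@mid_connected f).
have Mc f := @cluster_closed k (mid_set f) k50.
have Ms f := ne2 _ _ (mid_src f); have Mtg f := ne2 _ _ (mid_tgt f).
pose BB := branch (grid_edge k) (identified k) src tgt S M.
pose B u a' b' := `[< BB u (a', b') >].
have Bgrid u (q : nat * nat) : BB u q -> in_grid k q.
  by case=> [/(cluster_in_grid k50)//|[f [_ [/(cluster_in_grid k50)]]]].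
have Bcl u := branch_closed (hard := grid_edge k) (src := src) (tgt := tgt) idS Sc Mc (u := u).
have Bti u := branch_tied idS St S_ne (src := src) (tgt := tgt) (M := M) (u := u).
have V0 : (0 < #|V|)%N by apply/card_gt0P; exists v0.
have k0 : (0 < k)%N by lia.
apply: (@grid_euler I (gN k) k (gx0 k) (gy0 k) xf k0 _ _ partner _ _ V E src tgt B t (theta k)) => //.
- by move=> i; exact: grid_inside.
- by move=> i j; exact: grid_apart.
- exact: grid_partner_x.
- by move=> i; exact: grid_partner_y.
- exact: arc_loopless.
- move=> f g fg; apply: arc_pair.
  have := finset.set21 (src f) (tgt f); have := finset.set22 (src f) (tgt f).
  rewrite fg !finset.in_set2 => /orP[/eqP t1|/eqP t1] /orP[/eqP s1|/eqP s1].
  + by have := arc_loopless f; rewrite s1 t1 eqxx.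
  + by right.
  + by left.
  + by have := arc_loopless f; rewrite s1 t1 eqxx.
- by move=> H V1 gl th; exact: theta_hole.
- by move=> H V1 p th h1 h2; exact: theta_rim th h1 h2.
- by move=> u x y /asboolP/Bgrid.
- by move=> u w x y /asboolP b1 /asboolP b2; exact: (branch_disjoint dSS dMM dMS b1 b2).
- move=> u i x y /asboolP b1 r; have g1 := Bgrid _ _ b1; apply/asboolP; apply: Bcl b1.
  split => //; split; last by left; exists i.
  by have [] := grim_le k50 (grim_glue k50 r).
- move=> u x y x' y' /asboolP b1 o o' g1 g2; have g := Bgrid _ _ b1.
  by apply/asboolP; apply: Bcl b1; split => //; split => //; right.
- by move=> u; have [[x y] s] := S_ne u; exists x, y; apply/asboolP; left.
- move=> u p hed hri hou x y x' y' /asboolP b1 /asboolP b2.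
  have co : compatible (grid_edge k) (identified k) (BB u) (fun q : nat * nat => p q.1 q.2).
    case=> [q1 q2] [q1' q2'] c1 c2 [[d vd qE]|[_ [_ [[i r qE]|[o o']]]]] /=.
    - move: (qE) (hed d q1 q2 vd) c2 => <- /= h c2.
      by apply: h; apply/asboolP.
    - by case: qE => -> ->; apply: hri => //; exact/asboolP.
    - by apply: hou => //; exact/asboolP.
  exact: (Bti u _ co (x, y) (x', y') b1 b2).
- move=> f; have [q [q' [[[d vd qE]|[d vd qE]] [b1 b2]]]] :=
    branch_edge idS Sc Mt dSS Ms Mtg arc_loopless f.
  + exists d, q.1, q.2; split => //; left; split; apply/asboolP; first by case: (q) b1.
    by move: b2; rewrite qE; case: (head _ _ _).
  + exists d, q'.1, q'.2; split => //; right; split; apply/asboolP; first by case: (q') b2.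
    by move: b1; rewrite qE; case: (head _ _ _).
Qed.

End Drawing.

Lemma embedded_arcs (V : finType) (a : rel V) : oriented_graph a ->
  embeddable R X (underlying a) -> (0 < #|V|)%N ->
  (#|{: {f : V * V | a f.1 f.2}}| + 6 <= 3 * #|V| + 3 * t)%N.
Proof.
move=> ao [phi [gamma [h1 h2 h3 h4 h5]]] /card_gt0P[v0 _].
exact: (drawing_arcs ao h1 h2 h3 h4 h5 v0).
Qed.

Lemma card_arcs (V : finType) (a : rel V) (A : {set V}) :
  arcs a A A = #|{: {f : {v : V | v \in A} * {v : V | v \in A} | a (val f.1) (val f.2)}}|.
Proof.
rewrite card_sig -sum1_card /arcs.
transitivity (\sum_(u : {v : V | v \in A}) \sum_(w : {v : V | v \in A}) (a (val u) (val w) : nat))%N.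
  rewrite big_sub; apply: eq_bigr => u _; exact: big_sub.
rewrite pair_bigA /= [RHS]big_mkcond /=; apply: eq_bigr => f _.
by rewrite inE; case: (a _ _).
Qed.

(** Every subgraph of an embedded graph is embedded, so the bound holds for each
    of them and the sparseness criterion applies. *)
Lemma surface_dicolourable : (3 * t <= 30)%N -> all_dicolourable R X 4.
Proof.
move=> t10 V a ao [phi [gamma [h1 h2 h3 h4 h5]]].
apply: (sparse_dicolourable ao) => A /finset.set0Pn[v0 v0A] _.
pose W : finType := {v : V | v \in A}; pose b : rel W := fun u w => a (val u) (val w).
have bo : oriented_graph b.
  by have [irr as2] := ao; split => [u|u w]; [exact: irr|exact: as2].
have emb : embeddable R X (underlying b).
  exists (phi \o val), (fun u w => gamma (val u) (val w)); split.
  - by move=> u w /h1/val_inj.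
  - by move=> u w; exact: h2.
  - by move=> u w; exact: h3.
  - by move=> u w z s uw s01; exact: h4 uw s01.
  - move=> u w u' w' s s' uw uw' i1 i2 g.
    by have [[/val_inj-> /val_inj->]|[/val_inj-> /val_inj->]] := h5 _ _ _ _ _ _ uw uw' i1 i2 g;
      [left|right].
have W0 : (0 < #|W|)%N by apply/card_gt0P; exists (exist _ v0 v0A).
have := embedded_arcs bo emb W0; rewrite -(card_arcs a A) card_sig.
have -> : #|[pred u | u \in A]| = #|A| by apply: eq_card.
by move: t10; clear; lia.
Qed.

End Count.
End Model.

(** * The two surfaces *)

Lemma path_sum (f : nat -> 'F_2) a n :
  \sum_(u < n) (f (a + u)%N + f (a + u).+1) = f a + f (a + n)%N.
Proof.
elim: n => [|n IHn]; first by rewrite big_ord0 addn0 addrr_F2.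
rewrite big_ord_recr /= IHn addnS -addrA; congr (_ + _).
by rewrite addrA addrr_F2 add0r.
Qed.

Lemma hole_curl_sub (I : finType) k (x0 y0 : I -> nat) (H V H' V' : nat -> nat -> 'F_2) i :
  hole_curl k x0 y0 (clear_hor k x0 y0 (fun a b => H a b - H' a b))
    (clear_ver k x0 y0 (fun a b => V a b - V' a b)) i =
  hole_curl k x0 y0 (clear_hor k x0 y0 H) (clear_ver k x0 y0 V) i -
  hole_curl k x0 y0 (clear_hor k x0 y0 H') (clear_ver k x0 y0 V') i.
Proof.
rewrite /hole_curl -sumrB; apply: eq_bigr => u _.
rewrite -sumrB; apply: eq_bigr => v _; rewrite /curl.
have hE a b : clear_hor k x0 y0 (fun a b => H a b - H' a b) a b =
    clear_hor k x0 y0 H a b - clear_hor k x0 y0 H' a b.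
  by rewrite /clear_hor; case: ifP => _; rewrite ?subr0.
have vE a b : clear_ver k x0 y0 (fun a b => V a b - V' a b) a b =
    clear_ver k x0 y0 V a b - clear_ver k x0 y0 V' a b.
  by rewrite /clear_ver; case: ifP => _; rewrite ?subr0.
by rewrite !hE !vE; ring.
Qed.

Section CrossCapSurface.
Variable R : realType.
Let cx (i : 'I_10) := (4 * i)%N.
Let cy (i : 'I_10) := 3%N.
Local Notation X := (nonorientable_surface R 10).
Local Notation ctr := (@crosscap_centre R 10).

(** The obstruction to a potential on the glued grid is measured, for each cross-cap,
    along half of its rim, from a corner to the antipodal one. *)
Let theta k (i : 'I_10) (H V : nat -> nat -> 'F_2) : 'F_2 :=
  \sum_(u < k + k) H (gx0 cx k i + u)%N (gy0 cy k i) +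
  \sum_(v < k + k) V (gx0 cx k i + (k + k))%N (gy0 cy k i + v)%N.

Let ctrE i : ctr i = ((cx i)%:R, (cy i)%:R - 3).
Proof. by rewrite /crosscap_centre /cx /cy natrM subrr. Qed.

Let cx_le i : (cx i <= 36)%N.
Proof. by rewrite /cx; have := ltn_ord i; lia. Qed.

Let cy_bd i : (0 < cy i <= 5)%N.
Proof. by []. Qed.

Let ctr_apart i j : i != j -> [|| (cx i + 4 <= cx j)%N, (cx j + 4 <= cx i)%N,
  (cy i + 4 <= cy j)%N | (cy j + 4 <= cy i)%N].
Proof. by rewrite -(inj_eq val_inj) /cx /= => ij; move: ij; clear; lia. Qed.

Let cx_partner i : cx (id i) = cx i. Proof. by []. Qed.
Let cy_partner i : (cy (id i) + cy i)%N = 6%N. Proof. by []. Qed.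

Let inside k i (k50 : (50 <= k)%N) := grid_inside cx_le cy_bd i k50.
Let apart k (k50 : (50 <= k)%N) i j := grid_apart ctr_apart (i := i) (j := j) k50.
Let mirror k i (k50 : (50 <= k)%N) := grid_partner_y cy_partner i k50.

Lemma crosscap_rim k H V (p : nat -> nat -> 'F_2) : (50 <= k)%N ->
  (forall i : 'I_10, theta k i H V = 0) ->
  (forall a b, (a < gN k)%N -> (b <= gN k)%N -> hor_valid k (gx0 cx k) (gy0 cy k) a b ->
     H a b = p a b + p a.+1 b) ->
  (forall a b, (a <= gN k)%N -> (b < gN k)%N -> ver_valid k (gx0 cx k) (gy0 cy k) a b ->
     V a b = p a b + p a b.+1) ->
  forall i, exists a b, on_rim k (gx0 cx k) (gy0 cy k) i a b /\
    p a b = p (glue_x k (gx0 cx k) true i a) (gN k - b)%N.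
Proof.
move=> k50 th hH hV i; have k0 : (0 < k)%N by apply: leq_trans k50.
have /and4P[_ i2 _ i4] := inside i k50; have mi := mirror i k50.
exists (gx0 cx k i), (gy0 cy k i); split; first by rewrite /on_rim !leqnn !leq_addr eqxx.
rewrite /glue_x (_ : _ + _ - _ = gx0 cx k i + (k + k))%N; last by rewrite -addnA addKn.
rewrite (_ : gN k - _ = gy0 cy k i + (k + k))%N; last by rewrite -mi addnK.
apply: add_eq0_F2; rewrite -(th i) /theta.
rewrite (eq_bigr (fun u : 'I_(k + k) => p (gx0 cx k i + u)%N (gy0 cy k i) +
  p (gx0 cx k i + u).+1 (gy0 cy k i))) => [|u _]; last first.
  apply: hH; [by have := ltn_ord u; move: i2; clear; lia|by move: i4; clear; lia|].
  apply: (hor_rim_valid k0 (apart k50) (i := i)).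
  by rewrite /hor_rim leq_addr ltn_add2l ltn_ord eqxx.
rewrite (path_sum (fun a => p a (gy0 cy k i))).
rewrite (eq_bigr (fun v : 'I_(k + k) => p (gx0 cx k i + (k + k))%N (gy0 cy k i + v)%N +
  p (gx0 cx k i + (k + k))%N (gy0 cy k i + v).+1)) => [|v _]; last first.
  apply: hV; [by move: i2; clear; lia|by have := ltn_ord v; move: i4; clear; lia|].
  apply: (ver_rim_valid k0 (apart k50) (i := i)).
  by rewrite /ver_rim leq_addr ltn_add2l ltn_ord eqxx orbT.
rewrite (path_sum (fun b => p (gx0 cx k i + (k + k))%N b)).
by rewrite -addrA (addrA (p (gx0 cx k i + _)%N _)) addrr_F2 add0r.
Qed.

Lemma crosscap_flip i p : 2 *: ctr i - p = flip cx true i p.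
Proof.
case: p => [x y]; rewrite /flip ctrE /cy /=; congr (_, _) => /=.
by rewrite subrr scaler0 sub0r.
Qed.

Lemma nonorientable_dicolourable : all_dicolourable R X 4.
Proof.
apply: (@surface_dicolourable R _ cx cy ctr true id ctrE cx_le cy_bd ctr_apart
  cx_partner cy_partner X (fun x => (\pi x)%qT : X) _ _ _ _ 10 theta) => //.
- by move=> xi; exists (repr xi); exact: reprK.
- move=> x y /eqmodP/asboolP[|[i [p [h1 h2 h3]]]]; first by left.
  by right; exists i, p; rewrite -crosscap_flip.
- move=> x y i p h1 h2 h3; apply/eqmodP/asboolP; right; exists i, p.
  by rewrite crosscap_flip.
- move=> k j H V H' V'; rewrite /theta !sumrB; ring.
- move=> k H V k50 gl _ i; have k0 : (0 < k)%N by apply: leq_trans k50.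
  apply: (hole_curl_crosscap (xf := true) k0 _ (apart k50) (partner := id) _ _ _ gl) => //.
    by move=> j; exact: inside.
  by move=> j; exact: mirror.
- by move=> k H V p k50 th h1 h2; exact: crosscap_rim th h1 h2.
Qed.

End CrossCapSurface.

Section HandleSurface.
Variable R : realType.
Local Notation I := ('I_5 * bool)%type.
Let cx (ib : I) := (4 * ib.1)%N.
Let cy (ib : I) := if ib.2 then 5%N else 1%N.
Let partner (ib : I) := (ib.1, ~~ ib.2).
Local Notation X := (orientable_surface R 5).
Local Notation ctr := (@handle_centre R 5).

(** Each handle carries two obstructions: the circulation around it, and the change
    of a potential through it, read along the segment that joins its two ends. *)
Let theta k (j : 'I_(5 + 5)) (H V : nat -> nat -> 'F_2) : 'F_2 :=
  match fintype.split j with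
  | inl i => hole_curl k (gx0 cx k) (gy0 cy k) (clear_hor k (gx0 cx k) (gy0 cy k) H)
      (clear_ver k (gx0 cx k) (gy0 cy k) V) (i, true)
  | inr i => \sum_(v < gy0 cy k (i, true) - (gN k - gy0 cy k (i, true)))
      V (gx0 cx k (i, true)) (gN k - gy0 cy k (i, true) + v)%N
  end.

Let ctrE i : ctr i = ((cx i)%:R, (cy i)%:R - 3).
Proof.
by case: i => [i b]; rewrite /handle_centre /cx /cy natrM; case: b => /=; congr (_, _); lra.
Qed.

Let cx_le i : (cx i <= 36)%N.
Proof. by rewrite /cx; have := ltn_ord i.1; lia. Qed.

Let cy_bd i : (0 < cy i <= 5)%N.
Proof. by rewrite /cy; case: ifP. Qed.

Let ctr_apart i j : i != j -> [|| (cx i + 4 <= cx j)%N, (cx j + 4 <= cx i)%N,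
  (cy i + 4 <= cy j)%N | (cy j + 4 <= cy i)%N].
Proof.
case: i j => [i b] [j c]; rewrite xpair_eqE /cx /cy -(inj_eq val_inj) /=.
by case: b c => [] [] /= ij; move: ij; clear; lia.
Qed.

Let cx_partner i : cx (partner i) = cx i. Proof. by []. Qed.
Let cy_partner i : (cy (partner i) + cy i)%N = 6%N.
Proof. by case: i => i []. Qed.

Let inside k i (k50 : (50 <= k)%N) := grid_inside cx_le cy_bd i k50.
Let apart k (k50 : (50 <= k)%N) i j := grid_apart ctr_apart (i := i) (j := j) k50.
Let mirror k i (k50 : (50 <= k)%N) := grid_partner_y cy_partner i k50.

Lemma handle_column k i b : (50 <= k)%N -> (gN k - gy0 cy k (i, true) <= b)%N ->
  (b < gy0 cy k (i, true))%N ->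
  ver_valid k (gx0 cx k) (gy0 cy k) (gx0 cx k (i, true)) b.
Proof.
move=> k50 b1 b2; apply/forallP => j; apply/negP; rewrite /ver_inner => h.
have k0 : (0 < k)%N by apply: leq_trans k50.
have [e|ne] := eqVneq i j.1.
  have xE : gx0 cx k (i, true) = gx0 cx k j by rewrite /gx0 /cx /= e.
  by move: h; rewrite xE ltnn.
have ap := apart k50 (i := (j.1, true)) (j := (i, true)).
have x1 : gx0 cx k (j.1, true) = gx0 cx k j by [].
have y1 : gy0 cy k (j.1, true) = gy0 cy k (i, true) by [].
have : (j.1, true) != (i, true) by rewrite xpair_eqE negb_and eq_sym ne.
move=> /ap; rewrite x1 y1; move/and4P: h => [h1 h2 _ _].
move: h1 h2; move: (gx0 cx k j) (gx0 cx k (i, true)) (gy0 cy k (i, true)) => c d d'.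
by clear; lia.
Qed.

Lemma handle_rim k H V (p : nat -> nat -> 'F_2) : (50 <= k)%N ->
  (forall j : 'I_(5 + 5), theta k j H V = 0) ->
  (forall a b, (a <= gN k)%N -> (b < gN k)%N -> ver_valid k (gx0 cx k) (gy0 cy k) a b ->
     V a b = p a b + p a b.+1) ->
  forall i, exists a b, on_rim k (gx0 cx k) (gy0 cy k) i a b /\
    p a b = p (glue_x k (gx0 cx k) false i a) (gN k - b)%N.
Proof.
move=> k50 th hV i; have k0 : (0 < k)%N by apply: leq_trans k50.
set up := (i.1, true); have /and4P[_ i2 _ i4] := inside up k50; have mi := mirror up k50.
have hy : (gN k - gy0 cy k up <= gy0 cy k up)%N.
  rewrite /gN /gy0 /cy /= -mulnDr leq_subLR -mulnDr leq_mul2l; lia.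
have pE : p (gx0 cx k up) (gN k - gy0 cy k up)%N = p (gx0 cx k up) (gy0 cy k up).
  apply: add_eq0_F2; rewrite -(th (rshift 5 i.1)) /theta.
  rewrite (unsplitK (inr i.1 : 'I_5 + 'I_5)).
  rewrite (eq_bigr (fun v : 'I_(gy0 cy k up - (gN k - gy0 cy k up)) =>
    p (gx0 cx k up) (gN k - gy0 cy k up + v)%N +
    p (gx0 cx k up) (gN k - gy0 cy k up + v).+1)) => [|v _]; last first.
    have vlt : (gN k - gy0 cy k up + v < gy0 cy k up)%N by have := ltn_ord v; move: hy; clear; lia.
    apply: hV.
    - by apply: leq_trans (ltnW i2); exact: leq_addr.
    - by apply: ltn_trans vlt _; apply: leq_ltn_trans i4; exact: leq_addr.
    by apply: handle_column => //; exact: leq_addr.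
  by rewrite (path_sum (p (gx0 cx k up))) subnKC.
case: i @up i2 i4 mi hy pE => i [] /= i2 i4 mi hy pE.
  exists (gx0 cx k (i, true)), (gy0 cy k (i, true)); split; last by rewrite /glue_x pE.
  by rewrite /on_rim !leqnn !leq_addr eqxx.
exists (gx0 cx k (i, true)), (gN k - gy0 cy k (i, true))%N; split; last first.
  rewrite /glue_x subKn; first exact: pE.
  by apply: leq_trans (ltnW i4); exact: leq_addr.
rewrite -mi addnK /partner /= /on_rim (_ : gx0 cx k (i, true) = gx0 cx k (i, false))//.
by rewrite !leqnn !leq_addr eqxx !orbT.
Qed.

Lemma orientable_dicolourable : all_dicolourable R X 4.
Proof.
apply: (@surface_dicolourable R _ cx cy ctr false partner ctrE cx_le cy_bd ctr_apart
  cx_partner cy_partner X (fun x => (\pi x)%qT : X) _ _ _ _ 10 theta) => //.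
- by move=> xi; exists (repr xi); exact: reprK.
- move=> x y /eqmodP/asboolP[|[i [p [h1 h2 h3]]]]; first by left.
  by right; exists i, p.
- move=> x y i p h1 h2 h3; apply/eqmodP/asboolP; right; exists i, p.
  by split.
- move=> k j H V H' V'; rewrite /theta; case: fintype.split => i; first exact: hole_curl_sub.
  by rewrite sumrB.
- move=> k H V k50 gl th i; have k0 : (0 < k)%N by apply: leq_trans k50.
  have up : hole_curl k (gx0 cx k) (gy0 cy k) (clear_hor k (gx0 cx k) (gy0 cy k) H)
      (clear_ver k (gx0 cx k) (gy0 cy k) V) (i.1, true) = 0.
    by rewrite -(th (lshift 5 i.1)) /theta (unsplitK (inl i.1 : 'I_5 + 'I_5)).
  case: i up => i [] //= up; rewrite -up.
  apply: (hole_curl_partner (xf := false) k0 _ (apart k50) (partner := partner) _ _ (i, true) _ gl) => //.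
    by move=> j; exact: inside.
  by move=> j; exact: mirror.
- by move=> k H V p k50 th _ h2; exact: handle_rim th h2.
Qed.

End HandleSurface.

(** * Arcs and drawings of complete graphs *)

Section Arcs.
Variables (R : realType) (X : topologicalType).
Implicit Types (x y z : X) (A B : set X).

(** A is the image of an arc from x to y; the parametrisation is continuous on the
    whole line, which makes arcs easy to concatenate. *)
Definition arc_image x y A : Prop := exists f : R -> X,
  [/\ continuous f, {in `[0, 1] &, injective f}, f 0 = x, f 1 = y & f @` `[0, 1] = A].

Lemma half_itv (t : R) : 0 <= t <= 1 -> t <= 1 / 2 -> 0 <= 2 * t <= 1.
Proof. by move=> /andP[? ?] ?; apply/andP; split; lra. Qed.

Lemma half_itv' (t : R) : 0 <= t <= 1 -> 1 / 2 < t -> 0 <= 2 * t - 1 <= 1.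
Proof. by move=> /andP[? ?] ?; apply/andP; split; lra. Qed.

Lemma arc_cat x y z A B : arc_image x y A -> arc_image y z B ->
  (forall xi, A xi -> B xi -> xi = y) -> arc_image x z (A `|` B).
Proof.
move=> [f [fc fi f0 f1 fA]] [g [gc gi g0 g1 gB]] AB.
have Af t : 0 <= t <= 1 -> A (f t) by move=> h; rewrite -fA; exists t; rewrite //= in_itv.
have Bg t : 0 <= t <= 1 -> B (g t) by move=> h; rewrite -gB; exists t; rewrite //= in_itv.
have e1 : 2 * (1 / 2) = 1 :> R by lra.
have e2 : (1 - 1 : R) = 0 by rewrite subrr.
pose h t := if t <= 1 / 2 then f (2 * t) else g (2 * t - 1).
have cross s t : 0 <= s <= 1 -> 0 <= t <= 1 -> s <= 1 / 2 -> 1 / 2 < t -> h s = h t -> False.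
  move=> s01 t01 s2 t2; rewrite /h s2 leNgt t2 /= => e.
  have a := half_itv s01 s2; have b := half_itv' t01 t2.
  have gy : g (2 * t - 1) = g 0 by rewrite g0; apply: AB (Bg _ b); rewrite -e; exact: Af.
  suff : 2 * t - 1 = 0 by lra.
  by apply: gi gy; rewrite in_itv //= lexx ler01.
exists h; split.
- have cf : continuous (fun t : R => f (2 * t)).
    by move=> t; apply: continuous_comp; [exact: mulrl_continuous|exact: fc].
  have cg : continuous (fun t : R => g (2 * t - 1)).
    move=> t; apply: continuous_comp; last exact: gc.
    by apply: continuousB; [exact: mulrl_continuous|exact: cst_continuous].
  suff : {within [set t | t <= 1 / 2] `|` [set t | 1 / 2 <= t], continuous h}.
    rewrite (_ : _ `|` _ = setT) => [|]; last first.
      by apply/seteqP; split => t //= _; case: (leP t (1 / 2)) => ?; [left|right; exact: ltW].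
    by move=> c; apply/continuous_subspace_setT.
  apply: withinU_continuous; [exact: closed_le|exact: closed_ge| |].
    apply: (@subspace_eq_continuous _ [set t : R | t <= 1 / 2] _ (fun t => f (2 * t)) h); last exact: continuous_subspaceT.
    by move=> t; rewrite inE /= /h => ->.
  apply: (@subspace_eq_continuous _ [set t : R | 1 / 2 <= t] _ (fun t => g (2 * t - 1)) h); last exact: continuous_subspaceT.
  move=> t; rewrite inE /= /h => t2; case: ifP => // t2'.
  have -> : t = 1 / 2 by apply/eqP; rewrite eq_le t2' t2.
  by rewrite e1 e2 f1 g0.
- move=> s t; rewrite !in_itv /= => s01 t01 e.
  have [s2|s2] := leP s (1 / 2); have [t2|t2] := leP t (1 / 2).
  + suff : 2 * s = 2 * t by lra.
    by apply: fi; [rewrite in_itv half_itv|rewrite in_itv half_itv|move: e; rewrite /h s2 t2].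
  + by case: (cross s t).
  + by case: (cross t s).
  + suff : 2 * s - 1 = 2 * t - 1 by lra.
    apply: gi; [by rewrite in_itv half_itv'|by rewrite in_itv half_itv'|].
    by move: e; rewrite /h !leNgt s2 t2.
- by rewrite /h mulr0 f0 ifT//; apply: divr_ge0.
- have e3 : 2 * 1 - 1 = 1 :> R by lra.
  by rewrite /h e3 g1 ifF//; apply/negbTE; rewrite -ltNge; lra.
- apply/seteqP; split => xi /=.
    move=> [t]; rewrite in_itv /= => t01 <-; rewrite /h; case: ifPn => t2.
      by left; apply: Af; exact: half_itv.
    by right; apply: Bg; apply: half_itv'; rewrite // ltNge.
  case; rewrite -?fA -?gB => -[t]; rewrite /= in_itv /= => /andP[t0 t1] <-.
    exists (t / 2); first by rewrite in_itv /=; apply/andP; split; lra.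
    by rewrite /h ifT; [congr f|]; lra.
  have [->|tN] := eqVneq t 0.
    exists (1 / 2); first by rewrite in_itv /=; apply/andP; split; lra.
    by rewrite /h lexx e1 f1 g0.
  have t0' : 0 < t by rewrite lt_neqAle eq_sym tN.
  exists ((t + 1) / 2); first by rewrite in_itv /=; apply/andP; split; lra.
  by rewrite /h ifF; [congr g; lra|apply/negbTE; rewrite -ltNge; lra].
Qed.

Section Complete.
Variables (n : nat) (phi : 'I_n -> X) (im : 'I_n -> 'I_n -> set X).
Hypothesis phi_inj : injective phi.
Hypothesis im_arc : forall u v : 'I_n, (u < v)%N -> arc_image (phi u) (phi v) (im u v).
Hypothesis im_off : forall u v w : 'I_n, (u < v)%N -> im u v (phi w) -> w = u \/ w = v.
Hypothesis im_cross : forall (u v u' v' : 'I_n) xi, (u < v)%N -> (u' < v')%N ->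
  (u, v) != (u', v') -> im u v xi -> im u' v' xi -> exists w, xi = phi w.

(** Only the images of the arcs matter: parametrisations can be chosen afterwards, and
    the arc from v to u is the reversed arc from u to v. *)
Lemma complete_embeddable (e : rel 'I_n) : irreflexive e -> embeddable R X e.
Proof.
move=> irr.
have ex (uv : 'I_n * 'I_n) : exists f : R -> X, (uv.1 < uv.2)%N ->
    [/\ continuous f, {in `[0, 1] &, injective f}, f 0 = phi uv.1, f 1 = phi uv.2 &
      f @` `[0, 1] = im uv.1 uv.2].
  have [lt|ge] := ltnP uv.1 uv.2; last by exists (fun=> phi uv.1).
  by have [f hf] := im_arc lt; exists f.
have [F hF] := choice ex.
pose gamma (u v : 'I_n) (t : R) := if (u < v)%N then F (u, v) t else F (v, u) (1 - t).
have e_neq u v : e u v -> (u < v)%N \/ (v < u)%N.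
  move=> uv; have : u != v by apply: contraTneq uv => ->; rewrite irr.
  by rewrite -(inj_eq val_inj) neq_ltn => /orP.
have gl (u v : 'I_n) t : (u < v)%N -> gamma u v t = F (u, v) t by rewrite /gamma => ->.
have gr (u v : 'I_n) t : (v < u)%N -> gamma u v t = F (v, u) (1 - t).
  by move=> vu; rewrite /gamma ltnNge ltnW.
have inner (u v : 'I_n) t w : (u < v)%N -> t \in `]0, 1[ -> F (u, v) t <> phi w.
  move=> uv t01 e1; have [_ inj f0 f1 fi] := hF (u, v) uv.
  have t01' : t \in `[0, 1] by apply: subset_itv_oo_cc.
  have : im u v (phi w) by rewrite -e1 -fi; exists t.
  move=> /(im_off uv)[wE|wE]; subst w.
    have : t = 0 by apply: inj; rewrite // ?e1 ?f0// in_itv /= lexx ler01.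
    by move: t01; rewrite in_itv /= => /andP[? _]; lra.
  have : t = 1 by apply: inj; rewrite // ?e1 ?f1// in_itv /= lexx ler01.
  by move: t01; rewrite in_itv /= => /andP[_ ?]; lra.
have flip01 (t : R) : t \in `]0, 1[ -> 1 - t \in `]0, 1[.
  by rewrite !in_itv /= => /andP[? ?]; apply/andP; split; lra.
have norm u v t : e u v -> t \in `]0, 1[ -> exists (u' v' : 'I_n) (t' : R),
    [/\ (u' < v')%N, t' \in `]0, 1[, gamma u v t = F (u', v') t' &
      (u' = u /\ v' = v) \/ (u' = v /\ v' = u)].
  move=> /e_neq[uv|vu] t01.
    by exists u, v, t; split => //; [rewrite gl|left].
  by exists v, u, (1 - t); split => //; [exact: flip01|rewrite gr|right].
exists phi, gamma; split => //.
- move=> u v /e_neq[uv|vu].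
    have [c inj f0 f1 _] := hF (u, v) uv.
    by rewrite (_ : gamma u v = F (u, v)); [split => //; exact: continuous_subspaceT|
      apply/funext => t; rewrite gl].
  have [c inj f0 f1 _] := hF (v, u) vu.
  rewrite (_ : gamma u v = fun t => F (v, u) (1 - t)); last by apply/funext => t; rewrite gr.
  split; rewrite ?subr0 ?subrr//.
    apply: continuous_subspaceT => t; apply: continuous_comp; last exact: c.
    by apply: continuousB; [exact: cst_continuous|].
  move=> s t; rewrite !in_itv /= => /andP[s0 s1] /andP[t0 t1] h.
  suff : 1 - s = 1 - t by lra.
  by apply: inj h; rewrite in_itv /=; apply/andP; split; lra.
- move=> u v t uv _; have [lt|lt] := e_neq _ _ uv; first by rewrite (gl u v)// (gr v u).
  by rewrite (gl v u)// (gr u v)// subKr.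
- by move=> u v w t uv /(norm _ _ _ uv)[u' [v' [t' [lt t01 -> _]]]]; exact: inner.
- move=> u v u' v' s t uv uv' /(norm _ _ _ uv)[x [y [s' [xy s01 -> hxy]]]].
  move=> /(norm _ _ _ uv')[x' [y' [t' [xy' t01 -> hxy']]]] h.
  have [[ex1 ey]|ne] := eqVneq (x, y) (x', y'); last first.
    have [_ _ _ _ fi] := hF (x, y) xy; have [_ _ _ _ fi'] := hF (x', y') xy'.
    have i1 : im x y (F (x, y) s') by rewrite -fi; exists s' => //; exact: subset_itv_oo_cc.
    have i2 : im x' y' (F (x, y) s') by rewrite h -fi'; exists t' => //; exact: subset_itv_oo_cc.
    by have [w ww] := im_cross xy xy' ne i1 i2; case: (inner _ _ _ _ xy s01 ww).
  by subst x' y'; case: hxy hxy' => -[? ?] [] [? ?]; subst; auto.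
Qed.

End Complete.
End Arcs.

(** ** Polygonal drawings with integer coordinates *)

Section IntegerChecks.
Local Open Scope Z_scope.
Notation point := (Z * Z)%type.
Notation segment := (point * point)%type.
Variables (D : Z) (xf : bool) (hs : seq point).
Implicit Types (o a b c z : point) (s : segment).

Definition zcross o a b : Z := (a.1 - o.1) * (b.2 - o.2) - (a.2 - o.2) * (b.1 - o.1).

(* Conditionals instead of boolean connectives: the evaluation by value of the
   latter would compute every alternative. *)
Definition apart_1d (a b c d : Z) : bool :=
  if a <? c then if a <? d then if b <? c then b <? d else false else false
  else if c <? a then if c <? b then if d <? a then d <? b else false else false
  else false.

Definition one_side a b c d : bool :=
  let x := zcross a b c in
  if 0 <? x then 0 <? zcross a b d else if x <? 0 then zcross a b d <? 0 else false.

(** Sufficient for two segments to meet at most in a common end. *)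
Definition pair_ok s s' : bool :=
  let: (a, b) := s in let: (c, d) := s' in
  if apart_1d a.1 b.1 c.1 d.1 then true else
  if apart_1d a.2 b.2 c.2 d.2 then true else
  if a == c then zcross a b d != 0 else
  if a == d then zcross a b c != 0 else
  if b == c then zcross b a d != 0 else
  if b == d then zcross b a c != 0 else
  if one_side a b c d then true else one_side c d a b.

(** Sufficient for the inner points of a segment to lie strictly outside the closed
    disc around c, and for its ends to lie outside the open disc. *)
Definition disc_ok s c : bool :=
  let: (a, b) := s in
  if (if c.1 + D <? a.1 then c.1 + D <? b.1 else false) then true else
  if (if a.1 <? c.1 - D then b.1 <? c.1 - D else false) then true else
  if (if c.2 + D <? a.2 then c.2 + D <? b.2 else false) then true else
  if (if a.2 <? c.2 - D then b.2 <? c.2 - D else false) then true else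
  let ax := a.1 - c.1 in let ay := a.2 - c.2 in
  let bx := b.1 - c.1 in let bye := b.2 - c.2 in
  let dx := bx - ax in let dy := bye - ay in
  let A := ax * ax + ay * ay - D * D in let B := bx * bx + bye * bye - D * D in
  let da := ax * dx + ay * dy in let db := bx * dx + bye * dy in
  let x := ax * dy - ay * dx in
  if (if 0 <=? A then 0 <? da else false) then true else
  if (if 0 <=? B then db <? 0 else false) then true else
  (0 <? A) && (0 <? B) && (D * D * (dx * dx + dy * dy) <? x * x).

Definition on_circle z c : bool :=
  (z.1 - c.1) * (z.1 - c.1) + (z.2 - c.2) * (z.2 - c.2) == D * D.

Definition zflip c z : point := (if xf then 2 * c.1 - z.1 else z.1, - z.2).

Definition lexle a b : bool := (a.1 <? b.1) || ((a.1 =? b.1) && (a.2 <=? b.2)).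

(** A representative of the one or two lattice points that give the same point of
    the surface. *)
Definition canon z : point :=
  if [seq c <- hs | on_circle z c] is c :: _ then
    let z' := zflip c z in if lexle z z' then z else z'
  else z.

Definition seg_ok s : bool := all (disc_ok s) hs.

Fixpoint chain c (l : seq segment) : bool :=
  if l is s :: l' then (canon s.1 == c) && chain (canon s.2) l' else true.

Definition ends (l : seq segment) : seq point := [seq canon s.2 | s <- l].

Definition coord (h : bool) z : Z := if h then z.1 else z.2.
Definition low h m s : bool := (coord h s.1 <=? m) || (coord h s.2 <=? m).
Definition high h m s : bool := (m <=? coord h s.1) || (m <=? coord h s.2).

(** All pairs of a list of segments are checked after recursive cuts by lines
    parallel to the axes; a pair that a line separates needs no test. *)
Fixpoint pairs_ok (n : nat) (h : bool) (l : seq segment) : bool :=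
  if n is n'.+1 then
    if (size l <= 25)%N then pairwise pair_ok l else
    let m := Z.div (foldr (fun s x => coord h s.1 + x) 0 l) (Z.of_nat (size l)) in
    pairs_ok n' (~~ h) (seq.filter (low h m) l) && pairs_ok n' (~~ h) (seq.filter (high h m) l)
  else pairwise pair_ok l.

Lemma pairwise_cover (T : eqType) (r : rel T) (P Q : pred T) (l : seq T) :
  (forall x y, ~~ (P x && P y) -> ~~ (Q x && Q y) -> r x y) ->
  pairwise r (seq.filter P l) -> pairwise r (seq.filter Q l) -> pairwise r l.
Proof.
move=> PQ; elim: l => //= x l IHl hP hQ.
have [hp hq] : pairwise r (seq.filter P l) /\ pairwise r (seq.filter Q l).
  by move: hP hQ; case: (P x); case: (Q x) => /=; do ?[move=> /andP[_ ->]|move=> ->].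
rewrite IHl// andbT; apply/allP => y yl.
have [pp|pp] := boolP (P x && P y).
  move: hP; case/andP: pp => -> Py /= /andP[/allP h _]; apply: h.
  by rewrite mem_filter Py.
have [qq|qq] := boolP (Q x && Q y).
  move: hQ; case/andP: qq => -> Qy /= /andP[/allP h _]; apply: h.
  by rewrite mem_filter Qy.
exact: PQ.
Qed.

Lemma pairs_okP n h l : pairs_ok n h l -> pairwise pair_ok l.
Proof.
elim: n h l => [//|n IHn] h l /=; case: ifP => // _.
move: (Z.div _ _) => m /andP[/IHn h1 /IHn h2]; apply: pairwise_cover h1 h2.
move=> [a b] [c d]; rewrite /low /high /= => h1 h2.
have ap : apart_1d (coord h a) (coord h b) (coord h c) (coord h d).
  move: h1 h2; rewrite /apart_1d.
  move: (coord h a) (coord h b) (coord h c) (coord h d) => p q r t; clear => h1 h2.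
  by do ![case: ifP => ?]; lia.
have {ap} [e|e] : apart_1d a.1 b.1 c.1 d.1 \/ apart_1d a.2 b.2 c.2 d.2.
- by move: ap; rewrite /coord; case: (h) => ap; [left|right].
- by rewrite /pair_ok e.
- by rewrite /pair_ok e; case: ifP.
Qed.

Definition vertex (vs : seq point) u : point := canon (nth (0, 0) vs u).

Definition inner_nodes (l : seq segment) : seq point := take (size l).-1 (ends l).

(** Vertices and inner nodes have to be distinct even after the gluing. Together with
    the local conditions on pairs of segments this makes the edges simple arcs that
    meet only in common ends. *)
Definition drawing_ok (n : nat) (vs : seq point) (es : seq ((nat * nat) * seq segment)) : bool :=
  [&& uniq (map fst es),
      all (fun v => all (fun u => (u, v) \in map fst es) (iota 0 v)) (iota 0 n),
      all (fun e => [&& e.2 != [::], (e.1.1 < e.1.2)%N, (e.1.2 < n)%N,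
        chain (vertex vs e.1.1) e.2 &
        last (vertex vs e.1.1) (ends e.2) == vertex vs e.1.2]) es,
      all seg_ok (flatten (map snd es)),
      pairs_ok 6 true (flatten (map snd es)) &
      uniq (map (vertex vs) (iota 0 n) ++ flatten (map (fun e => inner_nodes e.2) es))].

End IntegerChecks.

(** The segments of an edge that is given by the polygonal lines it follows between
    the circles it passes through. *)
Definition segments (l : seq (seq (Z * Z))) : seq ((Z * Z) * (Z * Z)) :=
  flatten [seq zip p (behead p) | p <- l].

Definition edge_segments (es : seq ((nat * nat) * seq (seq (Z * Z)))) :=
  [seq (e.1, segments e.2) | e <- es].

Section LatticeDrawings.
Variables (R : realType) (I : finType) (ctr : I -> R * R) (flip : I -> R * R -> R * R).
Variables (X : topologicalType) (proj : set_type (holed_sphere ctr) -> X).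
Hypothesis proj_continuous : continuous proj.
Hypothesis proj_fib : forall x y, proj x = proj y -> x = y \/
  exists i p, [/\ sqdist (ctr i) p = 1, val x = Some p & val y = Some (flip i p)].
Hypothesis proj_glue : forall x y i p, sqdist (ctr i) p = 1 ->
  val x = Some p -> val y = Some (flip i p) -> proj x = proj y.
Hypothesis disc_apart : forall i j p, sqdist (ctr i) p <= 1 -> sqdist (ctr j) p <= 1 -> i = j.
Variable partner : I -> I.
Hypothesis sqdist_flip : forall i p, sqdist (ctr i) p = 1 ->
  sqdist (ctr (partner i)) (flip i p) = 1.
Variables (D : Z) (xf : bool) (hs : seq (Z * Z)) (hole : I -> Z * Z).
Hypothesis D_gt0 : Z.lt 0 D.
Hypothesis hsP : forall c, c \in hs <-> exists i, c = hole i.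

Definition zr (x : Z) : R := (int_of_Z x)%:~R.
Definition pt (z : Z * Z) : R * R := (zr z.1 / zr D, zr z.2 / zr D).

Hypothesis holeE : forall i, ctr i = pt (hole i).
Hypothesis flipE : forall i z, pt (zflip xf (hole i) z) = flip i (pt z).
Hypothesis zflipK : forall i z, zflip xf (hole (partner i)) (zflip xf (hole i) z) = z.

Lemma zrD x y : zr (Z.add x y) = zr x + zr y.
Proof. by rewrite /zr -[Z.add x y]/(x + y) rmorphD rmorphD. Qed.
Lemma zrN x : zr (Z.opp x) = - zr x.
Proof. by rewrite /zr -[Z.opp x]/(- x) !rmorphN. Qed.
Lemma zrB x y : zr (Z.sub x y) = zr x - zr y.
Proof. by rewrite -Z.add_opp_r zrD zrN. Qed.
Lemma zrM x y : zr (Z.mul x y) = zr x * zr y.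
Proof. by rewrite /zr -[Z.mul x y]/(x * y) !rmorphM. Qed.

Lemma zr_lt x y : Z.ltb x y = (zr x < zr y).
Proof.
rewrite /zr ltr_int; apply/idP/idP; last first.
  by move=> h; lia.
by move=> h; lia.
Qed.

Lemma zr_le x y : Z.leb x y = (zr x <= zr y).
Proof. by rewrite -[RHS]negbK -ltNge -zr_lt Z.ltb_antisym negbK. Qed.

Lemma zr_inj : injective zr.
Proof.
by move=> x y e; apply/eqP; rewrite eq_le; apply/andP; split;
  [change (Z.leb x y)|change (Z.leb y x)]; rewrite zr_le e.
Qed.

Let zrE := (zrD, zrN, zrB, zrM).

Lemma zrD_gt0 : 0 < zr D.
Proof. by rewrite -[0]/(zr 0) -zr_lt; apply/Z.ltb_spec0. Qed.

Lemma zrD_neq0 : zr D != 0.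
Proof. by rewrite gt_eqF// zrD_gt0. Qed.

Lemma pt_inj : injective pt.
Proof.
move=> [x1 x2] [y1 y2] [/(divIf zrD_neq0)/zr_inj -> /(divIf zrD_neq0)/zr_inj ->].
by [].
Qed.

(** ** The geometric content of the checks *)

Definition pos (s : (Z * Z) * (Z * Z)) (t : R) : R * R :=
  ((zr s.1.1 + t * (zr s.2.1 - zr s.1.1)) / zr D, (zr s.1.2 + t * (zr s.2.2 - zr s.1.2)) / zr D).

Lemma pos0 s : pos s 0 = pt s.1. Proof. by rewrite /pos !mul0r !addr0. Qed.
Lemma pos1 s : pos s 1 = pt s.2. 
Proof. by rewrite /pos !mul1r; congr (_, _); congr (_ / _); rewrite addrC subrK. Qed.

Definition rnd_pt (p : R * R) := forall i, 1 <= sqdist (ctr i) p.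

Lemma conic (a b c d t : R) : 0 <= t <= 1 ->
  (a < c /\ a < d -> a < c + t * (d - c)) /\ (c < a /\ d < a -> c + t * (d - c) < a).
Proof.
move=> /andP[t0 t1]; split=> -[h1 h2].
  have : 0 <= t * (d - a) by rewrite mulr_ge0//; lra.
  have : 0 <= (1 - t) * (c - a) by rewrite mulr_ge0//; lra.
  have [->|tN] := eqVneq t 0; first by lra.
  have tp : 0 < t by rewrite lt_neqAle eq_sym tN.
  have : 0 < t * (d - a) by rewrite mulr_gt0//; lra.
  by lra.
have : 0 <= t * (a - d) by rewrite mulr_ge0//; lra.
have : 0 <= (1 - t) * (a - c) by rewrite mulr_ge0//; lra.
have [->|tN] := eqVneq t 0; first by lra.
have tp : 0 < t by rewrite lt_neqAle eq_sym tN.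
have : 0 < t * (a - d) by rewrite mulr_gt0//; lra.
by lra.
Qed.

Lemma apart_1dP (a b c d : Z) (t t' : R) : 0 <= t <= 1 -> 0 <= t' <= 1 -> apart_1d a b c d ->
  zr a + t * (zr b - zr a) <> zr c + t' * (zr d - zr c).
Proof.
move=> t01 t01'; rewrite /apart_1d !zr_lt => h e; move: h.
have [h1 h2] := conic (zr c) 0 (zr a) (zr b) t01.
have [h3 h4] := conic (zr d) 0 (zr a) (zr b) t01.
have [h5 h6] := conic (zr a + t * (zr b - zr a)) 0 (zr c) (zr d) t01'.
case: ifP => ac.
  case: ifP => // ad; case: ifP => // bc bd.
  have l1 := h2 (conj ac bc); have l2 := h4 (conj ad bd); have := h5 (conj l1 l2).
  by rewrite e ltxx.
case: ifP => // ca; case: ifP => // cb; case: ifP => // da db.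
have l1 := h1 (conj ca cb); have l2 := h3 (conj da db); have := h6 (conj l1 l2).
by rewrite e ltxx.
Qed.

Definition rcross (o a b : R * R) : R := (a.1 - o.1) * (b.2 - o.2) - (a.2 - o.2) * (b.1 - o.1).
Definition rz (z : Z * Z) : R * R := (zr z.1, zr z.2).

Lemma zcrossE o a b : zr (zcross o a b) = rcross (rz o) (rz a) (rz b).
Proof. by rewrite /zcross /rcross !zrE. Qed.

Lemma one_sideP a b c d (t t' : R) : 0 <= t' <= 1 -> one_side a b c d ->
  zr a.1 + t * (zr b.1 - zr a.1) = zr c.1 + t' * (zr d.1 - zr c.1) ->
  zr a.2 + t * (zr b.2 - zr a.2) = zr c.2 + t' * (zr d.2 - zr c.2) -> False.
Proof.
rewrite /one_side !zr_lt !zcrossE -[zr 0]/(0 : R) => t01 h e1 e2; move: h.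
have z : rcross (rz a) (rz b) (rz c) +
    t' * (rcross (rz a) (rz b) (rz d) - rcross (rz a) (rz b) (rz c)) = 0.
  transitivity ((zr b.1 - zr a.1) * ((zr c.2 + t' * (zr d.2 - zr c.2)) - zr a.2) -
    (zr b.2 - zr a.2) * ((zr c.1 + t' * (zr d.1 - zr c.1)) - zr a.1)).
    by rewrite /rcross /rz /=; ring.
  by rewrite -e1 -e2; ring.
have [h1 h2] := conic 0 0 (rcross (rz a) (rz b) (rz c)) (rcross (rz a) (rz b) (rz d)) t01.
case: ifP => [x y|_]; first by have := h1 (conj x y); rewrite z ltxx.
by case: ifP => // x y; have := h2 (conj x y); rewrite z ltxx.
Qed.

Lemma shared_end a b d (t t' : R) : zcross a b d != Z0 ->
  t * (zr b.1 - zr a.1) = t' * (zr d.1 - zr a.1) ->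
  t * (zr b.2 - zr a.2) = t' * (zr d.2 - zr a.2) -> t' = 0.
Proof.
move=> ne e1 e2; have : t' * rcross (rz a) (rz b) (rz d) = 0.
  transitivity ((zr b.1 - zr a.1) * (t' * (zr d.2 - zr a.2)) -
    (zr b.2 - zr a.2) * (t' * (zr d.1 - zr a.1))); first by rewrite /rcross /rz /=; ring.
  by rewrite -e1 -e2; ring.
move=> /eqP; rewrite mulf_eq0 => /orP[/eqP//|].
by rewrite -zcrossE -[0 : R]/(zr 0) => /eqP/zr_inj e; rewrite e eqxx in ne.
Qed.

Lemma pair_okP s s' (t t' : R) : 0 <= t <= 1 -> 0 <= t' <= 1 -> pair_ok s s' ->
  pos s t = pos s' t' -> exists z, [/\ z \in [:: s.1; s.2], z \in [:: s'.1; s'.2] & pos s t = pt z].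
Proof.
case: s s' => [a b] [c d] t01 t01' ok posE.
have [e1 e2] : zr a.1 + t * (zr b.1 - zr a.1) = zr c.1 + t' * (zr d.1 - zr c.1) /\
    zr a.2 + t * (zr b.2 - zr a.2) = zr c.2 + t' * (zr d.2 - zr c.2).
  by case: posE => /(divIf zrD_neq0) /= -> /(divIf zrD_neq0) /= ->.
move: ok; rewrite /pair_ok; case: ifP => [/(apart_1dP t01 t01') //|_].
case: ifP => [/(apart_1dP t01 t01') //|_]; rewrite /= posE.
have mem (x y u v : Z * Z) : x \in [:: u; v] -> x \in [:: x; y].
  by rewrite !inE eqxx.
case: eqP => [ac|_].
  subst c => ne; have t0 : t' = 0 by apply: (shared_end ne (t := t)); lra.
  by exists a; rewrite t0 pos0 !inE !eqxx.
case: eqP => [ad|_].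
  subst d => ne; have t0 : 1 - t' = 0 by apply: (shared_end ne (t := t)); lra.
  by exists a; rewrite (_ : t' = 1) ?pos1 ?inE ?eqxx ?orbT//; lra.
case: eqP => [bc|_].
  subst c => ne; have t0 : t' = 0 by apply: (shared_end ne (t := 1 - t)); lra.
  by exists b; rewrite t0 pos0 !inE !eqxx ?orbT.
case: eqP => [bd|_].
  subst d => ne; have t0 : 1 - t' = 0 by apply: (shared_end ne (t := 1 - t)); lra.
  by exists b; rewrite (_ : t' = 1) ?pos1 ?inE ?eqxx ?orbT//; lra.
case: ifP => [o _|_ o]; first by case: (one_sideP t01' o e1 e2).
by case: (one_sideP t01 o (esym e1) (esym e2)).
Qed.

Lemma sqdist_pos i s t : zr D ^+ 2 * sqdist (ctr i) (pos s t) =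
  (zr s.1.1 + t * (zr s.2.1 - zr s.1.1) - zr (hole i).1) ^+ 2 +
  (zr s.1.2 + t * (zr s.2.2 - zr s.1.2) - zr (hole i).2) ^+ 2.
Proof. by rewrite holeE /sqdist /pos /pt /=; field; exact: zrD_neq0. Qed.

Lemma disc_okP i s t : disc_ok D s (hole i) -> 0 <= t <= 1 ->
  1 <= sqdist (ctr i) (pos s t) /\ (sqdist (ctr i) (pos s t) = 1 -> t = 0 \/ t = 1).
Proof.
move=> ok t01; have D0 := zrD_gt0; have D2 : 0 < zr D ^+ 2 by rewrite exprn_gt0.
suff : zr D ^+ 2 <= zr D ^+ 2 * sqdist (ctr i) (pos s t) /\
    (zr D ^+ 2 * sqdist (ctr i) (pos s t) = zr D ^+ 2 -> t = 0 \/ t = 1).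
  move=> [h1 h2]; split; first by rewrite -(ler_pM2l D2) mulr1.
  by move=> e; apply: h2; rewrite e mulr1.
rewrite sqdist_pos; case: s (hole i) ok => [a b] c.
rewrite /disc_ok !zr_lt !zr_le !zrE -[zr 0]/(0 : R) /=.
move: (zr D) (zr a.1) (zr a.2) (zr b.1) (zr b.2) (zr c.1) (zr c.2) D0 D2 =>
  r a1 a2 b1 b2 c1 c2 r0 r2.
have far (u v : R) : r < u \/ u < - r ->
    r ^+ 2 <= u ^+ 2 + v ^+ 2 /\ (u ^+ 2 + v ^+ 2 = r ^+ 2 -> t = 0 \/ t = 1).
  move=> h; have v2 := sqr_ge0 v; suff : r ^+ 2 < u ^+ 2.
    by move=> lt; split; [lra|move=> e; exfalso; lra].
  case: h => h; first by rewrite ltr_pXn2r ?nnegrE//; lra.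
  by rewrite -(sqrrN u) ltr_pXn2r ?nnegrE//; lra.
have [x1 x2] := conic (c1 + r) 0 a1 b1 t01; have [y1 y2] := conic (c2 + r) 0 a2 b2 t01.
have [x3 x4] := conic (c1 - r) 0 a1 b1 t01; have [y3 y4] := conic (c2 - r) 0 a2 b2 t01.
case: ifP => [h _|_].
  by apply: far; left; move: h; case: ifP => // h1 h2; have := x1 (conj h1 h2); lra.
case: ifP => [h _|_].
  by apply: far; right; move: h; case: ifP => // h1 h2; have := x4 (conj h1 h2); lra.
case: ifP => [h _|_].
  rewrite (addrC (_ ^+ 2)); apply: far; left; move: h; case: ifP => // h1 h2.
  by have := y1 (conj h1 h2); lra.
case: ifP => [h _|_].
  rewrite (addrC (_ ^+ 2)); apply: far; right; move: h; case: ifP => // h1 h2.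
  by have := y4 (conj h1 h2); lra.
clear far x1 x2 x3 x4 y1 y2 y3 y4.
set ax := a1 - c1; set ay := a2 - c2; set dx := b1 - c1 - ax; set dy := b2 - c2 - ay.
have qE : (a1 + t * (b1 - a1) - c1) ^+ 2 + (a2 + t * (b2 - a2) - c2) ^+ 2 =
    ax ^+ 2 + ay ^+ 2 + 2 * t * (ax * dx + ay * dy) + t ^+ 2 * (dx ^+ 2 + dy ^+ 2).
  by rewrite /dx /dy /ax /ay; ring.
have qE' : (a1 + t * (b1 - a1) - c1) ^+ 2 + (a2 + t * (b2 - a2) - c2) ^+ 2 =
    (b1 - c1) ^+ 2 + (b2 - c2) ^+ 2 - 2 * (1 - t) * ((b1 - c1) * dx + (b2 - c2) * dy) +
    (1 - t) ^+ 2 * (dx ^+ 2 + dy ^+ 2).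
  by rewrite /dx /dy /ax /ay; ring.
have L0 : 0 <= dx ^+ 2 + dy ^+ 2 by rewrite addr_ge0 ?sqr_ge0.
move: t01 => /andP[t0 t1].
case: ifP => [h _|_].
  have {h} [hA hd] : 0 <= ax * ax + ay * ay - r * r /\ 0 < ax * dx + ay * dy by move: h; case: ifP.
  have tt : 0 <= t ^+ 2 * (dx ^+ 2 + dy ^+ 2) by rewrite mulr_ge0 ?sqr_ge0.
  have td : 0 <= t * (ax * dx + ay * dy) by rewrite mulr_ge0// ltW.
  rewrite qE; split; first by rewrite !expr2; move: tt; rewrite !expr2; lra.
  move=> e; left; have : t * (ax * dx + ay * dy) = 0.
    by move: e tt; rewrite !expr2; lra.
  by move=> /eqP; rewrite mulf_eq0 (gt_eqF hd) orbF => /eqP.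
case: ifP => [h _|_].
  have {h} [hB hd] : 0 <= (b1 - c1) * (b1 - c1) + (b2 - c2) * (b2 - c2) - r * r /\
      (b1 - c1) * dx + (b2 - c2) * dy < 0 by move: h; case: ifP.
  have tt : 0 <= (1 - t) ^+ 2 * (dx ^+ 2 + dy ^+ 2) by rewrite mulr_ge0 ?sqr_ge0.
  have td : 0 <= (1 - t) * - ((b1 - c1) * dx + (b2 - c2) * dy) by rewrite mulr_ge0//; lra.
  rewrite qE'; split; first by rewrite !expr2; move: tt; rewrite !expr2; lra.
  move=> e; right; have : (1 - t) * ((b1 - c1) * dx + (b2 - c2) * dy) = 0.
    by move: e tt; rewrite !expr2; lra.
  by move=> /eqP; rewrite mulf_eq0 (lt_eqF hd) orbF => /eqP; lra.
move=> /andP[/andP[hA hB] hx].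
have L1 : 0 < dx ^+ 2 + dy ^+ 2.
  rewrite lt_neqAle L0 andbT eq_sym; apply/eqP => z.
  have : dx = 0 /\ dy = 0.
    by move/eqP: z; rewrite paddr_eq0 ?sqr_ge0// !sqrf_eq0 => /andP[/eqP-> /eqP->].
  by move=> [z1 z2]; move: hx; rewrite z1 z2; lra.
suff lt : r ^+ 2 < (a1 + t * (b1 - a1) - c1) ^+ 2 + (a2 + t * (b2 - a2) - c2) ^+ 2.
  by split; [exact: ltW|move=> e; rewrite e ltxx in lt].
rewrite -(ltr_pM2r L1); apply: lt_le_trans (_ : (ax * dy - ay * dx) ^+ 2 <= _).
  by move: hx; rewrite !expr2; lra.
rewrite qE; set g := ax * dx + ay * dy; set L := dx ^+ 2 + dy ^+ 2.
have -> : (ax * dy - ay * dx) ^+ 2 = (ax ^+ 2 + ay ^+ 2) * L - g ^+ 2 by rewrite /g /L; ring.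
have := sqr_ge0 (g + t * L); rewrite !expr2; lra.
Qed.

(** ** Points of the surface *)

Lemma holedP p : holed_sphere ctr (Some p) <-> rnd_pt p.
Proof.
split=> [h i|h [i _ [q] /=]].
  by rewrite leNgt; apply/negP => lt1; apply: h; exists i => //; exists p.
by move=> lt1 [qp]; have := h i; rewrite leNgt -qp lt1.
Qed.

Lemma infinity_holed : holed_sphere ctr None.
Proof. by move=> [i _ [q]]. Qed.

Definition place (p : R * R) : X :=
  match pselect (holed_sphere ctr (Some p)) with
  | left h => proj (SigSub (mem_set h))
  | right _ => proj (SigSub (mem_set infinity_holed))
  end.

Lemma placeE p : rnd_pt p -> exists2 x, val x = Some p & place p = proj x.
Proof.
move=> /holedP h; rewrite /place; case: pselect => // h'.
by exists (SigSub (mem_set h')).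
Qed.

Lemma rnd_pt_flip i p : sqdist (ctr i) p = 1 -> rnd_pt (flip i p).
Proof.
move=> e j; rewrite leNgt; apply/negP => lt1; have e' := sqdist_flip e.
have ij : partner i = j by apply: (disc_apart (p := flip i p)); rewrite ?e' // ltW.
by move: lt1; rewrite -ij e' ltxx.
Qed.

Lemma place_fib p q : rnd_pt p -> rnd_pt q -> place p = place q ->
  p = q \/ exists2 i, sqdist (ctr i) p = 1 & q = flip i p.
Proof.
move=> /placeE[x xp ->] /placeE[y yq ->] /proj_fib[xy|[i [r [e]]]].
  by left; move: yq; rewrite -xy xp => -[].
by rewrite xp yq => -[->] [->]; right; exists i.
Qed.

Lemma place_flip i p : rnd_pt p -> sqdist (ctr i) p = 1 -> place (flip i p) = place p.
Proof.
move=> rp e; have [x xp ->] := placeE rp; have [y yq ->] := placeE (rnd_pt_flip e).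
by apply/esym/(proj_glue e xp yq).
Qed.

Lemma on_circleP i z : on_circle D z (hole i) = (sqdist (ctr i) (pt z) == 1).
Proof.
have D2 : zr D ^+ 2 != 0 by rewrite expf_neq0// zrD_neq0.
rewrite -(inj_eq (mulfI D2)) mulr1; have := sqdist_pos i (z, z) 0.
rewrite pos0 => ->; rewrite /= !mul0r !addr0 /on_circle -(inj_eq zr_inj) !zrE.
by rewrite !expr2.
Qed.

Lemma canon_circle i z : sqdist (ctr i) (pt z) = 1 ->
  canon D xf hs z = if lexle z (zflip xf (hole i) z) then z else zflip xf (hole i) z.
Proof.
move=> e; rewrite /canon.
have : hole i \in [seq c <- hs | on_circle D z c].
  by rewrite mem_filter on_circleP e eqxx; apply/hsP; exists i.
case E : [seq c <- hs | on_circle D z c] => [//|c l] _.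
have : c \in [seq c <- hs | on_circle D z c] by rewrite E mem_head.
rewrite mem_filter => /andP[oc /hsP[j cj]]; subst c.
rewrite on_circleP in oc; have ij : i = j by apply: (disc_apart (p := pt z)); rewrite ?e ?(eqP oc).
by rewrite -ij.
Qed.

Lemma canonP z : canon D xf hs z = z \/
  exists2 i, sqdist (ctr i) (pt z) = 1 & canon D xf hs z = zflip xf (hole i) z.
Proof.
have [[i e]|ne] := pselect (exists i, sqdist (ctr i) (pt z) = 1).
  by rewrite (canon_circle e); case: ifP => _; [left|right; exists i].
left; rewrite /canon; case E : [seq c <- hs | on_circle D z c] => [//|c l].
have : c \in [seq c <- hs | on_circle D z c] by rewrite E mem_head.
rewrite mem_filter => /andP[oc /hsP[j cj]]; subst c.
by case: ne; exists j; apply/eqP; rewrite -on_circleP.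
Qed.

Lemma lexle_sym a b : (if lexle a b then a else b) = (if lexle b a then b else a).
Proof.
case: a b => [a1 a2] [b1 b2]; rewrite /lexle /=.
case: ifP => h; case: ifP => h' //.
  by congr (_, _); lia.
by congr (_, _); lia.
Qed.

Lemma canon_flip i z : sqdist (ctr i) (pt z) = 1 ->
  canon D xf hs (zflip xf (hole i) z) = canon D xf hs z.
Proof.
move=> e; have e' : sqdist (ctr (partner i)) (pt (zflip xf (hole i) z)) = 1.
  by rewrite flipE; exact: sqdist_flip.
by rewrite (canon_circle e) (canon_circle e') zflipK lexle_sym.
Qed.

Lemma place_canon z : rnd_pt (pt z) -> place (pt (canon D xf hs z)) = place (pt z).
Proof.
move=> rz; have [->//|[i e ->]] := canonP z.
by rewrite flipE place_flip.
Qed.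

Lemma canon_eq z z' : rnd_pt (pt z) -> rnd_pt (pt z') -> place (pt z) = place (pt z') ->
  canon D xf hs z = canon D xf hs z'.
Proof.
move=> rz rz' /(place_fib rz rz')[/pt_inj->//|[i e]].
by rewrite -flipE => /pt_inj ->; rewrite canon_flip.
Qed.

Local Notation node := (canon D xf hs).
Local Notation segment := ((Z * Z) * (Z * Z))%type.
Implicit Types (s : segment) (l : seq segment).

Definition image s : set X := [set place (pos s t) | t in `[0, 1]].

Lemma seg_disc s i : seg_ok D hs s -> disc_ok D s (hole i).
Proof. by move=> /allP; apply; apply/hsP; exists i. Qed.

Lemma seg_rnd s t : seg_ok D hs s -> 0 <= t <= 1 -> rnd_pt (pos s t).
Proof. by move=> ok t01 i; have [] := disc_okP (seg_disc i ok) t01. Qed.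

Lemma seg_ends s i t : seg_ok D hs s -> 0 <= t <= 1 -> sqdist (ctr i) (pos s t) = 1 ->
  exists2 z, z \in [:: s.1; s.2] & pos s t = pt z.
Proof.
move=> ok t01 e; have [_ /(_ e)[->|->]] := disc_okP (seg_disc i ok) t01.
  by exists s.1; rewrite ?pos0// !inE eqxx.
by exists s.2; rewrite ?pos1// !inE eqxx orbT.
Qed.

Lemma rnd_ends s z : seg_ok D hs s -> z \in [:: s.1; s.2] -> rnd_pt (pt z).
Proof.
move=> ok; rewrite !inE => /orP[/eqP->|/eqP->]; rewrite -?pos0 -?pos1.
  by apply: seg_rnd; rewrite // lexx ler01.
by apply: seg_rnd; rewrite // lexx ler01.
Qed.

Lemma pos_inj s t t' : s.1 != s.2 -> pos s t = pos s t' -> t = t'.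
Proof.
case: s => [[a1 a2] [b1 b2]] ne [/(divIf zrD_neq0) /= /addrI e1 /(divIf zrD_neq0) /= /addrI e2].
apply/eqP; rewrite -subr_eq0; apply: contraNT ne => tt.
have c x y : t * (zr y - zr x) = t' * (zr y - zr x) -> x = y.
  move=> e; apply: zr_inj; apply/eqP; rewrite eq_sym -subr_eq0.
  have : (t - t') * (zr y - zr x) == 0 by rewrite mulrBl e subrr.
  by rewrite mulf_eq0 (negbTE tt).
by rewrite (c _ _ e1) (c _ _ e2).
Qed.

Lemma seg_arc s : seg_ok D hs s -> node s.1 != node s.2 ->
  arc_image R (place (pt s.1)) (place (pt s.2)) (image s).
Proof.
move=> ok ne; have ne' : s.1 != s.2 by apply: contra ne => /eqP->.
pose clamp (t : R) := Num.min 1 (Num.max 0 t).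
have clamp01 t : 0 <= clamp t <= 1.
  by rewrite /clamp le_min ler01 le_max lexx ge_min lexx.
have clampE t : 0 <= t <= 1 -> clamp t = t.
  by move=> /andP[t0 t1]; rewrite /clamp (max_idPr t0) (min_idPr t1).
have hol t : holed_sphere ctr (Some (pos s (clamp t))).
  by apply/holedP; exact: seg_rnd.
pose y t : set_type (holed_sphere ctr) := SigSub (mem_set (hol t)).
have yE t : place (pos s (clamp t)) = proj (y t).
  have [x xp ->] := placeE ((holedP _).1 (hol t)).
  by congr proj; apply: val_inj.
exists (fun t => place (pos s (clamp t))); split.
- rewrite (_ : (fun t => _) = proj \o y); last by apply/funext => t; exact: yE.
  move=> t; apply: continuous_comp; last exact: proj_continuous.
  apply: (@continuous_comp_initial _ _ _ set_val y) => {}t.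
  rewrite /continuous_at /=.
  have cc : continuous clamp.
    move=> u; rewrite /clamp; apply: continuous_min; first exact: cst_continuous.
    by apply: continuous_max => //; exact: cst_continuous.
  have cl (a b : R) : continuous (fun u => (a + clamp u * b) / zr D).
    move=> u; apply: cvgM; last exact: cvg_cst.
    by apply: cvgD; [exact: cvg_cst|apply: cvgM; [exact: cc|exact: cvg_cst]].
  have cp : continuous (fun u => pos s (clamp u)).
    by move=> u; exact: (cvg_pair (cl _ _ u) (cl _ _ u)).
  move=> U /= nU.
  have nU' : nbhs (pos s (clamp t)) ((Some : R * R -> sphere R) @^-1` U) := nU.
  exact: (cp t _ nU').
- move=> t t'; rewrite !in_itv /= => t01 t01'; rewrite !clampE// => e.
  have [/(pos_inj ne')//|[i ei pf]] := place_fib (seg_rnd ok t01) (seg_rnd ok t01') e.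
  have [_ /(_ ei) tE] := disc_okP (seg_disc i ok) t01.
  have e' : sqdist (ctr (partner i)) (pos s t') = 1 by rewrite pf; exact: sqdist_flip.
  have [_ /(_ e') tE'] := disc_okP (seg_disc (partner i) ok) t01'.
  have bad : place (pt s.1) = place (pt s.2) -> False.
    move=> /canon_eq h; case/negP: ne; apply/eqP; apply: h.
      by apply: (rnd_ends ok); rewrite !inE eqxx.
    by apply: (rnd_ends ok); rewrite !inE eqxx orbT.
  by move: tE tE' e => [->|->] [->|->] //; rewrite pos0 pos1 => e; case: bad.
- by rewrite clampE ?pos0// lexx ler01.
- by rewrite clampE ?pos1// lexx ler01.
- by apply/seteqP; split => xi [t t01 <-]; exists t; rewrite // clampE//; move: t01; rewrite /= in_itv.
Qed.

(** Two segments can meet on the surface in a common end, or because an end of one is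
    glued to an end of the other; in both cases the ends have the same
    representative. *)
Lemma images_meet s s' xi : seg_ok D hs s -> seg_ok D hs s' -> pair_ok s s' ->
  image s xi -> image s' xi ->
  exists c, [/\ c \in [:: node s.1; node s.2], c \in [:: node s'.1; node s'.2] & xi = place (pt c)].
Proof.
move=> ok ok' pok [t t01 <-] [t' t01' e].
rewrite /= in_itv /= in t01; rewrite /= in_itv /= in t01'.
have nodes (u : segment) z : z \in [:: u.1; u.2] -> node z \in [:: node u.1; node u.2].
  exact: (map_f node (s := [:: u.1; u.2])).
have [pe|[i ei pf]] := place_fib (seg_rnd ok t01) (seg_rnd ok' t01') (esym e).
  have [z [z1 z2 zE]] := pair_okP t01 t01' pok pe.
  exists (node z); rewrite zE place_canon; first by split => //; exact: nodes.
  exact: rnd_ends ok z1.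
have [z z1 zE] := seg_ends ok t01 ei.
have e' : sqdist (ctr (partner i)) (pos s' t') = 1 by rewrite pf; exact: sqdist_flip.
have [z' z2 zE'] := seg_ends ok' t01' e'.
have r1 := rnd_ends ok z1; have r2 := rnd_ends ok' z2.
exists (node z); rewrite zE place_canon//; split => //; first exact: nodes.
rewrite (@canon_eq z z') ?nodes//.
by rewrite -zE -zE'.
Qed.

Definition edge_image l : set X := [set xi | exists2 s, s \in l & image s xi].

Lemma chain_nodes c l s : chain D xf hs c l -> s \in l ->
  node s.1 \in c :: ends D xf hs l /\ node s.2 \in ends D xf hs l.
Proof.
elim: l c => [//|s0 l IHl] c /= /andP[/eqP e0 ch]; rewrite inE => /orP[/eqP->|sl].
  by rewrite e0 !inE !eqxx.
have [h1 h2] := IHl _ ch sl; split; rewrite inE ?h2 ?orbT//.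
by rewrite h1 orbT.
Qed.

Lemma chain_arc c l : l != [::] -> chain D xf hs c l -> uniq (c :: ends D xf hs l) ->
  all (seg_ok D hs) l -> pairwise pair_ok l ->
  arc_image R (place (pt c)) (place (pt (last c (ends D xf hs l)))) (edge_image l).
Proof.
elim: l c => [//|s l IHl] c _ /= /andP[/eqP e0 ch] /andP[cN un] /andP[oks okl] /andP[ps pl].
have a1 : arc_image R (place (pt c)) (place (pt (node s.2))) (image s).
  rewrite -e0 !place_canon; [apply: seg_arc => //| |].
  - by rewrite e0; apply: contraNneq cN => ->; rewrite mem_head.
  - by apply: (rnd_ends oks); rewrite !inE eqxx orbT.
  - by apply: (rnd_ends oks); rewrite !inE eqxx.
have [l0|lN] := eqVneq l [::].
  rewrite l0 /= (_ : edge_image [:: s] = image s)//.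
  by apply/seteqP; split => xi [] => [s'|t h e]; [rewrite inE => /eqP->|exists s; rewrite ?inE//; exists t].
rewrite (_ : edge_image (s :: l) = image s `|` edge_image l); last first.
  apply/seteqP; split => xi.
    move=> [s']; rewrite inE => /orP[/eqP->|sl] h; [by left|right; by exists s'].
  by move=> [h|[s' sl h]]; [exists s; rewrite ?mem_head|exists s'; rewrite // inE sl orbT].
apply: arc_cat a1 (IHl _ lN ch un okl pl) _ => xi hs1 [s' sl hs2].
have [n [n1 n2 ->]] := images_meet oks (allP okl _ sl) (allP ps _ sl) hs1 hs2.
have [m1 m2] := chain_nodes ch sl.
move: n1; rewrite !inE => /orP[/eqP nE|/eqP->//].
move: n2; rewrite nE e0 !inE => /orP[/eqP h|/eqP h].
  by rewrite h m1 in cN.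
by rewrite h inE m2 orbT in cN.
Qed.

Section CompleteGraph.
Variables (n : nat) (vs : seq (Z * Z)) (es : seq ((nat * nat) * seq segment)).
Hypothesis n_gt1 : (1 < n)%N.
Hypothesis drawing : drawing_ok D xf hs n vs es.
Local Notation vertex := (vertex D xf hs vs).
Local Notation ends := (ends D xf hs).
Local Notation inner := (inner_nodes D xf hs).

Lemma pairwise_flatten (T : eqType) (r : rel T) (L : seq (seq T)) :
  pairwise r (flatten L) -> pairwise (allrel r) L /\ all (pairwise r) L.
Proof.
elim: L => //= a L IHL; rewrite pairwise_cat => /and3P[h ha /IHL[h1 h2]].
split; last by rewrite ha.
rewrite h1 andbT; apply/allP => b bL; apply/allrelP => x y xa yb.
by move/allrelP: h; apply => //; apply/flattenP; exists b.
Qed.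

Lemma pairwise_mem (T : eqType) (r : rel T) (L : seq T) x y :
  pairwise r L -> x \in L -> y \in L -> x != y -> r x y || r y x.
Proof.
elim: L => //= a L IHL /andP[ha hL]; rewrite !inE => /orP[/eqP->|xL] /orP[/eqP->|yL] ne.
- by rewrite eqxx in ne.
- by rewrite (allP ha).
- by rewrite (allP ha) ?orbT.
- exact: IHL.
Qed.

Let fst_uniq : uniq (map fst es).
Proof. by case/and5P: drawing. Qed.

Lemma entry u v : (u < v)%N -> (v < n)%N -> exists l, ((u, v), l) \in es.
Proof.
case/and5P: drawing => _ h _ _ _ uv vn.
move/allP: h => /(_ v); rewrite mem_iota /= add0n => /(_ vn) /allP /(_ u).
rewrite mem_iota /= add0n => /(_ uv) /mapP[[[u' v'] l] el [-> ->]].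
by exists l.
Qed.

Lemma entry_uniq e l l' : (e, l) \in es -> (e, l') \in es -> l = l'.
Proof.
move: fst_uniq; elim: es => //= -[f m] L IHL /andP[fN un]; rewrite !inE.
move=> /orP[/eqP[e1 ->]|h] /orP[/eqP[e2 ->]|h'].
- by [].
- by case/negP: fN; apply/mapP; exists (e, l').
- by case/negP: fN; apply/mapP; exists (e, l).
- exact: IHL.
Qed.

Lemma entryP u v l : ((u, v), l) \in es ->
  [/\ l != [::], (u < v)%N, (v < n)%N, chain D xf hs (vertex u) l &
    last (vertex u) (ends l) = vertex v].
Proof.
case/and5P: drawing => _ _ /allP h _ _ /h /= /and5P[h1 h2 h3 h4 /eqP h5].
by split.
Qed.

Lemma entry_segs e l : (e, l) \in es -> all (seg_ok D hs) l.
Proof.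
case/and5P: drawing => _ _ _ /allP h _ el; apply/allP => s sl; apply: h.
by apply/flattenP; exists l => //; apply/mapP; exists (e, l).
Qed.

Let pairs : pairwise (allrel pair_ok) (map snd es) /\ all (pairwise pair_ok) (map snd es).
Proof. by apply: pairwise_flatten; case/and5P: drawing => _ _ _ _ /andP[/pairs_okP]. Qed.

Lemma entry_pairs e l : (e, l) \in es -> pairwise pair_ok l.
Proof. by move=> el; apply: (allP pairs.2); apply/mapP; exists (e, l). Qed.

Lemma entries_pairs e l f m : (e, l) \in es -> (f, m) \in es -> e != f ->
  allrel pair_ok l m || allrel pair_ok m l.
Proof.
move=> el fm ef; have := pairs.1; rewrite pairwise_map => h.
by apply: (pairwise_mem h el fm); rewrite xpair_eqE negb_and ef.
Qed.

Let nodes_uniq : uniq (map vertex (iota 0 n) ++ flatten (map (fun e => inner e.2) es)).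
Proof. by case/and5P: drawing => _ _ _ _ /andP[]. Qed.

Lemma vertex_inj u v : (u < n)%N -> (v < n)%N -> vertex u = vertex v -> u = v.
Proof.
move=> un vn; move: nodes_uniq; rewrite cat_uniq => /andP[h _].
have nE w : (w < n)%N -> vertex w = nth (Z0, Z0) (map vertex (iota 0 n)) w.
  by move=> wn; rewrite (nth_map 0%N) ?size_iota// nth_iota.
rewrite (nE u)// (nE v)// => /eqP; rewrite nth_uniq ?size_map ?size_iota//.
by move/eqP.
Qed.

Lemma inner_mem e l c : (e, l) \in es -> c \in inner l ->
  c \in flatten (map (fun e => inner e.2) es).
Proof. by move=> el cl; apply/flattenP; exists (inner l) => //; apply/mapP; exists (e, l). Qed.

Lemma inner_not_vertex e l c w : (e, l) \in es -> c \in inner l -> (w < n)%N -> c != vertex w.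
Proof.
move=> el /(inner_mem el) cl wn; apply: contraTneq nodes_uniq => cE.
rewrite cat_uniq negb_and; apply/orP; right; rewrite negb_and; apply/orP; left; rewrite negbK.
apply/hasP; exists c => //; rewrite cE /=; apply/mapP; exists w => //.
by rewrite mem_iota.
Qed.

Lemma inner_disjoint e l f m c : (e, l) \in es -> (f, m) \in es -> e != f ->
  c \in inner l -> c \notin inner m.
Proof.
move=> el fm ef cl; apply/negP => cm; move: nodes_uniq; rewrite cat_uniq => /and3P[_ _].
rewrite uniq_pairwise => /pairwise_flatten[]; rewrite pairwise_map => h _.
have := pairwise_mem h el fm; rewrite xpair_eqE negb_and ef => /(_ isT).
by case/orP => /allrelP /(_ c c) /=; rewrite cl cm eqxx => /(_ isT isT).
Qed.

Lemma ends_rcons u v l : ((u, v), l) \in es -> ends l = rcons (inner l) (vertex v).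
Proof.
move=> /entryP[lN _ _ _]; rewrite /inner_nodes.
have sz : size (ends l) = size l by rewrite size_map.
case/lastP E : (ends l) => [|x y].
  by move: sz; rewrite E; case: (l) lN.
by rewrite last_rcons -sz E size_rcons /= -cats1 take_size_cat// => ->; rewrite cats1.
Qed.

Lemma entry_nodes_uniq u v l : ((u, v), l) \in es -> uniq (vertex u :: ends l).
Proof.
move=> el; have [_ uv vn _ _] := entryP el; rewrite (ends_rcons el) /= rcons_uniq mem_rcons inE.
have un := ltn_trans uv vn; apply/and3P; split.
- rewrite negb_or; apply/andP; split.
    by apply/eqP => /(vertex_inj un vn) e; rewrite e ltnn in uv.
  by apply/negP => c; have := inner_not_vertex el c un; rewrite eqxx.
- by apply/negP => c; have := inner_not_vertex el c vn; rewrite eqxx.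
- move: nodes_uniq; rewrite cat_uniq => /and3P[_ _].
  rewrite uniq_pairwise => /pairwise_flatten[_ /allP h]; rewrite uniq_pairwise; apply: h.
  by apply/mapP; exists ((u, v), l).
Qed.

Lemma entry_arc u v l : ((u, v), l) \in es ->
  arc_image R (place (pt (vertex u))) (place (pt (vertex v))) (edge_image l).
Proof.
move=> el; have [lN _ _ ch <-] := entryP el.
apply: chain_arc => //; [exact: entry_nodes_uniq el|exact: entry_segs el|exact: entry_pairs el].
Qed.

Lemma arc_image_ends (x y : X) A : arc_image R x y A -> A x /\ A y.
Proof.
by move=> [f [_ _ <- <- <-]]; split; [exists 0|exists 1]; rewrite //= in_itv /= ?lexx ?ler01.
Qed.

Lemma entry_nodes u v l s c : ((u, v), l) \in es -> s \in l -> c \in [:: node s.1; node s.2] ->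
  [\/ c = vertex u, c = vertex v | c \in inner l].
Proof.
move=> el sl; have [_ _ _ ch _] := entryP el; have [n1 n2] := chain_nodes ch sl.
have : c \in [:: node s.1; node s.2] -> c \in vertex u :: ends l.
  by rewrite !inE => /orP[/eqP->|/eqP->]; [move: n1; rewrite inE|rewrite n2 orbT].
move=> h /h; rewrite (ends_rcons el) inE mem_rcons inE => /or3P[/eqP|/eqP|].
- by constructor 1.
- by constructor 2.
- by constructor 3.
Qed.

Lemma entries_meet u v l u' v' m xi : ((u, v), l) \in es -> ((u', v'), m) \in es ->
  (u, v) != (u', v') -> edge_image l xi -> edge_image m xi ->
  exists w, [/\ w = u \/ w = v, w = u' \/ w = v' & xi = place (pt (vertex w))].
Proof.
move=> el em ne [s sl hs1] [s' sm hs2].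
have ok := allP (entry_segs el) _ sl; have ok' := allP (entry_segs em) _ sm.
have [_ uv vn _ _] := entryP el; have [_ uv' vn' _ _] := entryP em.
have un := ltn_trans uv vn; have un' := ltn_trans uv' vn'.
have [c [c1 c2 xiE]] : exists c, [/\ c \in [:: node s.1; node s.2],
    c \in [:: node s'.1; node s'.2] & xi = place (pt c)].
  case/orP: (entries_pairs el em ne) => /allrelP h.
    exact: (images_meet ok ok' (h _ _ sl sm)).
  by have [c [? ? ?]] := images_meet ok' ok (h _ _ sm sl) hs2 hs1; exists c.
have N1 := entry_nodes el sl c1; have N2 := entry_nodes em sm c2.
have off w : (w < n)%N -> c = vertex w -> w = u \/ w = v.
  move=> wn cw; case: N1 => [e|e|h].
  - by left; apply: vertex_inj; rewrite -?cw.
  - by right; apply: vertex_inj; rewrite -?cw.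
  - by have := inner_not_vertex el h wn; rewrite cw eqxx.
case: N2 => [e|e|h].
- by exists u'; split; [exact: off|left|rewrite xiE e].
- by exists v'; split; [exact: off|right|rewrite xiE e].
case: N1 => [e|e|h'].
- by have := inner_not_vertex em h un; rewrite e eqxx.
- by have := inner_not_vertex em h vn; rewrite e eqxx.
- by have := inner_disjoint el em ne h'; rewrite h.
Qed.

Lemma incident w : (w < n)%N -> exists u v l, ((u, v), l) \in es /\ (w = u \/ w = v).
Proof.
case: w => [_|w wn].
  by have [l el] := entry (isT : (0 < 1)%N) n_gt1; exists 0%N, 1%N, l; split => //; left.
by have [l el] := entry (ltn0Sn w) wn; exists 0%N, w.+1, l; split => //; right.
Qed.

Lemma vertex_rep w : (w < n)%N -> exists2 z, rnd_pt (pt z) & node z = vertex w.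
Proof.
move=> /incident[u [v [l [el wE]]]]; have oks := entry_segs el.
have [lN _ _ ch _] := entryP el; have := ends_rcons el.
case: wE => [->|-> lE].
  case: (l) lN ch oks => [//|s l'] _ /= /andP[/eqP e _] /andP[ok _] _.
  by exists s.1 => //; apply: (rnd_ends ok); rewrite !inE eqxx.
have : vertex v \in ends l by rewrite lE mem_rcons mem_head.
move=> /mapP[s sl ->]; exists s.2 => //.
by apply: (rnd_ends (allP oks _ sl)); rewrite !inE eqxx orbT.
Qed.

Lemma place_vertex_inj u v : (u < n)%N -> (v < n)%N ->
  place (pt (vertex u)) = place (pt (vertex v)) -> u = v.
Proof.
move=> un vn; have [z rz zE] := vertex_rep un; have [z' rz' zE'] := vertex_rep vn.
by rewrite -zE -zE' !place_canon// => /(canon_eq rz rz'); rewrite zE zE'; exact: vertex_inj.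
Qed.

(** A vertex off the edge is an end of some other edge, which meets the first one only
    in a common end. *)
Lemma entry_vertex u v l w : ((u, v), l) \in es -> (w < n)%N ->
  edge_image l (place (pt (vertex w))) -> w = u \/ w = v.
Proof.
move=> el wn hw; have [_ uv vn _ _] := entryP el; have un := ltn_trans uv vn.
have [->|wu] := eqVneq w u; first by left.
have [->|wv] := eqVneq w v; first by right.
have [x [y [m [em [wxy xyw]]]]] : exists x y m, ((x, y), m) \in es /\
    ((w = x \/ w = y) /\ (x, y) != (u, v)).
  case: (ltngtP w u) wu => // lt _.
    have [m em] := entry lt un; exists w, u, m; split => //; split; first by left.
    by rewrite xpair_eqE negb_and; apply/orP; left; rewrite ltn_eqF.
  have [m em] := entry lt wn; exists u, w, m; split => //; split; first by right.
  by rewrite xpair_eqE negb_and wv orbT.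
have [a1 a2] := arc_image_ends (entry_arc em).
have hm : edge_image m (place (pt (vertex w))) by case: wxy => ->.
have [w' [h1 _ /(place_vertex_inj wn) h]] := entries_meet em el xyw hm hw.
have w'n : (w' < n)%N.
  by case: h1 => ->; have [_ xy yn _ _] := entryP em => //; exact: ltn_trans yn.
have [w2 [_ h2 /(place_vertex_inj wn) h']] := entries_meet em el xyw hm hw.
by rewrite h'; last by case: h2 => ->.
Qed.

(** A list of integer polygons that passes the checks draws the complete graph, hence
    every graph on its vertices. *)
Lemma drawing_embeddable (e : rel 'I_n) : irreflexive e -> embeddable R X e.
Proof.
pose im (u v : 'I_n) : set X :=
  [set xi | exists2 l, ((val u, val v), l) \in es & edge_image l xi].
have imE (u v : 'I_n) l : ((val u, val v), l) \in es -> im u v = edge_image l.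
  move=> el; apply/seteqP; split => xi; last by exists l.
  by move=> [l' el']; rewrite (entry_uniq el el').
apply: (@complete_embeddable R X n (fun u => place (pt (vertex (val u)))) im).
- by move=> u v /(place_vertex_inj (ltn_ord u) (ltn_ord v))/val_inj.
- move=> u v uv; have [l el] := entry uv (ltn_ord v).
  by rewrite (imE _ _ _ el); exact: entry_arc el.
- move=> u v w uv [l el] /(entry_vertex el (ltn_ord w))[/val_inj->|/val_inj->]; by [left|right].
- move=> u v u' v' xi uv uv' ne [l el h] [m em h'].
  have [//|w [h1 _ ->]] := entries_meet el em _ h h'.
  by case: h1 => ->; [exists u|exists v].
Qed.

End CompleteGraph.
End LatticeDrawings.

(** ** A tournament that is not 3-dicolourable *)

(** The Paley tournament on the integers modulo 11. *)
Definition paley (u v : nat) : bool := ((v + 11 - u) %% 11)%N \in [:: 1; 3; 4; 5; 9]%N.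

Definition closes_triangle (l : seq nat) : bool :=
  let k := (size l).-1 in
  has (fun u => has (fun v => [&& paley u v, paley v k, paley k u,
    nth 0%N l u == nth 0%N l k & nth 0%N l v == nth 0%N l k]) (iota 0 k)) (iota 0 k).

(** Whether every extension of a 3-colouring of the first vertices by m further
    vertices has a monochromatic directed triangle. *)
Fixpoint stuck (m : nat) (l : seq nat) : bool :=
  if closes_triangle l then true else
  if m is m'.+1 then all (fun c => stuck m' (rcons l c)) (iota 0 3) else false.

Lemma stuckP m l (g : nat -> nat) : (forall u, g u < 3)%N -> stuck m l -> (0 < size l)%N ->
  (forall u, (u < size l)%N -> nth 0%N l u = g u) -> (size l + m <= 11)%N ->
  exists u v w, [/\ paley u v, paley v w, paley w u, g u = g w & g v = g w] /\
    [/\ (u < 11)%N, (v < 11)%N & (w < 11)%N].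
Proof.
move=> g3; elim: m l => [|m IHm] l /=; rewrite ?addn0; case: ifP => //.
  move=> /hasP[u]; rewrite mem_iota add0n /= => ul /hasP[v].
  rewrite mem_iota add0n /= => vl /and5P[h1 h2 h3 /eqP h4 /eqP h5] _ l0 lg l11.
  have kl : ((size l).-1 < size l)%N by rewrite prednK.
  exists u, v, (size l).-1; rewrite -!lg//; [split => //; split|..];
    by move: ul vl kl l11; clear; lia.
- move=> /hasP[u]; rewrite mem_iota add0n /= => ul /hasP[v].
  rewrite mem_iota add0n /= => vl /and5P[h1 h2 h3 /eqP h4 /eqP h5] _ l0 lg l11.
  have kl : ((size l).-1 < size l)%N by rewrite prednK.
  exists u, v, (size l).-1; rewrite -!lg//; [split => //; split|..];
    by move: ul vl kl l11; clear; lia.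
- move=> _ h l0 lg l11; have {}h : stuck m (rcons l (g (size l))).
    by move: h (g3 (size l)); case: (g _) => [|[|[|]]] //= /and4P[? ? ? _].
  apply: IHm h _ _ _; rewrite size_rcons//; last by move: l11; clear; lia.
  move=> u; rewrite ltnS leq_eqVlt nth_rcons => /orP[/eqP->|ul]; first by rewrite ltnn eqxx.
  by rewrite ul lg.
Qed.

Lemma paley_stuck c : (c < 3)%N -> stuck 10 [:: c].
Proof.
have /allP h : all (fun c => stuck 10 [:: c]) (iota 0 3) by vm_compute.
by move=> c3; apply: h; rewrite mem_iota.
Qed.

Definition paley11 : rel 'I_11 := fun u v => paley u v.

Lemma ord11P (P : nat -> bool) : all P (iota 0 11) -> forall u : 'I_11, P u.
Proof. by move=> /allP h u; apply: h; rewrite mem_iota /= ltn_ord. Qed.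

Lemma paley11_oriented : oriented_graph paley11.
Proof.
have irr (u : 'I_11) : ~~ paley u u.
  by apply: (@ord11P (fun u => ~~ paley u u) _ u); vm_compute.
split => [u|u]; first by apply/negbTE; exact: irr.
pose P u := all (fun v => ~~ (paley u v && paley v u)) (iota 0 11).
have /ord11P : P u by apply: (@ord11P P); vm_compute.
exact.
Qed.

Lemma paley11_not_dicolourable j : (j < 4)%N -> ~ dicolourable paley11 j.
Proof.
move=> j3 [f ac]; pose g u := f (inord u) : nat.
have g3 u : (g u < 3)%N by apply: leq_trans (ltn_ord _) _.
have st : stuck 10 [:: g 0%N] := paley_stuck (g3 0%N).
have [||u [v [w [[uv vw wu guw gvw] [u11 v11 w11]]]]] := stuckP g3 st isT.
- by case.
- by [].
pose U : 'I_11 := inord u; pose V : 'I_11 := inord v; pose W : 'I_11 := inord w.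
have [irr _] := paley11_oriented.
have UV : paley11 U V by rewrite /paley11 !inordK.
have VW : paley11 V W by rewrite /paley11 !inordK.
have WU : paley11 W U by rewrite /paley11 !inordK.
have sub : {subset [:: U; V; W] <= [set u | f u == f W]%SET}.
  move=> x; rewrite finset.inE !inE => /or3P[/eqP->|/eqP->|/eqP->] //.
    by apply/eqP/val_inj.
  by apply/eqP/val_inj.
have := ac (f W) [:: U; V; W] isT sub.
rewrite /ucycleb /= UV VW WU /= !inE !negb_or !andbT.
have ne x y : paley11 x y -> x != y by move=> xy; apply: contraTneq xy => ->; rewrite irr.
have UW : U != W by rewrite eq_sym ne.
by rewrite UW (ne _ _ UV) (ne _ _ VW).
Qed.

Lemma dichromatic_ge4 (R : realType) (X : topologicalType) (j : nat) :
  (forall e : rel 'I_11, irreflexive e -> embeddable R X e) ->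
  all_dicolourable R X j -> (4 <= j)%N.
Proof.
move=> emb all; rewrite leqNgt; apply/negP => j4.
apply: (paley11_not_dicolourable j4); apply: all paley11_oriented _.
by apply: emb; exact: (underlying_simple paley11_oriented).2.
Qed.

(** ** Drawings of the complete graph on eleven vertices *)

Section DrawingData.
Local Open Scope Z_scope.

Definition crosscap_vertices : seq (Z * Z) := [:: (572507,119915); (346971,236549); (646493,-134016); (1088449,55443); (1056558,-219637); (284831,-241794); (452199,221119); (-20718,970189); (325120,-499378); (706612,-321519); (-259716,1157979)].
Definition crosscap_edges : seq ((nat * nat) * seq (seq (Z * Z))) := [::
((0,1)%N, [:: [:: (572507,119915); (414388,11661)]; [:: (354692,-11661); (263973,-35074); (263124,-31323)]; [:: (249596,31323); (346971,236549)]]);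
((0,2)%N, [:: [:: (572507,119915); (583225,-115828); (646493,-134016)]]);
((0,3)%N, [:: [:: (572507,119915); (581482,6850); (613575,-29114); (624984,-27813)]; [:: (656816,27813); (710293,137490); (768619,192138); (865436,3757)]; [:: (929084,-3757); (1086846,184988); (1088449,55443)]]);
((0,4)%N, [:: [:: (572507,119915); (584033,8581); (612625,-15080)]; [:: (669175,15080); (748676,171140); (867412,-11661)]; [:: (927108,11661); (1084723,326980); (1178415,20300)]; [:: (1128825,-20300); (1056558,-219637)]]);
((0,5)%N, [:: [:: (572507,119915); (404335,25200)]; [:: (364745,-25200); (284831,-241794)]]);
((0,6)%N, [:: [:: (572507,119915); (452199,221119)]]);
((0,7)%N, [:: [:: (572507,119915); (416208,-4901)]; [:: (352872,4901); (274651,-26312)]; [:: (238069,26312); (1741,961997); (-20718,970189)]]);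
((0,8)%N, [:: [:: (572507,119915); (526292,29029)]; [:: (499148,-29029); (325120,-499378)]]);
((0,9)%N, [:: [:: (572507,119915); (512004,32037)]; [:: (513436,-32037); (581617,-341770); (706612,-321519)]]);
((0,10)%N, [:: [:: (572507,119915); (580398,66193); (609577,-6764)]; [:: (672223,6764); (748796,167568); (857878,-11179); (870948,-18291)]; [:: (923572,18291); (769080,345782); (0,1160126); (-259716,1157979)]]);
((1,2)%N, [:: [:: (346971,236549); (572119,297596); (639537,32016)]; [:: (642263,-32016); (646493,-134016)]]);
((1,3)%N, [:: [:: (346971,236549); (572003,370082); (769080,254373); (870948,18291)]; [:: (923572,-18291); (1084278,129156); (1088449,55443)]]);
((1,4)%N, [:: [:: (346971,236549); (572003,410261); (769080,268705); (882180,28275)]; [:: (912340,-28275); (932928,-24078); (1002942,34749); (1018181,31212)]; [:: (1032699,-31212); (1056558,-219637)]]);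
((1,5)%N, [:: [:: (346971,236549); (261664,31603)]; [:: (251056,-31603); (284831,-241794)]]);
((1,6)%N, [:: [:: (346971,236549); (452199,221119)]]);
((1,7)%N, [:: [:: (346971,236549); (0,970249); (-20718,970189)]]);
((1,8)%N, [:: [:: (346971,236549); (282672,18291)]; [:: (230048,-18291); (146499,30863); (144449,27608)]; [:: (111911,-27608); (325120,-499378)]]);
((1,9)%N, [:: [:: (346971,236549); (572003,380663); (769080,260350); (875684,23693)]; [:: (918836,-23693); (931734,-17031); (1027439,56043); (1032204,31323)]; [:: (1018676,-31323); (956543,-352573); (706612,-321519)]]);
((1,10)%N, [:: [:: (346971,236549); (273613,27004)]; [:: (239107,-27004); (179200,-1075); (153816,19227)]; [:: (102544,-19227); (32037,716)]; [:: (-32037,-716); (-578887,564835); (-259716,1157979)]]);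
((2,3)%N, [:: [:: (646493,-134016); (633641,-31212)]; [:: (648159,31212); (709797,164697); (769080,211378); (867340,11475)]; [:: (927180,-11475); (1084723,166052); (1088449,55443)]]);
((2,4)%N, [:: [:: (646493,-134016); (737035,0)]; [:: (801125,0); (956543,-215599); (992951,15251); (996411,13572)]; [:: (1054469,-13572); (1056558,-219637)]]);
((2,5)%N, [:: [:: (646493,-134016); (579592,-130403); (570036,-34296); (543837,7656)]; [:: (481603,-7656); (284831,-241794)]]);
((2,6)%N, [:: [:: (646493,-134016); (651092,-30381)]; [:: (630708,30381); (572003,228898); (452199,221119)]]);
((2,7)%N, [:: [:: (646493,-134016); (740051,-13572)]; [:: (798109,13572); (868935,-47966); (897976,-32037)]; [:: (896544,32037); (769080,289342); (0,975467); (-20718,970189)]]);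
((2,8)%N, [:: [:: (646493,-134016); (581617,-125678); (572003,-18925); (540474,22757); (537515,20300)]; [:: (487925,-20300); (325120,-499378)]]);
((2,9)%N, [:: [:: (646493,-134016); (706612,-321519)]]);
((2,10)%N, [:: [:: (646493,-134016); (749285,-25200)]; [:: (788875,25200); (841186,-761); (861425,-28817); (889083,-34947); (890001,-31212)]; [:: (904519,31212); (769080,293202); (-59283,1132093); (-259716,1157979)]]);
((3,4)%N, [:: [:: (1088449,55443); (1056558,-219637)]]);
((3,5)%N, [:: [:: (1088449,55443); (1125345,15080)]; [:: (1181895,-15080); (956543,-844322); (837977,-873495); (256360,-691428); (-6764,-31323)]; [:: (6764,31323); (68897,130927); (100572,16269)]; [:: (155788,-16269); (284831,-241794)]]);
((3,6)%N, [:: [:: (1088449,55443); (1054469,13572)]; [:: (996411,-13572); (956543,-252878); (789380,-24795)]; [:: (748780,24795); (666100,-19795)]; [:: (615700,19795); (570538,216925); (452199,221119)]]);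
((3,7)%N, [:: [:: (1088449,55443); (1133320,24795)]; [:: (1173920,-24795); (897260,-854755); (256360,-660332); (7888,-31059)]; [:: (-7888,31059); (-20718,970189)]]);
((3,8)%N, [:: [:: (1088449,55443); (1156665,31900)]; [:: (1150575,-31900); (897260,-759343); (325120,-499378)]]);
((3,9)%N, [:: [:: (1088449,55443); (1045235,25200)]; [:: (1005645,-25200); (956543,-309329); (706612,-321519)]]);
((3,10)%N, [:: [:: (1088449,55443); (1144848,30821)]; [:: (1162392,-30821); (897260,-781125); (256360,-637348); (20300,-24795)]; [:: (-20300,24795); (-259716,1157979)]]);
((4,5)%N, [:: [:: (1056558,-219637); (1121720,3045)]; [:: (1185520,-3045); (1187180,-26271); (897260,-1080555); (256360,-730994); (-19227,-25636)]; [:: (19227,25636); (96512,4901)]; [:: (159848,-4901); (284831,-241794)]]);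
((4,6)%N, [:: [:: (1056558,-219637); (1061329,356); (1057485,0)]; [:: (993395,0); (956543,-235902); (798109,-13572)]; [:: (740051,13572); (659191,-26312)]; [:: (622609,26312); (571609,221839); (452199,221119)]]);
((4,7)%N, [:: [:: (1056558,-219637); (1045740,-24795)]; [:: (1005140,24795); (979650,10154); (917317,-39800); (905148,-31059)]; [:: (889372,31059); (769080,284092); (0,972425); (-20718,970189)]]);
((4,8)%N, [:: [:: (1056558,-219637); (897260,-688089); (325120,-499378)]]);
((4,9)%N, [:: [:: (1056558,-219637); (868285,-590428); (706612,-321519)]]);
((4,10)%N, [:: [:: (1056558,-219637); (1122799,-8772)]; [:: (1184441,8772); (1181758,32011); (1084723,378173); (0,1165452); (-259716,1157979)]]);
((5,6)%N, [:: [:: (284831,-241794); (379639,-31668)]; [:: (389441,31668); (452199,221119)]]);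
((5,7)%N, [:: [:: (284831,-241794); (147407,-25636)]; [:: (108953,25636); (-20718,970189)]]);
((5,8)%N, [:: [:: (284831,-241794); (325120,-499378)]]);
((5,9)%N, [:: [:: (284831,-241794); (481397,6764)]; [:: (544043,-6764); (581617,-306515); (706612,-321519)]]);
((5,10)%N, [:: [:: (284831,-241794); (159239,7888)]; [:: (97121,-7888); (28275,15080)]; [:: (-28275,-15080); (-1028427,552135); (-259716,1157979)]]);
((6,7)%N, [:: [:: (452199,221119); (287963,-5304)]; [:: (224757,5304); (-20718,970189)]]);
((6,8)%N, [:: [:: (452199,221119); (287683,6764)]; [:: (225037,-6764); (137801,38752); (133081,31668)]; [:: (123279,-31668); (325120,-499378)]]);
((6,9)%N, [:: [:: (452199,221119); (569135,205938); (611052,11661)]; [:: (670748,-11661); (760980,34965); (761821,31212)]; [:: (776339,-31212); (706612,-321519)]]);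
((6,10)%N, [:: [:: (452199,221119); (574626,154146); (609000,3045)]; [:: (672800,-3045); (754587,154988); (853854,-10008); (873779,-27144); (876260,-24205)]; [:: (918260,24205); (769080,302963); (0,1155911); (-259716,1157979)]]);
((7,8)%N, [:: [:: (-20718,970189); (120292,31059)]; [:: (136068,-31059); (325120,-499378)]]);
((7,9)%N, [:: [:: (-20718,970189); (-329,961024); (229356,17253)]; [:: (283364,-17253); (359340,19795)]; [:: (409740,-19795); (496710,32122); (499148,29029)]; [:: (526292,-29029); (581617,-321964); (706612,-321519)]]);
((7,10)%N, [:: [:: (-20718,970189); (-259716,1157979)]]);
((8,9)%N, [:: [:: (325120,-499378); (706612,-321519)]]);
((8,10)%N, [:: [:: (325120,-499378); (29325,-12920)]; [:: (-29325,12920); (-291805,575552); (-259716,1157979)]]);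
((9,10)%N, [:: [:: (706612,-321519); (761821,-31212)]; [:: (776339,31212); (825288,29991); (858979,-22300); (877043,-30557); (882180,-28275)]; [:: (912340,28275); (769080,297039); (0,1146450); (-259716,1157979)]])].
Definition handle_vertices : seq (Z * Z) := [:: (-42576805,38035182); (-82590947,17426329); (-17729482,-14645294); (-65173336,19221164); (32299494,-37913650); (19623651,-50143999); (-54767004,9962071); (-37690508,17229404); (31749839,-10270828); (10941514,-1182556); (-77411751,30241939)].
Definition handle_edges : seq ((nat * nat) * seq (seq (Z * Z))) := [::
((0,1)%N, [:: [:: (-42576805,38035182); (-62152341,6942711); (1530149,4520644); (1558486,4457966); (1869839,708402); (2129039,391429); (-1765333,-692729); (-1530149,-2559906); (-1439416,-3056016); (-1373211,-3182362)]; [:: (-1373211,3182362); (-90044742,6942345); (-82590947,17426329)]]);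
((0,2)%N, [:: [:: (-42576805,38035182); (-68006640,65207317); (-99261611,6942345); (-17729482,-14645294)]]);
((0,3)%N, [:: [:: (-42576805,38035182); (-65173336,19221164)]]);
((0,4)%N, [:: [:: (-42576805,38035182); (39182862,-1007529); (32299494,-37913650)]]);
((0,5)%N, [:: [:: (-42576805,38035182); (-14912740,6944997); (1558486,5450198); (1943728,708402); (2263154,316920); (440661,-244202); (7197369,-1137420); (7262293,-707840); (4108734,227221); (3797560,708403); (3838268,1170966); (7730999,790998); (7225705,4483484); (7197369,4547747); (4137071,4835303); (3749495,708402); (4108735,152634); (6711356,-586914); (4108734,-409179); (1994859,708736); (4108734,7390440); (7225705,9027535); (9804291,6843824); (12965295,3188812); (12751245,2833610)]; [:: (12751245,-2833610); (13026174,-1299749); (7211065,-1265439); (4108734,-1103977); (615323,-708402); (-48944,-570908); (986843,-708402); (7197308,-1245538); (12864589,-1027895); (13928639,-1122690); (13963640,-708402); (13126962,578382); (13706848,708402); (15443174,4483219); (18560146,4331495); (18640434,3368576); (18558795,597435); (15056412,-707716); (15071418,-40187552); (19623651,-50143999)]]);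
((0,6)%N, [:: [:: (-42576805,38035182); (-54767004,9962071)]]);
((0,7)%N, [:: [:: (-42576805,38035182); (-37690508,17229404)]]);
((0,8)%N, [:: [:: (-42576805,38035182); (-11210495,6941194); (1558486,5688282); (1959539,705569); (2296232,298543); (1415886,-196928); (4362549,-708402); (7225705,-914171); (7247999,-708487); (4108734,205366); (3783565,708402); (3838270,1328065); (4108734,1219233); (7719541,871258); (7225705,4480014); (7197369,4544277); (4137071,4831833); (3749857,708402); (4108735,153206); (6728003,-591057); (4108734,-411681); (1993479,708520); (4108734,7495415); (7225705,9121010); (25832407,4392096); (31586664,-708403); (31749839,-10270828)]]);
((0,9)%N, [:: [:: (-42576805,38035182); (-8461646,6836414); (1558486,5824161); (1971161,702388); (4108735,-601505); (7235628,-712008); (4108734,189188); (3773141,708402); (4137071,4566006); (5970480,4392096); (6212145,4141430)]; [:: (6212145,-4141430); (12892926,-13689720); (13681440,-1279220); (12892219,-1168236); (12284244,-1220343); (10941514,-1182556)]]);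
((0,10)%N, [:: [:: (-42576805,38035182); (-70627729,59536992); (-77411751,30241939)]]);
((1,2)%N, [:: [:: (-82590947,17426329); (-92206290,6942344); (-43859002,-708403); (-17729482,-14645294)]]);
((1,3)%N, [:: [:: (-82590947,17426329); (-83989900,6878502); (-544925,4141430)]; [:: (-544925,-4141430); (-1263760,-4079642); (-2081285,-763739); (1941499,358280); (1867740,708402); (1558486,4431931); (1530034,4494851); (-64489081,6987017); (-65173336,19221164)]]);
((1,4)%N, [:: [:: (-82590947,17426329); (-79259026,6898473); (1503956,4315477); (1690152,714730); (-2869056,-681659); (-1530149,-6125886); (1558486,-6440877); (4137071,-1346428); (6565252,-1330624); (6800664,-1983527)]; [:: (6800664,1983527); (7511114,2294119); (7197369,4478302); (4137071,4765583); (3755670,708402); (4108734,162191); (6990879,-656779); (4108735,-460105); (1985027,705246); (1553953,6016380); (-6598865,6837496); (7225705,9425539); (24369046,5816838); (26659858,4499323); (32323691,-708402); (32299494,-37913650)]]);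
((1,5)%N, [:: [:: (-82590947,17426329); (-78831462,6942581); (1529810,4407663); (1723153,708402); (1558486,469321); (-74213,34054); (-1558485,-361902); (-2841776,-704125); (-1530149,-6016140); (1558486,-6282069); (3720650,-1226220); (6996817,-1290178); (9775954,-5112077); (12892926,-6437455); (13253548,-1279305); (12878883,-1204592); (12864589,-1266932); (7192658,-1254474); (1558486,-770769); (1558486,-760195); (7197369,-1248057); (12892926,-1080029); (13931216,-1182265); (13991633,-654960); (15453541,4431375); (18560338,4265869); (18620323,3542214); (18551389,608686); (15031687,-705929); (15062604,-42130220); (19623651,-50143999)]]);
((1,6)%N, [:: [:: (-82590947,17426329); (-83747352,6942992); (1252167,4255986); (850083,3967054)]; [:: (850083,-3967054); (1558486,-3578055); (2286146,-1291694); (-1530149,-1145147); (-1726486,-707017); (2144378,382906); (1878215,708402); (1558486,4559459); (1530129,4622192); (-58908606,6943046); (-54767004,9962071)]]);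
((1,7)%N, [:: [:: (-82590947,17426329); (-77460119,6942679); (1530725,4408705); (1726087,708403); (1557398,464929); (-2820310,-704196); (-1530149,-5845504); (1558486,-6141767); (3671426,-1275124); (-1558486,-1010666); (-1693025,-709704); (-1552245,-672302); (1571191,208543); (2156544,376608); (1884201,708402); (1558790,4627504); (1562917,4613441); (1888753,708402); (2163866,372080); (1558504,202773); (-1558832,-676100); (-1670381,-706848); (-1537032,-1004661); (7074875,-1277374); (9775954,-3802516); (10615139,-4054242)]; [:: (10615139,4054242); (7197369,8420653); (4108734,6761623); (1999015,710239); (4108734,-400363); (6663420,-574915); (4108734,151008); (3748442,708402); (4137071,4847370); (7197369,4559838); (7225705,4495576); (7743958,708402); (7239966,595725); (3818208,892209); (3802033,708402); (4108734,234143); (7287476,-711908); (7197444,-1187887); (-431132,-433918); (425092,-193275); (1558486,125559); (2255130,321378); (1939347,708416); (1558486,5395521); (-22105420,6981274); (-37690508,17229404)]]);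
((1,8)%N, [:: [:: (-82590947,17426329); (-79414267,6848253); (1466517,4283137); (1644240,764589); (-3017240,-635732); (-1595288,-6194142); (1558486,-6537632); (4380373,-1383563); (5379771,-1370198); (5667220,-1416805)]; [:: (5667220,1416805); (6542839,1275124); (7612120,1616329); (7196826,4504874); (4137071,4793689); (3753375,708402); (4108734,158680); (6885471,-630283); (4108734,-439590); (1988725,706376); (1557518,6035642); (-4843845,6708861); (7188277,9369701); (24369046,5711736); (26352951,4434179); (31925632,-708402); (31749839,-10270828)]]);
((1,9)%N, [:: [:: (-82590947,17426329); (-79139660,6931911); (1528414,4393947); (1722256,708402); (1558486,470654); (-76459,34736); (-1558485,-360459); (-2847284,-704107); (-1530149,-6048963); (1558486,-6351716); (4108734,-1282171); (6706398,-1306489); (12892926,-9665031); (13381021,-1278694); (12892926,-1192170); (12543350,-1249088); (10941514,-1182556)]]);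
((1,10)%N, [:: [:: (-82590947,17426329); (-77411751,30241939)]]);
((2,3)%N, [:: [:: (-17729482,-14645294); (12892926,-24765251); (14811766,-625435); (18160439,708402); (18462018,2794485); (18418465,2833610)]; [:: (18418465,-2833610); (18631536,-3511788); (15435825,-10636552); (15192388,-709820); (18860468,541556); (18657193,3195976); (18560989,4349018); (15443174,4509966); (13691201,708402); (13122430,580900); (13960537,-708402); (13928639,-1085241); (9655991,708402); (7197369,4764796); (5294856,4795482); (7197461,4616612); (9705927,-709101); (9717507,-807725); (7235171,-641691); (7303267,-704383); (7225705,-1184839); (7201289,-1240274); (-299059,-528707); (-772443,-518976); (408903,-185865); (1564951,138571); (2242422,327800); (1932244,707958); (1530917,5226613); (-37839502,6177675); (1530149,4674279); (1558486,4611597); (1882573,708402); (2152369,378467); (1564542,214176); (309868,-140849); (-1558486,-667451); (-1699130,-705398); (-1705732,-707786); (-1532309,-1093386); (3251421,-1275876); (1530149,-4866974); (-1529845,-4523469); (-2291614,-705959); (-1557389,-512276); (142899,-64954); (1558454,307757); (1837962,708402); (1558543,4383010); (1530145,4445865); (-65062749,6942345); (-65173336,19221164)]]);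
((2,4)%N, [:: [:: (-17729482,-14645294); (15443174,-54443245); (24227366,-54700779); (32299494,-37913650)]]);
((2,5)%N, [:: [:: (-17729482,-14645294); (15471511,-53656710); (19623651,-50143999)]]);
((2,6)%N, [:: [:: (-17729482,-14645294); (-6828170,-690837); (-1558485,412491); (544925,1525790)]; [:: (544925,-1525790); (142078,-1275124); (-1530149,-1211069); (-1755382,-707168); (2134331,388488); (1872730,708402); (1558486,4493116); (1530158,4555779); (-59942527,6910768); (-54767004,9962071)]]);
((2,7)%N, [:: [:: (-17729482,-14645294); (12892926,-23239313); (14689418,-550877); (17404242,708403); (17851743,1700166)]; [:: (17851743,-1700166); (18782307,-2147332); (21110394,-7067409); (24227366,-6422051); (25265834,-4030421); (24199029,-1277615); (19952226,709671); (18561148,4681214); (15443174,4770992); (13572186,708402); (13088223,599904); (9946047,708403); (7225705,5123974); (4083857,5191182); (3332216,708402); (4108734,-385602); (6580288,-554132); (4108734,148160); (3746596,708402); (4137071,4868659); (7197369,4581721); (7225705,4517463); (7746998,708402); (8857504,-97342); (4456730,138480); (7291257,-708382); (7196491,-1210790); (-521949,-456355); (420915,-191325); (1558539,128406); (2251698,323284); (1937462,708402); (1558486,5372469); (-37956957,6942345); (-37690508,17229404)]]);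
((2,8)%N, [:: [:: (-17729482,-14645294); (1558486,-10885257); (4294009,-3182362)]; [:: (4294009,3182362); (4198269,2949942); (4139123,1273749); (7700049,1007797); (7225705,4474115); (7197369,4538378); (4137071,4825938); (3750491,708403); (4108734,154210); (6753181,-597175); (4108734,-416447); (1991030,708505); (1557391,6071353); (-3107372,6571282); (7225705,9247287); (24369475,5576454); (26127854,4357426); (31779409,-708402); (31749839,-10270828)]]);
((2,9)%N, [:: [:: (-17729482,-14645294); (12892926,-21194750); (13685814,-1275133); (12892926,-1165244); (12280338,-1219992); (10941514,-1182556)]]);
((2,10)%N, [:: [:: (-17729482,-14645294); (-93283261,6942345); (-77411751,30241939)]]);
((3,4)%N, [:: [:: (-65173336,19221164); (-65076528,6942345); (1529889,4445227); (1557941,4382383); (1835814,710560); (1519906,325028); (140245,-63748); (-1558485,-511202); (-2298943,-705641); (-1531119,-4526155); (1530149,-4869011); (3253502,-1275124); (-1530149,-1092453); (-1690999,-735554); (-1702065,-707924); (-1558489,-667461); (309874,-140855); (1557900,211344); (2152378,378463); (1882576,708402); (1558486,4611635); (1530149,4674317); (0,4732748); (-1530513,4791237); (-1558486,4792262); (-37784173,6175600); (1530149,5215579); (1929156,708402); (2237984,330903); (1558485,139277); (406559,-185590); (-800371,-526053); (-238670,-544015); (7196529,-1244006); (9720172,-822774); (9765638,-822259); (7246456,4603518); (7248845,4613897); (9745312,-709056); (12892926,-951885); (13928639,-1109120); (13962505,-708402); (13125239,579339); (13700877,708402); (15443174,4494979); (18560146,4344416); (18649731,3270178); (18795971,577388);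 (15139426,-701127); (15471511,-17418640); (25308908,-12326855); (26372224,-749683); (21000641,620793); (20910148,4451618); (24777531,4345071); (30865967,-952577); (32299494,-37913650)]]);
((3,5)%N, [:: [:: (-65173336,19221164); (-65059984,6942345); (1530149,4446079); (1558961,4383439); (1838276,708402); (1558485,307350); (143440,-65200); (-1558508,-512952); (-2290992,-706264); (-1529072,-4521461); (1558486,-4787711); (2820754,-1275124); (-1530149,-1107431); (-1708931,-707555); (-1558486,-665556); (307361,-139725); (1558608,213210); (2150132,379710); (1881356,708402); (1558486,4597574); (1530149,4660266); (-37850638,6178093); (1558486,5241493); (1933454,707980); (2244669,327051); (1558485,133135); (417181,-184833); (-639113,-484477); (7197369,-1238981); (7295796,-708402); (7225656,-644245); (6526150,-398193); (9704032,-708402); (7197369,4613867); (4579975,4859734); (7225705,4795095); (9669054,708402); (13928639,-1073634); (13959574,-708402); (13121026,581680); (13686354,708402); (15443174,4513831); (18563012,4378254); (18888430,539168); (15211059,-719582); (15615160,-9597760); (17851743,-3967054)]; [:: (17851743,3967054); (18560146,3506302); (18516732,713991); (14886886,-720016); (14583958,-48928775); (19623651,-50143999)]]);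
((3,6)%N, [:: [:: (-65173336,19221164); (-64634123,6941437); (1530149,4464245); (1559848,4400377); (1865237,708402); (1558505,267175); (-2154823,-706415); (-1492697,-4311317); (1558486,-4297453); (2528445,-1275124); (-1530149,-1120236); (-1714103,-707358); (-1560094,-664086); (305059,-138268); (1558486,214586); (2148185,380792); (1880294,708402); (1558486,4584777); (1530297,4647143); (-58629181,6942345); (-54767004,9962071)]]);
((3,7)%N, [:: [:: (-65173336,19221164); (-65070405,6942345); (1530149,4445614); (1558470,4382947); (1837102,708402); (1558379,308750); (141153,-65050); (-1558485,-511971); (-2295034,-705947); (-1530149,-4524153); (1530149,-4868107); (3252879,-1275418); (-1530233,-1092576); (-1703879,-708284); (-1701871,-707803); (-1558485,-667453); (309871,-140850); (1542208,207753); (2152372,378465); (1882574,708402); (1558486,4611618); (1530149,4674300); (-37808725,6176521); (1530149,5222616); (1929613,708402); (2238839,330502); (1556055,138031); (408516,-185689); (-777109,-520033); (-301357,-534770); (7201723,-1241449); (7230073,-1224619); (7328453,-668247); (9721657,-819553); (9707978,-709925); (7196343,4624210); (7197369,4754386); (9775954,-132857); (13928504,-1107240); (13962209,-708402); (13124771,579599); (13699247,708402); (15443174,4495969); (18560146,4346157); (18654709,3212275); (18812008,568479); (15150662,-713545); (15471463,-15176394); (25380997,-7940769); (25333417,-743515); (20143031,702589); (18587193,4849085); (15443174,4901572); (13506410,708403); (13069274,610431); (10256366,708402); (7197369,5357415); (4047123,5413615); (3251408,708402); (4108735,-390629); (6609534,-561444); (4108734,149169); (3747254,708402); (4137071,4860774);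 (7197369,4573163); (7225705,4508900); (7745776,708402); (8441279,203764); (4108734,236006); (7290479,-708404); (7196975,-1202126); (-488998,-448440); (422522,-192056); (1558689,126723); (2253111,322499); (1938234,708402); (1558486,5381992); (-27857492,7125744); (-37690508,17229404)]]);
((3,8)%N, [:: [:: (-65173336,19221164); (-65072957,6942345); (1530036,4445519); (1558362,4382512); (1836816,708402); (1558090,308974); (140872,-63979); (-1558486,-511650); (-2296182,-705944); (-1530451,-4525039); (1530149,-4868484); (3253271,-1275155); (-1530184,-1092491); (-1703775,-708394); (-1702022,-707897); (-1558486,-667454); (309872,-140851); (1557203,211261); (2152373,378465); (1882575,708402); (1558486,4611625); (1530149,4674307); (-37798484,6176137); (1530149,5217969); (1929395,708402); (2238383,330708); (1558485,138903); (408329,-185518); (-788766,-523057); (-271499,-539571); (7200149,-1242570); (7503072,-1189659); (7632512,-881954); (9723174,-820840); (9715472,-720878); (7200547,4623302); (7225802,4688539); (9748998,-708402); (12892926,-951552); (13928639,-1108763); (13962475,-708402); (13125192,579365); (13700715,708402); (15443174,4495320); (18560146,4344824); (18653173,3229324); (18806929,571301); (15146347,-708402); (15443174,-15586979); (25307976,-9769452); (26201503,-914385); (20856881,610370); (20437122,4537241); (24905363,4396646); (30918181,-799567); (31749839,-10270828)]]);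
((3,9)%N, [:: [:: (-65173336,19221164); (-64883411,6941073); (1535812,4448934); (1559752,4384019); (1839502,705494); (1563904,298539); (-2258517,-709399); (-1523290,-4510010); (1554231,-4777424); (2772500,-1275124); (-1531288,-1111001); (-1712475,-707971); (-1558485,-664760); (307535,-139075); (1558486,213793); (2149122,380271); (1880795,708402); (1558486,4589378); (1527764,4657323); (-37950986,6181409); (1558486,5268176); (1934132,708402); (2246480,326124); (1554225,131010); (416094,-189134); (-614305,-478964); (7197369,-1237547); (7295583,-708402); (7225706,-644453); (6158749,-295668); (9684029,-694087); (7196864,4612820); (4376244,4877834); (7225705,4811466); (9682425,708402); (13928639,-1048704); (13957507,-708402); (13118059,583328); (13676121,708402); (15443174,4530659); (18568978,4399722); (19244500,645274); (15334780,-767017); (15471511,-4448561); (16652908,-4206821)]; [:: (16652908,4206821); (15443174,4283856); (14023587,-700813); (13938456,-1241401); (12903612,-1119433); (10941514,-1182556)]]);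
((3,10)%N, [:: [:: (-65173336,19221164); (-65385551,44301578); (-77411751,30241939)]]);
((4,5)%N, [:: [:: (32299494,-37913650); (19623651,-50143999)]]);
((4,6)%N, [:: [:: (32299494,-37913650); (29810551,-708403); (23976700,2288685)]; [:: (23976700,-2288685); (23803062,-1491037); (19843329,708403); (18558168,4626264); (15443174,4718976); (13596942,708402); (13095347,595946); (9837213,708403); (7198575,5055012); (4107037,5089904); (3643170,708117); (4108735,131271); (4722962,-415684); (6516258,-538125); (4108734,145981); (3745192,708402); (4108734,4825289); (4137071,4884228); (7197561,4596843); (7226466,4531866); (8025605,827738); (9208718,-349685); (4984958,-9786); (7225706,-646170); (7293710,-708402); (7197462,-1224896); (-574829,-469519); (418626,-190233); (1558486,130075); (2249733,324376); (1936387,708402); (1558486,5359181); (-43469035,6942345); (-54767004,9962071)]]);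
((4,7)%N, [:: [:: (32299494,-37913650); (30207778,-708402); (23802324,3683693)]; [:: (23802324,-3683693); (24199029,-3257125); (24078306,-1307304); (19917629,708402); (18560146,4634355); (15443174,4729142); (13591994,708402); (13093922,596738); (9859902,708402); (7225705,5073418); (4104769,5123038); (3499470,708403); (4368327,-392216); (6520358,-539150); (4108734,146121); (3745282,708402); (4108734,4824263); (4137071,4883202); (7197369,4595748); (7225705,4531486); (7872975,685862); (9164663,-317881); (4902073,13628); (7293108,-708394); (7197367,-1223839); (-571066,-468632); (418839,-190381); (1559834,130265); (2249872,324299); (1936463,708402); (1558486,5360114); (-42895530,6942345); (-37690508,17229404)]]);
((4,8)%N, [:: [:: (32299494,-37913650); (31749839,-10270828)]]);
((4,9)%N, [:: [:: (32299494,-37913650); (32853302,-708402); (27262004,4392096); (24199029,6061483); (7225706,9578714); (-7940398,6926626); (1552462,5976273); (1978054,704064); (4108734,-494306); (7176173,-703103); (4108734,168542); (3759784,708403); (4137071,4718208); (7197369,4429532); (7040431,3182362)]; [:: (7040431,-3182362); (12892926,-12201728); (13649460,-1286892); (12892564,-1178838); (12358405,-1227018); (10941514,-1182556)]]);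
((4,10)%N, [:: [:: (32299494,-37913650); (30475180,-708402); (24199029,4280671); (21111934,4388464); (21057578,671740); (26446623,-714802); (25260642,-15982999); (15417152,-18316694); (15118610,-699838); (18785396,583263); (18649482,3272273); (18560146,4343558); (15443174,4494335); (13701166,708402); (13125322,579293); (13962557,-708402); (13928639,-1109740); (12892926,-952437); (7197369,-1244470); (1001668,-708402); (-232221,-545135); (-803497,-526758); (407734,-184840); (1558486,139367); (2237876,330963); (1929097,708402); (1530149,5214816); (-37631824,6169887); (1530149,4674422); (1558486,4611739); (1882585,708402); (2152396,378454); (1558439,211148); (309892,-140860); (-1558486,-667469); (-1702033,-707925); (-1530149,-1092348); (3256244,-1275124); (1530149,-4874736); (-1530545,-4532797); (-2613784,-741970); (1564893,422477); (1820433,738312); (1560901,4336579); (1530144,4443445); (-65127816,6942345); (-65385551,38211577); (-77411751,30241939)]]);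
((5,6)%N, [:: [:: (19623651,-50143999); (24227366,-45278365); (28298805,-708402); (22668880,1416805)]; [:: (22668880,-1416805); (19733385,708402); (18554968,4597700); (15443174,4692910); (13612730,705442); (13073143,586081); (9778136,702961); (7206353,5028299); (4108734,5066438); (3652117,746518); (4108734,141821); (6510572,-536703); (4108734,145787); (3745066,708402); (4108734,4826711); (4137071,4885649); (7198002,4598704); (7229249,4528149); (8476207,1202312); (9246373,-377893); (5096678,-41324); (7225706,-645964); (7293936,-708402); (7197561,-1226300); (-579038,-470205); (418494,-190088); (1558486,130231); (2249546,324480); (1936285,708402); (1558486,5357923); (-44172909,6942345); (-54767004,9962071)]]);
((5,7)%N, [:: [:: (19623651,-50143999); (15068519,-41376855); (15052284,-707962); (18557508,597774); (18638491,3382118); (18560146,4321639); (15443061,4472681); (13709776,693692); (13976424,-703545); (13932639,-1132543); (12864589,-1041004); (7196892,-1246502); (973839,-708402); (4137071,-1093750); (7225737,-1261077); (12864589,-1292775); (12892926,-1231698); (13235128,-1310599); (12864589,-4477282); (12053741,-4054242)]; [:: (12053741,4054242); (7197369,8596089); (4108734,6943910); (1996545,709279); (4108734,-405131); (6691347,-581897); (4108735,151976); (3749074,708402); (4137071,4839627); (7197025,4553498); (7225705,4488420); (7743323,708978); (3824806,969987); (3801788,708402); (4108734,233769); (7284690,-711442); (7197986,-1180412); (-418849,-431593); (444675,-191748); (1558486,125202); (2255558,321140); (1939572,708402); (1558486,5398414); (-20823488,6979701); (-37690508,17229404)]]);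
((5,8)%N, [:: [:: (19623651,-50143999); (15071418,-37938012); (15057462,-708402); (18560146,596503); (18641319,3365664); (18560146,4339135); (15443174,4490457); (13703079,708402); (13125874,578987); (13962917,-708402); (13928639,-1114034); (12864589,-1017946); (7197369,-1244674); (999348,-708402); (-194845,-550391); (466165,-708402); (4108734,-1153525); (7225705,-1270193); (12061060,-1370320); (12053741,-1612978)]; [:: (12053741,1612978); (12892926,1586059); (15491054,6971816); (25666673,4393124); (31471897,-708402); (31749839,-10270828)]]);
((5,9)%N, [:: [:: (19623651,-50143999); (15030465,-43718447); (15008171,-708402); (18546545,671800); (18587574,3870721); (18531809,4263229); (15443174,4372317); (14015680,-686453); (13932981,-1213279); (12892926,-1095809); (10941514,-1182556)]]);
((5,10)%N, [:: [:: (19623651,-50143999); (15071418,-32778433); (15059333,-708402); (18560146,593960); (18643189,3344382); (18560146,4340257); (15443174,4491396); (13702627,708402); (13125743,579059); (13962833,-708403); (13928639,-1113031); (12864589,-1016964); (7197369,-1244630); (999819,-708402); (-202225,-549358); (-814893,-529588); (287442,-177680); (1558486,139731); (2237442,331204); (1928860,708403); (1530149,5212005); (-37224304,6154605); (1530149,4674701); (1558486,4612019); (1882608,708403); (2152433,378431); (1556435,209524); (309940,-140882); (-1558485,-667505); (-1701785,-707977); (-1530106,-1092046); (3263566,-1275124); (1530149,-4889979); (-1530149,-4561981); (-2665772,-690118); (-1549598,-392153); (-7248,3295); (1558485,425324); (1751384,708403); (1554531,4341771); (1528864,4432045); (-66582544,6942345); (-77411751,30241939)]]);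
((6,7)%N, [:: [:: (-54767004,9962071); (-37690508,17229404)]]);
((6,8)%N, [:: [:: (-54767004,9962071); (-59073524,6917057); (1530149,4600106); (1558486,4537419); (1876386,708402); (2141115,384549); (-1735427,-707813); (-1530149,-1167165); (1924757,-1299761); (1373211,-2484858)]; [:: (1373211,2484858); (1533629,890035); (-3189942,-483294); (-1530149,-8409641); (1558486,-7950540); (4223071,-2179563); (4533776,-1983527)]; [:: (4533776,1983527); (4512366,1286585); (7686842,1093523); (7225705,4463591); (7197369,4527859); (4137071,4815963); (3751234,708402); (4108735,155331); (6794823,-607925); (4108734,-423877); (1989932,707946); (1557476,6054094); (-3576610,6608895); (7225705,9287117); (24369046,5634226); (26178475,4392096); (31812352,-708403); (31749839,-10270828)]]);
((6,9)%N, [:: [:: (-54767004,9962071); (-45965114,6944747); (1558486,5340867); (1935485,708396); (2248047,325130); (1558485,131327); (417066,-189575); (-611486,-478554); (7197369,-1233909); (7295042,-708402); (7225706,-644948); (5765987,-211627); (9468278,-535020); (7197282,4607552); (4137071,4895739); (7225705,4879098); (9704202,708402); (13936470,-902338); (13114848,585112); (13664924,708402); (15448755,4572639); (18569944,4451808); (19286651,589628); (15475897,-1052713); (15534169,-3316683); (15781028,-3552911)]; [:: (15781028,3552911); (15443174,3596189); (14078248,-629144); (13928639,-1516468); (13760395,-1245039); (12938410,-1138756); (10941514,-1182556)]]);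
((6,10)%N, [:: [:: (-54767004,9962071); (-45215322,6942345); (1558486,5354418); (1935960,708402); (2248946,324814); (1558483,130740); (417777,-189899); (-597827,-475098); (7197641,-1228372); (7294434,-708402); (7225705,-645509); (5410091,-129880); (9388773,-480773); (7226129,4537649); (7197369,4602647); (4137071,4890109); (4108734,4831170); (3744672,708402); (4104467,151803); (4106739,145119); (3742310,708402); (4108734,4995114); (7225705,4964114); (9768818,696218); (13876565,-828916); (13107802,589026); (13640506,707354); (15460750,4654842); (18560146,4541760); (19767628,-708402); (21535436,-1983527)]; [:: (21535436,1983527); (21424917,708402); (27011017,-708402); (24227366,-30404619); (15071418,-26713974); (15060860,-708402); (18560157,591968); (18644605,3328965); (18560146,4341803); (15443174,4492410); (13702075,708402); (13125584,579148); (13962726,-708402); (13928639,-1111741); (12892926,-954588); (7197369,-1244580); (1000375,-708402); (-212129,-547960); (-811231,-528673); (405256,-184017); (1558486,139614); (2237582,331127); (1928936,708403); (1530149,5212899); (-37349922,6159316); (1530149,4674615); (1558486,4611932); (1882601,708402); (2152422,378438); (1557127,210574); (309925,-140875); (-1558486,-667493); (-1701930,-707921); (-1530149,-1092155); (3261294,-1275124); (1530149,-4885189); (-1531551,-4541251); (-2646595,-692573); (-1556709,-413884); (-5978,2717); (1558454,424456); (1751935,708403); (1558486,4333053); (1527841,4438517); (-65324814,6942345); (-77411751,30241939)]]);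
((7,8)%N, [:: [:: (-37690508,17229404); (-23192788,6942345); (1558486,5391740); (1939032,708165); (2254248,321869); (1558438,125983); (424172,-192805); (-444881,-436979); (7197369,-1192406); (7290113,-708481); (4108749,234764); (3804321,706982); (8140585,421008); (7744676,708726); (7225987,4500828); (7198229,4563499); (4137071,4851246); (3748100,708402); (4108734,150480); (6647936,-571044); (4108734,-397644); (2734288,708402); (4040129,5674767); (7225705,5508760); (10590622,715908); (13414748,708403); (15471511,5213237); (24960604,4440820); (31020540,-708402); (31749839,-10270828)]]);
((7,9)%N, [:: [:: (-37690508,17229404); (-40333678,6942345); (1558486,5363083); (1936776,708402); (2250455,323975); (1558455,129460); (419519,-190691); (-556001,-464904); (7197369,-1220899); (7292721,-708532); (4641821,87146); (9075565,-254592); (7748348,708403); (7225705,4527810); (7197369,4592075); (4137071,4879888); (3745554,708402); (4108734,146537); (6532389,-542157); (4108734,-376527); (3387698,708402); (4103409,5168198); (7225705,5109266); (9910237,708402); (13090957,598385); (13581707,708402); (15443174,4749395); (18560146,4653489); (19926379,711301); (24192550,-1320181); (24387321,-5340407); (19232886,-2826119); (18698542,-1673045); (16743475,-1305428); (16652908,-1460399)]; [:: (16652908,1460399); (14658925,-99282); (13927070,-2033924); (13686093,-1273202); (12892926,-1164767); (12274100,-1219430); (10941514,-1182556)]]);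
((7,10)%N, [:: [:: (-37690508,17229404); (-22523056,6942345); (1558486,5393169); (1939140,708402); (2254728,321574); (1558515,125823); (422237,-193606); (-439365,-435706); (7197369,-1190981); (7288660,-708402); (4108734,234481); (3802249,708403); (4089107,800984); (8081634,451639); (7744279,708402); (7225705,4497913); (7197369,4562175); (4137071,4849703); (3748236,708402); (4108735,150690); (6654103,-572586); (4108734,-398763); (2109626,708402); (4108734,6105639); (7225705,7620998); (9917635,2833610)]; [:: (9917635,-2833610); (7188286,-1277406); (-1530149,-1001191); (-1661706,-708058); (1558513,200114); (2165599,371117); (1889704,708402); (1558486,4684888); (1530149,4690924); (1558486,4628221); (1883845,708403); (2154954,377198); (1560862,207954); (-1594520,-681241); (-1695697,-708930); (-1530149,-1077758); (3540891,-1275124); (1530149,-6074690); (-1558486,-5627114); (-2806066,-704303); (1558486,461713); (1728092,708402); (1531341,4412980); (-76078719,6942345); (-77411751,30241939)]]);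
((8,9)%N, [:: [:: (31749839,-10270828); (31719858,-708402); (26023289,4384963); (7197369,9205947); (1530149,6138171); (1558486,6073908); (1992830,708228); (4108734,-414081); (6740133,-594093); (4108734,153613); (3750118,708402); (4137009,4828399); (7197369,4540605); (7225705,4476342); (7707401,956300); (4108734,1226730); (4137071,4136753); (5122295,4141430)]; [:: (5122295,-4141430); (12892926,-14527444); (13684452,-1275669); (12892900,-1165504); (12284223,-1220341); (10941514,-1182556)]]);
((8,10)%N, [:: [:: (31749839,-10270828); (31323540,-708402); (25393172,4390868); (15532618,6657810); (12864589,1081481); (10682826,1275125); (10615139,1612978)]; [:: (10615139,-1612978); (7225832,-1274432); (-1528622,-993798); (-1561649,-684455); (2187498,365114); (1910227,719962); (1564989,4696968); (1530149,4759179); (-1530149,4805073); (1530149,4685928); (1558486,4623225); (1883329,708431); (2153921,377605); (1558097,209594); (308100,-142428); (-1558486,-668705); (-1697689,-707938); (-1530149,-1082785); (3410211,-1275124); (1530149,-5942688); (-1558486,-5492373); (-2787334,-705323); (1558485,457702); (1730698,708402); (1531981,4418013); (-66865314,6942345); (-77411751,30241939)]]);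
((9,10)%N, [:: [:: (10941514,-1182556); (12195403,-1197581); (12883606,-1156005); (13718101,-1269155); (13928639,-1881953); (14126218,-705437); (15693840,2288685)]; [:: (15693840,-2288685); (15600652,-1081487); (18560146,-1343385); (21361060,-3378535)]; [:: (21361060,3378535); (21142458,3092023); (21288725,634388); (26509148,-708402); (24210820,-29772475); (15072641,-19803207); (15068148,-708739); (18560145,588365); (18647047,3300643); (18560146,4342724); (15443174,4493487); (13701615,708402); (13125452,579221); (13962644,-708402); (13928639,-1110779); (12892926,-953603); (7197369,-1244528); (1001265,-708421); (-221702,-546614); (-807538,-527750); (412740,-182559); (1558486,139496); (2237723,331048); (1929014,708402); (1530149,5213837); (-37497337,6164844); (1530149,4674514); (1558486,4611832); (1882592,708402); (2152411,378444); (1558485,211049); (309908,-140867); (-1558465,-667480); (-1701977,-707924); (-1530149,-1092256); (3258661,-1275124); (1530149,-4879775); (-1531310,-4534934); (-2628409,-704836); (-1558613,-416278); (-5119,2327); (1558486,423829); (1752381,708402); (1558486,4343536); (1529998,4441633); (-65171427,6942345); (-65385551,33313459); (-77411751,30241939)]])].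

End DrawingData.

Section DrawnSurfaces.
Variable R : realType.

Lemma near_centre (a x y : R) : (x - a) ^+ 2 + y ^+ 2 <= 1 -> -1 <= x - a <= 1.
Proof.
move=> h; rewrite -ler_norml -(@ler_pXn2r _ 2)// ?nnegrE// expr1n real_normK ?num_real//.
by have := sqr_ge0 y; lra.
Qed.

Lemma far_columns (i j : nat) (p : R * R) (b c : R) :
  sqdist (4 * i%:R, b) p <= 1 -> sqdist (4 * j%:R, c) p <= 1 -> i = j.
Proof.
rewrite /sqdist /= => /near_centre/andP[h1 h2] /near_centre/andP[h3 h4].
case: (ltngtP i j) => // lt; exfalso.
  by have : i%:R + 1 <= j%:R :> R; [rewrite natr1 ler_nat|lra].
by have : j%:R + 1 <= i%:R :> R; [rewrite natr1 ler_nat|lra].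
Qed.

Lemma zr_nat n : zr R (Z.of_nat n) = n%:R.
Proof.
rewrite /zr; have -> : int_of_Z (Z.of_nat n) = n%:Z by lia.
by rewrite pmulrn.
Qed.

Let z2 : zr R (Zpos (xO xH)) = 2.
Proof. exact: (zr_nat 2). Qed.

Let column (D : Z) (i : nat) : Z := Z.mul (Z.of_nat (4 * i)) D.

Lemma column_place (D : Z) (i : nat) : zr R D != 0 -> zr R (column D i) / zr R D = 4 * i%:R.
Proof. by move=> D0; rewrite /column zrM zr_nat mulfK// natrM. Qed.

(** The scale is divisible by 5, 13, 17 and 29, so that a circle of this radius carries
    many lattice points, at which the edges can pass through the cross-caps. *)
Definition crosscap_scale : Z := 32045.
Definition crosscap_holes : seq (Z * Z) := [seq (column crosscap_scale i, Z0) | i <- iota 0 10].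

Lemma crosscap_drawing : drawing_ok crosscap_scale true crosscap_holes 11 crosscap_vertices
  (edge_segments crosscap_edges).
Proof. by vm_compute. Qed.

Lemma nonorientable_complete (e : rel 'I_11) : irreflexive e ->
  embeddable R (nonorientable_surface R 10) e.
Proof.
have D0 : Z.lt 0 crosscap_scale by [].
have zD0 := zrD_neq0 R D0.
pose hole (i : 'I_10) := (column crosscap_scale i, Z0).
have holeE i : crosscap_centre R i = pt R crosscap_scale (hole i).
  by rewrite /crosscap_centre /pt /= column_place// mul0r.
apply: (@drawing_embeddable R _ (@crosscap_centre R 10)
  (fun i p => 2 *: crosscap_centre R i - p) (nonorientable_surface R 10)
  (fun x => (\pi x)%qT) _ _ _ _ id _ crosscap_scale true crosscap_holes hole D0 _ holeE _ _
  11 crosscap_vertices (edge_segments crosscap_edges) isT crosscap_drawing).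
- exact: pi_continuous.
- by move=> x y /eqmodP/asboolP.
- by move=> x y i p h1 h2 h3; apply/eqmodP/asboolP; right; exists i, p.
- by move=> i j p h1 h2; apply: val_inj; exact: far_columns h1 h2.
- by move=> i p h; rewrite sqdist_antipode.
- move=> c; split => [/mapP[i]|[i ->]].
    rewrite mem_iota => /andP[_ i10] ->; by exists (Ordinal i10).
  by apply/mapP; exists (val i); rewrite // mem_iota ltn_ord.
- move=> i z; apply: injective_projections.
    have e1 : zr R (Z.sub (Z.mul 2 (column crosscap_scale i)) z.1) / zr R crosscap_scale =
        2 * (4 * (val i)%:R) - zr R z.1 / zr R crosscap_scale.
      by rewrite zrB zrM z2 mulrBl -mulrA column_place.
    exact: etrans e1 _.
  have e2 : zr R (Z.opp z.2) / zr R crosscap_scale = 2 * 0 - zr R z.2 / zr R crosscap_scale.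
    by rewrite zrN mulNr mulr0 sub0r.
  exact: etrans e2 _.
- by move=> i [z1 z3]; rewrite /zflip /=; congr (_, _); lia.
Qed.

(** Divisible by 5 and 13, for the same reason. *)
Definition handle_scale : Z := 1416805.
Definition handle_holes : seq (Z * Z) := flatten [seq
  [:: (column handle_scale i, Z.mul 2 handle_scale);
      (column handle_scale i, Z.mul (-2) handle_scale)] | i <- iota 0 5].

Lemma handle_drawing : drawing_ok handle_scale false handle_holes 11 handle_vertices
  (edge_segments handle_edges).
Proof. by vm_compute. Qed.

Lemma orientable_complete (e : rel 'I_11) : irreflexive e ->
  embeddable R (orientable_surface R 5) e.
Proof.
have D0 : Z.lt 0 handle_scale by [].
have zD0 := zrD_neq0 R D0.
pose hole (ib : 'I_5 * bool) :=
  (column handle_scale ib.1, Z.mul (if ib.2 then Zpos (xO xH) else Zneg (xO xH)) handle_scale).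
have holeE i : handle_centre R i = pt R handle_scale (hole i).
  by rewrite /handle_centre /pt /= column_place// zrM mulfK//; case: i => i [].
apply: (@drawing_embeddable R _ (@handle_centre R 5)
  (fun i p => (p.1, - p.2)) (orientable_surface R 5)
  (fun x => (\pi x)%qT) _ _ _ _ (fun ib => (ib.1, ~~ ib.2)) _ handle_scale false handle_holes
  hole D0 _ holeE _ _ 11 handle_vertices (edge_segments handle_edges) isT handle_drawing).
- exact: pi_continuous.
- by move=> x y /eqmodP/asboolP.
- by move=> x y i p h1 h2 h3; apply/eqmodP/asboolP; right; exists i, p.
- move=> [i b] [j c] p h1 h2; congr (_, _); first by apply: val_inj; exact: far_columns h1 h2.
  move: h1 h2; rewrite /sqdist /handle_centre /= addrC => h1; rewrite addrC => h2.
  have /andP[a1 a2] := near_centre h1; have /andP[b1 b2] := near_centre h2.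
  by case: b c a1 a2 b1 b2 {h1 h2} => [] [] //; lra.
- by move=> [i b] p <-; rewrite /sqdist /handle_centre /=; case: b => /=; ring.
- move=> c; split => [/flattenP[l /mapP[i]]|[[i b] ->]].
    rewrite mem_iota => /andP[_ i5] ->; rewrite !inE => /orP[/eqP->|/eqP->].
      by exists (Ordinal i5, true).
    by exists (Ordinal i5, false).
  apply/flattenP; exists [:: hole (i, true); hole (i, false)].
    by apply/mapP; exists (val i); rewrite // mem_iota ltn_ord.
  by case: b; rewrite !inE eqxx ?orbT.
- by move=> i z; rewrite /zflip /pt /= zrN mulNr.
- by move=> i [z1 z3]; rewrite /zflip /=; congr (_, _); lia.
Qed.

End DrawnSurfaces.

Theorem corollary3p8 (R : realType) :
  is_dichromatic_number R (nonorientable_surface R 10) 4 /\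
  is_dichromatic_number R (orientable_surface R 5) 4.
Proof.
split; split.
- exact: nonorientable_dicolourable.
- by move=> j; apply: dichromatic_ge4; exact: nonorientable_complete.
- exact: orientable_dicolourable.
- by move=> j; apply: dichromatic_ge4; exact: orientable_complete.
Qed.
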